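(* Let $\Sigma^2$ be a closed connected surface and let $F:\Sigma^2\to\mathbb{R}^4\simeq\mathbb{C}^2$ be an embedded Lagrangian self-shrinker which is symmetric with respect to a hyperplane in $\mathbb{R}^4$. Then, up to a unitary transformation of $\mathbb{C}^2$, $\Sigma^2$ is the Clifford torus; that is, there exists $G\in U(2)$ such that $G(F(\Sigma^2))=S^1\times S^1=\{(z,w)\in\mathbb{C}^2: |z|=|w|=1\}$.
   Context: Closed means compact without boundary; everything is smooth. $\mathbb{R}^4$ is identified with $\mathbb{C}^2$ via $(x_1,x_2,x_3,x_4)\leftrightarrow(x_1+ix_2,\,x_3+ix_4)$, with the standard Euclidean inner product and K\''ahler form $\omega=dx_1\wedge dx_2+dx_3\wedge dx_4$. A self-shrinker is an immersion $F:M^n\to\mathbb{R}^{n+k}$ satisfying $\vec{H}=-F^{\perp}$, where $\vec{H}$ is the mean curvature vector (the trace of the second fundamental form) and $F^\perp$ is the projection of the position vector onto the normal bundle of $M$. A Lagrangian self-shrinker in $\mathbb{R}^4$ is an immersed surface $F:\Sigma^2\to\mathbb{R}^4$ that is a self-shrinker and satisfies $F^*\omega=0$; it is embedded if $F$ is an embedding. The surface $F:\Sigma^2\to\mathbb{R}^4$ is symmetric with respect to an (affine) hyperplane $P$ if its image $F(\Sigma^2)$ is invariant under the orthogonal reflection of $\mathbb{R}^4$ across $P$. *)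

(* Defs.v *)
From HB Require Import structures.
From mathcomp Require Import all_boot all_order all_algebra.
From mathcomp Require Import all_classical all_reals all_analysis.
From mathcomp.real_closed Require Import complex.

Set Implicit Arguments.
Unset Strict Implicit.
Unset Printing Implicit Defensive.

Import Order.TTheory GRing.Theory Num.Theory.
Import numFieldNormedType.Exports.

Local Open Scope classical_set_scope.
Local Open Scope ring_scope.

(* The topology of 'rV[R]_n is the product one; the norm that the library puts
   on it is the sup norm, so Euclidean geometry goes through [dot]. *)
Definition dot (R : realType) (n : nat) (x y : 'rV[R]_n) : R :=
  \sum_i x 0 i * y 0 i.

(* Meant for open sets U. *)
Fixpoint class_C (R : realType) (V W : normedModType R) (k : nat)
    (U : set V) (f : V -> W) : Prop :=
  match k with
  | 0%N => {in U, continuous f}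
  | k'.+1 => (forall x, U x -> differentiable f x) /\
             (forall v : V, class_C k' U (fun x => 'D_v f x))
  end.

Definition smooth_on (R : realType) (V W : normedModType R)
    (U : set V) (f : V -> W) : Prop := forall k, class_C k U f.

(* A homeomorphism from the open set [chart_dom] onto the open set [chart_cod];
   the values of [chart_to] and [chart_inv] outside these sets are junk. *)
Record chart (R : realType) (n : nat) (S : topologicalType) := Chart {
  chart_dom : set S;
  chart_cod : set 'rV[R]_n;
  chart_to : S -> 'rV[R]_n;
  chart_inv : 'rV[R]_n -> S;
  chart_dom_open : open chart_dom;
  chart_cod_open : open chart_cod;
  chart_to_fun : set_fun chart_dom chart_cod chart_to;
  chart_inv_fun : set_fun chart_cod chart_dom chart_inv;
  chart_toK : {in chart_dom, cancel chart_to chart_inv};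
  chart_invK : {in chart_cod, cancel chart_inv chart_to};
  chart_to_cont : {in chart_dom, continuous chart_to};
  chart_inv_cont : {in chart_cod, continuous chart_inv} }.

(* n-dimensional smooth manifolds without boundary; the atlas need not be
   maximal. *)
Record smoothManifold (R : realType) (n : nat) := SmoothManifold {
  mfd_space :> topologicalType;
  atlas : set (chart R n mfd_space);
  mfd_hausdorff : hausdorff_space mfd_space;
  mfd_second_countable : @second_countable mfd_space;
  atlas_cover : \bigcup_(c in atlas) chart_dom c = [set: mfd_space];
  atlas_compat : forall c d, atlas c -> atlas d ->
    smooth_on (chart_cod c `&` chart_inv c @^-1` chart_dom d)
      (chart_to d \o chart_inv c) }.

(* The empty space is [connected] for the library, hence the last clause. *)
Definition closed_connected_manifold (R : realType) (n : nat)
    (S : smoothManifold R n) : Prop :=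
  [/\ compact [set: S], connected [set: S] & [set: S] !=set0].

Section Submanifolds.
Variables (R : realType) (n m : nat) (S : smoothManifold R n).
Implicit Types (F : S -> 'rV[R]_m) (c : chart R n S).

Definition in_chart F c : 'rV[R]_n -> 'rV[R]_m := F \o chart_inv c.

Definition smooth_map F : Prop :=
  forall c, atlas c -> smooth_on (chart_cod c) (in_chart F c).

Definition immersion F : Prop :=
  smooth_map F /\
  forall c u, atlas c -> chart_cod c u -> injective ('d (in_chart F c) u).

(* The last clause says that the inverse of F is continuous on the image of F
   with the subspace topology. *)
Definition embedding F : Prop :=
  [/\ immersion F, injective F &
      forall U : set S, open U ->
        exists2 V : set 'rV[R]_m, open V & F @` U = range F `&` V].

End Submanifolds.

Section LocalGeometry.
Variables (R : realType) (n m : nat).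
Implicit Types (X : 'rV[R]_n -> 'rV[R]_m) (u : 'rV[R]_n).

Definition partial (i : 'I_n) X u : 'rV[R]_m := 'D_(delta_mx 0 i) X u.

Definition first_form X u : 'M[R]_n :=
  \matrix_(i, j) dot (partial i X u) (partial j X u).

(* v - g^{ij} <v, X_i> X_j, where g = first_form X u: the component of v
   orthogonal to the tangent space of the immersion X at u. *)
Definition normal_part X u (v : 'rV[R]_m) : 'rV[R]_m :=
  v - \sum_i \sum_j (invmx (first_form X u) i j * dot v (partial i X u))
                      *: partial j X u.

Definition second_form X u (i j : 'I_n) : 'rV[R]_m :=
  normal_part X u (partial i (partial j X) u).

Definition mean_curvature X u : 'rV[R]_m :=
  \sum_i \sum_j invmx (first_form X u) i j *: second_form X u i j.

End LocalGeometry.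

Definition self_shrinker (R : realType) (n m : nat) (S : smoothManifold R n)
    (F : S -> 'rV[R]_m) : Prop :=
  immersion F /\
  forall c u, atlas c -> chart_cod c u ->
    mean_curvature (in_chart F c) u =
      - normal_part (in_chart F c) u (in_chart F c u).

Definition kahler_form (R : realType) (v w : 'rV[R]_4) : R :=
  (v 0 0 * w 0 1 - v 0 1 * w 0 0) + (v 0 2 * w 0 3 - v 0 3 * w 0 2).

Definition pullback_kahler_zero (R : realType) (S : smoothManifold R 2)
    (F : S -> 'rV[R]_4) : Prop :=
  forall c u, atlas c -> chart_cod c u ->
    forall v w : 'rV[R]_2,
      kahler_form ('d (in_chart F c) u v) ('d (in_chart F c) u w) = 0.

Definition lagrangian_self_shrinker (R : realType) (S : smoothManifold R 2)
    (F : S -> 'rV[R]_4) : Prop :=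
  self_shrinker F /\ pullback_kahler_zero F.

(* Orthogonal reflection across the affine hyperplane <x, nu> = b, for
   nu <> 0. *)
Definition hyperplane_reflection (R : realType) (m : nat)
    (nu : 'rV[R]_m) (b : R) (x : 'rV[R]_m) : 'rV[R]_m :=
  x - (2 * (dot x nu - b) / dot nu nu) *: nu.

Definition symmetric_wrt_hyperplane (R : realType) (T : Type) (m : nat)
    (nu : 'rV[R]_m) (b : R) (F : T -> 'rV[R]_m) : Prop :=
  hyperplane_reflection nu b @` range F = range F.

Definition to_C2 (R : realType) (x : 'rV[R]_4) : 'cV[R[i]]_2 :=
  \col_(j < 2) if j == 0 then (x 0 0 +i* x 0 1)%C else (x 0 2 +i* x 0 3)%C.

Definition clifford_torus (R : realType) : set 'cV[R[i]]_2 :=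
  [set z | `|z 0 0| = 1 /\ `|z 1 0| = 1].

(* Main.v *)
Require Import Defs.
From HB Require Import structures.
From mathcomp Require Import all_boot all_order all_algebra.
From mathcomp Require Import all_classical all_reals all_analysis.
From mathcomp.real_closed Require Import complex.
From mathcomp Require Import ring lra.

Set Implicit Arguments.
Unset Strict Implicit.
Unset Printing Implicit Defensive.

Import Order.TTheory GRing.Theory Num.Theory.
Import numFieldNormedType.Exports.

Local Open Scope classical_set_scope.
Local Open Scope ring_scope.

(* Choose a unitary frame (E1, iE1, E3, iE3) with E1 normal to the hyperplane, and
   let X1, ..., X4 be the coordinates of F, z = X1 + i X2, w = X3 + i X4. On the
   fixed curve K = {X1 = b}, secants joining mirror points converge to E1, so E1 is
   tangent and, F being Lagrangian, dX2 = 0 along K. Differentiating the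
   Lagrangian condition, the shrinker equation restricts on K to the planar
   self-shrinker equation for w, in the form det(w', w'') = |w'|^2 det(w, w'). No
   component of w(K) is a line through 0 (maximize |w|^2), so w(K) is locally a
   polar graph, and the outermost such graph is a 2 pi-periodic solution r = e^m of
   the shrinker ODE. Sturm comparison for the support function forces r = 1.
   Hence u = |w|^2 - 1 vanishes to first order along an arc of K. As
   |dX3|^2 + |dX4|^2 = 1 on a Lagrangian surface, u solves a linear homogeneous
   elliptic equation, and unique continuation (through a Carleman estimate with
   weight exp(t (psi + N psi^2 / 2))) gives |w| = 1 everywhere. Then the level
   curves of z are full circles in w, the surface is symmetric in X3, and the same
   argument with z and w exchanged gives |z| = 1. *)

(** * Smooth functions on open subsets of the plane *)

(** Only the image is symmetric, so the reflection is used through pairs of points and never as a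
    smooth map; the embedding keeps the partner of a point near the mirror in the same chart. The
    mirror curve may have many components, winding arbitrarily. Taking the outermost point on each
    ray produces a [2 pi]-periodic radius without parametrizing them, and embeddedness identifies
    that radius locally with a single smooth graph. The period [2 pi] is what rules out the other
    closed solutions of the planar equation: the tangent angle turns by exactly [2 pi], while the
    gaps between critical points of the radius lie strictly between [pi / 2] and [pi] and alternate
    in type; two gaps are too short, four too long, three have the wrong parity. In the Carleman
    estimate the quadratic form need not have a sign when [N = 0], which is the reason for the term
    [N psi^2 / 2]; integrals are replaced by sums over a grid. The shrinker equation is used
    multiplied by the determinant of the metric and modulo tangent vectors, so that neither
    Christoffel symbols nor the inverse metric have to be handled. *)

Section Differentiability.
Variables (R : realType) (V W : normedModType R).
Implicit Types (U : set V) (f g : V -> W).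

Lemma differentiable_near_le f x : differentiable f x ->
  forall e : R, 0 < e -> \forall y \near x,
    `|f y - f x - 'd f x (y - x)| <= e * `|y - x|.
Proof.
move=> df e e0.
have /eqaddoP/(_ _ e0) := diff_locally df.
move=> H; have cs : (y - x) @[y --> x] --> (0 : V).
  by rewrite -(subrr x); apply: cvgB; [exact: cvg_id|exact: cvg_cst].
have := cs _ H; apply: (@filterS _ (nbhs x)) => y /=.
by rewrite !fctE /= subrK opprD addrA.
Qed.

Lemma near_le_differentiable f x (df : {linear V -> W}) : continuous df ->
  (forall e : R, 0 < e -> \forall y \near x,
    `|f y - f x - df (y - x)| <= e * `|y - x|) ->
  differentiable f x /\ 'd f x = df :> (V -> W).
Proof.
move=> cdf H.
have E : f \o shift x = cst (f x) + df +o_ 0 id.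
  apply/eqaddoP => e e0; have := H _ e0.
  have cs : (y + x) @[y --> (0 : V)] --> x.
    by rewrite -[X in _ --> X]add0r; apply: cvgD; [exact: cvg_id|exact: cvg_cst].
  move=> /cs; apply: (@filterS _ (nbhs 0)) => y /=.
  by rewrite !fctE /= addrK opprD addrA.
have D := diff_unique cdf E.
by split => //; apply/diff_locallyP; rewrite D; split => //; rewrite D.
Qed.

Lemma differentiable_near_eq f g x :
  (\forall y \near x, f y = g y) -> differentiable f x -> differentiable g x.
Proof.
move=> fg df.
have cd : continuous ('d f x : {linear V -> W}) by exact: diff_continuous.
suff H (e : R) : 0 < e -> \forall y \near x,
    `|g y - g x - 'd f x (y - x)| <= e * `|y - x|.
  by have [] := near_le_differentiable cd H.
move=> e0; near=> y; have <- : f y = g y by near: y.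
by rewrite -(nbhs_singleton fg); near: y; exact: differentiable_near_le.
Unshelve. all: by end_near. Qed.

End Differentiability.

(** * Closure properties of the classes [C^k] *)

Section ClassC.
Variables (R : realType) (V : normedModType R).
Implicit Types (U : set V) (f g : V -> R).

Lemma open_near U x (P : V -> Prop) : open U -> U x ->
  (forall y, U y -> P y) -> \forall y \near x, P y.
Proof.
move=> oU Ux H; near=> y; apply: H; near: y; exact: open_nbhs_nbhs.
Unshelve. all: by end_near. Qed.

Lemma class_C_ext k U f g : open U -> (forall y, U y -> f y = g y) ->
  class_C k U f -> class_C k U g.
Proof.
elim: k f g => [|k IH] f g oU fg /=.
  move=> cf x xU; have Ux : U x by rewrite inE in xU.
  rewrite /prop_for /continuous_at -fg//.
  apply: cvg_trans (cf x xU); apply: near_eq_cvg.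
  exact: open_near oU Ux fg.
move=> [df cf]; split=> [x Ux|v].
  apply: differentiable_near_eq (df x Ux); exact: open_near oU Ux fg.
apply: IH (cf v) => // y Uy.
by apply: near_eq_derive; exact: open_near oU Uy fg.
Qed.

Lemma smooth_on_ext U f g : open U -> (forall y, U y -> f y = g y) ->
  smooth_on U f -> smooth_on U g.
Proof. by move=> oU fg sf k; exact: class_C_ext (sf k). Qed.

Lemma class_CW k U f : class_C k.+1 U f -> class_C k U f.
Proof.
elim: k f => [|k IH] f.
  move=> [df _] x; rewrite inE => Ux; exact/differentiable_continuous/df.
move=> [df cf]; split => // v; apply: IH; exact: cf.
Qed.

Lemma smooth_on_differentiable U f x :
  smooth_on U f -> U x -> differentiable f x.
Proof. by move=> /(_ 1%N)[df _] Ux; exact: df. Qed.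

Lemma smooth_on_continuous U f x : smooth_on U f -> U x -> {for x, continuous f}.
Proof.
by move=> sf Ux; apply: differentiable_continuous; exact: smooth_on_differentiable Ux.
Qed.

Lemma smooth_on_derive U f v : smooth_on U f -> smooth_on U ('D_v f).
Proof. by move=> sf k; have [_ /(_ v)] := sf k.+1. Qed.

Lemma smooth_on_sub U U' f : U' `<=` U -> smooth_on U f -> smooth_on U' f.
Proof.
move=> UU sf k; elim: k f {sf}(sf k) => [|k IH] f /=.
  by move=> cf x; rewrite inE => /UU Ux; apply: cf; rewrite inE.
by move=> [df cf]; split=> [x /UU|v]; [exact: df|exact: IH].
Qed.

Lemma smooth_on_cst U (c : R) : smooth_on U (fun=> c).
Proof.
move=> k; elim: k c => [|k IH] c /=; first by move=> x _; exact: cvg_cst.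
split=> [x _|v]; first exact: differentiable_cst.
by rewrite (_ : 'D_v _ = fun=> 0) //; apply/funext => x; rewrite derive_cst.
Qed.

Lemma smooth_on_lin U (f : {linear V -> R}) : continuous f -> smooth_on U f.
Proof.
move=> cf; case=> [|k] /=; first by move=> x _; exact: cf.
split=> [x _|v]; first exact: linear_differentiable.
rewrite (_ : 'D_v _ = fun=> f v); first exact: smooth_on_cst.
apply/funext => x; rewrite deriveE; last exact: linear_differentiable.
by rewrite diff_lin.
Qed.

Lemma class_CD k U f g : open U -> class_C k U f -> class_C k U g ->
  class_C k U (fun x => f x + g x).
Proof.
move=> oU; elim: k f g => [|k IH] f g /=.
  by move=> cf cg x xU; apply: continuousD; [exact: cf|exact: cg].
move=> [df cf] [dg cg]; split=> [x Ux|v].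
  by apply: differentiableD; [exact: df|exact: dg].
apply: class_C_ext (IH _ _ (cf v) (cg v)) => // y Uy.
by rewrite deriveD//; apply: diff_derivable; [exact: df|exact: dg].
Qed.

Lemma class_CM k U f g : open U -> class_C k U f -> class_C k U g ->
  class_C k U (fun x => f x * g x).
Proof.
move=> oU; elim: k f g => [|k IH] f g /=.
  by move=> cf cg x xU; apply: continuousM; [exact: cf|exact: cg].
move=> Cf Cg; have [df cf] := Cf; have [dg cg] := Cg; split=> [x Ux|v].
  by apply: differentiableM; [exact: df|exact: dg].
apply: class_C_ext (class_CD oU (IH _ _ (class_CW Cf) (cg v))
  (IH _ _ (class_CW Cg) (cf v))) => // y Uy.
by rewrite deriveM//; apply: diff_derivable; [exact: df|exact: dg].
Qed.

Lemma class_CV k U f : open U -> (forall x, U x -> f x != 0) ->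
  class_C k U f -> class_C k U (fun x => (f x)^-1).
Proof.
move=> oU f0; elim: k => [|k IH] /=.
  move=> cf x xU; apply: continuousV; last exact: cf.
  by apply: f0; rewrite inE in xU.
move=> Cf; have [df cf] := Cf; split=> [x Ux|v].
  by apply: differentiableV; [exact: df|exact: f0].
have CV := IH (class_CW Cf).
have C1 : class_C k U (fun=> -1 : R) by exact: smooth_on_cst.
apply: class_C_ext (class_CM oU C1 (class_CM oU (class_CM oU CV CV) (cf v))) => //.
move=> y Uy; rewrite deriveV; [|exact: f0|by apply: diff_derivable; exact: df].
by rewrite expr2 invfM mulN1r scaleNr.
Qed.

Lemma smooth_onD U f g : open U -> smooth_on U f -> smooth_on U g ->
  smooth_on U (fun x => f x + g x).
Proof. by move=> oU sf sg k; exact: class_CD. Qed.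

Lemma smooth_onM U f g : open U -> smooth_on U f -> smooth_on U g ->
  smooth_on U (fun x => f x * g x).
Proof. by move=> oU sf sg k; exact: class_CM. Qed.

Lemma smooth_onV U f : open U -> (forall x, U x -> f x != 0) ->
  smooth_on U f -> smooth_on U (fun x => (f x)^-1).
Proof. by move=> oU f0 sf k; exact: class_CV. Qed.

Lemma smooth_onN U f : open U -> smooth_on U f -> smooth_on U (fun x => - f x).
Proof.
move=> oU sf; apply: smooth_on_ext (smooth_onM oU (@smooth_on_cst U (-1)) sf) => //.
by move=> y _; rewrite mulN1r.
Qed.

Lemma smooth_onB U f g : open U -> smooth_on U f -> smooth_on U g ->
  smooth_on U (fun x => f x - g x).
Proof. by move=> oU sf sg; apply: smooth_onD => //; exact: smooth_onN. Qed.

End ClassC.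

(* The two partial derivatives are locked: unfolding them makes unification
   of [dx f] with [dy f] very slow. *)
HB.lock Definition dx (R : realType) (f : 'rV[R]_2 -> R) (u : 'rV[R]_2) : R :=
  'D_(delta_mx 0 0) f u.
HB.lock Definition dy (R : realType) (f : 'rV[R]_2 -> R) (u : 'rV[R]_2) : R :=
  'D_(delta_mx 0 1) f u.

Lemma dxE (R : realType) (f : 'rV[R]_2 -> R) : dx f = 'D_(delta_mx 0 0) f.
Proof. by apply/funext => u; rewrite dx.unlock. Qed.

Lemma dyE (R : realType) (f : 'rV[R]_2 -> R) : dy f = 'D_(delta_mx 0 1) f.
Proof. by apply/funext => u; rewrite dy.unlock. Qed.

(** * Gradients of functions of two variables *)

Section Plane.
Variable R : realType.
Implicit Types (u v : 'rV[R]_2) (f g : 'rV[R]_2 -> R) (U : set 'rV[R]_2).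

Definition pt (x y : R) : 'rV[R]_2 := \row_(j < 2) if j == 0 then x else y.

(** The values of the partial derivatives are arguments, so that the rules below build the gradient
    of a long expression by unification, and [has_grad_eq] compares it afterwards with the expected
    one. *)
Definition has_grad f u (a b : R) :=
  [/\ differentiable f u, dx f u = a & dy f u = b].

Lemma pt0 x y : pt x y 0 0 = x. Proof. by rewrite mxE. Qed.
Lemma pt1 x y : pt x y 0 1 = y. Proof. by rewrite mxE. Qed.

Lemma rV2P u v : u 0 0 = v 0 0 -> u 0 1 = v 0 1 -> u = v.
Proof.
move=> H0 H1; apply/rowP => i; case: i => [[|[|//]] Hi].
- by rewrite (_ : Ordinal Hi = 0)//; exact/val_inj.
- by rewrite (_ : Ordinal Hi = 1)//; exact/val_inj.
Qed.

Lemma ptK u : pt (u 0 0) (u 0 1) = u.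
Proof. by apply: rV2P; rewrite mxE. Qed.

Lemma ptE x y : pt x y = x *: delta_mx 0 0 + y *: delta_mx 0 1.
Proof. by apply: rV2P; rewrite !mxE/= !(mulr1, mulr0, addr0, add0r). Qed.

Lemma normrV0 u : `|u 0 0| <= `|u|.
Proof.
have [-> |u0] := eqVneq (u 0 0) 0; first by rewrite normr0.
rewrite [leRHS]/Num.norm /= mx_normrE; apply/bigmax_geP; right => /=.
by exists (0, 0).
Qed.

Lemma normrV1 u : `|u 0 1| <= `|u|.
Proof.
rewrite [leRHS]/Num.norm /= mx_normrE; apply/bigmax_geP; right => /=.
by exists (0, 1).
Qed.

Lemma norm_lt u (r : R) : 0 < r -> `|u 0 0| < r -> `|u 0 1| < r -> `|u| < r.
Proof.
move=> r0 H0 H1; rewrite [ltLHS]/Num.norm /= mx_normrE; apply/bigmax_ltP; split => //.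
move=> [i j] _ /=; rewrite (ord1 i); case: j => [[|[|//]] Hj].
- by rewrite (_ : Ordinal Hj = 0)//; exact/val_inj.
- by rewrite (_ : Ordinal Hj = 1)//; exact/val_inj.
Qed.

Lemma near_square u (P : 'rV[R]_2 -> Prop) : (\forall v \near u, P v) <->
  exists2 r : R, 0 < r & forall v, `|v 0 0 - u 0 0| < r -> `|v 0 1 - u 0 1| < r -> P v.
Proof.
split=> [/nbhs_ballP[r /= r0 H]|[r r0 H]].
  exists r => // v H0 H1; apply: H; rewrite -ball_normE /= distrC.
  by apply: norm_lt => //; rewrite !mxE.
apply/nbhs_ballP; exists r => // v; rewrite -ball_normE /= distrC => vr.
apply: H; apply: le_lt_trans vr.
  by apply: le_trans (normrV0 _); rewrite !mxE.
by apply: le_trans (normrV1 _); rewrite !mxE.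
Qed.

Lemma diff_dxdy f u v : differentiable f u ->
  'd f u v = v 0 0 * dx f u + v 0 1 * dy f u.
Proof.
move=> df; rewrite -{1}(ptK v) ptE linearD !linearZ dxE dyE.
by rewrite !deriveE//.
Qed.

Lemma has_grad_near_le f u a b : has_grad f u a b -> forall e : R, 0 < e ->
  \forall v \near u, `|f v - f u - ((v 0 0 - u 0 0) * a + (v 0 1 - u 0 1) * b)|
    <= e * `|v - u|.
Proof.
move=> [df da db] e e0; have := differentiable_near_le df e0.
by apply: filterS => v; rewrite diff_dxdy// da db !mxE.
Qed.

Definition lin2 (a b : R) (v : 'rV[R]_2) : R := v 0 0 * a + v 0 1 * b.

Fact lin2_linear a b : linear (lin2 a b).
Proof. by move=> k u v; rewrite /lin2 !mxE /GRing.scale /=; ring. Qed.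

HB.instance Definition _ a b :=
  GRing.isLinear.Build R 'rV[R]_2 R _ (lin2 a b) (lin2_linear a b).

Lemma lin2_continuous a b : continuous (lin2 a b).
Proof.
move=> v.
have H0 := cvgMr_tmp (@coord_continuous R 1 2 0 0 v).
have H1 := cvgMr_tmp (@coord_continuous R 1 2 0 1 v).
exact: cvgD (H0 _ a) (H1 _ b).
Qed.

Lemma near_le_has_grad f u a b : (forall e : R, 0 < e ->
  \forall v \near u, `|f v - f u - ((v 0 0 - u 0 0) * a + (v 0 1 - u 0 1) * b)|
    <= e * `|v - u|) -> has_grad f u a b.
Proof.
move=> H.
have [|df D] := @near_le_differentiable R _ _ f u (lin2 a b) (@lin2_continuous a b).
  by move=> e /H; apply: filterS => v; rewrite /= /lin2 !mxE.
split=> //; rewrite ?dxE ?dyE deriveE// D /= /lin2 !mxE/=;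
  by rewrite !(mul1r, mul0r, addr0, add0r).
Qed.

Lemma has_grad_lin2 a b u : has_grad (lin2 a b) u a b.
Proof.
apply: near_le_has_grad => e e0; near=> v.
rewrite [X in `|X|](_ : _ = 0); first by rewrite normrE mulr_ge0 // ltW.
by rewrite /lin2; ring.
Unshelve. all: by end_near. Qed.

Lemma has_grad_x u : has_grad (fun v => v 0 0) u 1 0.
Proof.
have := has_grad_lin2 1 0 u; congr has_grad.
by apply/funext => v; rewrite /lin2 mulr1 mulr0 addr0.
Qed.

Lemma has_grad_y u : has_grad (fun v => v 0 1) u 0 1.
Proof.
have := has_grad_lin2 0 1 u; congr has_grad.
by apply/funext => v; rewrite /lin2 mulr1 mulr0 add0r.
Qed.

Lemma has_grad_eq f u a b a' b' :
  has_grad f u a b -> a = a' -> b = b' -> has_grad f u a' b'.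
Proof. by move=> + <- <-. Qed.

Lemma has_grad_near f g u a b : (\forall v \near u, f v = g v) ->
  has_grad f u a b -> has_grad g u a b.
Proof.
move=> fg [df <- <-]; split; first exact: differentiable_near_eq df.
- by rewrite !dxE; apply/esym; apply: near_eq_derive.
- by rewrite !dyE; apply/esym; apply: near_eq_derive.
Qed.

Lemma has_grad_cst (c : R) u : has_grad (fun=> c) u 0 0.
Proof.
by split; [exact: differentiable_cst|rewrite dxE derive_cst|rewrite dyE derive_cst].
Qed.

Lemma has_gradD f g u a b a' b' : has_grad f u a b -> has_grad g u a' b' ->
  has_grad (fun v => f v + g v) u (a + a') (b + b').
Proof.
move=> [df <- <-] [dg <- <-]; split; first exact: differentiableD.
- by rewrite !dxE deriveD//; exact: diff_derivable.
- by rewrite !dyE deriveD//; exact: diff_derivable.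
Qed.

Lemma has_gradN f u a b : has_grad f u a b -> has_grad (fun v => - f v) u (- a) (- b).
Proof.
move=> [df <- <-]; split; first exact: differentiableN.
- by rewrite !dxE deriveN//; exact: diff_derivable.
- by rewrite !dyE deriveN//; exact: diff_derivable.
Qed.

Lemma has_gradB f g u a b a' b' : has_grad f u a b -> has_grad g u a' b' ->
  has_grad (fun v => f v - g v) u (a - a') (b - b').
Proof. by move=> hf hg; exact: has_gradD hf (has_gradN hg). Qed.

Lemma has_gradM f g u a b a' b' : has_grad f u a b -> has_grad g u a' b' ->
  has_grad (fun v => f v * g v) u (f u * a' + g u * a) (f u * b' + g u * b).
Proof.
move=> [df <- <-] [dg <- <-]; split; first exact: differentiableM.
- by rewrite !dxE deriveM//; exact: diff_derivable.
- by rewrite !dyE deriveM//; exact: diff_derivable.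
Qed.

Lemma has_grad_comp (h : R -> R) f u a b c : is_derive (f u) 1 h c ->
  has_grad f u a b -> has_grad (fun v => h (f v)) u (c * a) (c * b).
Proof.
move=> [/derivable1_diffP dh hc] [df da db].
have dhf : differentiable (h \o f) u by exact: differentiable_comp.
have E v : 'D_v (h \o f) u = c * 'D_v f u.
  rewrite !deriveE// diff_comp//= -hc deriveE//.
  by rewrite -[X in 'd h (f u) X]mulr1 [LHS]linearZ /= mulrC [LHS]mulrC [in RHS]mulrC.
by split => //; [rewrite dxE [LHS]E -da dxE|rewrite dyE [LHS]E -db dyE].
Qed.

Lemma has_gradV f u a b : f u != 0 -> has_grad f u a b ->
  has_grad (fun v => (f v)^-1) u (- (f u) ^- 2 * a) (- (f u) ^- 2 * b).
Proof.
move=> f0; apply: (@has_grad_comp (fun x => x^-1)).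
by apply: is_derive_eq; [exact: is_deriveV|rewrite scaler1].
Qed.

Lemma smooth_has_grad U f u : smooth_on U f -> U u -> has_grad f u (dx f u) (dy f u).
Proof. by move=> sf Uu; split => //; exact: smooth_on_differentiable Uu. Qed.

Lemma smooth_dx U f : smooth_on U f -> smooth_on U (dx f).
Proof. rewrite dxE; exact: smooth_on_derive. Qed.

Lemma smooth_dy U f : smooth_on U f -> smooth_on U (dy f).
Proof. rewrite dyE; exact: smooth_on_derive. Qed.

Lemma smooth_lin2 U a b : smooth_on U (lin2 a b).
Proof. by apply: smooth_on_lin; exact: lin2_continuous. Qed.

Lemma smooth_x U : smooth_on U (fun v : 'rV[R]_2 => v 0 0).
Proof.
rewrite (_ : (fun v => _) = lin2 1 0); first exact: smooth_lin2.
by apply/funext => v; rewrite /lin2 mulr1 mulr0 addr0.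
Qed.

Lemma smooth_y U : smooth_on U (fun v : 'rV[R]_2 => v 0 1).
Proof.
rewrite (_ : (fun v => _) = lin2 0 1); first exact: smooth_lin2.
by apply/funext => v; rewrite /lin2 mulr1 mulr0 add0r.
Qed.

Lemma has_grad_curve f (x y : R -> R) (t a b x' y' : R) :
  is_derive t 1 x x' -> is_derive t 1 y y' -> has_grad f (pt (x t) (y t)) a b ->
  is_derive t 1 (fun s => f (pt (x s) (y s))) (a * x' + b * y').
Proof.
move=> [x1 xE] [y1 yE] [df da db].
set c := fun s => pt (x s) (y s).
have xc : derivable c t 1.
  apply/derivable_mxP => i j; rewrite (_ : (fun _ => _) = if j == 0 then x else y).
    by case: ifP.
  by apply/funext => s; rewrite mxE; case: ifP.
have dc : is_derive t 1 c (pt x' y').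
  split => //; rewrite derive_mx//; apply: rV2P; rewrite !mxE/=.
    by rewrite -xE; congr ('D_1 _ t); apply/funext => s; rewrite mxE.
  by rewrite -yE; congr ('D_1 _ t); apply/funext => s; rewrite mxE.
have [/derivable1_diffP dc1 dc2] := dc.
have dfc : differentiable (f \o c) t by exact: differentiable_comp.
have E : 'd c t 1 = pt x' y' by rewrite -deriveE.
split; first by apply/derivable1_diffP.
rewrite -[LHS]/('D_1 (f \o c) t) deriveE// diff_comp//= E.
by rewrite diff_dxdy// pt0 pt1 da db mulrC; congr (_ + _); rewrite mulrC.
Qed.

End Plane.

(** * Mean value theorem and symmetry of second derivatives *)

Section MeanValue.
Variable R : realType.
Implicit Types (f g : 'rV[R]_2 -> R) (u v : 'rV[R]_2).

Lemma MVT01 (g dg : R -> R) :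
  (forall t : R, 0 <= t <= 1 -> is_derive t 1 g (dg t)) ->
  exists2 t : R, 0 <= t <= 1 & g 1 - g 0 = dg t.
Proof.
move=> H.
have H' (x : R) : x \in `]0, 1[%R -> is_derive x 1 g (dg x).
  by rewrite in_itv/= => /andP[x0 x1]; apply: H; rewrite !ltW.
have cg : {within `[0, 1], continuous g}.
  by apply: derivable_within_continuous => x; rewrite in_itv/= => /H[].
have [t t01 E] := MVT_segment ler01 H' cg.
by exists t; [move: t01; rewrite in_itv|rewrite E subr0 mulr1].
Qed.

Lemma is_derive_affine (a b t : R) : is_derive t 1 (fun s => a + s * b) b.
Proof. by apply: is_derive_eq; rewrite /GRing.scale /=; ring. Qed.

Lemma MVT_seg (f df : R -> R) a b :
  (forall t : R, 0 <= t <= 1 ->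
     is_derive (a + t * (b - a)) 1 f (df (a + t * (b - a)))) ->
  exists2 t : R, 0 <= t <= 1 & f b - f a = df (a + t * (b - a)) * (b - a).
Proof.
move=> H.
have [t t01|t t01 E] := @MVT01 (fun t => f (a + t * (b - a)))
  (fun t => df (a + t * (b - a)) * (b - a)).
  have := is_derive_affine a (b - a) t; have := H t t01.
  by move=> h1 h2; exact: (@is_derive1_comp R f (fun s => a + s * (b - a)) t _ _ h1 h2).
by exists t => //; rewrite -E mul1r mul0r addr0; congr (f _ - _); ring.
Qed.

Lemma plane_MVT f u v :
  (forall t : R, 0 <= t <= 1 ->
     differentiable f (pt (u 0 0 + t * (v 0 0 - u 0 0)) (u 0 1 + t * (v 0 1 - u 0 1)))) ->
  exists2 t : R, 0 <= t <= 1 &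
    let w := pt (u 0 0 + t * (v 0 0 - u 0 0)) (u 0 1 + t * (v 0 1 - u 0 1)) in
    f v - f u = (v 0 0 - u 0 0) * dx f w + (v 0 1 - u 0 1) * dy f w.
Proof.
move=> H; set x := fun t => u 0 0 + t * (v 0 0 - u 0 0).
set y := fun t => u 0 1 + t * (v 0 1 - u 0 1).
have [t t01|t t01 E] := @MVT01 (fun t => f (pt (x t) (y t)))
   (fun t => dx f (pt (x t) (y t)) * (v 0 0 - u 0 0) +
             dy f (pt (x t) (y t)) * (v 0 1 - u 0 1)).
  apply: has_grad_curve; [exact: is_derive_affine|exact: is_derive_affine|].
  by split => //; exact: H.
exists t => //=; move: E; have -> : pt (x 1) (y 1) = v.
  by rewrite -[RHS]ptK /x /y !mul1r ![_ + (_ - _)]addrC !subrK.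
have -> : pt (x 0) (y 0) = u by rewrite -[RHS]ptK /x /y !mul0r !addr0.
by move=> ->; congr (_ + _); rewrite mulrC.
Qed.

Lemma seg_near (a b r t : R) : 0 <= t <= 1 -> `|b - a| < r -> `|a + t * (b - a) - a| < r.
Proof.
move=> /andP[t0 t1] br; rewrite addrC addKr normrM ger0_norm//.
by apply: le_lt_trans br; rewrite ler_piMl.
Qed.

Lemma seg_near2 (a b c r t : R) : 0 <= t <= 1 -> `|a - c| < r -> `|b - c| < r ->
  `|a + t * (b - a) - c| < r.
Proof.
move=> /andP[t0 t1] ar br; apply: (@le_lt_trans _ _ (Num.max `|a - c| `|b - c|)).
  2: by rewrite gt_max ar br.
have : `|a - c| <= Num.max `|a - c| `|b - c| by rewrite le_max lexx.
have : `|b - c| <= Num.max `|a - c| `|b - c| by rewrite le_max lexx orbT.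
move: (Num.max _ _) => m.
by rewrite !ler_norml => /andP[? ?] /andP[? ?]; apply/andP; split; nra.
Qed.

Lemma continuous_near_lt f u (e : R) : {for u, continuous f} -> 0 < e ->
  exists2 r : R, 0 < r & forall v, `|v 0 0 - u 0 0| < r -> `|v 0 1 - u 0 1| < r ->
    `|f v - f u| < e.
Proof.
move=> /cvgrPdist_lt cf e0; have := cf _ e0.
by move=> /near_square[r r0 H]; exists r => // v v0 v1; rewrite distrC H.
Qed.

(** The second difference [D] over a square of side [h] equals [h * h] times either mixed derivative
    at some point of the square, by two mean value theorems in each order; both points lie where the
    mixed derivatives differ from their values at [u] by less than [e / 2]. *)
Lemma schwarz U f u : open U -> smooth_on U f -> U u -> dx (dy f) u = dy (dx f) u.
Proof.
move=> oU sf Uu; apply/eqP; rewrite -subr_eq0 -normr_le0; apply/ler_addgt0Pl => e e0.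
rewrite addr0.
have [rU rU0 HU] : exists2 r : R, 0 < r &
    forall v, `|v 0 0 - u 0 0| < r -> `|v 0 1 - u 0 1| < r -> U v.
  by apply/near_square; exact: open_nbhs_nbhs.
have e20 : 0 < e / 2 by rewrite divr_gt0.
have [r1 r10 H1] := continuous_near_lt
  (smooth_on_continuous (smooth_dx (smooth_dy sf)) Uu) e20.
have [r2 r20 H2] := continuous_near_lt
  (smooth_on_continuous (smooth_dy (smooth_dx sf)) Uu) e20.
pose r := Num.min rU (Num.min r1 r2).
have r0 : 0 < r by rewrite !lt_min rU0 r10 r20.
have [h h0 hr] : exists2 h : R, 0 < h & h < r.
  by exists (r / 2); [rewrite divr_gt0|rewrite ltr_pdivrMr// ltr_pMr// ltr1n].
pose a := u 0 0; pose b := u 0 1.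
have U' x y : `|x - a| < r -> `|y - b| < r -> U (pt x y).
  rewrite !lt_min => /and3P[xa _ _] /and3P[yb _ _].
  by apply: HU; rewrite mxE.
have ah : `|a + h - a| < r by rewrite addrC addKr gtr0_norm.
have bh : `|b + h - b| < r by rewrite addrC addKr gtr0_norm.
have aa : `|a - a| < r by rewrite subrr normr0.
have bb : `|b - b| < r by rewrite subrr normr0.
have px g x y : smooth_on U g -> `|x - a| < r -> `|y - b| < r ->
    is_derive x 1 (fun s => g (pt s y)) (dx g (pt x y)).
  move=> sg xa yb.
  have := has_grad_curve (is_derive_id x 1) (is_derive_cst y x 1)
     (smooth_has_grad sg (U' _ _ xa yb)).
  by rewrite mulr1 mulr0 addr0.
have py g x y : smooth_on U g -> `|x - a| < r -> `|y - b| < r ->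
    is_derive y 1 (fun s => g (pt x s)) (dy g (pt x y)).
  move=> sg xa yb.
  have := has_grad_curve (is_derive_cst x y 1) (is_derive_id y 1)
     (smooth_has_grad sg (U' _ _ xa yb)).
  by rewrite mulr1 mulr0 add0r.
have ahr (t : R) : 0 <= t <= 1 -> `|a + t * (a + h - a) - a| < r.
  by move=> t01; exact: seg_near.
have bhr (t : R) : 0 <= t <= 1 -> `|b + t * (b + h - b) - b| < r.
  by move=> t01; exact: seg_near.
pose D := f (pt (a + h) (b + h)) - f (pt a (b + h)) - f (pt (a + h) b) + f (pt a b).
have [x1 [y1 [x1r y1r D1]]] : exists x y, [/\ `|x - a| < r, `|y - b| < r &
    D = dy (dx f) (pt x y) * h * h].
  have [t t01|t t01] := @MVT_seg (fun s => f (pt s (b + h)) - f (pt s b))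
     (fun s => dx f (pt s (b + h)) - dx f (pt s b)) a (a + h).
    by apply: is_deriveB; apply: px => //; exact: ahr.
  set x := a + t * _ => E.
  have [s s01|s s01] := @MVT_seg (fun s => dx f (pt x s))
     (fun s => dy (dx f) (pt x s)) b (b + h).
    by apply: py; [exact: smooth_dx|rewrite /x; exact: ahr|exact: bhr].
  set y := b + s * _ => E2.
  exists x, y; split; [rewrite /x; exact: ahr|rewrite /y; exact: bhr|].
  move: E; rewrite E2 /= => E; rewrite /D; move: E.
  by rewrite ![_ + h - _]addrC !addKr => <-; ring.
have [x2 [y2 [x2r y2r D2]]] : exists x y, [/\ `|x - a| < r, `|y - b| < r &
    D = dx (dy f) (pt x y) * h * h].
  have [t t01|t t01] := @MVT_seg (fun s => f (pt (a + h) s) - f (pt a s))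
     (fun s => dy f (pt (a + h) s) - dy f (pt a s)) b (b + h).
    by apply: is_deriveB; apply: py => //; exact: bhr.
  set y := b + t * _ => E.
  have [s s01|s s01] := @MVT_seg (fun s => dy f (pt s y))
     (fun s => dx (dy f) (pt s y)) a (a + h).
    by apply: px; [exact: smooth_dy|exact: ahr|rewrite /y; exact: bhr].
  set x := a + s * _ => E2.
  exists x, y; split; [rewrite /x; exact: ahr|rewrite /y; exact: bhr|].
  move: E; rewrite E2 /= => E; rewrite /D; move: E.
  by rewrite ![_ + h - _]addrC !addKr => <-; ring.
have DD : dx (dy f) (pt x2 y2) = dy (dx f) (pt x1 y1).
  have hn : h * h != 0 by rewrite mulf_neq0 ?gt_eqF.
  by apply: (mulIf hn); rewrite [LHS]mulrA [RHS]mulrA -D2 -D1.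
have B1 : `|dx (dy f) (pt x2 y2) - dx (dy f) u| < e / 2.
  by move: x2r y2r; rewrite !lt_min => /and3P[? ? ?] /and3P[? ? ?]; apply: H1; rewrite mxE.
have B2 : `|dy (dx f) (pt x1 y1) - dy (dx f) u| < e / 2.
  by move: x1r y1r; rewrite !lt_min => /and3P[? ? ?] /and3P[? ? ?]; apply: H2; rewrite mxE.
move: B1 B2; rewrite DD; set p := dx _ u; set q := dy _ u; set s := dy _ _.
by rewrite !ltr_norml ler_norml => /andP[? ?] /andP[? ?]; apply/andP; split; lra.
Qed.

End MeanValue.

(** * Implicit function theorem for two real variables *)

Section ImplicitFunction.
Variable R : realType.

Definition scal (L v : R) : R := v * L.

Fact scal_linear L : linear (scal L).
Proof. by move=> k u v; rewrite /scal /GRing.scale /=; ring. Qed.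

HB.instance Definition _ L := GRing.isLinear.Build R R R _ (scal L) (scal_linear L).

Lemma near_le_is_derive (f : R -> R) (x L : R) : (forall e : R, 0 < e ->
    \forall y \near x, `|f y - f x - (y - x) * L| <= e * `|y - x|) ->
  is_derive x 1 f L.
Proof.
move=> H; have cs : continuous (scal L).
  by move=> v; apply: cvgMr_tmp; exact: cvg_id.
have [df D] := @near_le_differentiable R R R f x (scal L) cs H.
split; first exact/derivable1_diffP.
by rewrite deriveE// D /= /scal mul1r.
Qed.

Lemma near_real (x : R) (P : R -> Prop) : (\forall y \near x, P y) <->
  exists2 r : R, 0 < r & forall y, `|y - x| < r -> P y.
Proof.
split=> [/nbhs_ballP[r /= r0 H]|[r r0 H]].
  by exists r => // y yr; apply: H; rewrite /ball/= distrC.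
by apply/nbhs_ballP; exists r => // y; rewrite /ball/= distrC; exact: H.
Qed.

(** Near the base point [G] increases in [y] with slope above [m = Gy x0 y0 / 2], so the opposite
    signs at [y0 - h] and [y0 + h] persist for [x] near [x0] and enclose a unique zero. The form
    with two real arguments and explicit neighbourhoods serves both for level curves and for
    parametrizing a curve by its polar angle. *)
Lemma implicit_function (G Gx Gy : R -> R -> R) (x0 y0 r : R) : 0 < r ->
  (forall x y, `|x - x0| < r -> `|y - y0| < r ->
    is_derive x 1 (fun s => G s y) (Gx x y)) ->
  (forall x y, `|x - x0| < r -> `|y - y0| < r -> is_derive y 1 (G x) (Gy x y)) ->
  (forall x y, `|x - x0| < r -> `|y - y0| < r ->
    forall e : R, 0 < e -> exists2 d : R, 0 < d & forall x' y',
      `|x' - x| < d -> `|y' - y| < d -> `|Gx x' y' - Gx x y| < e) ->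
  (forall x y, `|x - x0| < r -> `|y - y0| < r ->
    forall e : R, 0 < e -> exists2 d : R, 0 < d & forall x' y',
      `|x' - x| < d -> `|y' - y| < d -> `|Gy x' y' - Gy x y| < e) ->
  G x0 y0 = 0 -> 0 < Gy x0 y0 ->
  exists d e : R, exists2 g : R -> R,
  [/\ 0 < d, 0 < e, d <= r & e <= r] & [/\ g x0 = y0,
  forall x, `|x - x0| < d -> `|g x - y0| < e /\ G x (g x) = 0,
  forall x y, `|x - x0| < d -> `|y - y0| < e -> G x y = 0 -> y = g x &
  forall x, `|x - x0| < d -> is_derive x 1 g (- Gx x (g x) / Gy x (g x))].
Proof.
move=> r0 dGx dGy cGx cGy G0 Gy0.
have z0 : `|x0 - x0| < r by rewrite subrr normr0.
have z1 : `|y0 - y0| < r by rewrite subrr normr0.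
pose m := Gy x0 y0 / 2; have m0 : 0 < m by rewrite divr_gt0.
have [d1 d10 H1] := cGx _ _ z0 z1 _ ltr01.
have [d2 d20 H2] := cGy _ _ z0 z1 _ m0.
pose e := Num.min r (Num.min d1 d2).
have e0 : 0 < e by rewrite !lt_min r0 d10 d20.
have er : e <= r by rewrite ge_min lexx.
pose M := `|Gx x0 y0| + 1; have M0 : 0 < M by rewrite ltr_wpDl.
have GxM x y : `|x - x0| < e -> `|y - y0| < e -> `|Gx x y| < M.
  rewrite !lt_min => /and3P[xr x1 x2] /and3P[yr y1 y2].
  have := H1 _ _ x1 y1; rewrite /M -{2}(subrK (Gx x0 y0) (Gx x y)) => h.
  by rewrite (le_lt_trans (ler_normD _ _))// addrC ltrD2l.
have Gym x y : `|x - x0| < e -> `|y - y0| < e -> m < Gy x y.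
  rewrite !lt_min => /and3P[xr x1 x2] /and3P[yr y1 y2].
  have := H2 _ _ x2 y2; rewrite ltr_norml => /andP[+ _].
  by rewrite /m; lra.
have lt_r a : a < e -> a < r by move=> /lt_le_trans; exact.
clearbody e.
have incr x y y' : `|x - x0| < e -> `|y - y0| < e -> `|y' - y0| < e ->
    exists2 b, m < b /\ (exists2 t, 0 <= t <= 1 & b = Gy x (y + t * (y' - y))) &
      G x y' - G x y = b * (y' - y).
  move=> xe ye y'e; have [t t01|t t01 E] := @MVT_seg R (G x) (Gy x) y y'.
    by apply: dGy; apply: lt_r => //; apply: seg_near2.
  exists (Gy x (y + t * (y' - y))) => //; split; last by exists t.
  by apply: Gym => //; apply: seg_near2.
pose h := e / 2; have h0 : 0 < h by rewrite divr_gt0.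
have he : h < e by rewrite ltr_pdivrMr// ltr_pMr// ltr1n.
have yp : `|y0 + h - y0| < e by rewrite addrC addKr gtr0_norm.
have ym : `|y0 - h - y0| < e by rewrite addrC addKr normrN gtr0_norm.
have y00 : `|y0 - y0| < e by rewrite subrr normr0.
have x00 : `|x0 - x0| < e by rewrite subrr normr0.
have Gp : 0 < G x0 (y0 + h).
  have [b [mb _]] := incr _ _ _ x00 y00 yp; rewrite G0 subr0 => ->.
  by rewrite addrC addKr mulr_gt0// (lt_trans m0).
have Gm : G x0 (y0 - h) < 0.
  have [b [mb _]] := incr _ _ _ x00 y00 ym; rewrite G0 subr0 => ->.
  by rewrite addrC addKr mulrN oppr_lt0 mulr_gt0// (lt_trans m0).
have ctx y : `|y - y0| < e -> {for x0, continuous (fun s => G s y)}.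
  move=> ye; have [dG _] := dGx _ _ z0 (lt_r _ ye).
  by apply: differentiable_continuous; exact/derivable1_diffP.
have [d3 d30 H3] : exists2 d : R, 0 < d & forall x, `|x - x0| < d -> 0 < G x (y0 + h).
  by apply/near_real; move/cvgr_gt : (ctx _ yp); exact.
have [d4 d40 H4] : exists2 d : R, 0 < d & forall x, `|x - x0| < d -> G x (y0 - h) < 0.
  by apply/near_real; move/cvgr_lt : (ctx _ ym); exact.
pose d := Num.min e (Num.min d3 d4).
have d0 : 0 < d by rewrite !lt_min e0 d30 d40.
have de : d <= e by rewrite ge_min lexx.
have lt_e a : a < d -> a < e by move=> /lt_le_trans; exact.
have ex x : `|x - x0| < d -> exists y, `|y - y0| < e /\ G x y = 0.
  move=> xd; have xe := lt_e _ xd.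
  have hy y : y \in `[y0 - h, y0 + h] -> `|y - y0| < e.
    rewrite in_itv/= => /andP[a b]; apply: le_lt_trans he.
    by rewrite ler_norml; apply/andP; split; move: a b; clear; lra.
  have cG : {within `[y0 - h, y0 + h], continuous (G x)}.
    apply: derivable_within_continuous => y /hy ye.
    by have [] := dGy _ _ (lt_r _ xe) (lt_r _ ye).
  have hh : y0 - h <= y0 + h by move: h0; clear; lra.
  have [|y yin Gy1] := @IVT R (G x) _ _ 0 hh cG.
    move: xd; rewrite !lt_min => /and3P[_ /H3 p /H4 q].
    by rewrite ge_min le_max (ltW q) (ltW p) orbT.
  by exists y; split => //; exact: hy.
have uniq x y y' : `|x - x0| < d -> `|y - y0| < e -> `|y' - y0| < e ->
    G x y = 0 -> G x y' = 0 -> y' = y.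
  move=> xd ye ye' Gy1 Gy2; have [b [mb _]] := incr _ _ _ (lt_e _ xd) ye ye'.
  rewrite Gy1 Gy2 subrr => /esym/eqP; rewrite mulf_eq0 subr_eq0.
  by rewrite gt_eqF ?(lt_trans m0)//= => /eqP.
have ex' x : exists y, `|x - x0| < d -> `|y - y0| < e /\ G x y = 0.
  have [xd|xd] := pselect (`|x - x0| < d); last by exists 0.
  by have [y ?] := ex x xd; exists y.
have [g Hg] := choice ex'.
exists d, e, g; first by split => //; exact: le_trans er.
have x0d : `|x0 - x0| < d by rewrite subrr normr0.
split=> //.
- by have [g1 g2] := Hg _ x0d; apply: uniq x0d _ _ _ _.
- by move=> x y xd ye Gy1; have [? ?] := Hg _ xd; apply: uniq xd _ _ _ _.
move=> x xd; have [gx Ggx] := Hg _ xd.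
have xe := lt_e _ xd.
set A := Gx x (g x); set B := Gy x (g x).
have B0 : m < B by exact: Gym.
have key x' : `|x' - x0| < d -> exists a b t s : R, [/\ 0 <= t <= 1, 0 <= s <= 1,
    `|a| < M /\ m < b, a = Gx (x + t * (x' - x)) (g x) /\
    b = Gy x' (g x + s * (g x' - g x)) & a * (x' - x) + b * (g x' - g x) = 0].
  move=> xd'; have [gx' Ggx'] := Hg _ xd'; have xe' := lt_e _ xd'.
  have [b [mb [s s01 bE]] Eb] := incr _ _ _ xe' gx gx'.
  have [t t01|t t01 Ea] := @MVT_seg R (fun s => G s (g x)) (fun s => Gx s (g x)) x x'.
    by apply: dGx; apply: lt_r => //; exact: seg_near2.
  exists (Gx (x + t * (x' - x)) (g x)), b, t, s; split => //.
    by split => //; apply: GxM => //; exact: seg_near2.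
  by rewrite -Ea -Eb Ggx Ggx'; ring.
have lip x' : `|x' - x0| < d -> `|g x' - g x| <= M / m * `|x' - x|.
  move=> /key[a [b [t [s [_ _ [aM mb] _ /eqP]]]]].
  rewrite addrC addr_eq0 => /eqP/(congr1 Num.norm); rewrite normrN !normrM.
  rewrite (gtr0_norm (lt_trans m0 mb)) => E.
  rewrite mulrAC ler_pdivlMr//; apply: (@le_trans _ _ (b * `|g x' - g x|)).
    by rewrite mulrC ler_wpM2r// ltW.
  by rewrite E ler_wpM2r// ltW.
apply: near_le_is_derive => eps eps0.
(* The error in the slope is [(A * (b - B) - B * (a - A)) / (b * B)] with [b] and [B] above [m], so
   errors below [eta] in [a] and [b] keep it at most [eps]. *)
pose eta := eps * (m * m) / (`|A| + B).
have B1 : 0 < B by exact: lt_trans B0.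
have AB : 0 < `|A| + B by rewrite ltr_wpDl.
have eta0 : 0 < eta by rewrite divr_gt0// !mulr_gt0.
have [k1 k10 K1] := cGx _ _ (lt_r _ xe) (lt_r _ gx) _ eta0.
have [k2 k20 K2] := cGy _ _ (lt_r _ xe) (lt_r _ gx) _ eta0.
apply/near_real; exists (Num.min (d - `|x - x0|) (Num.min k1 (Num.min k2 (k2 / (M / m))))).
  by rewrite !lt_min subr_gt0 xd k10 k20 !divr_gt0.
move=> x'; rewrite !lt_min => /and4P[xx1 xx2 xx3 xx4].
have xd' : `|x' - x0| < d.
  rewrite -(subrK x x') -addrA; apply: le_lt_trans (ler_normD _ _) _; move: xx1; clear; lra.
have := lip _ xd' => lp.
have [a [b [t [s [t01 s01 [aM mb] [aE bE] E]]]]] := key _ xd'.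
have b0 : 0 < b by exact: lt_trans mb.
have Aa : `|a - A| < eta.
  by rewrite aE; apply: K1; [exact: seg_near|rewrite subrr normr0].
have Bb : `|b - B| < eta.
  rewrite bE; apply: K2 => //; apply: seg_near => //.
  by apply: le_lt_trans lp _; rewrite mulrC -ltr_pdivlMr ?divr_gt0.
have -> : g x' - g x = - (a / b) * (x' - x).
  have nb : b != 0 by rewrite gt_eqF.
  apply: (mulfI nb); rewrite (_ : b * (- (a / b) * _) = - (a * (x' - x))).
    by apply/eqP; rewrite -addr_eq0 addrC E.
  by field.
have -> : - (a / b) * (x' - x) - (x' - x) * (- A / B) =
    ((A * (b - B) - B * (a - A)) / (b * B)) * (x' - x).
  by field; rewrite !gt_eqF.
rewrite normrM ler_wpM2r// normrM normfV (gtr0_norm (mulr_gt0 b0 B1)).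
rewrite ler_pdivrMr ?mulr_gt0//.
apply: (@le_trans _ _ ((`|A| + B) * eta)).
  apply: (le_trans (ler_normB _ _)); rewrite !normrM (gtr0_norm B1) mulrDl.
  by apply: lerD; rewrite ler_wpM2l// ltW.
rewrite /eta mulrC divfK ?gt_eqF//.
by rewrite ler_wpM2l ?(ltW eps0)// ler_pM// ltW.
Qed.

End ImplicitFunction.

(** * Local injectivity and level curves *)

Section LevelCurve.
Variable R : realType.
Implicit Types (f g h : 'rV[R]_2 -> R) (u v w : 'rV[R]_2).

(** By Cramer's rule two combinations of [g] and [h] have the coordinate vectors as gradients at
    [u]. Each differs from its coordinate by at most a quarter of the displacement, so half of the
    displacement is left and is controlled by the differences of [g] and [h]. *)
Lemma local_injectivity U g h u : open U -> U u -> smooth_on U g -> smooth_on U h ->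
  dx g u * dy h u - dy g u * dx h u != 0 ->
  exists C r : R, [/\ 0 < C, 0 < r & forall v w,
    `|v 0 0 - u 0 0| < r -> `|v 0 1 - u 0 1| < r ->
    `|w 0 0 - u 0 0| < r -> `|w 0 1 - u 0 1| < r ->
    `|v 0 0 - w 0 0| + `|v 0 1 - w 0 1| <= C * (`|g v - g w| + `|h v - h w|)].
Proof.
move=> oU Uu sg sh; set J := _ - _ => J0.
pose lc (a b : R) := fun v => a * g v + b * h v.
have slc a b : smooth_on U (lc a b).
  by apply: smooth_onD => //; apply: smooth_onM => //; exact: smooth_on_cst.
have glc a b v : U v -> has_grad (lc a b) v (a * dx g v + b * dx h v)
    (a * dy g v + b * dy h v).
  move=> Uv; have := has_gradD (has_gradM (has_grad_cst a v) (smooth_has_grad sg Uv))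
    (has_gradM (has_grad_cst b v) (smooth_has_grad sh Uv)).
  by move=> H; apply: has_grad_eq H _ _; rewrite !mulr0 !addr0.
have key (a b p q : R) : dx (lc a b) u = p -> dy (lc a b) u = q ->
    exists2 r : R, 0 < r & forall v w,
    `|v 0 0 - u 0 0| < r -> `|v 0 1 - u 0 1| < r ->
    `|w 0 0 - u 0 0| < r -> `|w 0 1 - u 0 1| < r ->
    `|lc a b v - lc a b w - (p * (v 0 0 - w 0 0) + q * (v 0 1 - w 0 1))| <=
      4^-1 * (`|v 0 0 - w 0 0| + `|v 0 1 - w 0 1|).
  move=> dp dq.
  have q0 : 0 < 4^-1 :> R by rewrite invr_gt0.
  have [r1 r10 H1] := continuous_near_lt
    (smooth_on_continuous (smooth_dx (slc a b)) Uu) q0.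
  have [r2 r20 H2] := continuous_near_lt
    (smooth_on_continuous (smooth_dy (slc a b)) Uu) q0.
  have [r3 r30 H3] : exists2 r : R, 0 < r &
      forall v, `|v 0 0 - u 0 0| < r -> `|v 0 1 - u 0 1| < r -> U v.
    by apply/near_square; exact: open_nbhs_nbhs.
  exists (Num.min r1 (Num.min r2 r3)); first by rewrite !lt_min r10 r20 r30.
  move=> v w v0 v1 w0 w1.
  have inr (t : R) : 0 <= t <= 1 ->
      `|(pt (w 0 0 + t * (v 0 0 - w 0 0)) (w 0 1 + t * (v 0 1 - w 0 1))) 0 0 - u 0 0|
         < Num.min r1 (Num.min r2 r3) /\
      `|(pt (w 0 0 + t * (v 0 0 - w 0 0)) (w 0 1 + t * (v 0 1 - w 0 1))) 0 1 - u 0 1|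
         < Num.min r1 (Num.min r2 r3).
    by move=> t01; rewrite pt0 pt1; split; apply: seg_near2.
  have [t t01|t t01 /=] := @plane_MVT R (lc a b) w v.
    have [] := inr t t01; rewrite !lt_min => /and3P[_ _ a3] /and3P[_ _ b3].
    by apply: smooth_on_differentiable (slc a b) _; exact: H3.
  set z := pt _ _ => ->.
  have [] := inr t t01; rewrite -/z !lt_min => /and3P[a1 a2 _] /and3P[b1 b2 _].
  have := H1 _ a1 b1; have := H2 _ a2 b2; rewrite dp dq => Hq Hp.
  set A := v 0 0 - w 0 0; set B := v 0 1 - w 0 1.
  rewrite (_ : _ - _ = A * (dx (lc a b) z - p) + B * (dy (lc a b) z - q)); last by ring.
  apply: le_trans (ler_normD _ _) _; rewrite !normrM mulrDr.
  by apply: lerD; rewrite mulrC ler_wpM2r// ltW.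
have [|| r1 r10 H1] := key (dy h u / J) (- (dy g u / J)) 1 0.
- by have [_ -> _] := glc (dy h u / J) (- (dy g u / J)) u Uu; rewrite /J in J0 *; field.
- by have [_ _ ->] := glc (dy h u / J) (- (dy g u / J)) u Uu; rewrite /J in J0 *; field.
have [|| r2 r20 H2] := key (- (dx h u / J)) (dx g u / J) 0 1.
- by have [_ -> _] := glc (- (dx h u / J)) (dx g u / J) u Uu; rewrite /J in J0 *; field.
- by have [_ _ ->] := glc (- (dx h u / J)) (dx g u / J) u Uu; rewrite /J in J0 *; field.
clear key.
move: H1 H2; rewrite /lc; move: (dy h u / J) (- (dy g u / J)) (- (dx h u / J)) (dx g u / J).
move=> a b c d H1 H2.
pose C := 2 * (`|a| + `|b| + `|c| + `|d|) + 1.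
have C0 : 0 < C by rewrite ltr_wpDl// mulr_ge0// !addr_ge0.
exists C, (Num.min r1 r2); split => //; first by rewrite lt_min r10 r20.
move=> v w; rewrite !lt_min => /andP[v1 v2] /andP[v3 v4] /andP[w1 w2] /andP[w3 w4].
have := H1 v w v1 v3 w1 w3; have := H2 v w v2 v4 w2 w4.
have E (k l : R) : k * g v + l * h v - (k * g w + l * h w) = k * (g v - g w) + l * (h v - h w).
  by ring.
rewrite !E; clear E H1 H2.
set dg := g v - g w; set dh := h v - h w.
set A := v 0 0 - w 0 0; set B := v 0 1 - w 0 1.
rewrite mul0r add0r !mul1r mul0r addr0 => H2 H1.
have tri (x y k : R) : `|x - y| <= k -> `|y| <= `|x| + k.
  move=> xy; have -> : y = x - (x - y) by ring.
  by rewrite (le_trans (ler_normB _ _))// lerD2l.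
have := tri _ _ _ H1; have := tri _ _ _ H2.
have nl (k l : R) : `|k * dg + l * dh| <= (`|k| + `|l|) * (`|dg| + `|dh|).
  apply: le_trans (ler_normD _ _) _; rewrite !normrM.
  have := mulr_ge0 (normr_ge0 k) (normr_ge0 dh).
  have := mulr_ge0 (normr_ge0 l) (normr_ge0 dg).
  by move=> ? ?; rewrite mulrDl !mulrDr; lra.
have := nl a b; have := nl c d; rewrite /C.
move: (`|a * _ + _|) (`|c * _ + _|) (`|A|) (`|B|) => x y z t.
have := addr_ge0 (normr_ge0 dg) (normr_ge0 dh).
move: (`|dg| + `|dh|) (`|a|) (`|b|) (`|c|) (`|d|) => S k l m n; clear.
move=> S0; rewrite !mulrDl mul1r => hy hx hz ht; lra.
Qed.

(** In the frame [P s t], whose second axis is the gradient of [f] at [u], the level set is a graph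
    [t = g s]. The velocity is the rotated gradient of [f] times [l s > 0], so a derivative along
    the curve is [l s] times [dx f * dy h - dy f * dx h]; the explicit equation for [l] gives its
    continuity, and the last clause says that [s] is a normalized tangential coordinate. *)
Lemma level_curve U f u : open U -> U u -> smooth_on U f ->
  (dx f u != 0) || (dy f u != 0) ->
  exists (X Y l : R -> R) (d r : R), [/\ 0 < d, 0 < r, pt (X 0) (Y 0) = u,
    forall s, `|s| < d -> let c := pt (X s) (Y s) in
      [/\ U c, f c = f u, 0 < l s /\ l s * (dx f u * dx f c + dy f u * dy f c) =
            dx f u ^+ 2 + dy f u ^+ 2, is_derive s 1 X (- l s * dy f c) &
          is_derive s 1 Y (l s * dx f c)] &
    forall v, `|v 0 0 - u 0 0| < r -> `|v 0 1 - u 0 1| < r -> f v = f u ->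
      exists2 s, `|s| < d /\ s * (dx f u ^+ 2 + dy f u ^+ 2) =
        - dy f u * (v 0 0 - u 0 0) + dx f u * (v 0 1 - u 0 1) & v = pt (X s) (Y s)].
Proof.
move=> oU Uu sf grad0; set a := dx f u in grad0 *; set b := dy f u in grad0 *.
have N0 : 0 < a ^+ 2 + b ^+ 2.
  case/orP: grad0 => h; first by rewrite ltr_pwDl ?sqr_ge0// exprn_even_gt0.
  by rewrite ltr_wpDl ?sqr_ge0// exprn_even_gt0.
pose P s t := pt (u 0 0 - s * b + t * a) (u 0 1 + s * a + t * b).
pose Gx s t := - b * dx f (P s t) + a * dy f (P s t).
pose Gy s t := a * dx f (P s t) + b * dy f (P s t).
have sGy : smooth_on U (fun v => a * dx f v + b * dy f v).
  by apply: smooth_onD => //; apply: smooth_onM; try exact: smooth_on_cst;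
    [done|exact: smooth_dx|done|exact: smooth_dy].
have sGx : smooth_on U (fun v => - b * dx f v + a * dy f v).
  by apply: smooth_onD => //; apply: smooth_onM; try exact: smooth_on_cst;
    [done|exact: smooth_dx|done|exact: smooth_dy].
have Gyu : 0 < a * dx f u + b * dy f u by rewrite -/a -/b -!expr2.
have [r1 r10 H1] : exists2 r : R, 0 < r & forall v,
    `|v 0 0 - u 0 0| < r -> `|v 0 1 - u 0 1| < r -> U v /\ 0 < a * dx f v + b * dy f v.
  apply/near_square; apply: filterI; first exact: open_nbhs_nbhs.
  exact: (cvgr_gt _ (smooth_on_continuous sGy Uu)).
pose K := `|a| + `|b| + 1; have K0 : 0 < K by rewrite ltr_wpDl// addr_ge0.
have est (x y k : R) : `|x| < k -> `|y| < k ->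
    `|- x * b + y * a| < k * K /\ `|x * a + y * b| < k * K.
  move=> xk yk; have k0 : 0 < k by exact: le_lt_trans xk.
  have h (p q : R) : `|p| < k -> `|q| < k -> `|p * b + q * a| < k * K.
    move=> pk qk; apply: le_lt_trans (ler_normD _ _) _; rewrite !normrM /K.
    have := ler_wpM2r (normr_ge0 b) (ltW pk); have := ler_wpM2r (normr_ge0 a) (ltW qk).
    by move=> ? ?; rewrite !mulrDr mulr1; lra.
  by split; [apply: h; rewrite ?normrN|rewrite addrC; apply: h].
pose r := r1 / K; have r0 : 0 < r by rewrite divr_gt0.
have rK : r * K = r1 by rewrite /r divfK// gt_eqF.
have inU s t : `|s - 0| < r -> `|t - 0| < r -> U (P s t) /\ 0 < Gy s t.
  rewrite !subr0 => sr tr; have [h1 h2] := est _ _ _ sr tr.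
  apply: H1; rewrite /P ?pt0 ?pt1.
    by rewrite (_ : _ - u 0 0 = - s * b + t * a) -?rK//; ring.
  by rewrite (_ : _ - u 0 1 = s * a + t * b) -?rK//; ring.
have dP g s t : smooth_on U g -> U (P s t) ->
    is_derive s 1 (fun s => g (P s t)) (- b * dx g (P s t) + a * dy g (P s t)) /\
    is_derive t 1 (fun t => g (P s t)) (a * dx g (P s t) + b * dy g (P s t)).
  move=> sg UP; split.
    have h1 : is_derive s 1 (fun s => u 0 0 - s * b + t * a) (- b).
      by apply: is_derive_eq; rewrite /GRing.scale /=; ring.
    have h2 : is_derive s 1 (fun s => u 0 1 + s * a + t * b) a.
      by apply: is_derive_eq; rewrite /GRing.scale /=; ring.
    have := has_grad_curve h1 h2 (smooth_has_grad sg UP).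
    by congr is_derive; ring.
  have h1 : is_derive t 1 (fun t => u 0 0 - s * b + t * a) a.
    by apply: is_derive_eq; rewrite /GRing.scale /=; ring.
  have h2 : is_derive t 1 (fun t => u 0 1 + s * a + t * b) b.
    by apply: is_derive_eq; rewrite /GRing.scale /=; ring.
  have := has_grad_curve h1 h2 (smooth_has_grad sg UP).
  by congr is_derive; ring.
have cP g s t : smooth_on U g -> U (P s t) -> forall e : R, 0 < e ->
    exists2 d : R, 0 < d & forall s' t',
      `|s' - s| < d -> `|t' - t| < d -> `|g (P s' t') - g (P s t)| < e.
  move=> sg UP e e0.
  have [d d0 H] := continuous_near_lt (smooth_on_continuous sg UP) e0.
  exists (d / K); first by rewrite divr_gt0.
  move=> s' t' ss tt; have [h1 h2] := est _ _ _ ss tt.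
  move: h1 h2; rewrite divfK ?gt_eqF// => h1 h2.
  apply: H; rewrite /P ?pt0 ?pt1.
    by rewrite (_ : _ - _ = - (s' - s) * b + (t' - t) * a)//; ring.
  by rewrite (_ : _ - _ = (s' - s) * a + (t' - t) * b)//; ring.
have P0 : P 0 0 = u by rewrite /P !mul0r subr0 !addr0 ptK.
have [d [e [g [d0 e0 dr er] [g0 gG guniq dg]]]] :
  exists d e : R, exists2 g : R -> R,
  [/\ 0 < d, 0 < e, d <= r & e <= r] & [/\ g 0 = 0,
  forall x, `|x - 0| < d -> `|g x - 0| < e /\ f (P x (g x)) - f u = 0,
  forall x y, `|x - 0| < d -> `|y - 0| < e -> f (P x y) - f u = 0 -> y = g x &
  forall x : R, `|x - 0| < d -> is_derive x 1 g (- Gx x (g x) / Gy x (g x))].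
  apply: (@implicit_function R (fun s t : R => f (P s t) - f u) Gx Gy 0 0 r r0).
  - move=> s t sr tr; have [UP _] := inU s t sr tr.
    have [h _] := dP f _ _ sf UP.
    by rewrite -[X in is_derive _ _ _ X]subr0; apply: is_deriveB.
  - move=> s t sr tr; have [UP _] := inU s t sr tr.
    have [_ h] := dP f _ _ sf UP.
    by rewrite -[X in is_derive _ _ _ X]subr0; apply: is_deriveB.
  - move=> s t sr tr; have [UP _] := inU s t sr tr.
    exact: cP sGx UP.
  - move=> s t sr tr; have [UP _] := inU s t sr tr.
    exact: cP sGy UP.
  - by rewrite P0 subrr.
  - by rewrite /Gy P0.
exists (fun s => u 0 0 - s * b + g s * a), (fun s => u 0 1 + s * a + g s * b).
exists (fun s => (a ^+ 2 + b ^+ 2) / Gy s (g s)).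
exists d, (Num.min d e * (a ^+ 2 + b ^+ 2) / K); split=> //.
- by rewrite !mulr_gt0// ?invr_gt0// lt_min d0.
- by rewrite g0 -/(P 0 0).
- move=> s sd /=; rewrite -/(P s (g s)).
  have sd0 : `|s - 0| < d by rewrite subr0.
  have [gs Gs] := gG s sd0.
  have [UP Gp] := inU s (g s) (lt_le_trans sd0 dr) (lt_le_trans gs er).
  have Gn : Gy s (g s) != 0 by rewrite gt_eqF.
  have dgs := dg s sd0.
  split => //; first by apply/eqP; rewrite -subr_eq0 Gs.
  + by split; [rewrite divr_gt0|rewrite divfK].
  + apply: is_derive_eq; rewrite /GRing.scale /=.
    by rewrite /Gx /Gy in Gn *; field.
  + apply: is_derive_eq; rewrite /GRing.scale /=.
    by rewrite /Gx /Gy in Gn *; field.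
- move=> v v0 v1 fv.
  pose n := a ^+ 2 + b ^+ 2.
  pose s := (- b * (v 0 0 - u 0 0) + a * (v 0 1 - u 0 1)) / n.
  pose t := (a * (v 0 0 - u 0 0) + b * (v 0 1 - u 0 1)) / n.
  have nn : n != 0 by rewrite gt_eqF.
  have vE : v = P s t.
    by apply: rV2P; rewrite /P ?pt0 ?pt1 /s /t /n in nn *; field.
  have bound (p q : R) : `|p| + `|q| < K ->
      `|(p * (v 0 0 - u 0 0) + q * (v 0 1 - u 0 1)) / n| < Num.min d e.
    move=> pqK; rewrite normrM normfV (gtr0_norm N0) ltr_pdivrMr//.
    apply: le_lt_trans (ler_normD _ _) _; rewrite !normrM.
    move: v0 v1; rewrite -/n ltr_pdivlMr// => v0; rewrite ltr_pdivlMr// => v1.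
    move: v0 v1; set M := Num.min d e * n.
    have M0 : 0 < M by rewrite mulr_gt0// lt_min d0.
    clearbody M.
    set A := `|v 0 0 - _|; set B := `|v 0 1 - _| => v0 v1.
    have A0 : 0 <= A := normr_ge0 _.
    have B0 : 0 <= B := normr_ge0 _.
    rewrite -(ltr_pM2r K0) mulrDl -!mulrA.
    apply: (@le_lt_trans _ _ ((`|p| + `|q|) * M)).
      by rewrite mulrDl lerD// ler_wpM2l// ltW.
    by rewrite mulrC ltr_pM2l.
  have Kab : `|a| + `|b| < K by rewrite ltrDl.
  have sE : `|s| < Num.min d e by apply: bound; rewrite normrN addrC.
  have tE : `|t| < Num.min d e by apply: bound.
  move: sE tE; rewrite !lt_min => /andP[sd _] /andP[_ te].
  exists s; first by split=> //; rewrite /s -/n divfK.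
  rewrite -/(P s (g s)) vE; congr (P s _).
  by apply: guniq; rewrite ?subr0// -vE fv subrr.
Qed.

Lemma level_tangent U f h u (r : R) : open U -> U u -> smooth_on U f -> smooth_on U h ->
  0 < r -> (forall v, `|v 0 0 - u 0 0| < r -> `|v 0 1 - u 0 1| < r ->
    U v -> f v = f u -> h v = 0) ->
  - dy f u * dx h u + dx f u * dy h u = 0.
Proof.
move=> oU Uu sf sh r0 H.
have [|/norP[/negPn/eqP -> /negPn/eqP ->]] := boolP ((dx f u != 0) || (dy f u != 0)).
  2: by rewrite oppr0 !mul0r addr0.
move=> /(level_curve oU Uu sf)[X [Y [l [d [r1 [d0 _ c0 cs _]]]]]].
have := cs 0; rewrite normr0 => /(_ d0)/=; rewrite c0 => -[_ _ [l0 _] dX dY].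
have dh : is_derive (0 : R) 1 (fun s => h (pt (X s) (Y s)))
    (dx h u * (- l 0 * dy f u) + dy h u * (l 0 * dx f u)).
  by apply: has_grad_curve => //; rewrite c0; exact: smooth_has_grad sh Uu.
have cX : {for 0, continuous X}.
  by have [dX' _] := dX; apply: differentiable_continuous; exact/derivable1_diffP.
have cY : {for 0, continuous Y}.
  by have [dY' _] := dY; apply: differentiable_continuous; exact/derivable1_diffP.
have X0 : X 0 = u 0 0 by rewrite -c0 pt0.
have Y0 : Y 0 = u 0 1 by rewrite -c0 pt1.
have nz : \forall s \near 0, 0 = h (pt (X s) (Y s)).
  near=> s; apply/esym.
  have sd : `|s| < d by near: s; apply/near_real; exists d => // y; rewrite subr0.
  have [Us fs _ _ _] := cs s sd.
  apply: H => //; rewrite ?pt0 ?pt1 -?X0 -?Y0 distrC.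
    by near: s; move/cvgrPdist_lt: cX; exact.
  by near: s; move/cvgrPdist_lt: cY; exact.
have [_ d1] := near_eq_is_derive nz (is_derive_cst (0 : R) (0 : R) 1).
have [_ d2] := dh.
move: d1; rewrite d2 => E; apply: (mulfI (lt0r_neq0 l0)).
by rewrite mulr0; apply: etrans E; ring.
Unshelve. all: by end_near. Qed.

End LevelCurve.

(** * Closed planar self-shrinkers in polar form *)

Section PlanarShrinkers.
Variable R : realType.
Implicit Types (f g k q th rho : R -> R).

Lemma isdM f g (x a b : R) : is_derive x 1 f a -> is_derive x 1 g b ->
  is_derive x 1 (fun y => f y * g y) (f x * b + g x * a).
Proof. by move=> df dg; apply: is_derive_eq. Qed.

Lemma isd_comp f g (x a b : R) : is_derive (g x) 1 f a -> is_derive x 1 g b ->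
  is_derive x 1 (fun y => f (g y)) (a * b).
Proof. by move=> df dg; exact: (@is_derive1_comp R f g x a b df dg). Qed.

Lemma isd_eq f (x a b : R) : is_derive x 1 f a -> a = b -> is_derive x 1 f b.
Proof. by move=> + <-. Qed.

Lemma isd_cont f df (a b : R) : (forall x : R, is_derive x 1 f (df x)) ->
  {within `[a, b], continuous f}.
Proof. by move=> H; apply: derivable_within_continuous => x _; have [] := H x. Qed.

Lemma isd_cont1 f df (x : R) : (forall x : R, is_derive x 1 f (df x)) ->
  {for x, continuous f}.
Proof.
move=> H; have [h _] := H x.
by apply: differentiable_continuous; exact/derivable1_diffP.
Qed.

Lemma isd_incr f df (a b : R) : a < b -> (forall x : R, is_derive x 1 f (df x)) ->
  (forall x, a < x < b -> 0 < df x) -> f a < f b.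
Proof.
move=> ab H pos; have [c] := MVT ab (fun x _ => H x) (isd_cont H).
rewrite in_itv/= => /pos d0 E.
by rewrite -subr_gt0 E mulr_gt0// subr_gt0.
Qed.

Lemma isd_right_pos f (a d : R) : is_derive a 1 f d -> f a = 0 -> 0 < d ->
  exists2 e : R, 0 < e & forall x, a < x -> x < a + e -> 0 < f x.
Proof.
move=> [df dE] fa d0.
have /derivable1_diffP df' := df.
have D v : 'd f a v = v * d.
  by rewrite -[v in LHS]mulr1 -[v * 1]/(v *: 1) linearZ /= -deriveE// dE.
have d20 : 0 < d / 2 by rewrite divr_gt0.
have /near_real[e e0 H] := differentiable_near_le df' d20.
exists e => // x ax xe.
have xa : `|x - a| < e by rewrite gtr0_norm ?subr_gt0// ltrBlDl.
have := H x xa; rewrite D fa subr0 [`|x - a|]gtr0_norm ?subr_gt0//.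
rewrite ler_norml => /andP[h _].
have : 0 < (x - a) * (d / 2) by rewrite mulr_gt0// subr_gt0.
by move: h; rewrite -lerBlDr opprK; clear; lra.
Qed.

Lemma isd_left_npos f (a d : R) : is_derive a 1 f d -> f a = 0 ->
  forall e : R, 0 < e -> (forall x, a - e < x -> x < a -> 0 < f x) -> d <= 0.
Proof.
move=> df fa e e0 H; rewrite leNgt; apply/negP => d0.
have df2 : is_derive (- a) 1 (fun x => - f (- x)) d.
  have h : is_derive (- - a) 1 f d by rewrite opprK.
  have n : is_derive (- a) 1 (fun x : R => - x) (-1).
    by apply: is_derive_eq.
  by apply: (isd_eq (is_deriveN (isd_comp h n))); rewrite mulrN1 opprK.
have fa2 : - f (- - a) = 0 by rewrite opprK fa oppr0.
have [e' e0' H'] := isd_right_pos df2 fa2 d0.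
pose x := - a + Num.min e e' / 2.
have m0 : 0 < Num.min e e' by rewrite lt_min e0.
have h1 : Num.min e e' / 2 < Num.min e e' by rewrite ltr_pdivrMr// ltr_pMr// ltr1n.
have h2 : 0 < Num.min e e' / 2 by rewrite divr_gt0.
have h3 : Num.min e e' <= e by rewrite ge_min lexx.
have h4 : Num.min e e' <= e' by rewrite ge_min lexx orbT.
have xp : 0 < - f (- x).
  apply: H'; rewrite /x; first by rewrite ltrDl.
  by rewrite ltrD2l (lt_le_trans h1).
have xE : - x = a - Num.min e e' / 2 by rewrite /x opprD opprK.
have l1 : a - e < - x by rewrite xE ltrD2l ltrN2 (lt_le_trans h1).
have l2 : - x < a by rewrite xE gtrDl oppr_lt0.
have := H _ l1 l2; move: xp; clear; lra.
Qed.

Lemma no_zero_pos f (a b : R) : (forall x : R, {for x, continuous f}) ->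
  (forall x, a < x < b -> f x != 0) ->
  forall c, a < c < b -> 0 < f c -> forall x, a < x < b -> 0 < f x.
Proof.
move=> cf nz c cab fc x xab; rewrite lt0r nz//= leNgt; apply/negP => fx.
have cw (u v : R) : {within `[u, v], continuous f} by exact/continuous_subspaceT.
have fxc : Num.min (f x) (f c) <= 0 <= Num.max (f x) (f c).
  by rewrite ge_min le_max (ltW fx) (ltW fc) orbT.
have fcx : Num.min (f c) (f x) <= 0 <= Num.max (f c) (f x).
  by rewrite ge_min le_max (ltW fx) (ltW fc) orbT.
case/andP: xab => ax xb; case/andP: cab => ac cb.
case: (leP x c) => [xc|/ltW cx].
  have [z zi fz] := IVT xc (cw _ _) fxc.
  move: zi; rewrite in_itv/= => /andP[xz zc]; have := nz z.
  by rewrite (lt_le_trans ax xz) (le_lt_trans zc cb) fz eqxx => /(_ isT).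
have [z zi fz] := IVT cx (cw _ _) fcx.
move: zi; rewrite in_itv/= => /andP[cz zx]; have := nz z.
by rewrite (lt_le_trans ac cz) (le_lt_trans zx xb) fz eqxx => /(_ isT).
Qed.

Lemma first_zero f (a b : R) : a <= b -> (forall x : R, {for x, continuous f}) ->
  f b = 0 -> exists2 c, a <= c <= b & f c = 0 /\ forall x, a <= x < c -> f x != 0.
Proof.
move=> ab cf fb.
pose A := `[a, b]%classic `&` f @^-1` [set 0].
have clA : closed (f @^-1` [set 0]).
  apply: closed_comp; last exact: closed_eq.
  by move=> x _; exact: cf.
have cA : compact A.
  by apply: compact_closedI => //; exact: segment_compact.
have A0 : A !=set0 by exists b; split => //=; rewrite in_itv/= lexx ab.
have cid : {within A, continuous (id : R -> R)}.
  by apply: continuous_subspaceT => x; exact: cvg_id.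
have [c cA' cmin] := compact_EVT_min A0 cA cid.
move: cA'; rewrite inE => -[/=]; rewrite in_itv/= => /andP[ac cb] fc.
exists c; first by rewrite ac cb.
split => // x /andP[ax xc]; apply/eqP => fx.
have xA : x \in A by rewrite inE; split => //=; rewrite in_itv/= ax (le_trans (ltW xc) cb).
by have := cmin x xA; rewrite leNgt xc.
Qed.

(** Here [k] is the support function of a planar shrinker, equal to its curvature, [q] is its
    derivative in the tangent angle and [rho] the speed of that angle. [E = k^2 + q^2 - 2 ln k] is a
    first integral of [k'' + k = 1 / k]; since [ln k <= k - 1], its minimum is attained only at the
    unit circle, [k = 1] and [q = 0]. *)
Lemma shrinker_energy k q rho : (forall x, 0 < k x) ->
  (forall x : R, is_derive x 1 k (q x * rho x)) ->
  (forall x : R, is_derive x 1 q (((k x)^-1 - k x) * rho x)) ->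
  forall a, k a = 1 -> q a = 0 -> forall x, k x = 1 /\ q x = 0.
Proof.
move=> k0 dk dq a ka qa x.
pose E x := k x * k x + q x * q x - 2 * ln (k x).
have dE (y : R) : is_derive y 1 E 0.
  have h1 := isd_comp (is_derive1_ln (k0 y)) (dk y).
  have := is_deriveB (is_deriveD (isdM (dk y) (dk y)) (isdM (dq y) (dq y)))
    (isdM (is_derive_cst (2 : R) y 1) h1).
  by move=> h; apply: (isd_eq h); field; rewrite gt_eqF.
have : E x = E a by exact: is_derive_0_is_cst.
rewrite /E ka qa ln1 !mulr0 mulr1 subr0 addr0 => Ex.
have lnk : ln (k x) <= k x - 1.
  have kE : k x = 1 + (k x - 1) by ring.
  by rewrite {1}kE; apply: le_ln1Dx; rewrite ltrBDl subrr.
have S : (k x - 1) ^+ 2 + q x ^+ 2 <= 0.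
  by rewrite !expr2; move: lnk Ex; clear; move=> h1 h2; nra.
have := sqr_ge0 (k x - 1); have := sqr_ge0 (q x) => h1 h2.
have : (k x - 1) ^+ 2 = 0 /\ q x ^+ 2 = 0.
  by move: S h1 h2; clear; move=> ? ? ?; split; lra.
by move=> -[/eqP + /eqP]; rewrite !expf_eq0/= subr_eq0 => /eqP-> /eqP->.
Qed.

(* The two comparison arguments are Sturm's: [q] solves q'' + (1 + 1/k^2) q = 0
   and [k q] solves z'' + (4 - 2/k^2) z = 0 in the tangent angle [th]; hence the
   gap between consecutive zeros of [q] lies strictly between pi/2 and pi. *)
Lemma shrinker_next_zero k q th rho (sg : R) : (sg = 1) \/ (sg = - 1) ->
  (forall x, 0 < k x) -> (forall x, 0 < rho x) ->
  (forall x : R, is_derive x 1 k (q x * rho x)) ->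
  (forall x : R, is_derive x 1 q (((k x)^-1 - k x) * rho x)) ->
  (forall x : R, is_derive x 1 th (rho x)) ->
  (forall x, q x = 0 -> k x != 1) ->
  forall a T, q a = 0 -> 0 < sg * (1 - k a) -> a < T -> th T = th a + pi ->
  exists b, [/\ a < b, b < T, q b = 0, sg * (1 - k b) < 0 & th a + pi / 2 < th b /\
    forall x, a < x < b -> q x != 0].
Proof.
move=> sg1 k0 rho0 dk dq dth nk a T qa ka aT thT.
have sg2 : sg * sg = 1 by case: sg1 => ->; rewrite ?mulr1// mulrNN mulr1.
have ssg (x : R) : sg * (sg * x) = x by rewrite mulrA sg2 mul1r.
have sgn0 : sg != 0 by case: sg1 => ->; rewrite ?oppr_eq0 oner_eq0.
pose Q x := sg * q x.
have dQ (x : R) : is_derive x 1 Q (sg * (((k x)^-1 - k x) * rho x)).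
  have h := isdM (is_derive_cst (sg : R) x 1) (dq x).
  by apply: (isd_eq h); rewrite mulr0 addr0.
have kinv x : (k x)^-1 - k x = (1 - k x) * ((1 + k x) / k x).
  by field; rewrite gt_eqF.
have kf x : 0 < (1 + k x) / k x by rewrite divr_gt0// addr_gt0.
have cQ x : {for x, continuous Q} by exact: isd_cont1.
have Q0 x : (Q x == 0) = (q x == 0) by rewrite mulf_eq0 (negbTE sgn0).
have Qa : Q a = 0 by rewrite /Q qa mulr0.
have [e e0 Qe] : exists2 e : R, 0 < e & forall x, a < x -> x < a + e -> 0 < Q x.
  apply: (isd_right_pos (dQ a)) => //.
  by have := mulr_gt0 ka (mulr_gt0 (kf a) (rho0 a)); rewrite kinv !mulrA.
have thlt (x y : R) : x < y -> th x < th y.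
  by move=> xy; apply: (isd_incr xy dth) => z _.
have dang (x : R) : is_derive x 1 (fun y => th y - th a) (rho x).
  have := is_deriveB (dth x) (is_derive_cst (th a) x 1).
  by move=> h; apply: (isd_eq h); rewrite subr0.
have dsin (x : R) : is_derive x 1 (fun y => sin (th y - th a)) (cos (th x - th a) * rho x).
  exact: isd_comp (is_derive_sin _) (dang x).
have dcos (x : R) : is_derive x 1 (fun y => cos (th y - th a)) (- sin (th x - th a) * rho x).
  exact: isd_comp (is_derive_cos _) (dang x).
have dki (x : R) : is_derive x 1 (fun y => (k y)^-1) (- (k x) ^- 2 * (q x * rho x)).
  by have := is_deriveV (lt0r_neq0 (k0 x)) (dk x).
have [c /andP[ac cT] qc] : exists2 c, a < c < T & q c = 0.
  apply: contrapT => nz.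
  have {}nz x : a < x < T -> Q x != 0.
    by move=> xaT; rewrite Q0; apply/eqP => qx; apply: nz; exists x.
  pose c := a + Num.min e (T - a) / 2.
  have m0 : 0 < Num.min e (T - a) by rewrite lt_min e0 subr_gt0.
  have m2 : Num.min e (T - a) / 2 < Num.min e (T - a).
    by rewrite ltr_pdivrMr// ltr_pMr// ltr1n.
  have cT : a < c < T.
    rewrite /c ltrDl divr_gt0//= -ltrBrDl (lt_le_trans m2)//.
    by rewrite ge_min lexx orbT.
  have Qc : 0 < Q c.
    apply: Qe; first by case/andP: cT.
    by rewrite /c ltrD2l (lt_le_trans m2)// ge_min lexx.
  have Qpos := no_zero_pos cQ nz cT Qc.
  (* Wronskian of [Q] and [sin (th - th a)] in the variable [th]. Its derivative [Q sin / k^2] is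
     positive up to [T], so [- Q T = W T > 0], whereas [Q > 0] just before [T]. *)
  pose W x := Q x * cos (th x - th a) - sg * (((k x)^-1 - k x) * sin (th x - th a)).
  have dW (x : R) : is_derive x 1 W (Q x * (k x) ^- 2 * sin (th x - th a) * rho x).
    have h1 := isdM (dQ x) (dcos x).
    have h2 := isdM (is_derive_cst (sg : R) x 1) (isdM (is_deriveB (dki x) (dk x)) (dsin x)).
    have := is_deriveB h1 h2.
    by move=> h; apply: (isd_eq h); rewrite /Q /= !fctE; field; rewrite gt_eqF.
  have : W a < W T.
    apply: (isd_incr aT dW) => x xaT; have qx := Qpos x xaT.
    have sx : 0 < sin (th x - th a).
      case/andP: xaT => ax xT; apply: sin_gt0_pi.
      by rewrite subr_gt0 thlt//= ltrBlDl -thT thlt.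
    have kx : 0 < (k x) ^- 2 by rewrite invr_gt0 exprn_gt0.
    by rewrite mulr_gt0// mulr_gt0// mulr_gt0.
  have thA : th T - th a = pi by rewrite thT addrC addKr.
  rewrite /W Qa thA subrr sin0 sinpi cospi !(mul0r, mulr0, subr0, mulrN1).
  rewrite oppr_gt0 => QT.
  have cQT : {for T, continuous Q} := cQ T.
  have [d d0 QTd] : exists2 d : R, 0 < d & forall x, `|x - T| < d -> Q x < 0.
    by apply/near_real; exact: (cvgr_lt _ cQT).
  pose x := T - Num.min d (T - a) / 2.
  have n0 : 0 < Num.min d (T - a) by rewrite lt_min d0 subr_gt0.
  have n2 : Num.min d (T - a) / 2 < Num.min d (T - a).
    by rewrite ltr_pdivrMr// ltr_pMr// ltr1n.
  have xd : `|x - T| < d.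
    rewrite /x addrC addKr normrN gtr0_norm ?divr_gt0//.
    by rewrite (lt_le_trans n2)// ge_min lexx.
  have xaT : a < x < T.
    rewrite /x gtrDl oppr_lt0 divr_gt0// andbT ltrBrDr -ltrBrDl (lt_le_trans n2)//.
    by rewrite ge_min lexx orbT.
  by have := Qpos x xaT; rewrite ltNge ltW// QTd.
pose a' := a + Num.min e (c - a) / 2.
have m0 : 0 < Num.min e (c - a) by rewrite lt_min e0 subr_gt0.
have m2 : Num.min e (c - a) / 2 < Num.min e (c - a).
  by rewrite ltr_pdivrMr// ltr_pMr// ltr1n.
have aa' : a < a' by rewrite /a' ltrDl divr_gt0.
have a'e : a' < a + e by rewrite /a' ltrD2l (lt_le_trans m2)// ge_min lexx.
have a'c : a' <= c.
  by rewrite /a' -lerBrDl ltW// (lt_le_trans m2)// ge_min lexx orbT.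
have cq x : {for x, continuous q} by exact: isd_cont1.
have [b /andP[a'b bc] [qb nzb]] := first_zero a'c cq qc.
have ab : a < b by exact: lt_le_trans a'b.
have nz x : a < x < b -> Q x != 0.
  move=> /andP[ax xb]; rewrite Q0; have [a'x|xa'] := leP a' x.
    by apply: nzb; rewrite a'x.
  by rewrite -Q0 gt_eqF// Qe// (lt_trans xa').
have a'ltb : a' < b.
  rewrite lt_neqAle a'b andbT; apply/eqP => a'E.
  by have := Qe a' aa' a'e; rewrite a'E /Q qb mulr0 ltxx.
have Qpos : forall x, a < x < b -> 0 < Q x.
  apply: (no_zero_pos cQ nz (c := a')); first by rewrite aa'.
  exact: Qe.
have kb : sg * (1 - k b) < 0.
  have Qb : Q b = 0 by rewrite /Q qb mulr0.
  have ba0 : 0 < b - a by rewrite subr_gt0.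
  have h : sg * (((k b)^-1 - k b) * rho b) <= 0.
    by apply: (isd_left_npos (dQ b) Qb ba0); rewrite subKr => x ax xb; rewrite Qpos// ax.
  have E : sg * (((k b)^-1 - k b) * rho b) =
      sg * (1 - k b) * ((1 + k b) / k b * rho b) by rewrite kinv !mulrA.
  move: h; rewrite E (pmulr_lle0 _ (mulr_gt0 (kf b) (rho0 b))).
  by rewrite le_eqVlt mulf_eq0 (negbTE sgn0) subr_eq0 eq_sym (negbTE (nk _ qb)).
exists b; split => //; first exact: le_lt_trans cT.
split; last by move=> x /nz; rewrite Q0.
rewrite ltNge; apply/negP => thb.
pose A x := th x - th a.
(* Wronskian of [k Q] and [sin (2 A)]. If the gap were at most [pi / 2], it would increase from
   [W a = 0], but at [b] it equals [sg (1 - k b ^ 2) sin (2 A)], which is not positive. *)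
pose W x := sg * (q x * q x + 1 - k x * k x) * (2 * sin (A x) * cos (A x))
  - 2 * (k x * Q x) * (cos (A x) * cos (A x) - sin (A x) * sin (A x)).
have dW (x : R) : is_derive x 1 W (2 / (k x) * Q x * (2 * sin (A x) * cos (A x)) * rho x).
  have h1 := isdM (isdM (is_derive_cst (sg : R) x 1) (is_deriveB (is_deriveD
     (isdM (dq x) (dq x)) (is_derive_cst (1 : R) x 1)) (isdM (dk x) (dk x))))
     (isdM (isdM (is_derive_cst (2 : R) x 1) (dsin x)) (dcos x)).
  have h2 := isdM (isdM (is_derive_cst (2 : R) x 1) (isdM (dk x) (dQ x)))
     (is_deriveB (isdM (dcos x) (dcos x)) (isdM (dsin x) (dsin x))).
  have := is_deriveB h1 h2.
  by move=> h; apply: (isd_eq h); rewrite /Q /A /= !fctE; field; rewrite gt_eqF.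
have scpos x : a < x < b -> 0 < 2 * sin (A x) * cos (A x).
  move=> /andP[ax xb]; have x0 : 0 < A x by rewrite subr_gt0 thlt.
  have x1 : A x < pi / 2 by rewrite ltrBlDl (lt_le_trans _ thb)// thlt.
  rewrite !mulr_gt0//.
    by apply: sin_gt0_pihalf; rewrite x0.
  by apply: cos_gt0_pihalf; rewrite x1 (lt_trans _ x0)// oppr_lt0 divr_gt0// pi_gt0.
have : W a < W b.
  apply: (isd_incr ab dW) => x xab.
  have kx : 0 < 2 / k x by rewrite divr_gt0.
  exact: mulr_gt0 (mulr_gt0 (mulr_gt0 kx (Qpos x xab)) (scpos x xab)) (rho0 x).
rewrite /W /A subrr sin0 qa qb /Q qa qb !(mulr0, mul0r, oppr0, subr0, add0r, addr0).
have s0 : 0 <= 2 * sin (th b - th a) * cos (th b - th a).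
  rewrite !mulr_ge0//.
    apply: sin_ge0_pi; rewrite subr_ge0 ltW ?thlt//= lerBlDl.
    by rewrite (le_trans thb)// lerD2l ler_pdivrMr// ler_pMr ?pi_gt0// ler1n.
  apply: cos_ge0_pihalf; rewrite lerBlDl thb andbT.
  by rewrite (@le_trans _ _ 0)// ?oppr_le0 ?divr_ge0 ?pi_ge0// subr_ge0 ltW ?thlt.
have L : sg * (1 - k b * k b) <= 0.
  have -> : sg * (1 - k b * k b) = sg * (1 - k b) * (1 + k b) by ring.
  have kb' : 0 < 1 + k b by rewrite addr_gt0.
  by rewrite (pmulr_lle0 _ kb') ltW.
by rewrite ltNge (mulr_le0_ge0 L s0).
Qed.

(** Over a period the tangent angle turns by [2 pi], and [q] has a zero by Rolle. Away from the
    circle, consecutive zeros have gaps in [(pi / 2, pi)] and alternate the sign of [1 - k].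
    Starting at [a], two gaps fall short of [a + T], three cannot end there by parity, and four
    would exceed [2 pi]. *)
Lemma shrinker_periodic k q th rho (T : R) : 0 < T ->
  (forall x, 0 < k x) -> (forall x, 0 < rho x) ->
  (forall x : R, is_derive x 1 k (q x * rho x)) ->
  (forall x : R, is_derive x 1 q (((k x)^-1 - k x) * rho x)) ->
  (forall x : R, is_derive x 1 th (rho x)) ->
  (forall x, k (x + T) = k x) -> (forall x, q (x + T) = q x) ->
  (forall x, th (x + T) = th x + pi *+ 2) ->
  forall x, k x = 1 /\ q x = 0.
Proof.
move=> T0 k0 rho0 dk dq dth kT qT thT.
have [a _ qa] : exists2 a, a \in `]0, T[ & q a = 0.
  have kd x : x \in `]0, T[ -> derivable k x 1 by move=> _; have [] := dk x.
  have [|a aT [_ da]] := Rolle T0 kd (isd_cont dk); first by rewrite -(kT 0) add0r.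
  exists a => //; have [_] := dk a; rewrite da => /esym/eqP.
  by rewrite mulf_eq0 [rho a == 0]gt_eqF// orbF => /eqP.
have [ka|ka] := eqVneq (k a) 1; first exact: shrinker_energy ka qa.
exfalso.
have nk x : q x = 0 -> k x != 1.
  move=> qx; apply/eqP => kx; have [ka' _] := shrinker_energy k0 dk dq kx qx a.
  by rewrite ka' eqxx in ka.
have thlt (x y : R) : x < y -> th x < th y.
  by move=> xy; apply: (isd_incr xy dth) => z _.
have thle (x y : R) : th x < th y -> x < y.
  move=> h; rewrite ltNge le_eqVlt; apply/negP => /predU1P[E|/thlt].
    by rewrite E ltxx in h.
  by rewrite ltNge ltW.
have NZ c : q c = 0 -> exists b, [/\ c < b, q b = 0, (1 - k c) * (1 - k b) < 0,
    th c + pi / 2 < th b < th c + pi & forall x, c < x < b -> q x != 0].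
  move=> qc.
  have cT : c <= c + T by rewrite lerDl ltW.
  have [|t tT tht] := IVT (v := th c + pi) cT (isd_cont dth).
    rewrite ge_min le_max lerDl pi_ge0/= thT lerD2l mulr2n lerDl pi_ge0.
    by rewrite orbT.
  have ct : c < t by apply: thle; rewrite tht ltrDl pi_gt0.
  pose sg : R := if k c < 1 then 1 else -1.
  have sg1 : sg = 1 \/ sg = -1 by rewrite /sg; case: ifP; [left|right].
  have sgc : 0 < sg * (1 - k c).
    rewrite /sg; case: (ltP (k c) 1) => h; first by rewrite mul1r subr_gt0.
    by rewrite mulN1r opprB subr_gt0 lt_neqAle eq_sym nk.
  have [b [cb bt qb kb [thb nz]]] :=
    shrinker_next_zero sg1 k0 rho0 dk dq dth nk qc sgc ct tht.
  exists b; split => //; last by rewrite thb -tht thlt.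
  have : sg * (1 - k c) * (sg * (1 - k b)) < 0 by rewrite pmulr_rlt0.
  by case: sg1 => ->; rewrite ?mul1r// !mulN1r mulrNN.
have first c b d : c < d -> q d = 0 -> (forall x, c < x < b -> q x != 0) -> b <= d.
  move=> cd qd nz; rewrite leNgt; apply/negP => db; have := nz d.
  by rewrite cd db qd eqxx => /(_ isT).
have [b1 [ab1 qb1 kb1 /andP[tl1 tu1] nz1]] := NZ a qa.
have [b2 [b12 qb2 kb2 /andP[tl2 tu2] nz2]] := NZ b1 qb1.
have [b3 [b23 qb3 kb3 /andP[tl3 tu3] nz3]] := NZ b2 qb2.
have [b4 [b34 qb4 kb4 /andP[tl4 tu4] nz4]] := NZ b3 qb3.
have pi0 : 0 < pi :> R := pi_gt0 R.
have qe : q (a + T) = 0 by rewrite qT.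
have ke : k (a + T) = k a := kT a.
have b2e : b2 < a + T.
  by apply: thle; rewrite thT mulr2n; move: tu1 tu2; clear; lra.
have b3e := first _ _ _ b2e qe nz3.
have b3e' : b3 < a + T.
  rewrite lt_neqAle b3e andbT; apply/eqP => E.
  move: kb1 kb2 kb3; rewrite E ke; move: (k a) (k b1) (k b2); clear.
  move=> x y z h1 h2 h3; have : 0 < ((1 - x) * (1 - y)) * ((1 - y) * (1 - z)).
    by rewrite nmulr_rgt0.
  have -> : ((1 - x) * (1 - y)) * ((1 - y) * (1 - z)) =
    (1 - y) ^+ 2 * ((1 - z) * (1 - x)) by ring.
  by apply/negP; rewrite -leNgt mulr_ge0_le0 ?sqr_ge0// ltW.
have b4e := first _ _ _ b3e' qe nz4.
have : th b4 <= th (a + T).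
  by move: b4e; rewrite le_eqVlt => /predU1P[->//|/thlt/ltW].
by rewrite thT mulr2n leNgt; apply/negP/negPn; move: tl1 tl2 tl3 tl4; clear; lra.
Qed.

(* [m] is the logarithm of the radius, as a function of the polar angle, of a
   planar curve with curvature vector [- x^perp]. *)
Lemma polar_shrinker (m m1 : R -> R) : (forall x : R, is_derive x 1 m (m1 x)) ->
  (forall x : R, is_derive x 1 m1 ((1 + m1 x ^+ 2) * (1 - expR (2 * m x)))) ->
  (forall x, m (x + pi *+ 2) = m x) ->
  forall x, m x = 0 /\ m1 x = 0.
Proof.
move=> dm dm1 mT.
pose c x := 1 + m1 x ^+ 2.
have c0 x : 0 < c x by rewrite ltr_wpDr// sqr_ge0.
(* With [r = e^m] and [m1 = r' / r]: [k] is the support function, [q] the tangential component of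
   the position, [th] the tangent angle up to a constant, and [rho = r^2] its derivative. *)
pose k x := expR (m x) / Num.sqrt (c x).
pose q x := k x * m1 x.
pose th x := x - atan (m1 x).
pose rho x := expR (2 * m x).
have m1T x : m1 (x + pi *+ 2) = m1 x.
  have h : is_derive x 1 (fun y => m (y + pi *+ 2)) (m1 (x + pi *+ 2)).
    have sh : is_derive x 1 (fun y : R => y + pi *+ 2) 1.
      by apply: is_derive_eq; rewrite addr0.
    by apply: (isd_eq (isd_comp (dm _) sh)); rewrite mulr1.
  have [_ <-] := h; have [_ <-] := dm x.
  by congr ('D_1 _ x); apply/funext => y; exact: mT.
have sc x : 0 < Num.sqrt (c x) by rewrite sqrtr_gt0.
have scE x : Num.sqrt (c x) ^+ 2 = c x by rewrite sqr_sqrtr// ltW.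
have k0 x : 0 < k x by rewrite divr_gt0// expR_gt0.
have rhoE x : rho x = expR (m x) ^+ 2 by rewrite /rho mulr2n mulrDl !mul1r expRD expr2.
have dc (x : R) : is_derive x 1 c (2 * m1 x * (c x * (1 - rho x))).
  have := is_deriveD (is_derive_cst (1 : R) x 1) (isdM (dm1 x) (dm1 x)).
  move=> h; have E : (cst 1 + (fun y => m1 y * m1 y)) = c.
    by apply/funext => y; rewrite /c expr2 !fctE.
  by rewrite E in h; apply: (isd_eq h); rewrite /c /rho; ring.
have dsc (x : R) : is_derive x 1 (fun y => Num.sqrt (c y))
    (m1 x * Num.sqrt (c x) * (1 - rho x)).
  apply: (isd_eq (isd_comp (is_derive1_sqrt (c0 x)) (dc x))).
  by rewrite -[X in 2 * m1 x * (X * _)]scE; field; rewrite gt_eqF.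
have dk (x : R) : is_derive x 1 k (q x * rho x).
  have h1 := isd_comp (is_derive_expR _) (dm x).
  have h2 := @is_deriveV R (fun y => Num.sqrt (c y)) x _ 1 (lt0r_neq0 (sc x)) (dsc x).
  apply: (isd_eq (isdM h1 h2)); rewrite /q /k /GRing.scale /=.
  by field; rewrite gt_eqF.
have dq (x : R) : is_derive x 1 q (((k x)^-1 - k x) * rho x).
  apply: (isd_eq (isdM (dk x) (dm1 x))); rewrite -/(rho x).
  have -> : 1 + m1 x ^+ 2 = Num.sqrt (c x) ^+ 2 by rewrite scE.
  have m1E : m1 x ^+ 2 = Num.sqrt (c x) ^+ 2 - 1 by rewrite scE /c addrC addKr.
  rewrite /q [m1 x * _]mulrA [m1 x * _]mulrCA -expr2 m1E.
  rewrite /k rhoE; have e0 := expR_gt0 (m x).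
  by field; rewrite !gt_eqF.
have dth (x : R) : is_derive x 1 th (rho x).
  have h := isd_comp (is_derive1_atan (m1 x)) (dm1 x).
  apply: (isd_eq (is_deriveB (is_derive_id x 1) h)).
  by rewrite -/(c x) -/(rho x); field; rewrite gt_eqF.
have cT x : c (x + pi *+ 2) = c x by rewrite /c m1T.
have kT x : k (x + pi *+ 2) = k x by rewrite /k cT mT.
have qT x : q (x + pi *+ 2) = q x by rewrite /q kT m1T.
have thT x : th (x + pi *+ 2) = th x + pi *+ 2 by rewrite /th m1T addrAC.
have pi20 : 0 < pi *+ 2 :> R by rewrite mulrn_wgt0// pi_gt0.
have rho0 x : 0 < rho x by exact: expR_gt0.
move=> x; have [kx qx] := shrinker_periodic pi20 k0 rho0 dk dq dth kT qT thT x.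
have m1x : m1 x = 0 by move: qx; rewrite /q kx mul1r.
split=> //; move: kx; rewrite /k /c m1x expr0n addr0 sqrtr1 divr1 => e1.
by rewrite -(expRK (m x)) e1 ln1.
Qed.

End PlanarShrinkers.

(** * Carleman estimate and unique continuation *)

Section Divergence.
Variable R : realType.
Implicit Types (D W f : 'rV[R]_2 -> R) (u v w p : 'rV[R]_2).

Definition box p (L : R) : set 'rV[R]_2 :=
  [set v | `|v 0 0 - p 0 0| <= L /\ `|v 0 1 - p 0 1| <= L].

Lemma compact_box p L : compact (box p L).
Proof.
have := @rV_compact R 2 (fun i => `[p 0 i - L, p 0 i + L]%classic)
  (fun i => @segment_compact R _ _).
congr compact; apply/seteqP; split=> v /=.
  by move=> H; split; rewrite ler_distl; [have := H 0|have := H 1]; rewrite in_itv/= .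
move=> [H0 H1] i; rewrite in_itv/= -ler_distl.
case: i => [[|[|//]] Hi].
- by rewrite (_ : Ordinal Hi = 0)//; exact/val_inj.
- by rewrite (_ : Ordinal Hi = 1)//; exact/val_inj.
Qed.

Lemma uniform_box D p L : continuous D -> forall e : R, 0 < e ->
  exists2 d : R, 0 < d & forall v w, box p L v -> `|w 0 0 - v 0 0| < d ->
    `|w 0 1 - v 0 1| < d -> `|D w - D v| < e.
Proof.
move=> cD e e0.
have e20 : 0 < e / 2 by rewrite divr_gt0.
have /compact_near_coveringP cov := @compact_box p L.
pose P d v := forall w, `|w 0 0 - v 0 0| < d -> `|w 0 1 - v 0 1| < d -> `|D w - D v| < e.
suff H : \forall d \near (0 : R)^'+, box p L `<=` P d.
  have [d [d0 Hd]] := filter_ex (filterI (nbhs_right_gt (0 : R)) H).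
  by exists d => // v w bv; exact: Hd.
apply: cov => v _; have [r r0 H] := continuous_near_lt (cD v) e20.
exists ([set x : 'rV[R]_2 | `|x 0 0 - v 0 0| < r / 2 /\ `|x 0 1 - v 0 1| < r / 2],
  [set d : R | d < r / 2]).
  split => /=; last by apply: nbhs_right_lt; rewrite divr_gt0.
  apply/near_square; exists (r / 2); first by rewrite divr_gt0.
  by move=> w.
case=> x d /= [[x0 x1] dr] w w0 w1.
have tri (a b c : R) : `|a - b| < d -> `|b - c| < r / 2 -> `|a - c| < r.
  move=> ab bc; rewrite -(subrKA b) (le_lt_trans (ler_normD _ _))//.
  by rewrite [ltRHS](splitr r) ltrD// (lt_trans ab).
have hw : `|D w - D v| < e / 2 by apply: H; [apply: tri w0 x0|apply: tri w1 x1].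
have r2 : r / 2 < r by rewrite ltr_pdivrMr// ltr_pMr// ltr1n.
have hx : `|D x - D v| < e / 2.
  by apply: H; [exact: lt_trans r2|exact: lt_trans r2].
by rewrite -(subrKA (D v)) (le_lt_trans (ler_normD _ _))// [ltRHS](splitr e) ltrD// distrC.
Qed.

(* A compactly supported field has zero total divergence; here this is used in
   the form of Riemann sums over a grid adapted to the small square at [z]. *)
Lemma divergence_bound (W1 W2 D1 D2 : 'rV[R]_2 -> R) (z : 'rV[R]_2) (l m M : R) (N : nat) :
  0 < l -> 0 < M -> (0 < N)%N ->
  (forall x y : R, is_derive x 1 (fun s => W1 (pt s y)) (D1 (pt x y))) ->
  (forall x y : R, is_derive y 1 (fun s => W2 (pt x s)) (D2 (pt x y))) ->
  continuous D1 -> continuous D2 ->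
  (forall v, N%:R * l <= `|v 0 0 - z 0 0| -> W1 v = 0) ->
  (forall v, N%:R * l <= `|v 0 1 - z 0 1| -> W2 v = 0) ->
  (forall v, D1 v + D2 v <= M) ->
  (forall v, `|v 0 0 - z 0 0| <= l -> `|v 0 1 - z 0 1| <= l -> D1 v + D2 v <= - m) ->
  m <= 4 * N%:R ^+ 2 * M.
Proof.
move=> l0 M0 N0 d1 d2 c1 c2 s1 s2 bM bm.
apply/ler_addgt0Pr => e' e'0.
(* The grid has [(2 N n)^2] points, each with error at most [2 e]; this value turns the total error
   into [n^2 e']. *)
pose e := e' / (4 * N%:R ^+ 2 * 2).
have N20 : 0 < 4 * N%:R ^+ 2 :> R by rewrite mulr_gt0// exprn_gt0// ltr0n.
have e0 : 0 < e by rewrite divr_gt0// mulr_gt0.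
pose L := N%:R * l; have L0 : 0 < L by rewrite mulr_gt0// ltr0n.
have [k1 k10 U1] := uniform_box z L c1 e0.
have [k2 k20 U2] := uniform_box z L c2 e0.
pose k := Num.min k1 k2; have k0 : 0 < k by rewrite lt_min k10 k20.
have [n n0 nk] : exists2 n : nat, (0 < n)%N & l / n%:R < k.
  exists (Num.truncn (l / k)).+1 => //.
  rewrite ltr_pdivrMr ?ltr0n// mulrC -ltr_pdivrMr//.
  by rewrite truncnS_gt ?divr_ge0// ltW.
have nR0 : 0 < n%:R :> R by rewrite ltr0n.
have [h h0 [hk hE]] : exists2 h : R, 0 < h & h < k /\ n%:R * h = l.
  by exists (l / n%:R); [rewrite divr_gt0|split => //; field; rewrite gt_eqF].
pose T := (2 * N * n)%N.
pose g (c : R) (i : nat) := c - L + i%:R * h.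
have TE : T%:R * h = 2 * L.
  by rewrite /T /L !natrM -hE; ring.
have gin c i : (i <= T)%N -> `|g c i - c| <= L.
  move=> iT; have : i%:R * h <= T%:R * h by rewrite ler_wpM2r ?(ltW h0)// ler_nat.
  have : 0 <= i%:R * h by rewrite mulr_ge0// ltW.
  rewrite TE /g ler_norml; move: (_ * h) L0 => x; clear => *; apply/andP; split; lra.
have g0 c : g c 0%N = c - L by rewrite /g mul0r addr0.
have gT c : g c T = c + L by rewrite /g TE; ring.
have gS c i : g c i.+1 = g c i + h by rewrite /g -natr1; ring.
pose x i := g (z 0 0) i; pose y i := g (z 0 1) i.
have row j : (j < T)%N -> - (T%:R * e) <= \sum_(0 <= i < T) D1 (pt (x i) (y j)).
  move=> jT; have tel : \sum_(0 <= i < T) (W1 (pt (x i.+1) (y j)) - W1 (pt (x i) (y j))) = 0.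
    rewrite telescope_sumr// s1 ?s1 ?subrr//.
      by rewrite pt0 /x g0 addrC addKr normrN gtr0_norm.
    by rewrite pt0 /x gT addrC addKr gtr0_norm.
  have : 0 <= \sum_(0 <= i < T) h * (D1 (pt (x i) (y j)) + e); last first.
    rewrite -mulr_sumr big_split /= sumr_const_nat subn0 -[e *+ T]mulr_natl pmulr_rge0//.
    by move=> A0; rewrite -[leRHS]addr0 -lerBlDl -opprD oppr_le0 addrC.
  rewrite -[leLHS]tel; apply: ler_sum_nat => i /andP[_ iT].
  have [t t01] := @MVT_seg R (fun s => W1 (pt s (y j)))
    (fun s => D1 (pt s (y j))) (x i) (x i.+1) (fun t _ => d1 _ _).
  rewrite /x gS [_ + h - _]addrC addKr -/(x i) => ->.
  rewrite mulrC ler_wpM2l ?(ltW h0)// -lerBlDl ltW//.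
  apply: le_lt_trans (ler_norm _) _; apply: U1.
  - split; rewrite ?pt0 ?pt1; [exact: gin (ltnW iT)|exact: gin (ltnW jT)].
  - rewrite !pt0 addrC addKr; have /andP[t0 t1] := t01.
    rewrite ger0_norm ?mulr_ge0// ?(ltW h0)//.
    have : t * h <= h by rewrite ler_piMl// ltW.
    by move=> /le_lt_trans; apply; rewrite (lt_le_trans hk)// ge_min lexx.
  - by rewrite !pt1 subrr normr0.
have col i : (i < T)%N -> - (T%:R * e) <= \sum_(0 <= j < T) D2 (pt (x i) (y j)).
  move=> iT; have tel : \sum_(0 <= j < T) (W2 (pt (x i) (y j.+1)) - W2 (pt (x i) (y j))) = 0.
    rewrite telescope_sumr// s2 ?s2 ?subrr//.
      by rewrite pt1 /y g0 addrC addKr normrN gtr0_norm.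
    by rewrite pt1 /y gT addrC addKr gtr0_norm.
  have : 0 <= \sum_(0 <= j < T) h * (D2 (pt (x i) (y j)) + e); last first.
    rewrite -mulr_sumr big_split /= sumr_const_nat subn0 -[e *+ T]mulr_natl pmulr_rge0//.
    by move=> A0; rewrite -[leRHS]addr0 -lerBlDl -opprD oppr_le0 addrC.
  rewrite -[leLHS]tel; apply: ler_sum_nat => j /andP[_ jT].
  have [t t01] := @MVT_seg R (fun s => W2 (pt (x i) s))
    (fun s => D2 (pt (x i) s)) (y j) (y j.+1) (fun t _ => d2 _ _).
  rewrite /y gS [_ + h - _]addrC addKr -/(y j) => ->.
  rewrite mulrC ler_wpM2l ?(ltW h0)// -lerBlDl ltW//.
  apply: le_lt_trans (ler_norm _) _; apply: U2.
  - split; rewrite ?pt0 ?pt1; [exact: gin (ltnW iT)|exact: gin (ltnW jT)].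
  - by rewrite !pt0 subrr normr0.
  - rewrite !pt1 addrC addKr; have /andP[t0 t1] := t01.
    rewrite ger0_norm ?mulr_ge0// ?(ltW h0)//.
    have : t * h <= h by rewrite ler_piMl// ltW.
    by move=> /le_lt_trans; apply; rewrite (lt_le_trans hk)// ge_min lexx orbT.
pose S := \sum_(0 <= i < T) \sum_(0 <= j < T) (D1 (pt (x i) (y j)) + D2 (pt (x i) (y j))).
have low : - (T%:R * (T%:R * (2 * e))) <= S.
  rewrite /S.
  under eq_bigr do rewrite big_split.
  rewrite big_split /= exchange_big /=.
  have -> : - (T%:R * (T%:R * (2 * e))) = - (T%:R * (T%:R * e)) + - (T%:R * (T%:R * e)).
    by ring.
  have -> : - (T%:R * (T%:R * e)) = \sum_(0 <= j < T) - (T%:R * e).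
    by rewrite sumr_const_nat subn0 mulNrn -[(T%:R * e) *+ T]mulr_natl.
  apply: lerD; first by apply: ler_sum_nat => j /andP[_ jT]; exact: row.
  by apply: ler_sum_nat => i /andP[_ iT]; exact: col.
(* The indices from [N n] to [N n + n - 1] give points between [c] and [c + l]; the resulting [n] by
   [n] block lies in the square where the divergence is at most [- m]. *)
pose I (i : nat) : R := (N * n <= i < N * n + n)%N%:R.
have sI : \sum_(0 <= i < T) I i = n%:R.
  rewrite (@big_cat_nat _ _ _ (N * n)%N) //=; last by rewrite /T -mulnA leq_pmull.
  rewrite big_nat big1 ?add0r; last first.
    by move=> i /andP[_ iN]; rewrite /I leqNgt iN.
  have NnT : (N * n + n <= T)%N.
    by rewrite /T -mulnA mul2n -addnn leq_add2l leq_pmull.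
  rewrite (@big_cat_nat _ _ _ (N * n + n)%N) ?leq_addr//=.
  rewrite [X in _ + X]big_nat [X in _ + X]big1 ?addr0; last first.
    by move=> i /andP[iN _]; rewrite /I [(i < _)%N]ltnNge iN andbF.
  rewrite big_nat (eq_bigr (fun=> 1)); last by move=> i iN; rewrite /I iN.
  by rewrite -big_nat big_const_nat addKn iter_addr_0.
have gI c i : I i = 1 -> `|g c i - c| <= l.
  rewrite /I; case: (boolP (_ <= _ < _)%N) => [/andP[i1 i2] _|_ /eqP]; last first.
    by rewrite eq_sym oner_eq0.
  have E1 : L = (N * n)%N%:R * h by rewrite /L -hE natrM; ring.
  have : (N * n)%N%:R * h <= i%:R * h by rewrite ler_wpM2r ?(ltW h0)// ler_nat.
  have : i%:R * h <= (N * n + n)%N%:R * h by rewrite ler_wpM2r ?(ltW h0)// ler_nat ltnW.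
  rewrite natrD mulrDl -E1 hE /g ler_norml; move: (_ * h) l0 => X; clear.
  by move=> *; apply/andP; split; lra.
have up : S <= \sum_(0 <= i < T) \sum_(0 <= j < T) (M - (M + m) * (I i * I j)).
  rewrite /S; apply: ler_sum_nat => i /andP[_ iT].
  apply: ler_sum_nat => j /andP[_ jT].
  have I01 a : I a = 0 \/ I a = 1 by rewrite /I; case: (_ <= _ < _)%N; [right|left].
  case: (I01 i) => [->|Ii]; first by rewrite mul0r mulr0 subr0.
  case: (I01 j) => [->|Ij]; first by rewrite !mulr0 subr0.
  rewrite Ii Ij !mulr1 opprD addrA subrr add0r.
  by apply: bm; rewrite ?pt0 ?pt1; apply: gI.
have upE : \sum_(0 <= i < T) \sum_(0 <= j < T) (M - (M + m) * (I i * I j)) =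
    T%:R * (T%:R * M) - (M + m) * (n%:R * n%:R).
  under eq_bigr do rewrite sumrB -!mulr_sumr sI sumr_const_nat subn0.
  rewrite sumrB sumr_const_nat subn0 -mulr_sumr -mulr_suml sI.
  by rewrite -[M *+ T *+ T]mulr_natl -[M *+ T]mulr_natl.
have := le_trans low up; rewrite upE /T !natrM => F.
have n2 : 0 < n%:R ^+ 2 :> R by rewrite exprn_gt0.
rewrite -(ler_pM2r n2).
have eE : e' = e * (4 * N%:R ^+ 2 * 2) by rewrite /e; field; rewrite gt_eqF// ltr0n.
rewrite eE; move: F M0 n2; rewrite !expr2; move: (N%:R : R) (n%:R : R) => a b; clear => F M0 n2.
have Mb : 0 < M * (b * b) by rewrite mulr_gt0.
move: F Mb; clear; lra.
Qed.

End Divergence.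

(** * The pointwise Carleman identity and estimate *)

Section Carleman.
Variable R : realType.

(* The flux of the Carleman identity for v = e^(t phi) u, where
   phi = psi + N psi^2 / 2, p = grad psi, F = 1 + N psi (so grad phi = F p),
   and a is the matrix of the operator. *)
Section Flux.
Variables (t N a11 a12 a22 p1 p2 F v v1 v2 : R).

Let E1 := a11 * p1 + a12 * p2.
Let E2 := a12 * p1 + a22 * p2.
Let e := E1 * p1 + E2 * p2.
Let g1 := a11 * v1 + a12 * v2.
Let g2 := a12 * v1 + a22 * v2.

Definition flux1 := - 2 * t * (F * (E1 * v1 + E2 * v2)) * g1
  + t * (F * E1) * (v1 * g1 + v2 * g2) - t ^+ 3 * (F * F * e) * (F * E1) * (v * v)
  - t * (2 * N * e) * v * g1.

Definition flux2 := - 2 * t * (F * (E1 * v1 + E2 * v2)) * g2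
  + t * (F * E2) * (v1 * g1 + v2 * g2) - t ^+ 3 * (F * F * e) * (F * E2) * (v * v)
  - t * (2 * N * e) * v * g2.

Variables (b1 b2 c1 c2 d1 d2 h11 h12 h22 v11 v12 v22 : R).

Let E11 := b1 * p1 + a11 * h11 + c1 * p2 + a12 * h12.
Let E12 := b2 * p1 + a11 * h12 + c2 * p2 + a12 * h22.
Let E21 := c1 * p1 + a12 * h11 + d1 * p2 + a22 * h12.
Let E22 := c2 * p1 + a12 * h12 + d2 * p2 + a22 * h22.
Let ex := E11 * p1 + E1 * h11 + E21 * p2 + E2 * h12.
Let ey := E12 * p1 + E1 * h12 + E22 * p2 + E2 * h22.
Let bv := (b1 + c2) * v1 + (c1 + d2) * v2.

(** [quadR], [zeroR] and [crossR] collect the derivatives of the coefficients and of [p]; none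
    involves [t] or [N], and they are respectively quadratic, constant and linear in the gradient of
    [v]. The terms of [carl_quad] that make it positive come from the convexification
    [N psi^2 / 2]. *)
Definition quadR := 2 * (g1 * (E11 * v1 + E21 * v2) + g2 * (E12 * v1 + E22 * v2))
  - (E11 + E22) * (v1 * g1 + v2 * g2)
  - (E1 * (b1 * v1 * v1 + 2 * c1 * v1 * v2 + d1 * v2 * v2)
    + E2 * (b2 * v1 * v1 + 2 * c2 * v1 * v2 + d2 * v2 * v2))
  + 2 * (E1 * v1 + E2 * v2) * bv.

Definition zeroR := e * (E11 + E22) + E1 * ex + E2 * ey.

Definition crossR := 2 * (ex * g1 + ey * g2) + 2 * e * bv.

Definition carl_quad := t * (2 * N * (E1 * v1 + E2 * v2) ^+ 2
    + N * e * (v1 * g1 + v2 * g2) + F * quadR)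
  + t ^+ 3 * (N * (F * F) * (e * e) + F ^+ 3 * zeroR) * (v * v) + t * v * (N * crossR).

(** The two parts of the operator conjugated by [e^(t phi)]. In [carl_skew] the coefficient [2 N e]
    takes the place of the exact divergence of [a grad phi]; the difference is a bounded multiple of
    [t v] and is treated as an error. *)
Definition carl_sym := a11 * v11 + 2 * a12 * v12 + a22 * v22 + t ^+ 2 * (F * F * e) * v.

Definition carl_skew := - 2 * t * (F * (E1 * v1 + E2 * v2)) - t * (2 * N * e) * v.

End Flux.

Ltac grad := repeat first
  [ eassumption | eapply has_grad_cst | eapply has_gradB | eapply has_gradD
  | eapply has_gradN | eapply has_gradM ].

(** The flux is designed so that the product rule gives this identity. Sharing [h12] and [v12]
    between the two components expresses the symmetry of second derivatives; the partial derivatives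
    of the flux are left to unification, and only the final identity to [ring]. *)
Lemma carleman_divergence (a11 a12 a22 p1 p2 F v v1 v2 : 'rV[R]_2 -> R) x
    (t N b1 b2 c1 c2 d1 d2 h11 h12 h22 v11 v12 v22 : R) :
  has_grad a11 x b1 b2 -> has_grad a12 x c1 c2 -> has_grad a22 x d1 d2 ->
  has_grad p1 x h11 h12 -> has_grad p2 x h12 h22 ->
  has_grad F x (N * p1 x) (N * p2 x) -> has_grad v x (v1 x) (v2 x) ->
  has_grad v1 x v11 v12 -> has_grad v2 x v12 v22 ->
  exists X1 X2 Y1 Y2 : R, [/\
    has_grad (fun y => flux1 t N (a11 y) (a12 y) (a22 y) (p1 y) (p2 y) (F y)
      (v y) (v1 y) (v2 y)) x X1 X2,
    has_grad (fun y => flux2 t N (a11 y) (a12 y) (a22 y) (p1 y) (p2 y) (F y)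
      (v y) (v1 y) (v2 y)) x Y1 Y2 &
    X1 + Y2 =
    carl_sym t (a11 x) (a12 x) (a22 x) (p1 x) (p2 x) (F x) (v x) v11 v12 v22 *
    carl_skew t N (a11 x) (a12 x) (a22 x) (p1 x) (p2 x) (F x) (v x) (v1 x) (v2 x)
    - carl_quad t N (a11 x) (a12 x) (a22 x) (p1 x) (p2 x) (F x) (v x) (v1 x) (v2 x)
        b1 b2 c1 c2 d1 d2 h11 h12 h22].
Proof.
move=> ga11 ga12 ga22 gp1 gp2 gF gv gv1 gv2.
do 4!eexists; split.
- by rewrite /flux1; under eq_fun do rewrite !exprS expr0; grad.
- by rewrite /flux2; under eq_fun do rewrite !exprS expr0; grad.
- rewrite /carl_sym /carl_skew /carl_quad /quadR /zeroR /crossR.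
  by ring.
Qed.

(** The product of the two parts is at most a quarter of the square of their sum, and this sum is of
    lower order because it is the conjugated operator applied to a solution. [N] is large against
    [C], so that the positive terms dominate [quadR] and [zeroR]; then [t] is large against [N C]
    and [K], and absorbs the remaining errors. *)
Lemma carleman_estimate (t N C K e0 al : R)
    (a11 a12 a22 p1 p2 F v v1 v2 b1 b2 c1 c2 d1 d2 h11 h12 h22 S G w : R) :
  let e := (a11 * p1 + a12 * p2) * p1 + (a12 * p1 + a22 * p2) * p2 in
  let A := v1 * (a11 * v1 + a12 * v2) + v2 * (a12 * v1 + a22 * v2) in
  1 <= C -> 1 <= N -> 0 <= K -> 0 < e0 -> 0 <= al ->
  2 * C + 2 <= N * e0 * al -> C + 2 <= N * (e0 * e0) / 4 ->
  1 <= t -> 3 * (N * C) ^+ 2 + K <= t ->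
  e0 <= e -> al * (v1 * v1 + v2 * v2) <= A -> 2^-1 <= F <= 1 ->
  `|quadR a11 a12 a22 p1 p2 v1 v2 b1 b2 c1 c2 d1 d2 h11 h12 h22|
    <= 2 * C * (v1 * v1 + v2 * v2) ->
  `|zeroR a11 a12 a22 p1 p2 b1 b2 c1 c2 d1 d2 h11 h12 h22| <= C ->
  `|crossR a11 a12 a22 p1 p2 v1 v2 b1 b2 c1 c2 d1 d2 h11 h12 h22|
    <= C * (`|v1| + `|v2|) ->
  `|G| <= 2 * (N * C) -> w * w <= K * (t ^+ 2 * (v * v) + (v1 * v1 + v2 * v2)) ->
  S + carl_skew t N a11 a12 a22 p1 p2 F v v1 v2 = w + t * G * v ->
  S * carl_skew t N a11 a12 a22 p1 p2 F v v1 v2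
    - carl_quad t N a11 a12 a22 p1 p2 F v v1 v2
        b1 b2 c1 c2 d1 d2 h11 h12 h22 <= - (t ^+ 3 * (v * v)).
Proof.
move=> e A C1 N1 K0 e00 al0 hN1 hN2 t1 ht he hA /andP[F0 F1].
rewrite /carl_quad -/e -/A.
move: (quadR _ _ _ _ _ _ _ _ _ _ _ _ _ _ _ _) (zeroR _ _ _ _ _ _ _ _ _ _ _ _ _ _).
move: (crossR _ _ _ _ _ _ _ _ _ _ _ _ _ _ _ _) (carl_skew _ _ _ _ _ _ _ _ _ _ _).
move: ((a11 * p1 + a12 * p2) * v1 + (a12 * p1 + a22 * p2) * v2) => Ev cr sk qR zR.
set X := v1 * v1 + v2 * v2 in hA *; set V := v * v.
move=> hq hz hc hG hw Sw.
have X0 : 0 <= X by rewrite addr_ge0// -expr2 sqr_ge0.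
have V0 : 0 <= V by rewrite /V -expr2 sqr_ge0.
have t0 : 0 <= t by apply: le_trans t1.
have N0 : 0 <= N by apply: le_trans N1.
have C0 : 0 <= C by apply: le_trans C1.
have F00 : 0 <= F by apply: le_trans F0.
have e0' : 0 <= e by rewrite (le_trans _ he)// ltW.
have D0 : 0 <= (N * C) ^+ 2 by exact: sqr_ge0.
have B1 : 2 * X <= 2 * N * Ev ^+ 2 + N * e * A + F * qR.
  have x1 : 0 <= 2 * N * Ev ^+ 2 by apply: mulr_ge0 (sqr_ge0 _); rewrite mulr_ge0.
  have x2 : (2 * C + 2) * X <= N * e * A.
    apply: (@le_trans _ _ (N * e0 * al * X)); first by rewrite ler_wpM2r.
    rewrite -mulrA; apply: ler_pM => //.
    - by rewrite mulr_ge0// ltW.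
    - by rewrite mulr_ge0.
    - by rewrite ler_wpM2l.
  have x3 : - (2 * C * X) <= F * qR.
    have : `|F * qR| <= 2 * C * X.
      by rewrite normrM (ger0_norm F00) (le_trans _ hq)// ler_piMl.
    by rewrite ler_norml => /andP[].
  by move: x1 x2 x3; clear; lra.
have B2 : 2 * V <= (N * (F * F) * (e * e) + F ^+ 3 * zR) * V.
  rewrite ler_wpM2r//.
  have x1 : C + 2 <= N * (F * F) * (e * e).
    apply: le_trans hN2 _; rewrite (_ : _ / 4 = N * (2^-1 * 2^-1) * (e0 * e0)); last by field.
    apply: ler_pM; rewrite ?mulr_ge0 ?invr_ge0// ?(ltW e00)//.
      by rewrite ler_wpM2l// ler_pM// invr_ge0.
    by rewrite ler_pM// ltW.
  have x2 : - C <= F ^+ 3 * zR.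
    have : `|F ^+ 3 * zR| <= C.
      rewrite normrM (le_trans _ hz)// ler_piMl// ger0_norm ?exprn_ge0//.
      by rewrite exprn_ile1.
    by rewrite ler_norml => /andP[].
  by move: x1 x2; clear; lra.
have B3 : - (X / 2 + (N * C) ^+ 2 * V) <= v * (N * cr).
  have : `|v * (N * cr)| <= `|v| * (N * (C * (`|v1| + `|v2|))).
    by rewrite !normrM (ger0_norm N0); apply: ler_wpM2l => //; apply: ler_wpM2l.
  have E (z : R) : z * z = `|z| * `|z| by rewrite -normrM ger0_norm// -expr2 sqr_ge0.
  rewrite /X /V (E v) (E v1) (E v2).
  rewrite (_ : `|v| * (N * _) = (N * C) * `|v| * `|v1| + (N * C) * `|v| * `|v2|); last by ring.
  rewrite (_ : (N * C) ^+ 2 * _ = (N * C * `|v|) ^+ 2); last by ring.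
  rewrite ler_norml => /andP[+ _]; move: (`|v1|) (`|v2|) (N * C * `|v|) => b c d.
  have := sqr_ge0 (d - b); have := sqr_ge0 (d - c); rewrite !expr2; clear => *; lra.
have B4 : S * sk <= K / 2 * (t ^+ 2 * V + X) + 2 * (t ^+ 2 * (N * C) ^+ 2 * V).
  have x1 : S * sk <= (S + sk) ^+ 2 / 4.
    by have := sqr_ge0 (S - sk); rewrite !expr2; clear => ?; lra.
  apply: le_trans x1 _; rewrite Sw.
  have x2 : (w + t * G * v) ^+ 2 / 4 <= w * w / 2 + (t * G * v) ^+ 2 / 2.
    by have := sqr_ge0 (w - t * G * v); rewrite !expr2; clear => ?; lra.
  apply: le_trans x2 _.
  have x3 : (t * G * v) ^+ 2 <= 4 * (t ^+ 2 * (N * C) ^+ 2 * V).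
    rewrite (_ : (t * G * v) ^+ 2 = G ^+ 2 * (t ^+ 2 * V)); last by rewrite /V; ring.
    rewrite (_ : 4 * _ = (2 * (N * C)) ^+ 2 * (t ^+ 2 * V)); last by ring.
    apply: ler_wpM2r; first exact: mulr_ge0 (sqr_ge0 t) V0.
    by rewrite -(real_normK (num_real G)) !expr2 ler_pM.
  by move: hw x3; rewrite -/V -/X; clear; lra.
have t20 : 0 <= t ^+ 2 by exact: sqr_ge0.
have L1 := ler_wpM2l t0 B1.
have L2 := ler_wpM2l (mulr_ge0 t20 t0) B2.
have L3 := ler_wpM2l t0 B3.
have L4 : K * X <= t * X.
  by rewrite ler_wpM2r// (le_trans _ ht)// lerDr mulr_ge0.
have L5 : (3 * (N * C) ^+ 2 + K) * (t ^+ 2 * V) <= t * (t ^+ 2 * V).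
  by apply: ler_wpM2r => //; exact: mulr_ge0.
have L6 : t * ((N * C) ^+ 2 * V) <= t ^+ 2 * ((N * C) ^+ 2 * V).
  by apply: ler_wpM2r; [exact: mulr_ge0|rewrite expr2 ler_peMl].
have L7 : 0 <= K * (t ^+ 2 * V) by apply: mulr_ge0 => //; exact: mulr_ge0.
have L8 : 0 <= t * X by rewrite mulr_ge0.
rewrite (_ : t ^+ 3 = t ^+ 2 * t); last by ring.
move: L1 L2 L3 L4 L5 L6 L7 L8 B4; rewrite -[t * v * (N * cr)]mulrA.
move: (2 * N * Ev ^+ 2 + _ + _) (v * (N * cr)) ((N * C) ^+ 2) (S * sk) => a b D s.
rewrite (_ : t ^+ 2 * t * (N * _ * _ + _) * V =
  t ^+ 2 * t * ((N * (F * F) * (e * e) + F ^+ 3 * zR) * V)); last by ring.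
move: ((N * (F * F) * (e * e) + F ^+ 3 * zR) * V) (t ^+ 2) => c T.
by clear => *; lra.
Qed.

End Carleman.

(** * Cutoff functions of class [C^1] and extension by zero *)

Section Cutoff.
Variable R : realType.
Implicit Types (f g Z : 'rV[R]_2 -> R) (u v w x : 'rV[R]_2) (U : set 'rV[R]_2).

Lemma near_lt_continuous (T : topologicalType) (g : T -> R) (v : T) :
  (forall e : R, 0 < e -> \forall w \near v, `|g w - g v| < e) -> {for v, continuous g}.
Proof.
move=> H; apply/cvgrPdist_lt => e e0; apply: filterS (H e e0) => w.
by rewrite distrC.
Qed.

Lemma class_C_expR k U f : open U -> class_C k U f -> class_C k U (fun x => expR (f x)).
Proof.
move=> oU; elim: k => [|k IH] /=.
  move=> cf x xU; apply: (@continuous_comp _ _ _ f expR); first exact: cf.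
  exact: continuous_expR.
move=> Cf; have [df cf] := Cf.
have dfE v x : U x -> 'D_v (fun y => expR (f y)) x = expR (f x) * 'D_v f x.
  move=> Ux; have dx := df x Ux.
  have de : differentiable expR (f x) by apply/derivable1_diffP; exact: derivable_expR.
  rewrite -[LHS]/('D_v (expR \o f) x) !deriveE//; last exact: differentiable_comp.
  rewrite diff_comp//= -[X in 'd expR (f x) X]mulr1 [LHS]linearZ /= mulrC.
  have [_ E] := is_derive_expR (f x).
  by rewrite deriveE// in E; rewrite -[in RHS]E mulrC [RHS]mulrC.
split=> [x Ux|v].
  apply: (@differentiable_comp _ _ _ _ f expR); first exact: df.
  by apply/derivable1_diffP; exact: derivable_expR.
apply: class_C_ext (class_CM oU (IH (class_CW Cf)) (cf v)) => // x Ux.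
by rewrite dfE.
Qed.

Lemma smooth_on_expR U f : open U -> smooth_on U f -> smooth_on U (fun x => expR (f x)).
Proof. by move=> oU sf k; exact: class_C_expR. Qed.

Lemma bounded_on_box U g x L : 0 <= L -> box x L `<=` U -> smooth_on U g ->
  exists2 C : R, 1 <= C & forall v, box x L v -> `|g v| <= C.
Proof.
move=> L0 BU sg.
have b0 : box x L !=set0 by exists x; split; rewrite subrr normr0.
have cg : {within box x L, continuous (fun v => `|g v|)}.
  apply: continuous_in_subspaceT => v /set_mem /BU Uv.
  by apply: (@continuous_comp _ _ _ g Num.norm); [exact: smooth_on_continuous sg Uv|exact: norm_continuous].
have [c _ H] := compact_EVT_max b0 (@compact_box R x L) cg.
exists (`|g c| + 1); first by rewrite lerDr.
by move=> v bv; rewrite (le_trans (H v (mem_set bv)))// lerDl.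
Qed.

Definition pos2 (s : R) : R := Num.max s 0 ^+ 2.

Lemma is_derive_pos2 (s : R) : is_derive s 1 pos2 (2 * Num.max s 0).
Proof.
apply: near_le_is_derive => e e0; apply/near_real.
exists e => // y ye; rewrite /pos2.
have [s0|s0] := leP s 0; have [y0|y0] := leP y 0.
- by rewrite expr0n subrr mulr0 mulr0 subr0 normr0 mulr_ge0// ltW.
- rewrite expr0n mulr0 mulr0 !subr0 normrX [`|y|]gtr0_norm// expr2.
  have ys : 0 < y - s by rewrite subr_gt0 (le_lt_trans s0).
  rewrite gtr0_norm// in ye *; move: ye s0 y0 e0 ys; clear => *; nra.
- have ys : y - s < 0 by rewrite subr_lt0 (le_lt_trans y0).
  rewrite ltr0_norm// in ye *; rewrite expr0n sub0r.
  by rewrite ler_norml; move: ye s0 y0 e0 ys; clear => *; apply/andP; split; nra.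
- rewrite (_ : _ - _ = (y - s) ^+ 2); last by ring.
  by rewrite normrX expr2 ler_wpM2r// ltW.
Qed.

(** Equal to 1 for [s >= - d / 2] and to 0 for [s <= - d]. It is only of class [C^1], as the cutoff
    is differentiated once; the factor in its derivative is [2 * 2 * (2 / d) = 8 / d]. *)
Definition plateau (d s : R) : R := pos2 (1 - pos2 (- 1 - 2 * s / d)).
Definition dplateau (d s : R) : R :=
  8 / d * Num.max (1 - pos2 (- 1 - 2 * s / d)) 0 * Num.max (- 1 - 2 * s / d) 0.

Lemma is_derive_plateau (d s : R) : d != 0 -> is_derive s 1 (plateau d) (dplateau d s).
Proof.
move=> d0.
have h : is_derive s 1 (fun s => - 1 - 2 * s / d) (- (2 / d)).
  by apply: is_derive_eq; rewrite /GRing.scale /=; field.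
have h2 := isd_comp (is_derive_pos2 _) h.
have h3 := is_deriveB (is_derive_cst (1 : R) s 1) h2.
apply: (isd_eq (isd_comp (is_derive_pos2 _) h3)).
by rewrite /dplateau /cst /=; field.
Qed.

Lemma plateau1 d s : 0 < d -> - d / 2 <= s -> plateau d s = 1 /\ dplateau d s = 0.
Proof.
move=> d0 ds; have t0 : - 1 - 2 * s / d <= 0.
  by rewrite -(ler_pM2r d0) mul0r mulrBl divfK ?gt_eqF//; move: ds; clear; lra.
by rewrite /plateau /dplateau /pos2 (max_r t0) expr0n subr0 max_l// expr1n !mulr0.
Qed.

Lemma plateau0 d s : 0 < d -> s <= - d -> plateau d s = 0 /\ dplateau d s = 0.
Proof.
move=> d0 ds; have t1 : 1 <= - 1 - 2 * s / d.
  by rewrite -(ler_pM2r d0) mulrBl divfK ?gt_eqF//; move: ds; clear; lra.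
have t2 : 1 - pos2 (- 1 - 2 * s / d) <= 0.
  by rewrite subr_le0 /pos2 max_l ?(le_trans _ t1)// exprn_ege1.
by rewrite /plateau /dplateau /(pos2 (1 - _)) (max_r t2) expr0n mulr0 mul0r.
Qed.

Lemma plateau_bounds d s : 0 < d -> 0 <= plateau d s /\ 0 <= dplateau d s <= 8 / d.
Proof.
move=> d0; split; first exact: sqr_ge0.
have p0 (x : R) : 0 <= Num.max x 0 by rewrite le_max lexx orbT.
have d8 : 0 <= 8 / d by rewrite divr_ge0// ltW.
rewrite /dplateau; apply/andP; split.
  by apply: mulr_ge0 => //; exact: mulr_ge0.
rewrite -mulrA ler_piMr// /pos2; move: (p0 (- 1 - 2 * s / d)).
move: (Num.max (- 1 - 2 * s / d) 0) => x x0.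
have [h|h] := leP (1 - x ^+ 2) 0; first by rewrite mul0r.
by move: h x0; rewrite expr2; clear => *; nra.
Qed.

Lemma continuous_dplateau d : continuous (dplateau d).
Proof.
have d1 (x : R) : is_derive x 1 (fun s => - 1 - 2 * s / d) (- (2 / d)).
  by apply: is_derive_eq; rewrite /GRing.scale /=; ring.
have d2 (x : R) := isd_comp (is_derive_pos2 _) (d1 x).
have d3 (x : R) := is_deriveB (is_derive_cst (1 : R) x 1) (d2 x).
have cd (g : R -> R) (dg : R -> R) (x : R) : is_derive x 1 g (dg x) -> {for x, continuous g}.
  by move=> [h _]; apply: differentiable_continuous; exact/derivable1_diffP.
have cm (g dg : R -> R) : (forall x : R, is_derive x 1 g (dg x)) ->
    continuous (fun s => Num.max (g s) 0).
  by move=> h x; apply: continuous_max; [exact: cd (h x)|exact: cst_continuous].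
move=> s; have h1 := cm _ _ d3 s; have h2 := cm _ _ d1 s.
exact: cvgM (cvgM (cvg_cst (8 / d)) h1) h2.
Qed.

Definition trunc f x (L : R) (g : 'rV[R]_2 -> R) v : R :=
  if `[< box x L v /\ 0 <= f v >] then g v else 0.

Lemma trunc_le f x L g v : `|trunc f x L g v| <= `|g v|.
Proof. by rewrite /trunc; case: ifP => // _; rewrite normr0. Qed.

(** Extension by zero preserves [C^1] for two reasons: across [f = 0] because [Z] vanishes there to
    first order and [trunc] only decreases absolute values, and near the edge of the box because [Z]
    already vanishes outside the smaller box on the side [f >= 0]. *)
Lemma cutoff U f Z Zx Zy x (L L' : R) : open U -> L' < L -> box x L `<=` U ->
  (forall v, U v -> {for v, continuous f}) ->
  (forall v, U v -> has_grad Z v (Zx v) (Zy v)) ->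
  (forall v, U v -> {for v, continuous Zx}) ->
  (forall v, U v -> {for v, continuous Zy}) ->
  (forall v, U v -> f v = 0 -> [/\ Z v = 0, Zx v = 0 & Zy v = 0]) ->
  (forall v, box x L v -> ~ box x L' v -> 0 <= f v -> [/\ Z v = 0, Zx v = 0 & Zy v = 0]) ->
  forall v, [/\ has_grad (trunc f x L Z) v (trunc f x L Zx v) (trunc f x L Zy v),
    {for v, continuous (trunc f x L Zx)} & {for v, continuous (trunc f x L Zy)}].
Proof.
move=> oU LL BU cf hZ cx cy f0 out v.
have dich : (\forall w \near v, forall g, (g = Z \/ g = Zx \/ g = Zy) -> trunc f x L g w = 0) \/
    (U v /\ \forall w \near v, forall g, trunc f x L g w = g w) \/
    (U v /\ f v = 0).
  have [bv|nbv] := pselect (box x L' v).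
    have nbx : \forall w \near v, box x L w.
      apply/near_square; exists (L - L'); first by rewrite subr_gt0.
      move=> w w0 w1; have [b0 b1] := bv; split.
        by rewrite -(subrKA (v 0 0)) (le_trans (ler_normD _ _))// -lerBrDr ltW// (lt_le_trans w0)// lerB.
      by rewrite -(subrKA (v 0 1)) (le_trans (ler_normD _ _))// -lerBrDr ltW// (lt_le_trans w1)// lerB.
    have Uv : U v by apply: BU; exact: (nbhs_singleton nbx).
    case: (ltrgtP (f v) 0) => fv.
    - left; have nf : \forall w \near v, f w < 0 by exact: cvgr_lt (cf v Uv) _ fv.
      apply: filterS nf => w fw g _; rewrite /trunc; case: asboolP => // -[_].
      by rewrite leNgt fw.
    - right; left; split => //.
      have nf : \forall w \near v, 0 < f w by exact: cvgr_gt (cf v Uv) _ fv.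
      apply: filterS2 nbx nf => w bw fw g; rewrite /trunc asboolT//.
      by split=> //; exact: ltW.
    - by right; right.
  left; have nn : \forall w \near v, ~ box x L' w.
    have cb : closed (box x L').
      apply: compact_closed (@compact_box R x L'); exact: norm_hausdorff.
    exact: (open_nbhs_nbhs (conj (closed_openC cb) nbv)).
  apply: filterS nn => w nw g gZ; rewrite /trunc; case: asboolP => // -[bw fw].
  by have [? ? ?] := out w bw nw fw; case: gZ => [->//|[]->].
case: dich => [z|[[Uv e]|[Uv fv]]].
- have zv := nbhs_singleton z.
  rewrite !zv; [|by right; right|by right; left].
  have nz g : (g = Z \/ g = Zx \/ g = Zy) -> \forall w \near v, 0 = trunc f x L g w.
    by move=> h; apply: filterS z => w H; rewrite H.
  have nz' g : (g = Z \/ g = Zx \/ g = Zy) -> \forall w \near v, trunc f x L g w = 0.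
    by move=> h; apply: filterS z => w H; rewrite H.
  split.
  + by apply: has_grad_near (has_grad_cst 0 v); apply: nz; left.
  + rewrite /prop_for /continuous_at zv; last by right; left.
    exact: cvg_near_cst (nz' Zx (or_intror (or_introl erefl))).
  + rewrite /prop_for /continuous_at zv; last by right; right.
    exact: cvg_near_cst (nz' Zy (or_intror (or_intror erefl))).
- have ev := nbhs_singleton e; rewrite !ev.
  have ng g : \forall w \near v, g w = trunc f x L g w by apply: filterS e => w ->.
  split; first exact: has_grad_near (ng Z) (hZ v Uv).
  + by rewrite /prop_for /continuous_at ev; apply: cvg_trans (near_eq_cvg (ng Zx)) (cx v Uv).
  + by rewrite /prop_for /continuous_at ev; apply: cvg_trans (near_eq_cvg (ng Zy)) (cy v Uv).
- have [z0 z1 z2] := f0 v Uv fv.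
  have c0 g : g v = 0 -> trunc f x L g v = 0 by move=> h; rewrite /trunc h if_same.
  rewrite !c0//; split.
  + apply: near_le_has_grad => e e0; have := has_grad_near_le (hZ v Uv) e0.
    apply: filterS => w; rewrite z0 z1 z2 !mulr0 addr0 !subr0 c0// subr0.
    exact: le_trans (trunc_le _ _ _ _ _).
  + have /cvgrPdist_lt h := cx v Uv; apply: near_lt_continuous => e e0.
    apply: filterS (h e e0) => w; rewrite c0// z1 subr0 sub0r normrN.
    exact: le_lt_trans (trunc_le _ _ _ _ _).
  + have /cvgrPdist_lt h := cy v Uv; apply: near_lt_continuous => e e0.
    apply: filterS (h e e0) => w; rewrite c0// z2 subr0 sub0r normrN.
    exact: le_lt_trans (trunc_le _ _ _ _ _).
Qed.

End Cutoff.

(** * The Carleman field of a function *)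

Section CarlemanField.
Variable R : realType.
Implicit Types (x v : 'rV[R]_2) (U : set 'rV[R]_2).
Variables (t N : R) (a11 a12 a22 ps u : 'rV[R]_2 -> R).

(** [wE] is the weight [e^(t phi)] with [phi = ps + N ps^2 / 2], and [wF] is the derivative of [phi]
    with respect to [ps]. [cv1] and [cv2] are the partial derivatives of [cv], written out. *)
Definition wF x : R := 1 + N * ps x.
Definition wE x : R := expR (t * (ps x + N / 2 * (ps x * ps x))).
Definition cv x : R := wE x * u x.
Definition cv1 x : R := wE x * (dx u x + t * (wF x * dx ps x) * u x).
Definition cv2 x : R := wE x * (dy u x + t * (wF x * dy ps x) * u x).

Definition field1 x : R := flux1 t N (a11 x) (a12 x) (a22 x) (dx ps x) (dy ps x)
  (wF x) (cv x) (cv1 x) (cv2 x).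
Definition field2 x : R := flux2 t N (a11 x) (a12 x) (a22 x) (dx ps x) (dy ps x)
  (wF x) (cv x) (cv1 x) (cv2 x).

Definition ell x : R := (a11 x * dx ps x + a12 x * dy ps x) * dx ps x +
  (a12 x * dx ps x + a22 x * dy ps x) * dy ps x.

Definition elliptic_part (g : 'rV[R]_2 -> R) x : R :=
  a11 x * dx (dx g) x + 2 * a12 x * dx (dy g) x + a22 x * dy (dy g) x.

End CarlemanField.

Ltac smooth := repeat first
  [ assumption | apply: smooth_on_cst | apply: smooth_onB | apply: smooth_onD
  | apply: smooth_onN | apply: smooth_onM | apply: smooth_dx | apply: smooth_dy ].

Section CarlemanFieldDivergence.
Variable R : realType.
Implicit Types (x v : 'rV[R]_2) (U : set 'rV[R]_2).
Variables (U : set 'rV[R]_2) (a11 a12 a22 ps u : 'rV[R]_2 -> R).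

Lemma smooth_wF N : open U -> smooth_on U ps -> smooth_on U (wF N ps).
Proof. by move=> oU sp; rewrite /wF; smooth. Qed.

Lemma smooth_wE t N : open U -> smooth_on U ps -> smooth_on U (wE t N ps).
Proof. by move=> oU sp; rewrite /wE; apply: smooth_on_expR => //; smooth. Qed.

Lemma smooth_field t N : open U -> smooth_on U a11 -> smooth_on U a12 ->
  smooth_on U a22 -> smooth_on U ps -> smooth_on U u ->
  smooth_on U (field1 t N a11 a12 a22 ps u) /\ smooth_on U (field2 t N a11 a12 a22 ps u).
Proof.
move=> oU s11 s12 s22 sp su.
have sF := smooth_wF N oU sp; have sE := smooth_wE t N oU sp.
have sv : smooth_on U (cv t N ps u) by rewrite /cv; smooth.
have sv1 : smooth_on U (cv1 t N ps u) by rewrite /cv1; smooth.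
have sv2 : smooth_on U (cv2 t N ps u) by rewrite /cv2; smooth.
by split; rewrite /field1 /field2 /flux1 /flux2; smooth.
Qed.

Lemma wE_grad t N x : open U -> smooth_on U ps -> U x ->
  has_grad (wE t N ps) x (t * (wF N ps x * dx ps x) * wE t N ps x)
    (t * (wF N ps x * dy ps x) * wE t N ps x).
Proof.
move=> oU sp Ux; have gp := smooth_has_grad sp Ux.
have g := has_gradM (has_grad_cst t x)
  (has_gradD gp (has_gradM (has_grad_cst (N / 2) x) (has_gradM gp gp))).
have := has_grad_comp (is_derive_expR _) g.
by move=> h; apply: has_grad_eq h _ _; rewrite /wF /wE; field.
Qed.

Lemma cv_grad t N x : open U -> smooth_on U ps -> smooth_on U u -> U x ->
  has_grad (cv t N ps u) x (cv1 t N ps u x) (cv2 t N ps u x).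
Proof.
move=> oU sp su Ux.
apply: has_grad_eq (has_gradM (wE_grad t N oU sp Ux) (smooth_has_grad su Ux)) _ _.
  by rewrite /cv1; ring.
by rewrite /cv2; ring.
Qed.

(** [S] is [carl_sym] at the weighted function. Undoing the conjugation, the sum of the two parts is
    the weight times the operator on [u], plus [t] times a coefficient that collects the second
    derivatives of [phi] and the [2 N e] correction. *)
Lemma field_div t N x : open U -> smooth_on U a11 -> smooth_on U a12 ->
  smooth_on U a22 -> smooth_on U ps -> smooth_on U u -> U x ->
  exists S : R,
    dx (field1 t N a11 a12 a22 ps u) x + dy (field2 t N a11 a12 a22 ps u) x =
      S * carl_skew t N (a11 x) (a12 x) (a22 x) (dx ps x) (dy ps x) (wF N ps x)
        (cv t N ps u x) (cv1 t N ps u x) (cv2 t N ps u x)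
      - carl_quad t N (a11 x) (a12 x) (a22 x) (dx ps x) (dy ps x) (wF N ps x)
        (cv t N ps u x) (cv1 t N ps u x) (cv2 t N ps u x)
        (dx a11 x) (dy a11 x) (dx a12 x) (dy a12 x) (dx a22 x) (dy a22 x)
        (dx (dx ps) x) (dx (dy ps) x) (dy (dy ps) x) /\
    S + carl_skew t N (a11 x) (a12 x) (a22 x) (dx ps x) (dy ps x) (wF N ps x)
        (cv t N ps u x) (cv1 t N ps u x) (cv2 t N ps u x) =
      wE t N ps x * elliptic_part a11 a12 a22 u x +
      t * (wF N ps x * elliptic_part a11 a12 a22 ps x
           - N * ell a11 a12 a22 ps x) * cv t N ps u x.
Proof.
move=> oU s11 s12 s22 sp su Ux.
have sch := schwarz oU sp Ux; have schu := schwarz oU su Ux.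
have gE := wE_grad t N oU sp Ux.
have gp := smooth_has_grad sp Ux.
have gp1 := smooth_has_grad (smooth_dx sp) Ux; rewrite -sch in gp1.
have gp2 := smooth_has_grad (smooth_dy sp) Ux.
have gu := smooth_has_grad su Ux.
have gu1 := smooth_has_grad (smooth_dx su) Ux; rewrite -schu in gu1.
have gu2 := smooth_has_grad (smooth_dy su) Ux.
have gF : has_grad (wF N ps) x (N * dx ps x) (N * dy ps x).
  apply: has_grad_eq (has_gradD (has_grad_cst 1 x) (has_gradM (has_grad_cst N x) gp)) _ _;
  by ring.
have gv1 := has_gradM gE (has_gradD gu1
  (has_gradM (has_gradM (has_grad_cst t x) (has_gradM gF gp1)) gu)).
have gv2 := has_gradM gE (has_gradD gu2
  (has_gradM (has_gradM (has_grad_cst t x) (has_gradM gF gp2)) gu)).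
set A := (X in has_grad _ x X _) in gv1; set B := (X in has_grad _ x _ X) in gv1.
set D := (X in has_grad _ x _ X) in gv2.
have gv2' : has_grad (cv2 t N ps u) x B D.
  by apply: has_grad_eq gv2 _ _ => //; rewrite /B; ring.
have [X1 [X2 [Y1 [Y2 [g1 g2 E]]]]] := carleman_divergence t
  (smooth_has_grad s11 Ux) (smooth_has_grad s12 Ux) (smooth_has_grad s22 Ux)
  gp1 gp2 gF (cv_grad t N oU sp su Ux) gv1 gv2'.
have [_ E1 _] := g1; have [_ _ E2] := g2; rewrite -{}E1 -{}E2 in E.
eexists; split; first exact: E.
rewrite /carl_sym /carl_skew /elliptic_part /ell /A /B /D /cv /cv1 /cv2.
by ring.
Qed.

End CarlemanFieldDivergence.

(** * Choice of the Carleman constants *)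

Section CarlemanInequality.
Variable R : realType.

Lemma bounded_family (U : set 'rV[R]_2) (x : 'rV[R]_2) (L : R) (n : nat)
    (g : nat -> 'rV[R]_2 -> R) : 0 <= L -> box x L `<=` U ->
  (forall i, (i < n)%N -> smooth_on U (g i)) ->
  exists2 C : R, 1 <= C & forall i v, (i < n)%N -> box x L v -> `|g i v| <= C.
Proof.
move=> L0 BU; elim: n => [|n IH] sg; first by exists 1.
have [i ni|C C1 HC] := IH; first exact: sg (ltnW ni).
have [D D1 HD] := bounded_on_box L0 BU (sg n (ltnSn n)).
exists (Num.max C D); first by rewrite le_max C1.
move=> i v; rewrite ltnS leq_eqVlt => /predU1P[->|ni] bv.
  by rewrite le_max HD ?orbT.
by rewrite le_max HC.
Qed.

Lemma carleman_inequality (U : set 'rV[R]_2) (a11 a12 a22 ps u : 'rV[R]_2 -> R)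
    (x0 : 'rV[R]_2) (L C0 : R) : open U -> smooth_on U a11 -> smooth_on U a12 ->
  smooth_on U a22 -> smooth_on U ps -> smooth_on U u ->
  0 <= L -> box x0 L `<=` U ->
  forall e0 al : R, 0 < e0 -> 0 < al ->
  (forall x, box x0 L x -> e0 <= ell a11 a12 a22 ps x) ->
  (forall x (v1 v2 : R), box x0 L x -> al * (v1 * v1 + v2 * v2) <=
     v1 * (a11 x * v1 + a12 x * v2) + v2 * (a12 x * v1 + a22 x * v2)) ->
  0 <= C0 ->
  (forall x, box x0 L x -> `|elliptic_part a11 a12 a22 u x| <=
     C0 * (`|u x| + `|dx u x| + `|dy u x|)) ->
  exists N t0 : R, [/\ 1 <= N, 1 <= t0 & forall t x, t0 <= t -> box x0 L x ->
    2^-1 <= wF N ps x <= 1 ->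
    dx (field1 t N a11 a12 a22 ps u) x + dy (field2 t N a11 a12 a22 ps u) x <=
      - (t ^+ 3 * (cv t N ps u x * cv t N ps u x))].
Proof.
move=> oU s11 s12 s22 sp su L0 BU e0 al e00 al0 he hA C00 hP.

pose Q (v1 v2 : R) x := quadR (a11 x) (a12 x) (a22 x) (dx ps x) (dy ps x) v1 v2
  (dx a11 x) (dy a11 x) (dx a12 x) (dy a12 x) (dx a22 x) (dy a22 x)
  (dx (dx ps) x) (dx (dy ps) x) (dy (dy ps) x).
pose Z x := zeroR (a11 x) (a12 x) (a22 x) (dx ps x) (dy ps x)
  (dx a11 x) (dy a11 x) (dx a12 x) (dy a12 x) (dx a22 x) (dy a22 x)
  (dx (dx ps) x) (dx (dy ps) x) (dy (dy ps) x).
pose T (v1 v2 : R) x := crossR (a11 x) (a12 x) (a22 x) (dx ps x) (dy ps x) v1 v2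
  (dx a11 x) (dy a11 x) (dx a12 x) (dy a12 x) (dx a22 x) (dy a22 x)
  (dx (dx ps) x) (dx (dy ps) x) (dy (dy ps) x).
have sQ (v1 v2 : R) : smooth_on U (Q v1 v2) by rewrite /Q /quadR; smooth.
have sZ : smooth_on U Z by rewrite /Z /zeroR; smooth.
have sT (v1 v2 : R) : smooth_on U (T v1 v2) by rewrite /T /crossR; smooth.
have sPp : smooth_on U (elliptic_part a11 a12 a22 ps) by rewrite /elliptic_part; smooth.
have sel : smooth_on U (ell a11 a12 a22 ps) by rewrite /ell; smooth.
(* The quadratic form [Q] is determined by its values at [(1, 0)], [(0, 1)] and [(1, 1)], the linear
   form [T] by two values, so it is enough to bound finitely many smooth functions. *)
pose fam := [:: Q 1 0; Q 0 1; Q 1 1; Z; T 1 0; T 0 1;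
  elliptic_part a11 a12 a22 ps; ell a11 a12 a22 ps; dx ps; dy ps].
have [B B1 HB] : exists2 C : R, 1 <= C &
    forall i v, (i < 10)%N -> box x0 L v -> `|nth (fun=> 0) fam i v| <= C.
  apply: bounded_family L0 BU _ => i.
  by do 10!(case: i => [_|i]; try (rewrite [nth _ _ _]/=; by smooth)).
have [C [C1 BC C3]] : exists C : R, [/\ 1 <= C, B <= C & C = 3 * B].
  by exists (3 * B); split => //; move: B1; clear; lra.
(* [K] comes from the bound on the operator and [(x + y + z)^2 <= 3 (x^2 + y^2 + z^2)]. [N] adds up
   the two thresholds of [carleman_estimate], and [t0] is chosen after it. *)
pose K := 3 * (C0 * (1 + 2 * C)) ^+ 2.
pose N := 1 + (2 * C + 2) / (e0 * al) + 4 * (C + 2) / (e0 * e0).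
pose t0 := 1 + 3 * (N * C) ^+ 2 + K.
have C0' : 0 <= C by apply: le_trans C1.
have ea : 0 < e0 * al by rewrite mulr_gt0.
have ee : 0 < e0 * e0 by rewrite mulr_gt0.
have n1 : 0 <= (2 * C + 2) / (e0 * al).
  by apply: divr_ge0; [move: C0'; clear; lra|exact: ltW].
have n2 : 0 <= 4 * (C + 2) / (e0 * e0).
  by apply: divr_ge0; [move: C0'; clear; lra|exact: ltW].
have N1 : 1 <= N by rewrite /N; move: n1 n2; clear; lra.
have K0 : 0 <= K by apply: mulr_ge0 => //; exact: sqr_ge0.
have D0 : 0 <= 3 * (N * C) ^+ 2 by apply: mulr_ge0 => //; exact: sqr_ge0.
exists N, t0; split => //; first by rewrite /t0; move: K0 D0; clear; lra.
move=> t x tt bx hF.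
have [S [-> SE]] := field_div t N oU s11 s12 s22 sp su (BU _ bx).
have t1 : 1 <= t by apply: le_trans tt; rewrite /t0; move: K0 D0; clear; lra.
have q10 := HB 0%N x isT bx; have q01 := HB 1%N x isT bx; have q11 := HB 2%N x isT bx.
have zz := le_trans (HB 3%N x isT bx) BC.
have c10 := le_trans (HB 4%N x isT bx) BC; have c01 := le_trans (HB 5%N x isT bx) BC.
have pp := le_trans (HB 6%N x isT bx) BC; have el := le_trans (HB 7%N x isT bx) BC.
have p1 := le_trans (HB 8%N x isT bx) BC; have p2 := le_trans (HB 9%N x isT bx) BC.
rewrite /= in q10 q01 q11 zz c10 c01 pp el p1 p2.
have q3 : `|Q 1 1 x| + `|Q 1 0 x| + `|Q 0 1 x| <= C.
  by rewrite C3; move: q10 q01 q11; clear; lra.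
have {}q10 := le_trans q10 BC; have {}q01 := le_trans q01 BC.
set v := cv t N ps u x; set v1 := cv1 t N ps u x; set v2 := cv2 t N ps u x.
apply: (carleman_estimate (C := C) (K := K) (e0 := e0) (al := al) _ _ _ _ _ _ _ _ _ _ _ _ _ _ _ _ _ SE) => //.
- exact: ltW.
- rewrite -mulrA -ler_pdivrMr// /N; move: n2; clear; lra.
- by rewrite -(ler_pM2r (ltr0n R 4)) divfK// [leLHS]mulrC -ler_pdivrMr// /N; move: n1; clear; lra.
- by apply: le_trans tt; rewrite /t0; clear; lra.
- exact: he.
- exact: hA.
- rewrite -/v1 -/v2 -/(Q v1 v2 x); clearbody v1 v2.
  have -> : Q v1 v2 x = v1 * v1 * Q 1 0 x + v2 * v2 * Q 0 1 x +
      v1 * v2 * (Q 1 1 x - Q 1 0 x - Q 0 1 x) by rewrite /Q /quadR; ring.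
  have m1 : `|v1 * v2| <= v1 * v1 + v2 * v2.
    have := sqr_ge0 (v1 - v2); have := sqr_ge0 (v1 + v2); have := sqr_ge0 v1; have := sqr_ge0 v2.
    by rewrite !expr2 ler_norml; clear => *; apply/andP; split; lra.
  have m2 : `|Q 1 1 x - Q 1 0 x - Q 0 1 x| <= C.
    apply: le_trans (ler_normB _ _) _; apply: le_trans q3.
    by rewrite lerD2r; exact: ler_normB.
  have s1 : 0 <= v1 * v1 by rewrite -expr2 sqr_ge0.
  have s2 : 0 <= v2 * v2 by rewrite -expr2 sqr_ge0.
  apply: le_trans (ler_normD _ _) _.
  rewrite [leRHS](_ : _ = (v1 * v1 * C + v2 * v2 * C) + (v1 * v1 + v2 * v2) * C); last by ring.
  apply: lerD; last by rewrite normrM ler_pM.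
  apply: le_trans (ler_normD _ _) _; rewrite !normrM.
  by apply: lerD; rewrite -normrM ger0_norm// ler_wpM2l.
- rewrite -/v1 -/v2 -/(T v1 v2 x); clearbody v1 v2.
  have -> : T v1 v2 x = v1 * T 1 0 x + v2 * T 0 1 x by rewrite /T /crossR; ring.
  clear zz pp el p1 p2; move: (T 1 0 x) (T 0 1 x) c10 c01 => T1 T2 c10 c01.
  rewrite [C * _]mulrDr; apply: le_trans (ler_normD _ _) _; rewrite !normrM.
  by apply: lerD; rewrite mulrC ler_wpM2r.
- have F1 : `|wF N ps x| <= 1.
    case/andP: hF => f1 f2; rewrite ger0_norm// (le_trans _ f1)//.
  apply: le_trans (ler_normB _ _) _; rewrite !normrM.
  have x1 : `|wF N ps x| * `|elliptic_part a11 a12 a22 ps x| <= C.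
    by rewrite -[leRHS]mul1r ler_pM.
  have x2 : `|N| * `|ell a11 a12 a22 ps x| <= N * C.
    by rewrite ger0_norm ?(le_trans _ N1)// ler_wpM2l// (le_trans _ N1).
  have x3 : C <= N * C by rewrite ler_peMl.
  by move: x1 x2 x3; clear; lra.
- rewrite -/v -/v1 -/v2; set w := wE t N ps x * _.
  have t00 : 0 <= t by apply: le_trans t1.
  have W0 : 0 < wE t N ps x by exact: expR_gt0.
  have F1 : `|wF N ps x| <= 1.
    case/andP: hF => f1 f2; rewrite ger0_norm// (le_trans _ f1)//.
  have cvE p d : `|p| <= C ->
      wE t N ps x * `|d| <= `|wE t N ps x * (d + t * (wF N ps x * p) * u x)| + t * C * `|v|.
    move=> pC; rewrite -{1}(gtr0_norm W0) -normrM.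
    have -> : wE t N ps x * d = wE t N ps x * (d + t * (wF N ps x * p) * u x) -
       (t * (wF N ps x * p)) * v by rewrite /v /cv; ring.
    apply: le_trans (ler_normB _ _) _; rewrite lerD2l !normrM (ger0_norm t00).
    rewrite ler_wpM2r// ler_wpM2l// -[leRHS]mul1r ler_pM//.
  have wle : `|w| <= C0 * (1 + 2 * C) * (t * `|v| + `|v1| + `|v2|).
    rewrite /w normrM (gtr0_norm W0).
    apply: (@le_trans _ _ (wE t N ps x * (C0 * (`|u x| + `|dx u x| + `|dy u x|)))).
      by rewrite ler_wpM2l ?(ltW W0)//; exact: hP.
    rewrite mulrCA -mulrA ler_wpM2l// !mulrDr.
    have y0 : wE t N ps x * `|u x| = `|v| by rewrite /v /cv normrM (gtr0_norm W0).
    have y1 := cvE _ (dx u x) p1; have y2 := cvE _ (dy u x) p2.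
    rewrite -/(cv1 t N ps u x) -/v1 in y1; rewrite -/(cv2 t N ps u x) -/v2 in y2.
    have y3 : `|v| <= t * `|v| by rewrite ler_peMl.
    have y4 : 0 <= C * `|v1| by rewrite mulr_ge0.
    have y5 : 0 <= C * `|v2| by rewrite mulr_ge0.
    by rewrite y0 !mulrDl; move: y1 y2 y3 y4 y5; clear; lra.
  have K1 : 0 <= C0 * (1 + 2 * C) by rewrite mulr_ge0// addr_ge0// mulr_ge0.
  have w2 : w * w <= (C0 * (1 + 2 * C) * (t * `|v| + `|v1| + `|v2|)) ^+ 2.
    rewrite -[w * w]ger0_norm -?expr2 ?sqr_ge0// normrX expr2 [leRHS]expr2.
    by rewrite ler_pM.
  apply: le_trans w2 _; rewrite exprMn /K -mulrA [3 * _]mulrCA ler_wpM2l ?sqr_ge0//.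
  have E (z : R) : z * z = `|z| * `|z| by rewrite -normrM ger0_norm// -expr2 sqr_ge0.
  rewrite (E v) (E v1) (E v2) (_ : t ^+ 2 * _ = (t * `|v|) ^+ 2); last by ring.
  move: (t * `|v|) (`|v1|) (`|v2|) => a b d.
  have := sqr_ge0 (a - b); have := sqr_ge0 (a - d); have := sqr_ge0 (b - d).
  by rewrite !expr2; clear => *; lra.
Qed.

End CarlemanInequality.

(** * Bounds on the Carleman field and its truncation *)

Section UniqueContinuation.
Variable R : realType.

Lemma flux_grad0 (a11 a12 a22 p1 p2 F v v1 v2 : 'rV[R]_2 -> R) x
    (t N b1 b2 c1 c2 d1 d2 h11 h12 h21 h22 k1 k2 w1 w2 v11 v12 v21 v22 : R) :
  has_grad a11 x b1 b2 -> has_grad a12 x c1 c2 -> has_grad a22 x d1 d2 ->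
  has_grad p1 x h11 h12 -> has_grad p2 x h21 h22 ->
  has_grad F x k1 k2 -> has_grad v x w1 w2 ->
  has_grad v1 x v11 v12 -> has_grad v2 x v21 v22 ->
  v x = 0 -> v1 x = 0 -> v2 x = 0 ->
  has_grad (fun y => flux1 t N (a11 y) (a12 y) (a22 y) (p1 y) (p2 y) (F y)
      (v y) (v1 y) (v2 y)) x 0 0 /\
  has_grad (fun y => flux2 t N (a11 y) (a12 y) (a22 y) (p1 y) (p2 y) (F y)
      (v y) (v1 y) (v2 y)) x 0 0.
Proof.
move=> ga11 ga12 ga22 gp1 gp2 gF gv gv1 gv2 z0 z1 z2.
split; eapply has_grad_eq.
1: by rewrite /flux1; repeat first
  [ eassumption | eapply has_grad_cst | eapply has_gradB | eapply has_gradD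
  | eapply has_gradN | eapply has_gradM ].
1,2: by rewrite /= z0 z1 z2; ring.
1: by rewrite /flux2; repeat first
  [ eassumption | eapply has_grad_cst | eapply has_gradB | eapply has_gradD
  | eapply has_gradN | eapply has_gradM ].
all: by rewrite /= z0 z1 z2; ring.
Qed.

(** With [s = 1 / t] the flux is [t^3 E^2] times a polynomial of degree at most two in [s], so a
    bound uniform in [t >= 1] reduces to [s] in [[0, 1]]. *)
Lemma flux_scale (t N a11 a12 a22 p1 p2 F E u u1 u2 : R) : t != 0 ->
  flux1 t N a11 a12 a22 p1 p2 F (E * u) (E * (u1 + t * (F * p1) * u))
    (E * (u2 + t * (F * p2) * u)) =
  t ^+ 3 * E ^+ 2 * flux1 1 (t^-1 * N) a11 a12 a22 p1 p2 F u
    (t^-1 * u1 + F * p1 * u) (t^-1 * u2 + F * p2 * u) /\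
  flux2 t N a11 a12 a22 p1 p2 F (E * u) (E * (u1 + t * (F * p1) * u))
    (E * (u2 + t * (F * p2) * u)) =
  t ^+ 3 * E ^+ 2 * flux2 1 (t^-1 * N) a11 a12 a22 p1 p2 F u
    (t^-1 * u1 + F * p1 * u) (t^-1 * u2 + F * p2 * u).
Proof. by move=> t0; rewrite /flux1 /flux2; split; field. Qed.

(** Lagrange interpolation at [0], [1], [-1]: on [[0, 1]] each of the three basis polynomials is at
    most 1 in absolute value. *)
Lemma quadratic_bound (A : R -> R) (B s : R) : 0 <= s <= 1 ->
  A s = A 0 * (1 - s * s) + A 1 * ((s * s + s) / 2) + A (-1) * ((s * s - s) / 2) ->
  `|A 0| <= B -> `|A 1| <= B -> `|A (-1)| <= B -> `|A s| <= 3 * B.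
Proof.
move=> /andP[s0 s1] -> h0 h1 h2.
have B0 : 0 <= B by apply: le_trans h0.
have k (a c : R) : `|a| <= B -> `|c| <= 1 -> `|a * c| <= B.
  by move=> aB c1; rewrite normrM -[leRHS]mulr1 ler_pM.
rewrite (_ : 3 * B = B + B + B); last by ring.
have ss : 0 <= s * s <= 1 by rewrite mulr_ge0//= mulr_ile1.
case/andP: ss => ss0 ss1.
apply: le_trans (ler_normD _ _) _; apply: lerD; last first.
  by apply: k => //; rewrite ler_norml; move: s0 s1 ss0 ss1; clear => *; apply/andP; split; lra.
apply: le_trans (ler_normD _ _) _; apply: lerD; apply: k => //; rewrite ler_norml;
  by move: s0 s1 ss0 ss1; clear => *; apply/andP; split; lra.
Qed.

Lemma field_bound (U : set 'rV[R]_2) (a11 a12 a22 ps u : 'rV[R]_2 -> R)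
    (x0 : 'rV[R]_2) (L N : R) :
  open U -> smooth_on U a11 -> smooth_on U a12 -> smooth_on U a22 ->
  smooth_on U ps -> smooth_on U u -> 0 <= L -> box x0 L `<=` U ->
  exists2 K : R, 1 <= K & forall t x, 1 <= t -> box x0 L x ->
    `|dx ps x * field1 t N a11 a12 a22 ps u x + dy ps x * field2 t N a11 a12 a22 ps u x|
      <= K * (t ^+ 3 * wE t N ps x ^+ 2).
Proof.
move=> oU s11 s12 s22 sp su L0 BU.
have sF := smooth_wF N oU sp.
pose A (s : R) x := dx ps x * flux1 1 (s * N) (a11 x) (a12 x) (a22 x) (dx ps x) (dy ps x)
    (wF N ps x) (u x) (s * dx u x + wF N ps x * dx ps x * u x)
    (s * dy u x + wF N ps x * dy ps x * u x)
  + dy ps x * flux2 1 (s * N) (a11 x) (a12 x) (a22 x) (dx ps x) (dy ps x)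
    (wF N ps x) (u x) (s * dx u x + wF N ps x * dx ps x * u x)
    (s * dy u x + wF N ps x * dy ps x * u x).
have sA s : smooth_on U (A s) by rewrite /A /flux1 /flux2; smooth.
have [B B1 HB] : exists2 C : R, 1 <= C & forall i v, (i < 3)%N -> box x0 L v ->
    `|nth (fun=> 0) [:: A 0; A 1; A (-1)] i v| <= C.
  apply: bounded_family L0 BU _ => i.
  by do 3!(case: i => [_|i]; first exact: sA).
exists (3 * B); first by move: B1; clear; lra.
move=> t x t1 bx; have t0 : 0 < t by apply: lt_le_trans t1.
have tn : t != 0 by rewrite gt_eqF.
have [E1 E2] := flux_scale N (a11 x) (a12 x) (a22 x) (dx ps x) (dy ps x) (wF N ps x)
  (wE t N ps x) (u x) (dx u x) (dy u x) tn.
rewrite /field1 /field2 /cv /cv1 /cv2 E1 E2.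
set T := t ^+ 3 * _.
rewrite (_ : _ + _ = T * A t^-1 x); last by rewrite /A; ring.
have T0 : 0 <= T by apply: mulr_ge0; [rewrite exprn_ge0// ltW|exact: sqr_ge0].
rewrite normrM ger0_norm// mulrC ler_wpM2r//.
apply: (@quadratic_bound (fun s => A s x)).
- by rewrite invr_ge0 ltW//= invf_le1.
- by rewrite /A /flux1 /flux2; field.
- exact: HB 0%N x isT bx.
- exact: HB 1%N x isT bx.
- exact: HB 2%N x isT bx.
Qed.

(* The total divergence of the truncated Carleman field: the mass near [x1] is
   bounded by what crosses the strip where the truncation is not constant. *)
Lemma carleman_mass (U : set 'rV[R]_2) (a11 a12 a22 f ps u : 'rV[R]_2 -> R)
    (x0 x1 : 'rV[R]_2) (L N d t l m K M : R) (n : nat) :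
  open U -> smooth_on U a11 -> smooth_on U a12 -> smooth_on U a22 ->
  smooth_on U f -> smooth_on U ps -> smooth_on U u ->
  0 < L -> 0 < d -> 0 < l -> 0 < M -> (0 < n)%N -> box x0 L `<=` U -> box x0 L x1 ->
  2 * L < n%:R * l ->
  (forall v, U v -> f v = 0 -> [/\ u v = 0, dx u v = 0 & dy u v = 0]) ->
  (forall v, box x0 L v -> ~ box x0 (L / 2) v -> 0 <= f v -> ps v <= - d) ->
  (forall v, box x0 L v -> 0 <= f v -> - d <= ps v ->
    dx (field1 t N a11 a12 a22 ps u) v + dy (field2 t N a11 a12 a22 ps u) v <= 0) ->
  (forall v, box x0 L v -> 0 <= f v -> - d <= ps v -> ps v <= - d / 2 ->
    `|dx ps v * field1 t N a11 a12 a22 ps u v + dy ps v * field2 t N a11 a12 a22 ps u v|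
      <= d / 8 * M) ->
  (forall v : 'rV[R]_2, `|v 0 0 - x1 0 0| <= l -> `|v 0 1 - x1 0 1| <= l ->
    [/\ box x0 L v, 0 <= f v, - d / 2 <= ps v &
    dx (field1 t N a11 a12 a22 ps u) v + dy (field2 t N a11 a12 a22 ps u) v <= - m]) ->
  m <= 4 * n%:R ^+ 2 * M.
Proof.
move=> oU s11 s12 s22 sf sp su L0 d0 l0 M0 n0 BU b1 nL fz out neg mid small.
have [s1 s2] := smooth_field t N oU s11 s12 s22 sp su.
set f1 := field1 _ _ _ _ _ _ _ in s1 neg mid small *.
set f2 := field2 _ _ _ _ _ _ _ in s2 neg mid small *.
have dn : d != 0 by rewrite gt_eqF.
have cps v : U v -> {for v, continuous ps} by move=> Uv; exact: smooth_on_continuous sp Uv.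
pose et v := plateau d (ps v); pose et' v := dplateau d (ps v).
have get v : U v -> has_grad et v (et' v * dx ps v) (et' v * dy ps v).
  by move=> Uv; apply: has_grad_comp (is_derive_plateau _ dn) (smooth_has_grad sp Uv).
have cet v : U v -> {for v, continuous et}.
  by move=> Uv; have [h _ _] := get v Uv; exact: differentiable_continuous.
have cet' v : U v -> {for v, continuous et'}.
  move=> Uv; apply: (@continuous_comp _ _ _ ps (dplateau d)); first exact: cps.
  exact: continuous_dplateau.
have LL : L / 2 < L by rewrite ltr_pdivrMr// ltr_pMr// ltr1n.
have cut_field g : smooth_on U g ->
    (forall v, U v -> f v = 0 -> has_grad g v 0 0 /\ g v = 0) ->
    forall v, [/\ has_grad (trunc f x0 L (fun v => et v * g v)) v
        (trunc f x0 L (fun v => et v * dx g v + g v * (et' v * dx ps v)) v)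
        (trunc f x0 L (fun v => et v * dy g v + g v * (et' v * dy ps v)) v),
      {for v, continuous (trunc f x0 L (fun v => et v * dx g v + g v * (et' v * dx ps v)))} &
      {for v, continuous (trunc f x0 L (fun v => et v * dy g v + g v * (et' v * dy ps v)))}].
  move=> sg gz; apply: (@cutoff R U f _ _ _ x0 L (L / 2)) => //.
  - by move=> v Uv; exact: smooth_on_continuous sf Uv.
  - by move=> v Uv; exact: has_gradM (get v Uv) (smooth_has_grad sg Uv).
  - move=> v Uv; have h2 := smooth_on_continuous (smooth_dx sg) Uv.
    have h3 := smooth_on_continuous sg Uv; have h5 := smooth_on_continuous (smooth_dx sp) Uv.
    exact: cvgD (cvgM (cet v Uv) h2) (cvgM h3 (cvgM (cet' v Uv) h5)).
  - move=> v Uv; have h2 := smooth_on_continuous (smooth_dy sg) Uv.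
    have h3 := smooth_on_continuous sg Uv; have h5 := smooth_on_continuous (smooth_dy sp) Uv.
    exact: cvgD (cvgM (cet v Uv) h2) (cvgM h3 (cvgM (cet' v Uv) h5)).
  - move=> v Uv fv; have [[_ h1 h2] h0] := gz v Uv fv.
    by rewrite h0 h1 h2 !mulr0 !mul0r addr0.
  - move=> v bv nb fv; have [h1 h2] := plateau0 d0 (out v bv nb fv).
    by rewrite /et /et' h1 h2 !mul0r !mulr0 addr0.
(* The flux is quadratic in the weighted function and its gradient, so it vanishes to first order
   wherever [u] does. *)
have gz v : U v -> f v = 0 -> (has_grad f1 v 0 0 /\ f1 v = 0) /\ (has_grad f2 v 0 0 /\ f2 v = 0).
  move=> Uv fv; have [u0 u1 u2] := fz v Uv fv.
  have sF := smooth_wF N oU sp; have sE := smooth_wE t N oU sp.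
  have z0 : cv t N ps u v = 0 by rewrite /cv u0 mulr0.
  have z1 : cv1 t N ps u v = 0 by rewrite /cv1 u0 u1 mulr0 addr0 mulr0.
  have z2 : cv2 t N ps u v = 0 by rewrite /cv2 u0 u2 mulr0 addr0 mulr0.
  have sv : smooth_on U (cv t N ps u) by rewrite /cv; smooth.
  have sv1 : smooth_on U (cv1 t N ps u) by rewrite /cv1; smooth.
  have sv2 : smooth_on U (cv2 t N ps u) by rewrite /cv2; smooth.
  have [h1 h2] := flux_grad0 t N (smooth_has_grad s11 Uv) (smooth_has_grad s12 Uv)
    (smooth_has_grad s22 Uv) (smooth_has_grad (smooth_dx sp) Uv)
    (smooth_has_grad (smooth_dy sp) Uv) (smooth_has_grad sF Uv) (smooth_has_grad sv Uv)
    (smooth_has_grad sv1 Uv) (smooth_has_grad sv2 Uv) z0 z1 z2.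
  split; split => //.
  - by rewrite /f1 /field1 /flux1 z0 z1 z2; ring.
  - by rewrite /f2 /field2 /flux2 z0 z1 z2; ring.
have C1 := cut_field f1 s1 (fun v Uv fv => (gz v Uv fv).1).
have C2 := cut_field f2 s2 (fun v Uv fv => (gz v Uv fv).2).
set W1 := trunc f x0 L (fun v => et v * f1 v) in C1.
set W2 := trunc f x0 L (fun v => et v * f2 v) in C2.
set D1 := trunc f x0 L (fun v => et v * dx f1 v + f1 v * (et' v * dx ps v)) in C1.
set D2 := trunc f x0 L (fun v => et v * dy f2 v + f2 v * (et' v * dy ps v)) in C2.
have DE v : D1 v + D2 v = if `[< box x0 L v /\ 0 <= f v >] then
    et v * (dx f1 v + dy f2 v) + et' v * (dx ps v * f1 v + dy ps v * f2 v) else 0.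
  by rewrite /D1 /D2 /trunc; case: ifP => _; [ring|rewrite addr0].
have far (a b c : R) : `|b - c| <= L -> n%:R * l <= `|a - b| -> L < `|a - c|.
  move=> bc ab; have : `|a - b| <= `|a - c| + `|b - c|.
    by rewrite -[`|b - c|]distrC -(subrKA c) ler_normD.
  by move: bc ab nL; clear; lra.
apply: (@divergence_bound R W1 W2 D1 D2 x1 l m M n) => //.
- move=> x y; have [h _ _] := C1 (pt x y).
  by apply: (isd_eq (has_grad_curve (is_derive_id x 1) (is_derive_cst y x 1) h));
    rewrite mulr1 mulr0 addr0.
- move=> x y; have [h _ _] := C2 (pt x y).
  by apply: (isd_eq (has_grad_curve (is_derive_cst x y 1) (is_derive_id y 1) h));
    rewrite mulr1 mulr0 add0r.
- by move=> v; have [] := C1 v.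
- by move=> v; have [] := C2 v.
- move=> v vl; rewrite /W1 /trunc; case: asboolP => // -[[bv _] _].
  by have := far _ _ _ b1.1 vl; rewrite ltNge bv.
- move=> v vl; rewrite /W2 /trunc; case: asboolP => // -[[_ bv] _].
  by have := far _ _ _ b1.2 vl; rewrite ltNge bv.
(* The divergence is at most 0 except on the strip [- d < ps < - d / 2], where the derivative of the
   plateau, at most [8 / d], multiplies a flux of size at most [d / 8 * M]. *)
- move=> v; rewrite DE; case: asboolP => [[bv fv]|_]; last exact: ltW.
  have [psd|psd] := leP (ps v) (- d).
    by have [h1 h2] := plateau0 d0 psd; rewrite /et /et' h1 h2 !mul0r addr0 ltW.
  have nv := neg v bv fv (ltW psd).
  have [e0 /andP[e0' e1']] := plateau_bounds (ps v) d0.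
  have x1' : et v * (dx f1 v + dy f2 v) <= 0 by rewrite mulr_ge0_le0.
  have [psd2|psd2] := leP (- d / 2) (ps v).
    have [_ h2] := plateau1 d0 psd2; rewrite /et' h2 mul0r addr0.
    by rewrite (le_trans x1')// ltW.
  have mv := mid v bv fv (ltW psd) (ltW psd2).
  have x2 : et' v * (dx ps v * f1 v + dy ps v * f2 v) <= M.
    apply: le_trans (ler_norm _) _; rewrite normrM (ger0_norm e0').
    rewrite (_ : M = 8 / d * (d / 8 * M)); last by field.
    by rewrite ler_pM.
  by rewrite -[M]add0r lerD.
- move=> v v0 v1; have [bv fv psd dv] := small v v0 v1.
  rewrite DE asboolT//; have [h1 h2] := plateau1 d0 psd.
  by rewrite /et /et' h1 h2 mul1r mul0r addr0.
Qed.

End UniqueContinuation.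

(** * Unique continuation to one side of a curve *)

Section OneSided.
Variable R : realType.

(** Completing the square, and Cayley-Hamilton: with [A] the symmetric matrix of entries [a, b, c],
    the trace times the form is [|A v|^2 + det A |v|^2]. This gives the ellipticity constant
    [det A / (a + c)]. *)
Lemma ell_form (a b c p q : R) :
  a * ((a * p + b * q) * p + (b * p + c * q) * q) =
    (a * p + b * q) ^+ 2 + (a * c - b ^+ 2) * q ^+ 2 /\
  (a + c) * (p * (a * p + b * q) + q * (b * p + c * q)) =
    (a * p + b * q) ^+ 2 + (b * p + c * q) ^+ 2 + (a * c - b ^+ 2) * (p * p + q * q).
Proof. by split; ring. Qed.

Lemma pos_form (a b c p q : R) : 0 < a -> 0 < a * c - b ^+ 2 -> (p != 0) || (q != 0) ->
  0 < (a * p + b * q) * p + (b * p + c * q) * q.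
Proof.
move=> a0 d0 pq; rewrite -(pmulr_rgt0 _ a0) (ell_form a b c p q).1.
have [q0|q0] := eqVneq q 0.
  rewrite q0 eqxx orbF in pq *; rewrite mulr0 addr0 expr0n mulr0 addr0 exprMn mulr_gt0//.
    by rewrite exprn_gt0.
  by rewrite exprn_even_gt0.
by rewrite ltr_wpDl ?sqr_ge0// mulr_gt0// exprn_even_gt0.
Qed.

Lemma pos_form_trace (a b c : R) : 0 < a -> 0 < a * c - b ^+ 2 -> 0 < c.
Proof.
move=> a0 d0; rewrite -(pmulr_rgt0 _ a0); have := sqr_ge0 b; move: d0; clear; lra.
Qed.

Lemma exp_dominated (q C g t0 : R) : 0 < q -> 0 < g -> 0 <= C -> 0 <= t0 ->
  exists2 t, t0 <= t & C < expR (t * g) * q.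
Proof.
move=> q0 g0 C0 t00; exists (t0 + C / (g * q)).
  by rewrite lerDl divr_ge0// mulr_ge0 ?ltW.
have -> : (t0 + C / (g * q)) * g = t0 * g + C / q by field; rewrite !gt_eqF.
apply: (@lt_le_trans _ _ ((1 + (t0 * g + C / q)) * q)).
  rewrite mulrDl mulrDl divfK ?gt_eqF// mul1r.
  have : 0 <= t0 * g * q by rewrite !mulr_ge0// ltW.
  by move: q0; clear; lra.
by rewrite ler_wpM2r ?expR_ge1Dx// ltW.
Qed.

Lemma smooth_square (U : set 'rV[R]_2) (x0 : 'rV[R]_2) : open U ->
  smooth_on U (fun v : 'rV[R]_2 => (v 0 0 - x0 0 0) * (v 0 0 - x0 0 0) +
    (v 0 1 - x0 0 1) * (v 0 1 - x0 0 1)).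
Proof.
move=> oU; have sx := @smooth_x R U; have sy := @smooth_y R U.
by smooth.
Qed.

Lemma smooth_near_gt (U : set 'rV[R]_2) (f : 'rV[R]_2 -> R) x (c : R) : smooth_on U f -> U x ->
  c < f x -> \forall v \near x, c < f v.
Proof.
move=> sf Ux cf; have cfx := smooth_on_continuous sf Ux.
have := @continuous_near_lt R f x (f x - c) cfx.
rewrite subr_gt0 => /(_ cf)[r r0 H]; apply/near_square; exists r => // v v0 v1.
by have := H v v0 v1; rewrite ltr_distl => /andP[+ _]; rewrite subKr.
Qed.

(** With [ps = - f - |v - x0|^2], the set where [f >= 0] and [ps >= - d] is a lens shrinking to [x0]
    as [d] decreases. If [u] did not vanish at [x1] close to [x0], the mass near [x1], where
    [ps > - d / 4], would carry a weight exponentially larger in [t] than the strip [ps <= - d / 2]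
    that bounds it in [carleman_mass]. *)
Lemma unique_continuation_side (U : set 'rV[R]_2) (a11 a12 a22 f u : 'rV[R]_2 -> R)
    (x0 : 'rV[R]_2) (C0 : R) :
  open U -> U x0 -> smooth_on U a11 -> smooth_on U a12 -> smooth_on U a22 ->
  smooth_on U f -> smooth_on U u ->
  0 < a11 x0 -> 0 < a11 x0 * a22 x0 - a12 x0 ^+ 2 -> 0 <= C0 ->
  (forall x, U x -> `|elliptic_part a11 a12 a22 u x| <=
     C0 * (`|u x| + `|dx u x| + `|dy u x|)) ->
  f x0 = 0 -> (dx f x0 != 0) || (dy f x0 != 0) ->
  (forall v, U v -> f v = 0 -> [/\ u v = 0, dx u v = 0 & dy u v = 0]) ->
  exists2 r : R, 0 < r & forall v : 'rV[R]_2, `|v 0 0 - x0 0 0| < r -> `|v 0 1 - x0 0 1| < r ->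
    0 <= f v -> u v = 0.
Proof.
move=> oU Ux0 s11 s12 s22 sf su a0 det0 C00 hP f0 gf fz.
pose sq (v : 'rV[R]_2) := (v 0 0 - x0 0 0) * (v 0 0 - x0 0 0) +
    (v 0 1 - x0 0 1) * (v 0 1 - x0 0 1).
have ssq : smooth_on U sq := smooth_square x0 oU.
pose ps v := - f v - sq v.
have sp : smooth_on U ps by rewrite /ps; smooth.
have gsq : has_grad sq x0 0 0.
  have gx := has_gradB (has_grad_x x0) (has_grad_cst (x0 0 0) x0).
  have gy := has_gradB (has_grad_y x0) (has_grad_cst (x0 0 1) x0).
  apply: has_grad_eq (has_gradD (has_gradM gx gx) (has_gradM gy gy)) _ _;
  by rewrite /= !subrr !mul0r !addr0.
have ps0 : ps x0 = 0 by rewrite /ps /sq f0 !subrr !mul0r !addr0 oppr0 addr0.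
have [dps1 dps2] : dx ps x0 = - dx f x0 /\ dy ps x0 = - dy f x0.
  have [_ -> ->] := has_gradB (has_gradN (smooth_has_grad sf Ux0)) gsq.
  by rewrite !subr0.
have sel : smooth_on U (ell a11 a12 a22 ps) by rewrite /ell; smooth.
have el0 : 0 < ell a11 a12 a22 ps x0.
  by apply: pos_form => //; rewrite dps1 dps2 !oppr_eq0.
pose det v := a11 v * a22 v - a12 v * a12 v.
have sdet : smooth_on U det by rewrite /det; smooth.
have dt0 : 0 < det x0 by rewrite /det -expr2.
have a220 := pos_form_trace a0 det0.
pose tr0 := a11 x0 + a22 x0; have tr00 : 0 < tr0 by rewrite addr_gt0.
(* Near [x0] the determinant stays above half its value and the trace below twice its value; their
   quotient bounds the form from below. *)
pose al := det x0 / 2 / (2 * tr0); have al0 : 0 < al by rewrite !divr_gt0// mulr_gt0.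
have str : smooth_on U (fun v => - (a11 v + a22 v)) by smooth.
have nU : \forall v \near x0, U v by exact: open_nbhs_nbhs.
have n1 : \forall v \near x0, ell a11 a12 a22 ps x0 / 2 < ell a11 a12 a22 ps v.
  by apply: (smooth_near_gt sel Ux0); rewrite ltr_pdivrMr// ltr_pMr// ltr1n.
have n2 : \forall v \near x0, det x0 / 2 < det v.
  by apply: (smooth_near_gt sdet Ux0); rewrite ltr_pdivrMr// ltr_pMr// ltr1n.
have n3 : \forall v \near x0, - (2 * tr0) < - (a11 v + a22 v).
  apply: (smooth_near_gt str Ux0) => /=; rewrite ltrN2 -/tr0.
  by move: tr00; clear; lra.
have n4 : \forall v \near x0, 0 < a11 v by exact: smooth_near_gt s11 Ux0 a0.
have /near_square[r0 r00 Hr0] : \forall v \near x0, [/\ U v,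
    ell a11 a12 a22 ps x0 / 2 < ell a11 a12 a22 ps v, det x0 / 2 < det v,
    - (2 * tr0) < - (a11 v + a22 v) & 0 < a11 v].
  by near=> v; split; near: v.
pose L := r0 / 2; have L0 : 0 < L by rewrite divr_gt0.
have Lr : L < r0 by rewrite /L ltr_pdivrMr// ltr_pMr// ltr1n.
have Hb v : box x0 L v -> [/\ U v,
    ell a11 a12 a22 ps x0 / 2 < ell a11 a12 a22 ps v, det x0 / 2 < det v,
    - (2 * tr0) < - (a11 v + a22 v) & 0 < a11 v].
  by move=> [b0 b1]; apply: Hr0; [exact: le_lt_trans Lr|exact: le_lt_trans Lr].
have BU : box x0 L `<=` U by move=> v /Hb[].
have e00 : 0 < ell a11 a12 a22 ps x0 / 2 by rewrite divr_gt0.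
have [N [t0 [N1 t01 carl]]] : exists N t0 : R, [/\ 1 <= N, 1 <= t0 &
    forall t x, t0 <= t -> box x0 L x -> 2^-1 <= wF N ps x <= 1 ->
    dx (field1 t N a11 a12 a22 ps u) x + dy (field2 t N a11 a12 a22 ps u) x <=
      - (t ^+ 3 * (cv t N ps u x * cv t N ps u x))].
  apply: (carleman_inequality oU s11 s12 s22 sp su (ltW L0) BU e00 al0 _ _ C00).
  - by move=> x /Hb[_ /ltW].
  - move=> x v1 v2 /Hb[_ _ dd tt aa].
    have det' : 0 < a11 x * a22 x - a12 x ^+ 2.
      by rewrite expr2; apply: lt_trans dd; rewrite divr_gt0.
    have aa2 := pos_form_trace aa det'.
    have tr1 : 0 < a11 x + a22 x by rewrite addr_gt0.
    rewrite -(ler_pM2l tr1) (ell_form _ _ _ _ _).2.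
    have s0 : 0 <= v1 * v1 + v2 * v2 by rewrite addr_ge0// -expr2 sqr_ge0.
    apply: (@le_trans _ _ (det x * (v1 * v1 + v2 * v2))); last first.
      by rewrite /det -expr2 lerDr addr_ge0 ?sqr_ge0.
    rewrite mulrA ler_wpM2r// (le_trans _ (ltW dd))//.
    apply: (@le_trans _ _ (2 * tr0 * al)).
      by rewrite ler_wpM2r ?ltW//; move: tt; rewrite ltrN2.
    by rewrite /al mulrC divfK// gt_eqF// mulr_gt0.
  - by move=> x bx; apply: hP; exact: BU.
have [K K1 HK] := field_bound N oU s11 s12 s22 sp su (ltW L0) BU.
(* The first bound gives [ps <= - d] outside the half box; the second keeps [1 + N ps] between
   [1 / 2] and [1], where [phi] increases with [ps]. *)
pose d := Num.min (L ^+ 2 / 4) (1 / (2 * N)).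
have N0 : 0 < N by apply: lt_le_trans N1.
have d0 : 0 < d by rewrite lt_min !divr_gt0// ?exprn_gt0// mulr_gt0.
have dL : d <= L ^+ 2 / 4 by rewrite ge_min lexx.
have dN : N * d <= 1 / 2.
  rewrite -ler_pdivlMl//; have -> : N^-1 * (1 / 2) = 1 / (2 * N) by field; rewrite gt_eqF.
  by rewrite ge_min lexx orbT.
move: d d0 dL dN => d d0 dL dN.
have sq0 v : 0 <= sq v by rewrite addr_ge0// -expr2 sqr_ge0.
have psle v : 0 <= f v -> ps v <= 0.
  by move=> fv; have := sq0 v; rewrite /ps; move: fv; clear; lra.
have wFb v : 0 <= f v -> - d <= ps v -> 2^-1 <= wF N ps v <= 1.
  move=> fv dv; rewrite /wF; have h : N * ps v <= 0 by rewrite mulr_ge0_le0 ?psle// ltW.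
  have h2 : - (N * d) <= N * ps v by rewrite -mulrN ler_wpM2l// ltW.
  by move: h h2 dN; clear => *; apply/andP; split; lra.
pose phi s := s + N / 2 * (s * s).
have phi_mono s1 s2 : - d <= s1 -> s1 <= s2 -> s2 <= 0 -> phi s1 <= phi s2.
  move=> h1 h2 h3; rewrite -subr_ge0.
  have -> : phi s2 - phi s1 = (s2 - s1) * (1 + N / 2 * (s1 + s2)) by rewrite /phi; ring.
  apply: mulr_ge0; first by rewrite subr_ge0.
  have : N * (- d - d) <= N * (s1 + s2).
    rewrite ler_wpM2l ?(ltW N0)//; move: h1 h2; clear; lra.
  by move: dN; clear; lra.
have wEphi t v : wE t N ps v = expR (t * phi (ps v)) by [].
have np : \forall v \near x0, - d / 4 < ps v.
  by apply: (smooth_near_gt sp Ux0); rewrite ps0 mulNr oppr_lt0 divr_gt0.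
have /near_square[r r10 Hr] := np.
exists (Num.min r L); first by rewrite lt_min r10 L0.
move=> x1 x10 x11 fx1; apply/eqP; apply: contrapT => /negP ux1.
move: x10 x11; rewrite !lt_min => /andP[x10 x10'] /andP[x11 x11'].
have Ux1 : U x1 by apply: BU; split; exact: ltW.
have fx1' : 0 < f x1.
  rewrite lt_neqAle fx1 andbT; apply/eqP => /esym /(fz _ Ux1)[u0 _ _].
  by rewrite u0 eqxx in ux1.
pose q := u x1 ^+ 2 / 2; have q0 : 0 < q by rewrite divr_gt0// exprn_even_gt0.
have suu : smooth_on U (fun v => u v * u v) by smooth.
have nb : \forall v \near x1, `|(v : 'rV[R]_2) 0 0 - x0 0 0| < L /\ `|v 0 1 - x0 0 1| < L.
  apply/near_square; exists (Num.min (L - `|x1 0 0 - x0 0 0|) (L - `|x1 0 1 - x0 0 1|)).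
    by rewrite lt_min !subr_gt0 x10'.
  move=> v; rewrite !lt_min => /andP[v0 _] /andP[_ v1]; split.
    by rewrite -(subrKA (x1 0 0)) (le_lt_trans (ler_normD _ _))// -ltrBrDr.
  by rewrite -(subrKA (x1 0 1)) (le_lt_trans (ler_normD _ _))// -ltrBrDr.
have m1 : \forall v \near x1, 0 < f v by exact: smooth_near_gt sf Ux1 fx1'.
have m2 : \forall v \near x1, - d / 4 < ps v by apply: smooth_near_gt sp Ux1 (Hr _ x10 x11).
have m3 : \forall v \near x1, q < u v * u v.
  apply: (smooth_near_gt suu Ux1); rewrite /q -expr2 ltr_pdivrMr// ltr_pMr ?ltr1n//.
  by rewrite exprn_even_gt0.
have /near_square[l' l'0 Hl] : \forall v \near x1, [/\
    `|(v : 'rV[R]_2) 0 0 - x0 0 0| < L /\ `|v 0 1 - x0 0 1| < L, 0 < f v, - d / 4 < ps v & q < u v * u v].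
  by near=> v; split; near: v.
pose l := l' / 2; have l0 : 0 < l by rewrite divr_gt0.
have ll : l < l' by rewrite /l ltr_pdivrMr// ltr_pMr// ltr1n.
pose n := (Num.truncn (2 * L / l)).+1.
have nL : 2 * L < n%:R * l.
  by rewrite -ltr_pdivrMr// /n truncnS_gt// divr_ge0 ?mulr_ge0// ltW.
pose phi1 := phi (- d / 2); pose phi2 := phi (- d / 4).
have gap : d / 8 <= phi2 - phi1.
  have -> : phi2 - phi1 = d / 4 - (N * d) * d * (3 / 32) by rewrite /phi1 /phi2 /phi; field.
  have : (N * d) * d <= 1 / 2 * d by rewrite ler_wpM2r// ltW.
  by move: d0; clear; lra.
pose C := 4 * n%:R ^+ 2 * (8 / d * K).
have C0' : 0 <= C.
  apply: mulr_ge0; first by rewrite mulr_ge0// sqr_ge0.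
  by apply: mulr_ge0; [rewrite divr_ge0// ltW|apply: le_trans K1].
have [t tt tC] : exists2 t, t0 <= t & C < expR (t * (d / 4)) * q.
  by apply: exp_dominated => //; [rewrite divr_gt0|apply: le_trans t01].
have t1 : 1 <= t by apply: le_trans tt.
have tp : 0 < t by apply: lt_le_trans t1.
have t3 : 0 < t ^+ 3 by rewrite exprn_gt0.
have K0 : 0 < K by apply: lt_le_trans K1.
pose E1 := expR (t * phi1); pose E2 := expR (t * phi2).
have E10 : 0 < E1 := expR_gt0 _. have E20 : 0 < E2 := expR_gt0 _.
have := @carleman_mass R U a11 a12 a22 f ps u x0 x1 L N d t l
  (t ^+ 3 * E2 ^+ 2 * q) K (8 / d * K * (t ^+ 3 * E1 ^+ 2)) n oU s11 s12 s22 sf sp su L0 d0 l0.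
have M0 : 0 < 8 / d * K * (t ^+ 3 * E1 ^+ 2).
  by rewrite mulr_gt0// mulr_gt0// ?divr_gt0// exprn_gt0.
move=> /(_ M0 isT BU).
have dd8 : d / 8 * (8 / d * K * (t ^+ 3 * E1 ^+ 2)) = K * (t ^+ 3 * E1 ^+ 2).
  by field; rewrite gt_eqF.
have bx1 : box x0 L x1 by split; exact: ltW.
move=> /(_ bx1 nL fz); rewrite dd8.
have out v : box x0 L v -> ~ box x0 (L / 2) v -> 0 <= f v -> ps v <= - d.
  move=> bv nbv fv; suff : L ^+ 2 / 4 <= sq v.
    by rewrite /ps; move: dL fv; clear; lra.
  have L2 : L ^+ 2 / 4 = (L / 2) ^+ 2 by field.
  have L20 : 0 <= L / 2 by rewrite divr_ge0// ltW.
  have key (z : R) : L / 2 < `|z| -> L ^+ 2 / 4 <= z * z.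
    move=> h; rewrite L2 -expr2 -(real_normK (num_real z)).
    by rewrite lerXn2r ?nnegrE// ltW.
  have [h|h] := leP `|v 0 0 - x0 0 0| (L / 2); last first.
    by rewrite /sq (le_trans (key _ h))// lerDl -expr2 sqr_ge0.
  have [h'|h'] := leP `|v 0 1 - x0 0 1| (L / 2); first by case: nbv.
  by rewrite /sq (le_trans (key _ h'))// lerDr -expr2 sqr_ge0.
have neg v : box x0 L v -> 0 <= f v -> - d <= ps v ->
    dx (field1 t N a11 a12 a22 ps u) v + dy (field2 t N a11 a12 a22 ps u) v <=
    - (t ^+ 3 * (cv t N ps u v * cv t N ps u v)).
  by move=> bv fv pv; apply: carl => //; exact: wFb.
have neg0 v : box x0 L v -> 0 <= f v -> - d <= ps v ->
    dx (field1 t N a11 a12 a22 ps u) v + dy (field2 t N a11 a12 a22 ps u) v <= 0.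
  move=> bv fv pv; apply: le_trans (neg v bv fv pv) _.
  by rewrite oppr_le0 mulr_ge0 ?(ltW t3)// -expr2 sqr_ge0.
have mid v : box x0 L v -> 0 <= f v -> - d <= ps v -> ps v <= - d / 2 ->
    `|dx ps v * field1 t N a11 a12 a22 ps u v + dy ps v * field2 t N a11 a12 a22 ps u v|
      <= K * (t ^+ 3 * E1 ^+ 2).
  move=> bv fv pv pv2; apply: le_trans (HK t v t1 bv) _.
  rewrite ler_wpM2l ?(ltW K0)// ler_wpM2l ?(ltW t3)// lerXn2r ?nnegrE ?(ltW E10) ?expR_ge0//.
  rewrite wEphi ler_expR ler_wpM2l ?(ltW tp)//; apply: phi_mono => //.
  by rewrite mulNr oppr_le0 divr_ge0// ltW.
have small (v : 'rV[R]_2) : `|v 0 0 - x1 0 0| <= l -> `|v 0 1 - x1 0 1| <= l ->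
    [/\ box x0 L v, 0 <= f v, - d / 2 <= ps v &
    dx (field1 t N a11 a12 a22 ps u) v + dy (field2 t N a11 a12 a22 ps u) v <=
      - (t ^+ 3 * E2 ^+ 2 * q)].
  move=> v0 v1; have [[b0 b1] fv pv qv] := Hl v (le_lt_trans v0 ll) (le_lt_trans v1 ll).
  have bv : box x0 L v by split; exact: ltW.
  have pv1 : - d <= ps v by move: pv d0; clear; lra.
  split=> //; [exact: ltW|by move: pv d0; clear; lra|].
  apply: le_trans (neg v bv (ltW fv) pv1) _; rewrite lerN2 -mulrA ler_wpM2l ?(ltW t3)//.
  have -> : cv t N ps u v * cv t N ps u v = wE t N ps v ^+ 2 * (u v * u v) by rewrite /cv; ring.
  apply: ler_pM; [exact: sqr_ge0|exact: ltW| |exact: ltW].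
  rewrite lerXn2r ?nnegrE ?(ltW E20) ?expR_ge0// wEphi ler_expR ler_wpM2l ?(ltW tp)//.
  by apply: phi_mono; [move: d0; clear; lra|exact: ltW|apply: psle; exact: ltW].
move=> /(_ out neg0 mid small).
have E21 : E2 ^+ 2 = E1 ^+ 2 * expR (t * (phi2 - phi1)) ^+ 2.
  by rewrite -exprMn /E1 /E2 -expRD; congr (expR _ ^+ 2); ring.
have E3 : expR (t * (d / 4)) <= expR (t * (phi2 - phi1)) ^+ 2.
  rewrite expr2 -expRD ler_expR -mulrDr ler_wpM2l ?(ltW tp)//.
  by move: gap; clear; lra.
have T0 : 0 < t ^+ 3 * E1 ^+ 2 by rewrite mulr_gt0// exprn_gt0.
rewrite E21 (_ : t ^+ 3 * _ * q = t ^+ 3 * E1 ^+ 2 * (expR (t * (phi2 - phi1)) ^+ 2 * q)); last by ring.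
rewrite (_ : 4 * _ * _ = t ^+ 3 * E1 ^+ 2 * C); last by rewrite /C; ring.
rewrite ler_pM2l// leNgt; case/negP; apply: (lt_le_trans tC).
by rewrite ler_wpM2r// ltW.
Unshelve. all: by end_near. Qed.

End OneSided.

(** * Level sets *)

Section LevelSets.
Variable R : realType.
Implicit Types (u v w : 'rV[R]_2) (U : set 'rV[R]_2) (f g h : 'rV[R]_2 -> R).

Definition square u (r : R) : set 'rV[R]_2 :=
  [set v | `|v 0 0 - u 0 0| < r /\ `|v 0 1 - u 0 1| < r].

Lemma open_square u r : open (square u r).
Proof.
rewrite openE => v [v0 v1]; apply/near_square.
exists (Num.min (r - `|v 0 0 - u 0 0|) (r - `|v 0 1 - u 0 1|)).
  by rewrite lt_min !subr_gt0 v0.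
move=> w; rewrite !lt_min => /andP[w0 _] /andP[_ w1]; split.
  by rewrite -(subrKA (v 0 0)) (le_lt_trans (ler_normD _ _))// -ltrBrDr.
by rewrite -(subrKA (v 0 1)) (le_lt_trans (ler_normD _ _))// -ltrBrDr.
Qed.

Lemma is_derive_continuous (h : R -> R) (x l : R) : is_derive x 1 h l -> {for x, continuous h}.
Proof. by move=> [d _]; apply: differentiable_continuous; exact/derivable1_diffP. Qed.

Lemma strict_diff U g u (e : R) : open U -> U u -> smooth_on U g -> 0 < e ->
  exists2 r : R, 0 < r & forall v w, square u r v -> square u r w ->
    `|g w - g v - ((w 0 0 - v 0 0) * dx g u + (w 0 1 - v 0 1) * dy g u)| <=
      e * (`|w 0 0 - v 0 0| + `|w 0 1 - v 0 1|).
Proof.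
move=> oU Uu sg e0.
have [r1 r10 H1] := continuous_near_lt (smooth_on_continuous (smooth_dx sg) Uu) e0.
have [r2 r20 H2] := continuous_near_lt (smooth_on_continuous (smooth_dy sg) Uu) e0.
have /near_square[r3 r30 H3] : \forall v \near u, U v by exact: open_nbhs_nbhs.
exists (Num.min r1 (Num.min r2 r3)); first by rewrite !lt_min r10 r20.
move=> v w [v0 v1] [w0 w1].
have sq (t : R) : 0 <= t <= 1 ->
    let z := pt (v 0 0 + t * (w 0 0 - v 0 0)) (v 0 1 + t * (w 0 1 - v 0 1)) in
    [/\ U z, `|dx g z - dx g u| < e & `|dy g z - dy g u| < e].
  move=> t01 z; have z0 := seg_near2 t01 v0 w0; have z1 := seg_near2 t01 v1 w1.
  move: z0 z1; rewrite !lt_min => /and3P[a1 a2 a3] /and3P[b1 b2 b3].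
  by split; [apply: H3|apply: H1|apply: H2]; rewrite /z ?pt0 ?pt1.
have [t t01 ->] := @plane_MVT R g v w (fun t t01 => let: And3 Uz _ _ := sq t t01 in
  smooth_on_differentiable sg Uz).
have [_ h1 h2] := sq t t01; move: (pt _ _) h1 h2 => z h1 h2.
rewrite (_ : _ - _ = (w 0 0 - v 0 0) * (dx g z - dx g u) +
  (w 0 1 - v 0 1) * (dy g z - dy g u)); last by ring.
apply: le_trans (ler_normD _ _) _; rewrite !normrM mulrDr.
by apply: lerD; rewrite mulrC ler_wpM2r// ltW.
Qed.

Lemma level_const U f h u : open U -> U u -> smooth_on U f -> smooth_on U h ->
  (dx f u != 0) || (dy f u != 0) ->
  (forall v, U v -> f v = f u -> - dy f v * dx h v + dx f v * dy h v = 0) ->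
  \forall v \near u, f v = f u -> h v = h u.
Proof.
move=> oU Uu sf sh g0 H.
have [X [Y [l [d [r [d0 r0 c0 cs cov]]]]]] := level_curve oU Uu sf g0.
apply/near_square; exists r => // v v0 v1 fv.
have [s [sd _] ->] := cov v v0 v1 fv.
have D (t : R) : 0 <= t <= 1 ->
    is_derive (0 + t * (s - 0)) 1 (fun s => h (pt (X s) (Y s))) 0.
  move=> /andP[t0 t1]; rewrite add0r subr0.
  have /cs[Uc fc _ dX dY] : `|t * s| < d.
    by apply: le_lt_trans sd; rewrite normrM ger0_norm// ler_piMl.
  have := has_grad_curve dX dY (smooth_has_grad sh Uc).
  congr is_derive; have := H _ Uc fc; move=> E.
  by rewrite -(mulr0 (l (t * s))) -E; ring.
have [_ _] := @MVT_seg R _ (fun=> 0) 0 s D.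
by rewrite mul0r => /eqP; rewrite subr_eq0 c0 => /eqP.
Qed.

(** Lagrange's condition in tangential form: the restriction of [h] to the level curve has a
    critical point. Where [f] itself is critical the identity is trivial. *)
Lemma level_max U f h u : open U -> U u -> smooth_on U f -> smooth_on U h ->
  (\forall v \near u, f v = f u -> h v <= h u) ->
  - dy f u * dx h u + dx f u * dy h u = 0.
Proof.
move=> oU Uu sf sh hm.
have [g0|/norP[/negPn/eqP -> /negPn/eqP ->]] := boolP ((dx f u != 0) || (dy f u != 0));
  last by rewrite oppr0 !mul0r addr0.
have [X [Y [l [d [r [d0 r0 c0 cs cov]]]]]] := level_curve oU Uu sf g0.
have D (s : R) : `|s| < d -> is_derive s 1 (fun s => h (pt (X s) (Y s)))
    (l s * (- dy f (pt (X s) (Y s)) * dx h (pt (X s) (Y s)) +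
       dx f (pt (X s) (Y s)) * dy h (pt (X s) (Y s)))).
  move=> /cs[Uc fc _ dX dY].
  have := has_grad_curve dX dY (smooth_has_grad sh Uc).
  by congr is_derive; ring.
have D0 := D 0; rewrite normr0 c0 in D0.
have cX : {for 0, continuous X}.
  by have := cs 0; rewrite normr0 => /(_ d0)[_ _ _ h1 _]; exact: is_derive_continuous h1.
have cY : {for 0, continuous Y}.
  by have := cs 0; rewrite normr0 => /(_ d0)[_ _ _ _ h1]; exact: is_derive_continuous h1.
have [r1 r10 Hm] := (near_square _ _).1 hm.
have /near_real[d1 d10 H1] : \forall s \near (0 : R), `|X s - X 0| < r1 /\ `|Y s - Y 0| < r1.
  apply: filterI.
    by move/cvgrPdist_lt : cX => /(_ _ r10); apply: filterS => s; rewrite distrC.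
  by move/cvgrPdist_lt : cY => /(_ _ r10); apply: filterS => s; rewrite distrC.
have [uX uY] : u 0 0 = X 0 /\ u 0 1 = Y 0 by rewrite -c0 pt0 pt1.
pose dd := Num.min d d1; have dd0 : 0 < dd by rewrite lt_min d0 d10.
have Z : is_derive (0 : R) 1 (fun s => h (pt (X s) (Y s))) 0.
  apply: (@derive1_at_max R _ (- dd) dd).
  - by rewrite ge0_cp// ltW.
  - move=> t; rewrite in_itv/= -ltr_norml lt_min => /andP[td _].
    by have [] := D t td.
  - by rewrite in_itv/= oppr_lt0 dd0.
  - move=> t; rewrite in_itv/= -ltr_norml lt_min => /andP[td td1].
    have := H1 t; rewrite subr0 => /(_ td1)[x1 y1].
    rewrite c0; apply: Hm; rewrite ?pt0 ?pt1 ?uX ?uY//.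
    by have [_ ->] := cs t td.
have := cs 0; rewrite normr0 => /(_ d0)[_ _ [l0 _] _ _].
have [_ z0] := Z; have [_] := D0 d0; rewrite z0 => /esym/eqP.
by rewrite mulf_eq0 gt_eqF//= => /eqP.
Qed.

Lemma continuous_zero g v : {for v, continuous g} ->
  (forall r : R, 0 < r -> exists2 w, square v r w & g w = 0) -> g v = 0.
Proof.
move=> cg H; apply/eqP; rewrite -normr_le0; apply/ler_addgt0Pl => e e0; rewrite addr0.
have [r r0 Hr] := continuous_near_lt cg e0; have [w [w0 w1] gw] := H r r0.
by have := Hr w w0 w1; rewrite gw sub0r normrN => /ltW.
Qed.

Lemma near_zero_grad g v : (\forall w \near v, g w = 0) -> [/\ g v = 0, dx g v = 0 & dy g v = 0].
Proof.
move=> H; have [_ h1 h2] : has_grad g v 0 0.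
  by apply: has_grad_near (has_grad_cst 0 v); apply: filterS H => w ->.
by split => //; exact: nbhs_singleton H.
Qed.

(** The one-sided statement is applied to [f] and to [- f]. *)
Lemma unique_continuation_across U (a11 a12 a22 f g : 'rV[R]_2 -> R) u (C : R) :
  open U -> U u -> smooth_on U a11 -> smooth_on U a12 -> smooth_on U a22 ->
  smooth_on U f -> smooth_on U g ->
  0 < a11 u -> 0 < a11 u * a22 u - a12 u ^+ 2 -> 0 <= C ->
  (forall v, U v -> `|elliptic_part a11 a12 a22 g v| <=
     C * (`|g v| + `|dx g v| + `|dy g v|)) ->
  f u = 0 -> (dx f u != 0) || (dy f u != 0) ->
  (forall v, U v -> f v = 0 -> [/\ g v = 0, dx g v = 0 & dy g v = 0]) ->
  \forall v \near u, g v = 0.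
Proof.
move=> oU Uu s1 s2 s3 sf sg a0 d0 C0 HC fu gf fz.
have [r1 r10 H1] := unique_continuation_side oU Uu s1 s2 s3 sf sg a0 d0 C0 HC fu gf fz.
have snf : smooth_on U (fun v => - f v) by exact: smooth_onN.
have [_ e1 e2] := has_gradN (smooth_has_grad sf Uu).
have [] := unique_continuation_side oU Uu s1 s2 s3 snf sg a0 d0 C0 HC.
- by rewrite fu oppr0.
- by rewrite e1 e2 !oppr_eq0.
- by move=> v Uv /eqP; rewrite oppr_eq0 => /eqP; exact: fz.
move=> r2 r20 H2; apply/near_square; exists (Num.min r1 r2); first by rewrite lt_min r10.
move=> v; rewrite !lt_min => /andP[v0 v0'] /andP[v1 v1'].
have [fv|fv] := leP 0 (f v); first exact: H1.
by apply: H2 => //; rewrite oppr_ge0 ltW.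
Qed.

(** Let [x0] be the point of the box nearest to [q] that is not interior to the zero set. Near [x0],
    [g] vanishes inside the circle around [q] through [x0], hence to first order on the circle, and
    continuation across it makes [x0] interior after all. *)
Lemma unique_continuation_closure U (a11 a12 a22 g : 'rV[R]_2 -> R) p :
  open U -> U p -> smooth_on U a11 -> smooth_on U a12 -> smooth_on U a22 ->
  smooth_on U g ->
  (forall v, U v -> 0 < a11 v /\ 0 < a11 v * a22 v - a12 v ^+ 2) ->
  (forall v, U v -> exists C r : R, [/\ 0 <= C, 0 < r & forall w, square v r w -> U w ->
     `|elliptic_part a11 a12 a22 g w| <= C * (`|g w| + `|dx g w| + `|dy g w|)]) ->
  (forall r : R, 0 < r -> exists2 q, square p r q & \forall v \near q, g v = 0) ->
  \forall v \near p, g v = 0.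
Proof.
move=> oU Up s1 s2 s3 sg ell HC acc; apply: contrapT => np.
have /near_square[L' L'0 HL] : \forall v \near p, U v by exact: open_nbhs_nbhs.
pose L := L' / 2; have L0 : 0 < L by rewrite divr_gt0.
have LL : L < L' by rewrite /L ltr_pdivrMr// ltr_pMr// ltr1n.
have BU : box p L `<=` U.
  by move=> v [v0 v1]; apply: HL; [exact: le_lt_trans LL|exact: le_lt_trans LL].
(* As [q] is within [L / 8] of [p] in each coordinate, the nearest bad point is within [L / 4] of
   [q] and stays away from the edge of the box. *)
have [q [q0 q1] gq] := acc (L / 8) ltac:(by rewrite divr_gt0).
pose f' v := (v 0 0 - q 0 0) * (v 0 0 - q 0 0) + (v 0 1 - q 0 1) * (v 0 1 - q 0 1).
have sf' V : open V -> smooth_on V f' by move=> oV; exact: smooth_square.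
have cf' : continuous f'.
  by move=> v; exact: smooth_on_continuous (sf' setT openT) I.
pose Z := box p L `&` ~` interior [set v | g v = 0].
have cZ : compact Z.
  by apply: compact_closedI; [exact: compact_box|apply: open_closedC; exact: open_interior].
have Zp : Z p by split => //; split; rewrite subrr normr0 ltW.
have [x0 /set_mem[[x00 x01] nx0] xmin] : exists2 c, c \in Z & forall t, t \in Z -> f' c <= f' t.
  apply: compact_EVT_min => //; first by exists p.
  by apply: continuous_subspaceT.
have fx0p : f' x0 <= f' p by apply: xmin; exact: mem_set.
have fp : f' p < (L / 4) ^+ 2.
  have sq (z : R) : `|z| < L / 8 -> z * z < (L / 8) ^+ 2.
    move=> h; rewrite -expr2 -(real_normK (num_real z)).
    by rewrite ltr_pXn2r// nnegrE// ltW// divr_gt0.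
  have h1 := sq _ q0; have h2 := sq _ q1.
  have : (L / 4) ^+ 2 = (L / 8) ^+ 2 * 4 by field.
  have : 0 < (L / 8) ^+ 2 by rewrite exprn_gt0// divr_gt0.
  move: h1 h2; rewrite /f' -[p 0 0 - _]opprB -[p 0 1 - _]opprB !mulrNN.
  by clear; lra.
have near_p (z a b : R) : z * z <= f' x0 -> z = a - b -> forall c, `|b - c| < L / 8 -> `|a - c| < L / 2.
  move=> h za c bc; have : `|z| < L / 4.
    rewrite -(@ltr_pXn2r _ 2) ?nnegrE//; last by rewrite divr_ge0// ltW.
    by rewrite real_normK ?num_real// expr2 (le_lt_trans h)// (le_lt_trans fx0p).
  rewrite za -(subrKA b a (- c)) => h'; apply: le_lt_trans (ler_normD _ _) _.
  by move: h' bc L0; clear; lra.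
have xq0 : `|x0 0 0 - p 0 0| < L / 2.
  by apply: (near_p _ _ _ _ erefl) q0; rewrite /f' lerDl -expr2 sqr_ge0.
have xq1 : `|x0 0 1 - p 0 1| < L / 2.
  by apply: (near_p _ _ _ _ erefl) q1; rewrite /f' lerDr -expr2 sqr_ge0.
have Ux0 : U x0 by exact: BU.
have fpos : 0 < f' x0.
  rewrite lt_neqAle addr_ge0 -?expr2 ?sqr_ge0// andbT; apply/negP => /eqP/esym/eqP.
  rewrite paddr_eq0 ?sqr_ge0// !sqrf_eq0 !subr_eq0 => /andP[/eqP e0 /eqP e1].
  by apply: nx0; rewrite (rV2P e0 e1).
have [C [r [C0 r0 Hr]]] := HC x0 Ux0.
pose k := Num.min (L / 2) r; have k0 : 0 < k by rewrite lt_min r0 divr_gt0.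
pose V := square x0 k.
have VB v : V v -> box p L v.
  move=> []; rewrite !lt_min => /andP[v0 _] /andP[v1 _].
  have h (a b c : R) : `|a - b| < L / 2 -> `|b - c| < L / 2 -> `|a - c| <= L.
    move=> ab bc; rewrite -(subrKA b a (- c)); apply: le_trans (ler_normD _ _) _.
    by move: ab bc; clear; lra.
  by split; [apply: h xq0|apply: h xq1].
have oV : open V by exact: open_square.
have VU : V `<=` U by move=> v /VB/BU.
pose f v := f' v - f' x0.
have sf : smooth_on V f.
  by apply: smooth_onB => //; [exact: sf'|exact: smooth_on_cst].
have Vx0 : V x0 by split; rewrite subrr normr0.
have inside v : V v -> f v < 0 -> \forall w \near v, g w = 0.
  move=> Vv; rewrite subr_lt0 => fv; apply: contrapT => nv.
  have /xmin : v \in Z by apply/mem_set; split; [exact: VB|].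
  by rewrite leNgt fv.
have gf : has_grad f x0 (2 * (x0 0 0 - q 0 0)) (2 * (x0 0 1 - q 0 1)).
  have gx := has_gradB (has_grad_x x0) (has_grad_cst (q 0 0) x0).
  have gy := has_gradB (has_grad_y x0) (has_grad_cst (q 0 1) x0).
  apply: has_grad_eq (has_gradB (has_gradD (has_gradM gx gx) (has_gradM gy gy))
    (has_grad_cst (f' x0) x0)) _ _; by rewrite /=; ring.
apply: nx0; rewrite /interior /=.
have [l1 l2] := ell x0 Ux0.
have ss (h : 'rV[R]_2 -> R) : smooth_on U h -> smooth_on V h by exact: smooth_on_sub.
apply: (@unique_continuation_across V a11 a12 a22 f g x0 C) => //; try exact: ss.
- move=> v Vv; apply: Hr; last exact: VU.
  by case: Vv; rewrite !lt_min => /andP[_ ?] /andP[_ ?].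
- by rewrite /f subrr.
- have [_ -> ->] := gf; rewrite !mulf_eq0 !pnatr_eq0/=; apply/norP => -[].
  move=> /negPn/eqP e0 /negPn/eqP e1.
  by move: fpos; rewrite /f' e0 e1 !mul0r addr0 ltxx.
move=> v Vv /eqP; rewrite subr_eq0 => /eqP fv.
have lim (h : 'rV[R]_2 -> R) : smooth_on U h ->
    (forall w, V w -> f w < 0 -> h w = 0) -> h v = 0.
  move=> sh Hh; apply: continuous_zero (smooth_on_continuous sh (VU _ Vv)) _ => d d0.
  have /near_square[d1 d10 Hd] : \forall w \near v, V w by exact: open_nbhs_nbhs.
  pose M := `|q 0 0 - v 0 0| + `|q 0 1 - v 0 1| + 1.
  have M0 : 0 < M by rewrite ltr_wpDl// addr_ge0.
  pose s := Num.min 1 (Num.min d d1 / M).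
  have s0 : 0 < s by rewrite lt_min ltr01 divr_gt0// lt_min d0.
  have s1' : s <= 1 by rewrite ge_min lexx.
  have sM : s * M <= Num.min d d1 by rewrite -ler_pdivlMr// ge_min lexx orbT.
  have step (z : R) : `|z| < M -> `|s * z| < Num.min d d1.
    move=> zM; apply: lt_le_trans sM; rewrite normrM gtr0_norm//.
    by rewrite ltr_pM2l.
  (* Moving from a point of the circle towards its centre [q] enters the open disk, where [g]
     vanishes identically. *)
  pose w := pt (v 0 0 + s * (q 0 0 - v 0 0)) (v 0 1 + s * (q 0 1 - v 0 1)).
  have w0 : `|w 0 0 - v 0 0| < Num.min d d1.
    by rewrite pt0 addrC addKr; apply: step; rewrite /M -addrA ltrDl ltr_wpDl.
  have w1 : `|w 0 1 - v 0 1| < Num.min d d1.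
    by rewrite pt1 addrC addKr; apply: step; move: (normr_ge0 (q 0 0 - v 0 0)); rewrite /M; clear; lra.
  move: w0 w1; rewrite !lt_min => /andP[w0 w0'] /andP[w1 w1'].
  exists w => //; apply: Hh; first exact: Hd.
  have -> : f w = (1 - s) ^+ 2 * f' v - f' x0 by rewrite /f /f' /w !pt0 !pt1; ring.
  rewrite fv -{2}[f' x0]mul1r -mulrBl pmulr_llt0// subr_lt0.
  by rewrite expr_lt1 ?subr_ge0// ltrBlDr ltrDl.
split; apply: lim => //; try (by [exact: smooth_dx|exact: smooth_dy]).
- by move=> w Vw fw; have [] := near_zero_grad (inside w Vw fw).
- by move=> w Vw fw; have [] := near_zero_grad (inside w Vw fw).
- by move=> w Vw fw; have [] := near_zero_grad (inside w Vw fw).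
Qed.

End LevelSets.

(** * Lagrangian self-shrinkers in a chart *)

Section Patches.
Variable R : realType.
Implicit Types (u v w : 'rV[R]_2) (U : set 'rV[R]_2) (f g h : 'rV[R]_2 -> R).

Definition wedge f g u : R := dx f u * dy g u - dy f u * dx g u.

Definition sum4 (f1 f2 f3 f4 : 'rV[R]_2 -> R) u : R := f1 u + f2 u + f3 u + f4 u.

Definition ptmul f g u : R := f u * g u.

Definition metric_xx (f1 f2 f3 f4 : 'rV[R]_2 -> R) :=
  sum4 (ptmul (dx f1) (dx f1)) (ptmul (dx f2) (dx f2))
       (ptmul (dx f3) (dx f3)) (ptmul (dx f4) (dx f4)).
Definition metric_xy (f1 f2 f3 f4 : 'rV[R]_2 -> R) :=
  sum4 (ptmul (dx f1) (dy f1)) (ptmul (dx f2) (dy f2))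
       (ptmul (dx f3) (dy f3)) (ptmul (dx f4) (dy f4)).
Definition metric_yy (f1 f2 f3 f4 : 'rV[R]_2 -> R) :=
  sum4 (ptmul (dy f1) (dy f1)) (ptmul (dy f2) (dy f2))
       (ptmul (dy f3) (dy f3)) (ptmul (dy f4) (dy f4)).

(* det g times the operator g^{jk} d_j d_k. *)
Definition trace_op (f1 f2 f3 f4 : 'rV[R]_2 -> R) (h : 'rV[R]_2 -> R) :=
  elliptic_part (metric_yy f1 f2 f3 f4) (fun u => - metric_xy f1 f2 f3 f4 u)
    (metric_xx f1 f2 f3 f4) h.

Definition det_metric (f1 f2 f3 f4 : 'rV[R]_2 -> R) u : R :=
  metric_xx f1 f2 f3 f4 u * metric_yy f1 f2 f3 f4 u - metric_xy f1 f2 f3 f4 u ^+ 2.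

(* The four functions are the coordinates of a Lagrangian self-shrinker in an
   orthonormal frame (E, iE, E', iE'); the last field is the self-shrinker
   equation multiplied by the determinant of the metric. *)
Record lag_patch U (f1 f2 f3 f4 : 'rV[R]_2 -> R) : Prop := LagPatch {
  patch_open : open U;
  patch_smooth : [/\ smooth_on U f1, smooth_on U f2, smooth_on U f3 & smooth_on U f4];
  patch_lag : forall u, U u -> wedge f1 f2 u + wedge f3 f4 u = 0;
  patch_imm : forall u (s t : R), U u ->
    s * dx f1 u + t * dy f1 u = 0 -> s * dx f2 u + t * dy f2 u = 0 ->
    s * dx f3 u + t * dy f3 u = 0 -> s * dx f4 u + t * dy f4 u = 0 -> s = 0 /\ t = 0;
  patch_shrinker : forall u, U u -> exists c1 c2 : R,
    let eqn f := trace_op f1 f2 f3 f4 f u + det_metric f1 f2 f3 f4 u * f u =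
      c1 * dx f u + c2 * dy f u in [/\ eqn f1, eqn f2, eqn f3 & eqn f4] }.

(** Cauchy-Binet. *)
Lemma det_metricE f1 f2 f3 f4 u : det_metric f1 f2 f3 f4 u =
  wedge f1 f2 u ^+ 2 + wedge f1 f3 u ^+ 2 + wedge f1 f4 u ^+ 2 +
  wedge f2 f3 u ^+ 2 + wedge f2 f4 u ^+ 2 + wedge f3 f4 u ^+ 2.
Proof.
by rewrite /det_metric /metric_xx /metric_yy /metric_xy /sum4 /ptmul /wedge; ring.
Qed.

Lemma lag_patchC U f1 f2 f3 f4 : lag_patch U f1 f2 f3 f4 -> lag_patch U f3 f4 f1 f2.
Proof.
move=> [oU [s1 s2 s3 s4] lag imm shr]; split => //.
- by move=> u Uu; rewrite addrC lag.
- by move=> u s t Uu h1 h2 h3 h4; exact: imm Uu h3 h4 h1 h2.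
have Exx : metric_xx f3 f4 f1 f2 = metric_xx f1 f2 f3 f4.
  by apply/funext => u; rewrite /metric_xx /sum4; ring.
have Exy : metric_xy f3 f4 f1 f2 = metric_xy f1 f2 f3 f4.
  by apply/funext => u; rewrite /metric_xy /sum4; ring.
have Eyy : metric_yy f3 f4 f1 f2 = metric_yy f1 f2 f3 f4.
  by apply/funext => u; rewrite /metric_yy /sum4; ring.
move=> u Uu; have [c1 [c2 [h1 h2 h3 h4]]] := shr u Uu; exists c1, c2.
by rewrite /trace_op /det_metric Exx Exy Eyy.
Qed.

Section PatchTheory.
Variables (U : set 'rV[R]_2) (f1 f2 f3 f4 : 'rV[R]_2 -> R).
Hypothesis P : lag_patch U f1 f2 f3 f4.

(** If all six minors vanish, then for each [i] the vector [(- dy fi, dx fi)] is annihilated by the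
    four differentials, so the immersion property kills every gradient. *)
Lemma patch_minor u : U u ->
  ~ [/\ wedge f1 f2 u = 0, wedge f1 f3 u = 0 & wedge f1 f4 u = 0] \/
  ~ [/\ wedge f2 f3 u = 0, wedge f2 f4 u = 0 & wedge f3 f4 u = 0].
Proof.
move=> Uu; apply: contrapT => /not_orP[/contrapT[w12 w13 w14] /contrapT[w23 w24 w34]].
move: w12 w13 w14 w23 w24 w34; rewrite /wedge => w12 w13 w14 w23 w24 w34.
have imm := patch_imm P Uu.
have z1 : dx f1 u = 0 /\ dy f1 u = 0.
  have [|||| e1 e2] := imm (- dy f1 u) (dx f1 u); try by move: w12 w13 w14 w23 w24 w34; clear; lra.
  by split=> //; apply/eqP; rewrite -oppr_eq0 e1.
have z2 : dx f2 u = 0 /\ dy f2 u = 0.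
  have [|||| e1 e2] := imm (- dy f2 u) (dx f2 u); try by move: w12 w13 w14 w23 w24 w34; clear; lra.
  by split=> //; apply/eqP; rewrite -oppr_eq0 e1.
have z3 : dx f3 u = 0 /\ dy f3 u = 0.
  have [|||| e1 e2] := imm (- dy f3 u) (dx f3 u); try by move: w12 w13 w14 w23 w24 w34; clear; lra.
  by split=> //; apply/eqP; rewrite -oppr_eq0 e1.
have z4 : dx f4 u = 0 /\ dy f4 u = 0.
  have [|||| e1 e2] := imm (- dy f4 u) (dx f4 u); try by move: w12 w13 w14 w23 w24 w34; clear; lra.
  by split=> //; apply/eqP; rewrite -oppr_eq0 e1.
have [/eqP] := imm 1 0 ltac:(by rewrite z1.1 z1.2; ring) ltac:(by rewrite z2.1 z2.2; ring)
  ltac:(by rewrite z3.1 z3.2; ring) ltac:(by rewrite z4.1 z4.2; ring).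
by rewrite oner_eq0.
Qed.

Lemma det_metric_gt0 u : U u -> 0 < det_metric f1 f2 f3 f4 u.
Proof.
move=> Uu; rewrite lt_neqAle det_metricE; apply/andP; split; last first.
  by rewrite !addr_ge0 ?sqr_ge0.
apply/eqP => /esym/eqP; rewrite !paddr_eq0 ?addr_ge0 ?sqr_ge0// !sqrf_eq0.
move=> /andP[/andP[/andP[/andP[/andP[/eqP w12 /eqP w13] /eqP w14] /eqP w23] /eqP w24] /eqP w34].
by have [] := patch_minor Uu; case.
Qed.

Lemma metric_yy_gt0 u : U u -> 0 < metric_yy f1 f2 f3 f4 u.
Proof.
move=> Uu; rewrite lt_neqAle /metric_yy /sum4 /ptmul -!expr2; apply/andP; split; last first.
  by rewrite !addr_ge0 ?sqr_ge0.
apply/eqP => /esym/eqP; rewrite !paddr_eq0 ?addr_ge0 ?sqr_ge0// !sqrf_eq0.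
move=> /andP[/andP[/andP[/eqP y1 /eqP y2] /eqP y3] /eqP y4].
have [_ /eqP] : (0 : R) = 0 /\ (1 : R) = 0.
  by apply: (patch_imm P Uu); rewrite ?y1 ?y2 ?y3 ?y4; ring.
by rewrite oner_eq0.
Qed.

Lemma pair_injective g h u : U u -> smooth_on U g -> smooth_on U h -> wedge g h u != 0 ->
  exists C r : R, [/\ 0 < C, 0 < r & forall v w, square u r v -> square u r w ->
    `|v 0 0 - w 0 0| + `|v 0 1 - w 0 1| <= C * (`|g v - g w| + `|h v - h w|)].
Proof.
move=> Uu sg sh gh; have [C [r [C0 r0 H]]] := local_injectivity (patch_open P) Uu sg sh gh.
by exists C, r; split => // v w [? ?] [? ?]; exact: H.
Qed.

Lemma patch_injective u : U u ->
  exists C r : R, [/\ 0 < C, 0 < r & forall v w, square u r v -> square u r w ->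
    `|v 0 0 - w 0 0| + `|v 0 1 - w 0 1| <=
      C * (`|f1 v - f1 w| + `|f2 v - f2 w| + `|f3 v - f3 w| + `|f4 v - f4 w|)].
Proof.
have [s1 s2 s3 s4] := patch_smooth P.
move=> Uu; have use g h : smooth_on U g -> smooth_on U h -> wedge g h u != 0 ->
  (forall v w, `|g v - g w| + `|h v - h w| <=
     `|f1 v - f1 w| + `|f2 v - f2 w| + `|f3 v - f3 w| + `|f4 v - f4 w|) ->
  exists C r : R, [/\ 0 < C, 0 < r & forall v w, square u r v -> square u r w ->
    `|v 0 0 - w 0 0| + `|v 0 1 - w 0 1| <=
      C * (`|f1 v - f1 w| + `|f2 v - f2 w| + `|f3 v - f3 w| + `|f4 v - f4 w|)].
  move=> sg sh gh le; have [C [r [C0 r0 H]]] := pair_injective Uu sg sh gh.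
  exists C, r; split => // v w uv uw; apply: le_trans (H v w uv uw) _.
  by rewrite ler_wpM2l// ltW.
have bd v w := (normr_ge0 (f1 v - f1 w), normr_ge0 (f2 v - f2 w),
  normr_ge0 (f3 v - f3 w), normr_ge0 (f4 v - f4 w)).
have [w12|/negPn/eqP w12] := boolP (wedge f1 f2 u != 0).
  by apply: (use f1 f2) => // v w; move: (bd v w) => [[[]]]; clear; lra.
have [w13|/negPn/eqP w13] := boolP (wedge f1 f3 u != 0).
  by apply: (use f1 f3) => // v w; move: (bd v w) => [[[]]]; clear; lra.
have [w14|/negPn/eqP w14] := boolP (wedge f1 f4 u != 0).
  by apply: (use f1 f4) => // v w; move: (bd v w) => [[[]]]; clear; lra.
have [w23|/negPn/eqP w23] := boolP (wedge f2 f3 u != 0).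
  by apply: (use f2 f3) => // v w; move: (bd v w) => [[[]]]; clear; lra.
have [w24|/negPn/eqP w24] := boolP (wedge f2 f4 u != 0).
  by apply: (use f2 f4) => // v w; move: (bd v w) => [[[]]]; clear; lra.
have [w34|/negPn/eqP w34] := boolP (wedge f3 f4 u != 0).
  by apply: (use f3 f4) => // v w; move: (bd v w) => [[[]]]; clear; lra.
by have [] := patch_minor Uu; case.
Qed.

(** Where [f1] is critical, some nonzero minor involves only the other three functions, which
    therefore separate nearby points. This makes mirror pairs collapse at such a point. *)
Lemma patch_injective_critical u : U u -> dx f1 u = 0 -> dy f1 u = 0 ->
  exists2 r : R, 0 < r & forall v w, square u r v -> square u r w ->
    f2 v = f2 w -> f3 v = f3 w -> f4 v = f4 w -> v = w.
Proof.
have [s1 s2 s3 s4] := patch_smooth P.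
move=> Uu d1 d2; have use g h : smooth_on U g -> smooth_on U h -> wedge g h u != 0 ->
  (forall v w, f2 v = f2 w -> f3 v = f3 w -> f4 v = f4 w -> g v = g w /\ h v = h w) ->
  exists2 r : R, 0 < r & forall v w, square u r v -> square u r w ->
    f2 v = f2 w -> f3 v = f3 w -> f4 v = f4 w -> v = w.
  move=> sg sh gh E; have [C [r [C0 r0 H]]] := pair_injective Uu sg sh gh.
  exists r => // v w uv uw e2 e3 e4; have [eg eh] := E v w e2 e3 e4.
  have := H v w uv uw; rewrite eg eh !subrr normr0 addr0 mulr0 => le0.
  have /eqP : `|v 0 0 - w 0 0| + `|v 0 1 - w 0 1| = 0.
    by apply/eqP; rewrite eq_le le0 addr_ge0.
  rewrite paddr_eq0// !normr_eq0 !subr_eq0 => /andP[/eqP e0 /eqP e1].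
  exact: rV2P.
have z g : wedge f1 g u = 0 by rewrite /wedge d1 d2 !mul0r subr0.
have [w23|/negPn/eqP w23] := boolP (wedge f2 f3 u != 0); first by apply: (use f2 f3).
have [w24|/negPn/eqP w24] := boolP (wedge f2 f4 u != 0); first by apply: (use f2 f4).
have [w34|/negPn/eqP w34] := boolP (wedge f3 f4 u != 0); first by apply: (use f3 f4).
by have [] := patch_minor Uu; case.
Qed.

End PatchTheory.

Lemma local_max_critical U h u : open U -> U u -> smooth_on U h ->
  (\forall v \near u, h v <= h u) -> dx h u = 0 /\ dy h u = 0.
Proof.
move=> oU Uu sh hm.
have [_ x1 x2] := has_grad_x u; have [_ y1 y2] := has_grad_y u.
have hm' f : \forall v \near u, f v = f u -> h v <= h u by apply: filterS hm.
have := level_max oU Uu (@smooth_x R U) sh (hm' _).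
have := level_max oU Uu (@smooth_y R U) sh (hm' _).
rewrite x1 x2 y1 y2 oppr0 !mul0r mul1r mulN1r add0r addr0 => /eqP.
by rewrite oppr_eq0 => /eqP.
Qed.

End Patches.

(** * The fixed mirror *)

Section ReflectionData.
Variables (R : realType) (T : topologicalType).
Implicit Types (U : set 'rV[R]_2) (inv : 'rV[R]_2 -> T).

(** [chart_near] says that [inv] carries the neighbourhoods of a point of [U] to those of its image;
    this is the only property of a chart, besides the equations in coordinates, that the argument
    uses. *)
Record lag_chart (X1 X2 X3 X4 : T -> R) U inv : Prop := LagChart {
  chart_near : forall v (P : T -> Prop), U v ->
    (\forall w \near v, P (inv w)) <-> (\forall y \near inv v, P y);
  chart_patch : lag_patch U (X1 \o inv) (X2 \o inv) (X3 \o inv) (X4 \o inv) }.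

Definition sep4 (X1 X2 X3 X4 : T -> R) x y (e : R) : Prop :=
  [/\ `|X1 y - X1 x| < e, `|X2 y - X2 x| < e, `|X3 y - X3 x| < e & `|X4 y - X4 x| < e].

(* The last field says that the four functions jointly embed the surface. *)
Record lag_data (X1 X2 X3 X4 : T -> R) : Prop := LagData {
  data_compact : compact [set: T];
  data_connected : connected [set: T];
  data_nonempty : [set: T] !=set0;
  data_chart : forall x, exists U inv p,
    [/\ lag_chart X1 X2 X3 X4 U inv, U p & inv p = x];
  data_embedding : forall x (A : set T), nbhs x A ->
    exists2 e : R, 0 < e & forall y, sep4 X1 X2 X3 X4 x y e -> A y }.

Definition reflective (X1 X2 X3 X4 : T -> R) (b : R) : Prop :=
  forall x, exists y, [/\ X1 y = 2 * b - X1 x, X2 y = X2 x, X3 y = X3 x & X4 y = X4 x].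

Lemma lag_dataC X1 X2 X3 X4 : lag_data X1 X2 X3 X4 -> lag_data X3 X4 X1 X2.
Proof.
move=> [cT kT nT ch emb]; split => //.
  move=> x; have [U [inv [p [[h1 h2] h3 h4]]]] := ch x; exists U, inv, p; split => //.
  by split => //; exact: lag_patchC.
move=> x A xA; have [e e0 H] := emb x A xA; exists e => // y [h1 h2 h3 h4].
by apply: H; split.
Qed.

Lemma clopen_all (B : set T) : connected [set: T] -> open B -> closed B -> B !=set0 ->
  forall x, B x.
Proof.
move=> kT oB cB B0 x; rewrite (kT B B0); first exact: I.
  by exists B => //; rewrite setTI.
by exists B => //; rewrite setTI.
Qed.

Lemma open_near_set (Q : T -> Prop) : open [set x | \forall y \near x, Q y].
Proof. exact: open_interior. Qed.

Section Theory.
Variables (X1 X2 X3 X4 : T -> R).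
Hypothesis D : lag_data X1 X2 X3 X4.

Lemma chart_continuous (X : T -> R) U inv p : lag_chart X1 X2 X3 X4 U inv -> U p ->
  smooth_on U (X \o inv) -> {for inv p, continuous X}.
Proof.
move=> L Up sX; apply: near_lt_continuous => e e0.
apply/(chart_near L (fun y => `|X y - X (inv p)| < e) Up).
have [r r0 H] := continuous_near_lt (smooth_on_continuous sX Up) e0.
by apply/near_square; exists r.
Qed.

Lemma chart_closure (B : set T) U inv p (r : R) : lag_chart X1 X2 X3 X4 U inv -> U p ->
  closure B (inv p) -> 0 < r -> exists2 q, square p r q & U q /\ B (inv q).
Proof.
move=> L Up cB r0.
have /cB[y [By [q [sq Uq] E]]] :
    nbhs (inv p) [set y | exists2 q, square p r q /\ U q & inv q = y].
  apply/(chart_near L (fun y => exists2 q, square p r q /\ U q & inv q = y) Up).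
  have nU : \forall w \near p, U w.
    exact: open_nbhs_nbhs (conj (patch_open (chart_patch L)) Up).
  have nq : \forall w \near p, square p r w by apply/near_square; exists r.
  by apply: filterS2 nU nq => w Uw sw; exists w.
by exists q => //; rewrite E.
Qed.

Lemma data_continuous :
  [/\ continuous X1, continuous X2, continuous X3 & continuous X4].
Proof.
split=> x; have [U [inv [p [L Up <-]]]] := data_chart D x;
  have [s1 s2 s3 s4] := patch_smooth (chart_patch L); exact: chart_continuous Up _.
Qed.

Lemma data_max (X : T -> R) (Z : set T) : closed Z -> Z !=set0 -> continuous X ->
  exists2 x, Z x & forall y, Z y -> X y <= X x.
Proof.
move=> cZ Z0 cX.
have kZ : compact Z by rewrite -(setTI Z); exact: compact_closedI (data_compact D) cZ.
have [x /set_mem Zx xm] := compact_EVT_max Z0 kZ (continuous_subspaceT cX).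
by exists x => // y Zy; apply: xm; exact: mem_set.
Qed.

Section Reflection.
Variable b : R.
Hypothesis refl : reflective X1 X2 X3 X4 b.

(** Otherwise [X1 < b] is a clopen condition, hence holds everywhere or nowhere, whereas the
    reflection reverses it. *)
Lemma mirror_nonempty : exists x, X1 x = b.
Proof.
apply: contrapT => none; have [x _] := data_nonempty D.
have ne y : X1 y != b by apply/eqP => E; apply: none; exists y.
have [c1 _ _ _] := data_continuous.
have oB : open [set y | X1 y < b] by apply: (@open_comp _ _ X1 [set z | z < b]) => [y _|]; [exact: c1|exact: open_lt].
have oB' : open [set y | b < X1 y].
  by apply: (@open_comp _ _ X1 [set z | b < z]) => [y _|]; [exact: c1|exact: open_gt].
have cB : closed [set y | X1 y < b].
  rewrite (_ : [set y | X1 y < b] = ~` [set y | b < X1 y]); first exact: open_closedC.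
  apply/seteqP; split => y /=; first by move=> h; rewrite lt_gtF.
  by move=> /negP; rewrite -leNgt le_eqVlt (negbTE (ne y)).
have [z zb] : exists z, X1 z < b.
  have [y [y1 _ _ _]] := refl x; have := ne x; rewrite neq_lt => /orP[h|h]; first by exists x.
  by exists y; rewrite y1; move: h; lra.
have all := clopen_all (data_connected D) oB cB (ex_intro _ z zb).
have [y [y1 _ _ _]] := refl z; have := all y; have := all z; rewrite /= y1.
by lra.
Qed.

(* Near a point of the mirror, the reflection acts on the chart, and it is
   continuous by the embedding hypothesis. *)
Lemma mirror_pair U inv p (r : R) : lag_chart X1 X2 X3 X4 U inv -> U p -> X1 (inv p) = b ->
  0 < r -> \forall q \near p, exists2 q', square p r q' &
    [/\ X1 (inv q') = 2 * b - X1 (inv q), X2 (inv q') = X2 (inv q),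
        X3 (inv q') = X3 (inv q) & X4 (inv q') = X4 (inv q)].
Proof.
move=> L Up pb r0; have [s1 s2 s3 s4] := patch_smooth (chart_patch L).
have A : \forall y \near inv p, exists2 q', square p r q' & inv q' = y.
  apply/(chart_near L (fun y => exists2 q', square p r q' & inv q' = y) Up).
  by apply/near_square; exists r => // w w0 w1; exists w.
have [e e0 He] := data_embedding D A.
have ball (X : T -> R) : smooth_on U (X \o inv) ->
    \forall q \near p, `|X (inv q) - X (inv p)| < e.
  move=> sX; have [d d0 H] := continuous_near_lt (smooth_on_continuous sX Up) e0.
  by apply/near_square; exists d.
near=> q; have [y [y1 y2 y3 y4]] := refl (inv q).
have [|q' sq E] := He y; last by exists q' => //; rewrite E.
split; rewrite ?y1 ?y2 ?y3 ?y4; last 3 first.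
- by near: q; exact: ball.
- by near: q; exact: ball.
- by near: q; exact: ball.
rewrite pb (_ : _ - b = - (X1 (inv q) - X1 (inv p))); last by rewrite pb; ring.
by rewrite normrN; near: q; exact: ball.
Unshelve. all: by end_near. Qed.

(* The secant joining a point to its mirror image is normal to the mirror, and
   [X2] is the Lagrangian partner of that normal direction. *)
Lemma mirror_dichotomy U inv p : lag_chart X1 X2 X3 X4 U inv -> U p -> X1 (inv p) = b ->
  (\forall q \near p, X1 (inv q) = b) \/ (dx (X2 \o inv) p = 0 /\ dy (X2 \o inv) p = 0).
Proof.
move=> L Up pb.
have [nb|nb] := pselect (\forall q \near p, X1 (inv q) = b); first by left.
right; have P := chart_patch L; have oU := patch_open P.
have [s1 s2 s3 s4] := patch_smooth P.
set f1 := X1 \o inv in P s1 *; set f2 := X2 \o inv in P s2 *.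
set f3 := X3 \o inv in P s3 *; set f4 := X4 \o inv in P s4 *.
have lag := patch_lag P Up; rewrite /wedge in lag.
have [C [r0 [C0 r00 inj]]] := patch_injective P Up.
(* [K] says that the Kahler form vanishes between every tangent vector and [(a1, a2, a3, a4)].
   Secants of mirror pairs are multiples of the first axis and are nearly tangent, and pairing that
   axis with the vector leaves [a2]. *)
have key (a1 a2 a3 a4 : R) :
    (forall d0 d1 : R, (d0 * dx f1 p + d1 * dy f1 p) * a2 - (d0 * dx f2 p + d1 * dy f2 p) * a1 +
      (d0 * dx f3 p + d1 * dy f3 p) * a4 - (d0 * dx f4 p + d1 * dy f4 p) * a3 = 0) -> a2 = 0.
  move=> K; apply/eqP; rewrite -normr_le0; apply/ler_addgt0Pl => e' e'0; rewrite addr0.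
  pose M := `|a1| + `|a2| + `|a3| + `|a4| + 1.
  have M0 : 0 < M by rewrite ltr_wpDl// !addr_ge0.
  pose e := e' / (C * M); have e0 : 0 < e by rewrite divr_gt0// mulr_gt0.
  have [r1 r10 H1] := strict_diff oU Up s1 e0.
  have [r2 r20 H2] := strict_diff oU Up s2 e0.
  have [r3 r30 H3] := strict_diff oU Up s3 e0.
  have [r4 r40 H4] := strict_diff oU Up s4 e0.
  have [r [rp rr0 rr1 rr2 [rr3 rr4]]] : exists r : R, [/\ 0 < r, r <= r0, r <= r1, r <= r2 &
      r <= r3 /\ r <= r4].
    exists (Num.min r0 (Num.min r1 (Num.min r2 (Num.min r3 r4)))).
    by rewrite !lt_min !ge_min !lexx !orbT r00 r10 r20 r30 r40.
  have mp := mirror_pair L Up pb rp.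
  have [q [[q' sq' [y1 y2 y3 y4]] [sq qb]]] : exists q, (exists2 q', square p r q' &
      [/\ X1 (inv q') = 2 * b - X1 (inv q), X2 (inv q') = X2 (inv q),
          X3 (inv q') = X3 (inv q) & X4 (inv q') = X4 (inv q)]) /\
      square p r q /\ X1 (inv q) <> b.
    apply: contrapT => no; apply: nb.
    have nsq : \forall q \near p, square p r q by apply/near_square; exists r.
    near=> q; apply: contrapT => qb; apply: no; exists q; split; last split => //.
      by near: q.
    by near: q.
  have sub r' (le : r <= r') v : square p r v -> square p r' v.
    by move=> [h1 h2]; split; exact: lt_le_trans le.
  have I0 := inj _ _ (sub _ rr0 _ sq') (sub _ rr0 _ sq).
  have J1 := H1 _ _ (sub _ rr1 _ sq) (sub _ rr1 _ sq').
  have J2 := H2 _ _ (sub _ rr2 _ sq) (sub _ rr2 _ sq').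
  have J3 := H3 _ _ (sub _ rr3 _ sq) (sub _ rr3 _ sq').
  have J4 := H4 _ _ (sub _ rr4 _ sq) (sub _ rr4 _ sq').
  have E2 : f2 q' = f2 q := y2.
  have E3 : f3 q' = f3 q := y3.
  have E4 : f4 q' = f4 q := y4.
  rewrite E2 subrr in J2 I0; rewrite E3 subrr in J3 I0; rewrite E4 subrr in J4 I0.
  rewrite sub0r normrN in J2; rewrite sub0r normrN in J3; rewrite sub0r normrN in J4.
  rewrite normr0 !addr0 in I0.
  have Kq := K (q' 0 0 - q 0 0) (q' 0 1 - q 0 1).
  have t0 : 0 < `|f1 q' - f1 q|.
    rewrite normr_gt0 /f1 /= y1; apply/eqP => E; apply: qb.
    by move: E; lra.
  move: I0 J1 J2 J3 J4 Kq t0.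
  set D1 := _ * dx f1 p + _; set D2 := _ * dx f2 p + _.
  set D3 := _ * dx f3 p + _; set D4 := _ * dx f4 p + _.
  move: D1 D2 D3 D4 (f1 q' - f1 q) => D1 D2 D3 D4 t.
  set n := `|_| + `|_|; have n0 : 0 <= n by rewrite addr_ge0.
  move: n n0 => n n0 I0 J1 J2 J3 J4 Kq t0.
  have E : t * a2 = (t - D1) * a2 + D2 * a1 - D3 * a4 + D4 * a3 by rewrite -[RHS]addr0 -Kq; ring.
  have bd : `|t| * `|a2| <= e * n * M.
    rewrite -normrM E; apply: (@le_trans _ _ (e * n * (`|a2| + `|a1| + `|a4| + `|a3|))).
      rewrite !mulrDr; apply: le_trans (ler_normD _ _) _; apply: lerD; last first.
        by rewrite normrM ler_wpM2r.
      apply: le_trans (ler_normB _ _) _; apply: lerD; last by rewrite normrM ler_wpM2r.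
      by apply: le_trans (ler_normD _ _) _; apply: lerD; rewrite normrM ler_wpM2r.
    rewrite ler_wpM2l//; first by rewrite mulr_ge0// ltW.
    by rewrite /M; lra.
  rewrite -(ler_pM2l t0); apply: le_trans bd _.
  rewrite -mulrA [n * M]mulrC mulrA (_ : e * M = e' / C); last first.
    by rewrite /e; field; rewrite !gt_eqF.
  apply: (@le_trans _ _ (e' / C * (C * `|t|))).
    by rewrite ler_wpM2l// divr_ge0// ltW.
  by rewrite mulrA divfK ?gt_eqF// mulrC.
split; [apply: (key (dx f1 p) _ (dx f3 p) (dx f4 p))|
        apply: (key (dy f1 p) _ (dy f3 p) (dy f4 p))] => d0 d1.
  rewrite -[RHS](mulr0 (- d1)) -lag; ring.
rewrite -[RHS](mulr0 d0) -lag; ring.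
Unshelve. all: by end_near. Qed.

(** Mirror points agree in [X2], [X3], [X4]; at a critical point of [X1] these functions separate
    points, so each nearby point is its own mirror image and lies on the mirror. *)
Lemma mirror_critical U inv p : lag_chart X1 X2 X3 X4 U inv -> U p -> X1 (inv p) = b ->
  dx (X1 \o inv) p = 0 -> dy (X1 \o inv) p = 0 -> \forall y \near inv p, X1 y = b.
Proof.
move=> L Up pb d1 d2; apply/(chart_near L (fun y => X1 y = b) Up).
have [r r0 inj] := patch_injective_critical (chart_patch L) Up d1 d2.
have mp := mirror_pair L Up pb r0.
have sq : \forall q \near p, square p r q by apply/near_square; exists r.
apply: filterS2 mp sq => q [q' sq' [y1 y2 y3 y4]] sq.
have E := inj _ _ sq' sq y2 y3 y4.
by move: y1; rewrite E; lra.
Qed.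

(** The interior of the mirror is closed, since both [X1 = b] and [dX1 = 0] pass to the limit and
    [mirror_critical] applies there. By connectedness [X1] would be constant; at a maximum of [X2]
    then [dX1 = dX2 = 0], the Lagrangian condition makes [dX3] and [dX4] proportional, and all six
    minors vanish. *)
Lemma mirror_interior_empty (x : T) : ~ (\forall y \near x, X1 y = b).
Proof.
move=> xB; pose B := [set x : T | \forall y \near x, X1 y = b].
have oB : open B by exact: open_near_set.
have [c1 c2 _ _] := data_continuous.
have cB : closed B.
  move=> z zB; have [U [inv [p [L Up pz]]]] := data_chart D z.
  have P := chart_patch L; have [s1 _ _ _] := patch_smooth P.
  have acc r : 0 < r -> exists2 q, square p r q & U q /\ \forall w \near q, X1 (inv w) = b.
    move=> r0; rewrite -pz in zB; have [q sq [Uq qB]] := chart_closure L Up zB r0.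
    by exists q => //; split => //; apply/(chart_near L (fun y => X1 y = b) Uq).
  have lim (h : 'rV[R]_2 -> R) : smooth_on U h -> (forall q, U q -> (\forall w \near q, X1 (inv w) = b) -> h q = 0) ->
      h p = 0.
    move=> sh H; apply: continuous_zero (smooth_on_continuous sh Up) _ => r r0.
    by have [q sq [Uq qB]] := acc r r0; exists q => //; exact: H.
  have near0 q : (\forall w \near q, X1 (inv w) = b) ->
      [/\ X1 (inv q) - b = 0, dx (X1 \o inv) q = 0 & dy (X1 \o inv) q = 0].
    move=> qB; split; first by rewrite (nbhs_singleton qB) subrr.
      have [_ <- _] := has_grad_near (f := fun=> b) (filterS (fun _ => esym) qB) (has_grad_cst b q).
      by [].
    have [_ _ <-] := has_grad_near (f := fun=> b) (filterS (fun _ => esym) qB) (has_grad_cst b q).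
    by [].
  have pb : X1 (inv p) = b.
    apply/eqP; rewrite -subr_eq0; apply/eqP; apply: (lim (fun q => X1 (inv q) - b)).
      exact: (smooth_onB (patch_open P) s1 (smooth_on_cst _ _)).
    by move=> q _ /near0[].
  rewrite /B /= -pz; apply: (mirror_critical L Up pb).
    by apply: (lim (dx (X1 \o inv))); [exact: smooth_dx|move=> q _ /near0[]].
  by apply: (lim (dy (X1 \o inv))); [exact: smooth_dy|move=> q _ /near0[]].
have all := clopen_all (data_connected D) oB cB (ex_intro _ x xB).
have [z _ zm] := data_max closedT (data_nonempty D) c2.
have [U [inv [p [L Up pz]]]] := data_chart D z.
have P := chart_patch L; have [s1 s2 _ _] := patch_smooth P.
have [d1 d1'] : dx (X1 \o inv) p = 0 /\ dy (X1 \o inv) p = 0.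
  apply: (local_max_critical (patch_open P) Up s1).
  apply/(chart_near L (fun y => X1 y <= X1 (inv p)) Up).
  have := all (inv p); rewrite /B /= => h; rewrite (nbhs_singleton h).
  by apply: filterS h => y ->.
have [d2 d2'] : dx (X2 \o inv) p = 0 /\ dy (X2 \o inv) p = 0.
  apply: (local_max_critical (patch_open P) Up s2).
  by near=> q; rewrite /= pz; exact: zm.
have lag := patch_lag P Up.
have z12 : wedge (X1 \o inv) (X2 \o inv) p = 0 by rewrite /wedge d1 d1' !mul0r subr0.
rewrite z12 add0r in lag.
by have [] := patch_minor P Up; apply; split => //; rewrite /wedge ?d1 ?d1' ?d2 ?d2' !mul0r subr0.
Unshelve. all: by end_near. Qed.

Lemma mirror_grad U inv p : lag_chart X1 X2 X3 X4 U inv -> U p -> X1 (inv p) = b ->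
  [/\ (dx (X1 \o inv) p != 0) || (dy (X1 \o inv) p != 0), dx (X2 \o inv) p = 0 &
      dy (X2 \o inv) p = 0].
Proof.
move=> L Up pb; have [nb|[h1 h2]] := mirror_dichotomy L Up pb.
  by case: (@mirror_interior_empty (inv p)); apply/(chart_near L (fun y => X1 y = b) Up).
split => //; apply/negPn/negP => /norP[/negPn/eqP d1 /negPn/eqP d2].
exact: mirror_interior_empty (mirror_critical L Up pb d1 d2).
Qed.

End Reflection.
End Theory.
End ReflectionData.

(** * Curvature of the mirror curve *)

Section MirrorCurve.
Variable R : realType.
Implicit Types (u v w : 'rV[R]_2) (U : set 'rV[R]_2) (f g h : 'rV[R]_2 -> R).

Lemma smooth_wedge U f g : open U -> smooth_on U f -> smooth_on U g -> smooth_on U (wedge f g).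
Proof. by move=> oU sf sg; rewrite /wedge; smooth. Qed.

(* [wedge f] is the derivation along the level curves of [f]. *)
Definition has_D f u h (l : R) :=
  exists hx hy, has_grad h u hx hy /\ l = dx f u * hy - dy f u * hx.

Lemma has_DE f u h l : has_D f u h l -> wedge f h u = l.
Proof. by move=> [hx [hy [[_ <- <-] ->]]]. Qed.

Lemma has_D_smooth U f u h : smooth_on U h -> U u -> has_D f u h (wedge f h u).
Proof. by move=> sh Uu; exists (dx h u), (dy h u); split => //; exact: smooth_has_grad sh Uu. Qed.

Lemma has_D_cst f u (c : R) : has_D f u (fun=> c) 0.
Proof. by exists 0, 0; split; [exact: has_grad_cst|ring]. Qed.

Lemma has_DD f u g h l m : has_D f u g l -> has_D f u h m ->
  has_D f u (fun v => g v + h v) (l + m).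
Proof.
move=> [g1 [g2 [G ->]]] [h1 [h2 [H ->]]]; exists (g1 + h1), (g2 + h2); split; last by ring.
exact: has_gradD.
Qed.

Lemma has_DN f u g l : has_D f u g l -> has_D f u (fun v => - g v) (- l).
Proof.
move=> [g1 [g2 [G ->]]]; exists (- g1), (- g2); split; last by ring.
exact: has_gradN.
Qed.

Lemma has_DM f u g h l m : has_D f u g l -> has_D f u h m ->
  has_D f u (fun v => g v * h v) (g u * m + h u * l).
Proof.
move=> [g1 [g2 [G ->]]] [h1 [h2 [H ->]]].
exists (g u * h1 + h u * g1), (g u * h2 + h u * g2); split; last by ring.
exact: has_gradM.
Qed.

Lemma has_D_comp f u (k : R -> R) g (c l : R) : is_derive (g u) 1 k c -> has_D f u g l ->
  has_D f u (fun v => k (g v)) (c * l).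
Proof.
move=> dk [g1 [g2 [G ->]]]; exists (c * g1), (c * g2); split; last by ring.
exact: has_grad_comp.
Qed.

Lemma has_DV f u g l : g u != 0 -> has_D f u g l ->
  has_D f u (fun v => (g v)^-1) (- (g u) ^- 2 * l).
Proof.
move=> g0 [g1 [g2 [G ->]]]; exists (- (g u) ^- 2 * g1), (- (g u) ^- 2 * g2); split.
  exact: has_gradV.
by ring.
Qed.

Lemma level_const_near U f h u : open U -> U u -> smooth_on U f -> smooth_on U h ->
  (dx f u != 0) || (dy f u != 0) ->
  (\forall v \near u, f v = f u -> wedge f h v = 0) ->
  \forall v \near u, f v = f u -> h v = h u.
Proof.
move=> oU Uu sf sh g0 /near_square[r r0 H].
have oV : open (U `&` square u r) by apply: openI => //; exact: open_square.
have sub g : smooth_on U g -> smooth_on (U `&` square u r) g.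
  by apply: smooth_on_sub => v [].
apply: (level_const oV) => //; try exact: sub.
  by split => //; split; rewrite subrr normr0.
by move=> v [Uv [v0 v1]] fv; rewrite -(H v v0 v1 fv) /wedge; ring.
Qed.

Lemma level_tangent_near U f h u : open U -> U u -> smooth_on U f -> smooth_on U h ->
  (\forall v \near u, f v = f u -> h v = 0) -> wedge f h u = 0.
Proof.
move=> oU Uu sf sh /near_square[r r0 H].
have := @level_tangent _ U f h u r oU Uu sf sh r0.
move=> <-; first by rewrite /wedge; ring.
by move=> v v0 v1 _; exact: H.
Qed.

(** [(a, b)] is the gradient of [f1], and [f3], [f4] have gradients [al (n1, n2)] and [be (n1, n2)].
    In [al] times the equation of [f4] minus [be] times that of [f3], the second derivatives along
    [(- b, a)] give the curvature, while those along [(n2, - n1)] combine to [n1 L2 - n2 L1 = 0]. *)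
Lemma curvature_algebra (al be n1 n2 a b x3 y3 z3 x4 y4 z4 r s t f3 f4 c1 c2 : R) :
  let k := a * n2 - b * n1 in let q := al ^+ 2 + be ^+ 2 in
  al * n1 * y4 + be * n2 * x3 - al * n2 * x4 - be * n1 * y3 = 0 ->
  al * n1 * z4 + be * n2 * y3 - al * n2 * y4 - be * n1 * z3 = 0 ->
  (b ^+ 2 + q * n2 ^+ 2) * x3 - 2 * (a * b + q * (n1 * n2)) * y3 +
    (a ^+ 2 + q * n1 ^+ 2) * z3 + q * k ^+ 2 * f3 = al * (c1 * n1 + c2 * n2) ->
  (b ^+ 2 + q * n2 ^+ 2) * x4 - 2 * (a * b + q * (n1 * n2)) * y4 +
    (a ^+ 2 + q * n1 ^+ 2) * z4 + q * k ^+ 2 * f4 = be * (c1 * n1 + c2 * n2) ->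
  let Q A1 A2 x y z := a * (s * A2 - t * A1 + a * z - b * y) -
    b * (r * A2 - s * A1 + a * y - b * x) in
  (al * k) * Q (be * n1) (be * n2) x4 y4 z4 - (be * k) * Q (al * n1) (al * n2) x3 y3 z3 =
    ((al * k) ^+ 2 + (be * k) ^+ 2) * (f3 * (be * k) - f4 * (al * k)).
Proof.
move=> k q L1 L2 S3 S4 Q; apply/eqP; rewrite -subr_eq0; apply/eqP.
transitivity (k * (al * ((b ^+ 2 + q * n2 ^+ 2) * x4 - 2 * (a * b + q * (n1 * n2)) * y4 +
    (a ^+ 2 + q * n1 ^+ 2) * z4 + q * k ^+ 2 * f4 - be * (c1 * n1 + c2 * n2)) -
  be * ((b ^+ 2 + q * n2 ^+ 2) * x3 - 2 * (a * b + q * (n1 * n2)) * y3 +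
    (a ^+ 2 + q * n1 ^+ 2) * z3 + q * k ^+ 2 * f3 - al * (c1 * n1 + c2 * n2))) -
  k * q * (n1 * (al * n1 * z4 + be * n2 * y3 - al * n2 * y4 - be * n1 * z3) -
    n2 * (al * n1 * y4 + be * n2 * x3 - al * n2 * x4 - be * n1 * y3))).
  by rewrite /Q /q /k; ring.
by rewrite S3 S4 L1 L2; ring.
Qed.

Lemma rank_one (a b A1 A2 B1 B2 : R) : A1 * B2 = A2 * B1 ->
  0 < (a * A2 - b * A1) ^+ 2 + (a * B2 - b * B1) ^+ 2 ->
  exists al be n1 n2 : R, [/\ A1 = al * n1, A2 = al * n2, B1 = be * n1 & B2 = be * n2].
Proof.
move=> rk N0.
have [p3|p3] := eqVneq (a * A2 - b * A1) 0; last first.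
  exists 1, ((a * B2 - b * B1) / (a * A2 - b * A1)), A1, A2.
  rewrite !mul1r; split => //; rewrite mulrAC; apply: (canRL (mulfK p3)).
    have := congr1 ( *%R a) rk; rewrite /=; clear; lra.
  have := congr1 ( *%R b) rk; rewrite /=; clear; lra.
have p4 : a * B2 - b * B1 != 0.
  by apply/eqP => p4; move: N0; rewrite p3 p4 expr0n addr0 ltxx.
exists ((a * A2 - b * A1) / (a * B2 - b * B1)), 1, B1, B2.
rewrite !mul1r; split => //; rewrite mulrAC; apply: (canRL (mulfK p4)).
  have := congr1 ( *%R a) rk; rewrite /=; clear; lra.
have := congr1 ( *%R b) rk; rewrite /=; clear; lra.
Qed.

Section Curve.
Variables (U : set 'rV[R]_2) (f1 f2 f3 f4 : 'rV[R]_2 -> R) (b : R).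
Hypothesis P : lag_patch U f1 f2 f3 f4.
Hypothesis M : forall v, U v -> f1 v = b ->
  [/\ (dx f1 v != 0) || (dy f1 v != 0), dx f2 v = 0 & dy f2 v = 0].

Let oU := patch_open P.
Let s1 : smooth_on U f1. Proof. by have [] := patch_smooth P. Qed.
Let s2 : smooth_on U f2. Proof. by have [] := patch_smooth P. Qed.
Let s3 : smooth_on U f3. Proof. by have [] := patch_smooth P. Qed.
Let s4 : smooth_on U f4. Proof. by have [] := patch_smooth P. Qed.

Definition vel3 := wedge f1 f3.
Definition vel4 := wedge f1 f4.
Definition momentum v : R := f3 v * vel4 v - f4 v * vel3 v.
Definition speed2 v : R := vel3 v ^+ 2 + vel4 v ^+ 2.

Lemma smooth_vel : smooth_on U vel3 /\ smooth_on U vel4.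
Proof. by split; exact: smooth_wedge. Qed.

Lemma speed2_gt0 v : U v -> f1 v = b -> 0 < speed2 v.
Proof.
move=> Uv fv; have [g0 d1 d2] := M Uv fv.
rewrite lt_neqAle /speed2 addr_ge0 ?sqr_ge0// andbT; apply/eqP => /esym/eqP.
rewrite paddr_eq0 ?sqr_ge0// !sqrf_eq0 => /andP[/eqP v3 /eqP v4].
have [|||| e1 e2] := patch_imm P (s := - dy f1 v) (t := dx f1 v) Uv.
- by ring.
- by rewrite d1 d2; ring.
- by rewrite -[RHS]v3 /vel3 /wedge; ring.
- by rewrite -[RHS]v4 /vel4 /wedge; ring.
by move: g0; rewrite e2 -[dy f1 v == 0]oppr_eq0 e1 eqxx.
Qed.

Lemma curve_rank v : U v -> f1 v = b -> dx f3 v * dy f4 v = dy f3 v * dx f4 v.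
Proof.
move=> Uv fv; have [_ d1 d2] := M Uv fv; have := patch_lag P Uv.
by rewrite /wedge d1 d2; lra.
Qed.

Lemma wedge_grad f g u : smooth_on U f -> smooth_on U g -> U u ->
  dx (wedge f g) u = dx f u * dx (dy g) u + dy g u * dx (dx f) u
    - (dy f u * dx (dx g) u + dx g u * dx (dy f) u) /\
  dy (wedge f g) u = dx f u * dy (dy g) u + dy g u * dx (dy f) u
    - (dy f u * dx (dy g) u + dx g u * dy (dy f) u).
Proof.
move=> sf sg Uu; rewrite !(schwarz oU _ Uu)//.
have G h : smooth_on U h -> has_grad h u (dx h u) (dy h u).
  by move=> sh; exact: smooth_has_grad sh Uu.
have [_ e1 e2] := has_gradB (has_gradM (G _ (smooth_dx sf)) (G _ (smooth_dy sg)))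
  (has_gradM (G _ (smooth_dy sf)) (G _ (smooth_dx sg))).
by split; [rewrite [LHS]e1|rewrite [LHS]e2]; rewrite ?(schwarz oU _ Uu).
Qed.

(** On the mirror [df2 = 0], so the Lagrangian condition makes [df3] and [df4] proportional. When
    that condition is differentiated, [f2] enters only through the derivative of [df2] along the
    curve, which is zero; what remains are the two relations between the Hessians of [f3] and [f4]
    required by [curvature_algebra]. *)
Lemma curvature v : U v -> f1 v = b ->
  vel3 v * wedge f1 vel4 v - vel4 v * wedge f1 vel3 v = speed2 v * momentum v.
Proof.
move=> Uv fv; have [g0 d1 d2] := M Uv fv; have rk := curve_rank Uv fv.
have kz (h : 'rV[R]_2 -> R) : smooth_on U h -> (forall w, U w -> f1 w = b -> h w = 0) -> wedge f1 h v = 0.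
  move=> sh Hh; apply: (level_tangent_near oU Uv s1 sh).
  have nU : \forall w \near v, U w by exact: open_nbhs_nbhs.
  by apply: filterS nU => w Uw; rewrite fv => fw; exact: Hh.
have K1 : wedge f1 (dx f2) v = 0.
  by apply: kz; [exact: smooth_dx|move=> w Uw fw; have [] := M Uw fw].
have K2 : wedge f1 (dy f2) v = 0.
  by apply: kz; [exact: smooth_dy|move=> w Uw fw; have [] := M Uw fw].
rewrite /wedge -(schwarz oU s2 Uv) in K1; rewrite /wedge in K2.
have [|_ L1 L2] := @near_zero_grad R (fun w => wedge f1 f2 w + wedge f3 f4 w) v.
  have nU : \forall w \near v, U w by exact: open_nbhs_nbhs.
  by apply: filterS nU => w Uw; exact: (patch_lag P Uw).
have G h : smooth_on U h -> has_grad h v (dx h v) (dy h v).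
  by move=> sh; exact: smooth_has_grad sh Uv.
have [_ e1 e2] := has_gradD (G _ (smooth_wedge oU s1 s2)) (G _ (smooth_wedge oU s3 s4)).
rewrite e1 in L1; rewrite e2 in L2.
have [x12 y12] := wedge_grad s1 s2 Uv; have [x34 y34] := wedge_grad s3 s4 Uv.
rewrite x12 x34 d1 d2 in L1; rewrite y12 y34 d1 d2 in L2.
have [x13 y13] := wedge_grad s1 s3 Uv; have [x14 y14] := wedge_grad s1 s4 Uv.
have [c1 [c2 [_ _ S3 S4]]] := patch_shrinker P Uv.
move: S3 S4; rewrite /trace_op /elliptic_part /det_metric /metric_xx /metric_xy /metric_yy
  /sum4 /ptmul /= d1 d2 => S3 S4.
rewrite /speed2 /momentum.
have -> : wedge f1 vel3 v = dx f1 v * dy vel3 v - dy f1 v * dx vel3 v by [].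
have -> : wedge f1 vel4 v = dx f1 v * dy vel4 v - dy f1 v * dx vel4 v by [].
rewrite /vel3 /vel4 x13 y13 x14 y14 /wedge.
have [al [be [n1 [n2 [A1 A2 B1 B2]]]]] : exists al be n1 n2 : R,
    [/\ dx f3 v = al * n1, dy f3 v = al * n2, dx f4 v = be * n1 & dy f4 v = be * n2].
  by apply: (rank_one rk); exact: speed2_gt0.
rewrite /= A1 A2 B1 B2 in L1 L2 S3 S4 *.
move: (dx (dx f3) v) (dx (dy f3) v) (dy (dy f3) v) (dx (dx f4) v) (dx (dy f4) v) (dy (dy f4) v)
  (dx f1 v) (dy f1 v) (dx (dx f1) v) (dx (dy f1) v) (dy (dy f1) v) (dx (dx f2) v)
  (dx (dy f2) v) (dy (dy f2) v) (f3 v) (f4 v) K1 K2 L1 L2 S3 S4.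
move=> x3 y3 z3 x4 y4 z4 a b0 r s t x2 y2 z2 F3 F4 K1 K2 L1 L2 S3 S4.
have := @curvature_algebra al be n1 n2 a b0 x3 y3 z3 x4 y4 z4 r s t F3 F4 c1 c2.
cbv zeta => K0.
have H1 := K0 ltac:(by apply: (etrans _ (etrans (congr2 (fun p q : R => p - q) L1 K1) (subr0 0))); ring).
have H2 := H1 ltac:(by apply: (etrans _ (etrans (congr2 (fun p q : R => p - q) L2 K2) (subr0 0))); ring).
have H3 := H2 ltac:(by apply: (etrans (etrans _ S3)); ring).
have H4 := H3 ltac:(by apply: (etrans (etrans _ S4)); ring).
by apply: (etrans (etrans _ H4)); ring.
Qed.

End Curve.
End MirrorCurve.

(** * Excluding mirror curves on a line through the origin *)

Section LinePropagation.
Variable R : realType.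
Implicit Types (u v w : 'rV[R]_2) (U : set 'rV[R]_2) (f g h : 'rV[R]_2 -> R).

Definition mirror_patch U (f1 f2 f3 f4 : 'rV[R]_2 -> R) (b : R) : Prop :=
  lag_patch U f1 f2 f3 f4 /\ forall v, U v -> f1 v = b ->
  [/\ (dx f1 v != 0) || (dy f1 v != 0), dx f2 v = 0 & dy f2 v = 0].

Lemma mirror_patch_sub U V f1 f2 f3 f4 b : open V -> V `<=` U ->
  mirror_patch U f1 f2 f3 f4 b -> mirror_patch V f1 f2 f3 f4 b.
Proof.
move=> oV VU [[oU [s1 s2 s3 s4] lag imm shr] M]; split; last by move=> v /VU; exact: M.
split => //; first by split; exact: (smooth_on_sub VU).
- by move=> u /VU; exact: lag.
- by move=> u s t /VU; exact: imm.
- by move=> u /VU; exact: shr.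
Qed.

Section Invariants.
Variables (U : set 'rV[R]_2) (f1 f2 f3 f4 : 'rV[R]_2 -> R) (b : R).
Hypothesis MP : mirror_patch U f1 f2 f3 f4 b.

Let P : lag_patch U f1 f2 f3 f4 := MP.1.
Let M := MP.2.
Let oU := patch_open P.
Let s1 : smooth_on U f1. Proof. by have [] := patch_smooth P. Qed.
Let s3 : smooth_on U f3. Proof. by have [] := patch_smooth P. Qed.
Let s4 : smooth_on U f4. Proof. by have [] := patch_smooth P. Qed.

(* Along the mirror curve, with w = (f3, f4), p = w' and W = det(w, p), the
   quantity W^2 e^(-|w|^2) / |p|^2 is constant; once W = 0 the direction of p is
   constant as well. *)
Lemma line_propagation u (e3 e4 : R) : U u -> f1 u = b -> (e3 != 0) || (e4 != 0) ->
  e3 * f3 u + e4 * f4 u = 0 -> e3 * vel3 f1 f3 u + e4 * vel4 f1 f4 u = 0 ->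
  (forall v, U v -> speed2 f1 f3 f4 v != 0) ->
  \forall v \near u, f1 v = b -> e3 * f3 v + e4 * f4 v = 0.
Proof.
move=> Uu fu e0 h0 v0 N0; have [g0 _ _] := M Uu fu.
have [sv3 sv4] := smooth_vel P.
pose W := momentum f1 f3 f4; pose N := speed2 f1 f3 f4.
have sN : smooth_on U N.
  rewrite /N /speed2 (_ : (fun v => _) =
    fun v => vel3 f1 f3 v * vel3 f1 f3 v + vel4 f1 f4 v * vel4 f1 f4 v); first by smooth.
  by apply/funext => v; rewrite !expr2.
have sNV : smooth_on U (fun v => (N v)^-1) by exact: smooth_onV.
have W0 : W u = 0.
  rewrite /W /momentum; case/orP: e0 => e0; apply: (mulfI e0); rewrite mulr0.
    transitivity ((e3 * f3 u + e4 * f4 u) * vel4 f1 f4 u -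
      f4 u * (e3 * vel3 f1 f3 u + e4 * vel4 f1 f4 u)); first by ring.
    by rewrite h0 v0 mul0r mulr0 subr0.
  transitivity (f3 u * (e3 * vel3 f1 f3 u + e4 * vel4 f1 f4 u) -
    (e3 * f3 u + e4 * f4 u) * vel3 f1 f3 u); first by ring.
  by rewrite h0 v0 mul0r mulr0 subr0.
have D3 v : U v -> has_D f1 v f3 (vel3 f1 f3 v) by exact: has_D_smooth.
have D4 v : U v -> has_D f1 v f4 (vel4 f1 f4 v) by exact: has_D_smooth.
have DV3 v : U v -> has_D f1 v (vel3 f1 f3) (wedge f1 (vel3 f1 f3) v) by exact: has_D_smooth.
have DV4 v : U v -> has_D f1 v (vel4 f1 f4) (wedge f1 (vel4 f1 f4) v) by exact: has_D_smooth.
have DN v (Uv : U v) := has_DD (has_DM (DV3 v Uv) (DV3 v Uv)) (has_DM (DV4 v Uv) (DV4 v Uv)).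
have DNV v (Uv : U v) := has_DV (N0 v Uv) (DN v Uv).
have nU : \forall v \near u, U v by exact: open_nbhs_nbhs.
have nW : \forall v \near u, f1 v = b -> W v = 0.
  pose E v := expR (- (f3 v * f3 v + f4 v * f4 v)).
  (* The derivative of [I] along the curve has the difference of the two sides of [curvature] as a
     factor. *)
  pose I v := W v * W v * (N v)^-1 * E v.
  have sW : smooth_on U W by rewrite /W /momentum; smooth.
  have sE : smooth_on U E by apply: smooth_on_expR => //; smooth.
  have sI : smooth_on U I by rewrite /I; smooth.
  have := level_const_near oU Uu s1 sI g0; rewrite fu.
  have I0 : I u = 0 by rewrite /I W0 !mul0r.
  rewrite I0 => H; have {}H : \forall v \near u, f1 v = b -> I v = 0.
    apply: H; apply: filterS nU => v Uv fv; have C := curvature P M Uv fv.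
    have DW := has_DD (has_DM (D3 v Uv) (DV4 v Uv)) (has_DN (has_DM (D4 v Uv) (DV3 v Uv))).
    have DE := has_D_comp (is_derive_expR _)
      (has_DN (has_DD (has_DM (D3 v Uv) (D3 v Uv)) (has_DM (D4 v Uv) (D4 v Uv)))).
    apply: (etrans (has_DE (has_DM (has_DM (has_DM DW DW) (DNV v Uv)) DE))) => /=.
    have Nv := N0 v Uv; rewrite -/(W v) -/(E v); move: Nv C.
    rewrite /W /momentum /speed2.
    move: (E v) (f3 v) (f4 v) (vel3 f1 f3 v) (vel4 f1 f4 v) (wedge f1 (vel3 f1 f3) v)
      (wedge f1 (vel4 f1 f4) v) => e F3 F4 p3 p4 Q3 Q4 Nv C.
    transitivity (2 * e * (F3 * p4 - F4 * p3) / (p3 ^+ 2 + p4 ^+ 2) ^+ 2 *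
      (F3 * p3 + F4 * p4) * ((p3 * Q4 - p4 * Q3) - (p3 ^+ 2 + p4 ^+ 2) * (F3 * p4 - F4 * p3))).
      by field.
    by rewrite C subrr mulr0.
  apply: filterS2 nU H => v Uv H fv; apply/eqP; have /eqP := H fv.
  rewrite /I !mulf_eq0 invr_eq0 (negbTE (N0 v Uv)) orbF.
  by rewrite (gt_eqF (expR_gt0 _ : 0 < E v)) orbF orbb.
have nV : \forall v \near u, f1 v = b -> e3 * vel3 f1 f3 v + e4 * vel4 f1 f4 v = 0.
  pose V v := e3 * vel3 f1 f3 v + e4 * vel4 f1 f4 v.
  have sV : smooth_on U V by rewrite /V; smooth.
  pose I v := V v * V v * (N v)^-1.
  have sI : smooth_on U I by rewrite /I; smooth.
  have := level_const_near oU Uu s1 sI g0; rewrite fu.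
  have -> : I u = 0 by rewrite /I /V v0 !mul0r.
  move=> H; have {}H : \forall v \near u, f1 v = b -> I v = 0.
    apply: H; apply: filterS2 nU nW => v Uv Wv fv; have C := curvature P M Uv fv.
    have DV := has_DD (has_DM (has_D_cst f1 v e3) (DV3 v Uv)) (has_DM (has_D_cst f1 v e4) (DV4 v Uv)).
    apply: (etrans (has_DE (has_DM (has_DM DV DV) (DNV v Uv)))) => /=.
    have Nv := N0 v Uv; have {}Wv := Wv fv; move: Nv C Wv.
    rewrite /W /momentum /speed2 => Nv C Wv; rewrite Wv mulr0 in C; move: Nv C.
    move: (vel3 f1 f3 v) (vel4 f1 f4 v) (wedge f1 (vel3 f1 f3) v)
      (wedge f1 (vel4 f1 f4) v) => p3 p4 Q3 Q4 Nv C.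
    transitivity (2 * (e3 * p3 + e4 * p4) / (p3 ^+ 2 + p4 ^+ 2) ^+ 2 *
      (e4 * p3 - e3 * p4) * (p3 * Q4 - p4 * Q3)); last by rewrite C mulr0.
    by field.
  apply: filterS2 nU H => v Uv H fv; apply/eqP; have /eqP := H fv.
  by rewrite /I !mulf_eq0 invr_eq0 (negbTE (N0 v Uv)) orbF orbb.
pose h v := e3 * f3 v + e4 * f4 v.
have sh : smooth_on U h by rewrite /h; smooth.
have := level_const_near oU Uu s1 sh g0; rewrite fu (_ : h u = 0)//; apply.
apply: filterS2 nU nV => v Uv Vv fv.
have Dh := has_DD (has_DM (has_D_cst f1 v e3) (D3 v Uv)) (has_DM (has_D_cst f1 v e4) (D4 v Uv)).
by apply: (etrans (has_DE Dh)); apply: (etrans _ (Vv fv)); ring.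
Qed.

End Invariants.
End LinePropagation.

Section MirrorMomentum.
Variables (R : realType) (T : topologicalType).
Variables (X1 X2 X3 X4 : T -> R) (b : R).
Hypothesis D : lag_data X1 X2 X3 X4.
Hypothesis refl : reflective X1 X2 X3 X4 b.
Implicit Types (U : set 'rV[R]_2) (inv : 'rV[R]_2 -> T).

Lemma chart_mirror U inv : lag_chart X1 X2 X3 X4 U inv ->
  mirror_patch U (X1 \o inv) (X2 \o inv) (X3 \o inv) (X4 \o inv) b.
Proof.
by move=> L; split; [exact: chart_patch L|move=> v Uv fv; exact: (mirror_grad D refl L)].
Qed.

Lemma line_propagation_near U (f1 f2 f3 f4 : 'rV[R]_2 -> R) u (e3 e4 : R) :
  mirror_patch U f1 f2 f3 f4 b -> U u -> f1 u = b -> (e3 != 0) || (e4 != 0) ->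
  e3 * f3 u + e4 * f4 u = 0 -> e3 * wedge f1 f3 u + e4 * wedge f1 f4 u = 0 ->
  \forall v \near u, f1 v = b -> e3 * f3 v + e4 * f4 v = 0.
Proof.
move=> MP Uu fu e0 h0 v0; have P := MP.1; have oU := patch_open P.
have [s1 s2 s3 s4] := patch_smooth P; have [sv3 sv4] := smooth_vel P.
have sN : smooth_on U (speed2 f1 f3 f4).
  rewrite /speed2 (_ : (fun v => _) =
    fun v => vel3 f1 f3 v * vel3 f1 f3 v + vel4 f1 f4 v * vel4 f1 f4 v); first by smooth.
  by apply/funext => v; rewrite !expr2.
have /near_square[r r0 Hr] := smooth_near_gt sN Uu (speed2_gt0 P MP.2 Uu fu).
have oV : open (U `&` square u r) by apply: openI => //; exact: open_square.
apply: (@line_propagation R (U `&` square u r) f1 f2 f3 f4 b) => //.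
- by apply: mirror_patch_sub MP => // v [].
- by split => //; split; rewrite subrr normr0.
- by move=> v [_ [h1 h2]]; rewrite gt_eqF// Hr.
Qed.

(** [dX2 = 0] along the mirror curve. Consequently a level of [X2] cuts out a relatively open part
    of the mirror. *)
Lemma mirror_partner_const U inv p : lag_chart X1 X2 X3 X4 U inv -> U p -> X1 (inv p) = b ->
  \forall y \near inv p, X1 y = b -> X2 y = X2 (inv p).
Proof.
move=> L Up pb; have [P M] := chart_mirror L; have oU := patch_open P.
have [s1 s2 _ _] := patch_smooth P; have [g0 _ _] := M p Up pb.
apply/(chart_near L (fun y => X1 y = b -> X2 y = X2 (inv p)) Up).
have nU : \forall w \near p, U w by exact: open_nbhs_nbhs.
have := level_const_near oU Up s1 s2 g0; rewrite /= pb; apply.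
apply: filterS nU => v Uv fv; have [_ d1 d2] := M v Uv fv.
by rewrite /wedge d1 d2; ring.
Qed.

(** If it vanished, the points near which the mirror curve lies on a fixed line through 0 would form
    a nonempty set [Z], closed and relatively open in the mirror. At a maximum of [|w|^2] on [Z],
    [w] is both parallel and orthogonal to its velocity, so [w = 0] there and hence nearby on the
    curve, against the positive speed. *)
Lemma momentum_neq0 U inv p : lag_chart X1 X2 X3 X4 U inv -> U p -> X1 (inv p) = b ->
  momentum (X1 \o inv) (X3 \o inv) (X4 \o inv) p != 0.
Proof.
move=> L Up pb; apply/eqP => m0.
(* [(e3, e4)] is normal to the velocity of [w]; zero momentum says that the tangent line passes
   through the origin. *)
pose e3 := - wedge (X1 \o inv) (X4 \o inv) p; pose e4 := wedge (X1 \o inv) (X3 \o inv) p.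
have [P M] := chart_mirror L.
have e0 : (e3 != 0) || (e4 != 0).
  rewrite -negb_and; apply/negP => /andP[/eqP z3 /eqP z4].
  have := speed2_gt0 P M Up pb; rewrite /speed2 /vel3 /vel4 -/e4 z4.
  by rewrite -[wedge _ (X4 \o inv) p]opprK -/e3 z3 oppr0 expr0n addr0 ltxx.
have h0 : e3 * X3 (inv p) + e4 * X4 (inv p) = 0.
  by rewrite -[RHS]oppr0 -m0 /momentum /vel3 /vel4 /e3 /e4 /=; ring.
have v0 : e3 * wedge (X1 \o inv) (X3 \o inv) p + e4 * wedge (X1 \o inv) (X4 \o inv) p = 0.
  by rewrite /e3 /e4; ring.
clearbody e3 e4.
pose Z := [set x : T | X1 x = b /\ \forall y \near x, X1 y = b -> e3 * X3 y + e4 * X4 y = 0].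
have prop V jnv q : lag_chart X1 X2 X3 X4 V jnv -> V q -> X1 (jnv q) = b ->
    e3 * X3 (jnv q) + e4 * X4 (jnv q) = 0 ->
    e3 * wedge (X1 \o jnv) (X3 \o jnv) q + e4 * wedge (X1 \o jnv) (X4 \o jnv) q = 0 ->
    Z (jnv q).
  move=> K Vq qb z0 w0; split => //.
  apply/(chart_near K (fun y => X1 y = b -> e3 * X3 y + e4 * X4 y = 0) Vq).
  exact: (line_propagation_near (chart_mirror K)).
have Zp : Z (inv p) by exact: (prop _ _ _ L Up pb h0 v0).
have tang V jnv q : lag_chart X1 X2 X3 X4 V jnv -> V q -> Z (jnv q) ->
    [/\ X1 (jnv q) = b, e3 * X3 (jnv q) + e4 * X4 (jnv q) = 0 &
    e3 * wedge (X1 \o jnv) (X3 \o jnv) q + e4 * wedge (X1 \o jnv) (X4 \o jnv) q = 0].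
  move=> K Vq [qb zq]; have [Pq _] := chart_mirror K; have oV := patch_open Pq.
  have [s1 _ s3 s4] := patch_smooth Pq.
  split => //; first exact: (nbhs_singleton zq).
  have sh : smooth_on V (fun v => e3 * X3 (jnv v) + e4 * X4 (jnv v)).
    by apply: smooth_onD => //; apply: smooth_onM => //; exact: smooth_on_cst.
  have /= := level_tangent_near oV Vq s1 sh.
  rewrite qb => <-; last first.
    by apply/(chart_near K (fun y => X1 y = b -> e3 * X3 y + e4 * X4 y = 0) Vq).
  have Dh := has_DD (has_DM (has_D_cst (X1 \o jnv) q e3) (has_D_smooth (X1 \o jnv) s3 Vq))
    (has_DM (has_D_cst (X1 \o jnv) q e4) (has_D_smooth (X1 \o jnv) s4 Vq)).
  by apply: etrans (esym (has_DE Dh)); ring.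
have cZ : closed Z.
  move=> z zZ; have [V [jnv [q [K Vq qz]]]] := data_chart D z.
  have [Pq _] := chart_mirror K; have oV := patch_open Pq.
  have [s1 _ s3 s4] := patch_smooth Pq; rewrite -qz in zZ *.
  have lim (h : 'rV[R]_2 -> R) : smooth_on V h -> (forall w, V w -> Z (jnv w) -> h w = 0) -> h q = 0.
    move=> sh H; apply: (continuous_zero (smooth_on_continuous sh Vq)) => r r0.
    by have [w sw [Vw Zw]] := chart_closure K Vq zZ r0; exists w => //; exact: H.
  apply: (prop _ _ _ K Vq).
  - apply/eqP; rewrite -subr_eq0; apply/eqP; apply: (lim (fun w => X1 (jnv w) - b)).
      exact: (smooth_onB oV s1 (smooth_on_cst _ _)).
    by move=> w Vw [-> _]; rewrite subrr.
  - apply: (lim (fun w => e3 * X3 (jnv w) + e4 * X4 (jnv w))).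
      by apply: smooth_onD => //; apply: smooth_onM => //; exact: smooth_on_cst.
    by move=> w Vw Zw; have [] := tang _ _ _ K Vw Zw.
  apply: (lim (fun w => e3 * wedge (X1 \o jnv) (X3 \o jnv) w + e4 * wedge (X1 \o jnv) (X4 \o jnv) w)).
    by apply: smooth_onD => //; apply: smooth_onM => //; try exact: smooth_on_cst;
      exact: smooth_wedge.
  by move=> w Vw Zw; have [] := tang _ _ _ K Vw Zw.
have [_ _ c3 c4] := data_continuous D.
have cN : continuous (fun x => X3 x * X3 x + X4 x * X4 x).
  by move=> x; exact: cvgD (cvgM (c3 x) (c3 x)) (cvgM (c4 x) (c4 x)).
have [x1 Zx1 xm] := data_max D cZ (ex_intro _ _ Zp) cN.
have [V [jnv [q [K Vq qz]]]] := data_chart D x1; rewrite -qz in Zx1 xm.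
have [Pq Mq] := chart_mirror K; have oV := patch_open Pq.
have [s1 _ s3 s4] := patch_smooth Pq.
have [qb hq vq] := tang _ _ _ K Vq Zx1.
have nV : \forall v \near q, V v by exact: open_nbhs_nbhs.
have nZ : \forall v \near q, X1 (jnv v) = b -> Z (jnv v).
  have H : \forall v \near q, \forall y \near jnv v, X1 y = b -> e3 * X3 y + e4 * X4 y = 0.
    apply/(chart_near K (fun x => \forall y \near x, X1 y = b -> e3 * X3 y + e4 * X4 y = 0) Vq).
    by apply: near_join; exact: Zx1.2.
  by apply: filterS H => v Hv vb; split.
have sN : smooth_on V (fun v => X3 (jnv v) * X3 (jnv v) + X4 (jnv v) * X4 (jnv v)).
  by apply: smooth_onD => //; exact: smooth_onM.
have wp : X3 (jnv q) * wedge (X1 \o jnv) (X3 \o jnv) q +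
    X4 (jnv q) * wedge (X1 \o jnv) (X4 \o jnv) q = 0.
  have := level_max oV Vq s1 sN; rewrite /= qb => H.
  have /H E : \forall v \near q, X1 (jnv v) = b ->
      X3 (jnv v) * X3 (jnv v) + X4 (jnv v) * X4 (jnv v) <=
      X3 (jnv q) * X3 (jnv q) + X4 (jnv q) * X4 (jnv q).
    by apply: filterS nZ => v Hv vb; apply: xm; exact: Hv.
  have Dh := has_DD (has_DM (has_D_smooth (X1 \o jnv) s3 Vq) (has_D_smooth (X1 \o jnv) s3 Vq))
    (has_DM (has_D_smooth (X1 \o jnv) s4 Vq) (has_D_smooth (X1 \o jnv) s4 Vq)).
  have := has_DE Dh; rewrite {1}/wedge -mulNr addrC E /= => /esym E2.
  apply: (@mulfI _ 2) => //; rewrite mulr0 -[RHS]E2; ring.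
have sp := speed2_gt0 Pq Mq Vq qb; rewrite /speed2 /vel3 /vel4 /= in sp.
have [w3 w4] : X3 (jnv q) = 0 /\ X4 (jnv q) = 0.
  move: (X3 (jnv q)) (X4 (jnv q)) (wedge (X1 \o jnv) (X3 \o jnv) q)
    (wedge (X1 \o jnv) (X4 \o jnv) q) sp hq vq wp => a c p3 p4 sp hq vq wp.
  have dt : a * p4 - c * p3 = 0.
    case/orP: e0 => e0; apply: (mulfI e0); rewrite mulr0.
      by transitivity ((e3 * a + e4 * c) * p4 - c * (e3 * p3 + e4 * p4));
        [ring|rewrite hq vq; ring].
    by transitivity (a * (e3 * p3 + e4 * p4) - (e3 * a + e4 * c) * p3);
      [ring|rewrite hq vq; ring].
  have s0 : p3 ^+ 2 + p4 ^+ 2 != 0 by rewrite gt_eqF.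
  split; apply: (mulfI s0); rewrite mulr0.
    by transitivity (p3 * (a * p3 + c * p4) + p4 * (a * p4 - c * p3));
      [ring|rewrite wp dt; ring].
  by transitivity (p4 * (a * p3 + c * p4) - p3 * (a * p4 - c * p3));
    [ring|rewrite wp dt; ring].
have zero : \forall v \near q, X1 (jnv v) = b -> X3 (jnv v) = 0 /\ X4 (jnv v) = 0.
  apply: filterS nZ => v Hv vb; have := xm _ (Hv vb).
  rewrite w3 w4 !mulr0 addr0 -!expr2 => le0.
  have /eqP : X3 (jnv v) ^+ 2 + X4 (jnv v) ^+ 2 = 0.
    by apply/eqP; rewrite eq_le le0 addr_ge0 ?sqr_ge0.
  by rewrite paddr_eq0 ?sqr_ge0// !sqrf_eq0 => /andP[/eqP ? /eqP ?].
have z3 : wedge (X1 \o jnv) (X3 \o jnv) q = 0.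
  apply: (level_tangent_near oV Vq s1 s3); rewrite /= qb.
  by apply: filterS zero => v Hv vb; have [] := Hv vb.
have z4 : wedge (X1 \o jnv) (X4 \o jnv) q = 0.
  apply: (level_tangent_near oV Vq s1 s4); rewrite /= qb.
  by apply: filterS zero => v Hv vb; have [] := Hv vb.
by move: sp; rewrite z3 z4 expr0n addr0 ltxx.
Qed.

End MirrorMomentum.

(** * The mirror curve is a unit circle *)

Section AngularGraph.
Variable R : realType.
Implicit Types (u v w : 'rV[R]_2) (U : set 'rV[R]_2) (f g h : 'rV[R]_2 -> R).

Lemma continuous_prod_eps (A B S C : R -> R) (x y : R) :
  {for y, continuous A} -> {for y, continuous B} ->
  {for x, continuous S} -> {for x, continuous C} ->
  forall e : R, 0 < e -> exists2 d : R, 0 < d & forall x' y', `|x' - x| < d -> `|y' - y| < d ->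
    `|A y' * S x' + B y' * C x' - (A y * S x + B y * C x)| < e.
Proof.
move=> cA cB cS cC e e0.
have cv (h : R -> R) (z : R * R) : {for z.1, continuous h} -> (fun p : R * R => h p.1) @ z --> h z.1.
  by move=> ch; apply: continuous_comp; [exact: cvg_fst|].
have cv2 (h : R -> R) (z : R * R) : {for z.2, continuous h} -> (fun p : R * R => h p.2) @ z --> h z.2.
  by move=> ch; apply: continuous_comp; [exact: cvg_snd|].
have cG : {for ((x, y) : R * R), continuous (fun p : R * R => A p.2 * S p.1 + B p.2 * C p.1)}.
  exact: cvgD (cvgM (cv2 A (x, y) cA) (cv S (x, y) cS)) (cvgM (cv2 B (x, y) cB) (cv C (x, y) cC)).
have : \forall p \near ((x, y) : R * R),
    `|A y * S x + B y * C x - (A p.2 * S p.1 + B p.2 * C p.1)| < e.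
  exact: cG _ (nbhsx_ballx _ e e0).
move=> /nbhs_ballP[d /= d0 H]; exists d => // x' y' xx yy.
rewrite distrC; apply: (H (x', y')).
by split; rewrite /ball /= distrC.
Qed.

(** After rotation by [- phi] the point has coordinates [p > 0] and [q], so its angle differs from
    [phi] by [atan (q / p)]. *)
Lemma near_polar (phi : R) (d : R) : 0 < d -> exists2 e : R, 0 < e & forall a c : R,
  0 < a * cos phi + c * sin phi ->
  `|(c * cos phi - a * sin phi) / (a * cos phi + c * sin phi)| < e ->
  exists psi rho : R, [/\ `|psi - phi| < d, 0 < rho, a = rho * cos psi & c = rho * sin psi].
Proof.
move=> d0; have /cvgrPdist_lt/(_ d d0)/near_real[e e0 He] := @continuous_atan R 0.
exists e => // a c; set p := a * _ + _; set q := c * _ - _ => p0 qp.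
pose t := atan (q / p); have ct : 0 < cos t.
  by apply: cos_gt0_pihalf; rewrite atan_gtNpi2 atan_ltpi2.
have td : `|t| < d.
  by have := He (q / p); rewrite subr0 atan0 sub0r normrN; apply.
have tt : sin t / cos t = q / p by exact: atanK.
have st : sin t = q / p * cos t by rewrite -tt divfK// gt_eqF.
have cs := cos2Dsin2 phi.
exists (phi + t), (p / cos t); split.
- by rewrite addrC addKr.
- exact: divr_gt0.
- rewrite cosD st [RHS](_ : _ = p * cos phi - q * sin phi); last by field; rewrite !gt_eqF.
  by rewrite -[LHS]mulr1 -cs /p /q; ring.
- rewrite sinD st [RHS](_ : _ = p * sin phi + q * cos phi); last by field; rewrite !gt_eqF.
  by rewrite -[LHS]mulr1 -cs /p /q; ring.
Qed.

(** A nonzero momentum means that the polar angle is strictly monotone along the curve and can be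
    its parameter; the curvature identity becomes the equation for the logarithm of the radius. The
    clause on every [d'] says that the graph exhausts the mirror near [u], with angles as close to
    [phi1] as desired. *)
Lemma angular_graph U (f1 f2 f3 f4 : 'rV[R]_2 -> R) (b phi1 rho1 : R) u :
  mirror_patch U f1 f2 f3 f4 b -> U u -> f1 u = b -> 0 < rho1 ->
  f3 u = rho1 * cos phi1 -> f4 u = rho1 * sin phi1 ->
  (forall v, U v -> f1 v = b -> momentum f1 f3 f4 v != 0) ->
  exists (V : R -> 'rV[R]_2) (m n : R -> R) (d : R), [/\ 0 < d <= 1,
    forall phi, `|phi - phi1| < d -> [/\ U (V phi) /\ f1 (V phi) = b,
      f3 (V phi) = expR (m phi) * cos phi, f4 (V phi) = expR (m phi) * sin phi,
      is_derive phi 1 m (n phi) &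
      is_derive phi 1 n ((1 + n phi ^+ 2) * (1 - expR (2 * m phi)))],
    V phi1 = u,
    forall Q : set 'rV[R]_2, nbhs u Q -> \forall phi \near phi1, Q (V phi) &
    forall d', 0 < d' <= d ->
      \forall v \near u, f1 v = b -> exists2 phi, `|phi - phi1| < d' & v = V phi].
Proof.
move=> [P M] Uu fu rho10 w3 w4 mom; have oU := patch_open P.
have [s1 s2 s3 s4] := patch_smooth P; have [sv3 sv4] := smooth_vel P.
have [g0 _ _] := M u Uu fu.
have [X [Y [l [d0 [r [d00 r0 c0 cs cov]]]]]] := level_curve oU Uu s1 g0.
pose c s := pt (X s) (Y s); pose n0 := dx f1 u ^+ 2 + dy f1 u ^+ 2.
have n00 : 0 < n0.
  case/orP: g0 => h; first by rewrite ltr_pwDl ?sqr_ge0// exprn_even_gt0.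
  by rewrite ltr_wpDl ?sqr_ge0// exprn_even_gt0.
have Uc s : `|s| < d0 -> U (c s) by case/cs.
have fc s : `|s| < d0 -> f1 (c s) = b by case/cs => _ ->.
have lp s : `|s| < d0 -> 0 < l s by case/cs => _ _ [].
have dc (h : 'rV[R]_2 -> R) (s L : R) : `|s| < d0 -> has_D f1 (c s) h L ->
    is_derive s 1 (fun s => h (c s)) (l s * L).
  move=> sd [hx [hy [H ->]]]; have [_ _ _ dX dY] := cs s sd.
  apply: (isd_eq (has_grad_curve dX dY H)); rewrite -/(c s); ring.
have dcs (h : 'rV[R]_2 -> R) (s : R) : smooth_on U h -> `|s| < d0 ->
    is_derive s 1 (fun s => h (c s)) (l s * wedge f1 h (c s)).
  by move=> sh sd; apply: dc => //; apply: has_D_smooth sh _; exact: Uc.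
have cc (h : 'rV[R]_2 -> R) (s : R) : smooth_on U h -> `|s| < d0 -> {for s, continuous (fun s => h (c s))}.
  by move=> sh sd; exact: is_derive_continuous (dcs h s sh sd).
have cl (s : R) : `|s| < d0 -> {for s, continuous l}.
  move=> sd; pose k v := dx f1 u * dx f1 v + dy f1 u * dy f1 v.
  have sk : smooth_on U k.
    by rewrite /k; smooth.
  have kE t : `|t| < d0 -> k (c t) != 0 /\ l t = n0 * (k (c t))^-1.
    move=> td; have [_ _ [l0 E] _ _] := cs t td.
    have k0 : k (c t) != 0.
      by apply/eqP => z; move: E; rewrite -/(c t) -/(k (c t)) z mulr0 -/n0 => /esym/eqP; rewrite gt_eqF.
    by split => //; rewrite -/n0 in E; rewrite -E mulfK.
  have [k0 ls] := kE s sd.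
  have ck : {for s, continuous (fun t => n0 * (k (c t))^-1)}.
    exact: cvgM (cvg_cst _) (cvgV k0 (cc k s sk sd)).
  have nt : \forall t \near s, `|t| < d0.
    apply/near_real; exists (d0 - `|s|); first by rewrite subr_gt0.
    by move=> t ts; rewrite -[t](subrK s) (le_lt_trans (ler_normD _ _))// -ltrBrDr.
  apply: near_lt_continuous => e e0.
  move/cvgrPdist_lt : ck => /(_ e e0); apply: filterS2 nt => t td.
  by rewrite distrC ls (kE t td).2.
pose W := momentum f1 f3 f4; have W0 : W u != 0 by exact: mom.
(* With this sign the function [G] below, whose zeros put [w] on the line of angle [phi], has
   positive derivative in [s] at the base point for either orientation of the curve. *)
pose sg : R := if 0 < W u then 1 else - 1.
have sW : 0 < sg * W u.
  rewrite /sg; case: ifPn => [|]; first by rewrite mul1r.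
  by rewrite -leNgt le_eqVlt (negbTE W0)/= mulN1r oppr_gt0.
have sg0 : sg != 0 by rewrite /sg; case: ifP; rewrite ?oppr_eq0 oner_eq0.
pose G phi s := f4 (c s) * (sg * cos phi) + f3 (c s) * (- sg * sin phi).
pose Gp phi s := f4 (c s) * (- sg * sin phi) + f3 (c s) * (- sg * cos phi).
pose Gs phi s := (l s * vel4 f1 f4 (c s)) * (sg * cos phi) + (l s * vel3 f1 f3 (c s)) * (- sg * sin phi).
have ccos x : {for x, continuous (fun y : R => sg * cos y)}.
  exact: cvgM (cvg_cst _) (@continuous_cos R x).
have ccosN x : {for x, continuous (fun y : R => - sg * cos y)}.
  exact: cvgM (cvg_cst _) (@continuous_cos R x).
have csinN x : {for x, continuous (fun y : R => - sg * sin y)}.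
  exact: cvgM (cvg_cst _) (@continuous_sin R x).
have c0u : c 0 = u by [].
have d0' : `|(0 : R)| < d0 by rewrite normr0.
have W1 : W u = rho1 * (cos phi1 * vel4 f1 f4 u - sin phi1 * vel3 f1 f3 u).
  by rewrite /W /momentum w3 w4; ring.
have [d1 [e1 [g [[d10 e10 d1r e1r] [g1 gG guniq dg]]]]] :
  exists d e : R, exists2 g : R -> R,
  [/\ 0 < d, 0 < e, d <= d0 & e <= d0] & [/\ g phi1 = 0,
  forall x, `|x - phi1| < d -> `|g x - 0| < e /\ G x (g x) = 0,
  forall x y, `|x - phi1| < d -> `|y - 0| < e -> G x y = 0 -> y = g x &
  forall x : R, `|x - phi1| < d -> is_derive x 1 g (- Gp x (g x) / Gs x (g x))].
  apply: (@implicit_function R G Gp Gs phi1 0 d0 d00).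
  - move=> x s _ _; rewrite /G /Gp.
    have h1 := isdM (is_derive_cst sg x 1) (is_derive_cos x).
    have h2 := isdM (is_derive_cst (- sg) x 1) (is_derive_sin x).
    apply: (isd_eq (is_deriveD (isdM (is_derive_cst (f4 (c s)) x 1) h1)
      (isdM (is_derive_cst (f3 (c s)) x 1) h2))); rewrite /=; ring.
  - move=> x s _; rewrite subr0 => sd; rewrite /G /Gs.
    apply: (isd_eq (is_deriveD (isdM (dcs f4 s s4 sd) (is_derive_cst (sg * cos x) s 1))
      (isdM (dcs f3 s s3 sd) (is_derive_cst (- sg * sin x) s 1)))).
    by rewrite /vel3 /vel4 /=; ring.
  - move=> x s _; rewrite subr0 => sd.
    exact: (continuous_prod_eps (cc f4 s s4 sd) (cc f3 s s3 sd) (csinN x) (ccosN x)).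
  - move=> x s _; rewrite subr0 => sd.
    exact: (continuous_prod_eps (cvgM (cl s sd) (cc _ s sv4 sd)) (cvgM (cl s sd) (cc _ s sv3 sd))
      (ccos x) (csinN x)).
  - by rewrite /G c0u w3 w4; ring.
  - have -> : Gs phi1 0 = l 0 * (sg * W u) / rho1.
      by rewrite /Gs c0u W1; field; rewrite gt_eqF.
    by rewrite divr_gt0// mulr_gt0// lp.
pose rho phi := f3 (c (g phi)) * cos phi + f4 (c (g phi)) * sin phi.
have gd phi : `|phi - phi1| < d1 -> `|g phi| < d0.
  by move=> h; have [] := gG phi h; rewrite subr0 => h1 _; exact: lt_le_trans e1r.
have cg (phi : R) : `|phi - phi1| < d1 -> {for phi, continuous g}.
  by move=> h; exact: is_derive_continuous (dg phi h).
have wE phi : `|phi - phi1| < d1 -> f3 (c (g phi)) = rho phi * cos phi /\ f4 (c (g phi)) = rho phi * sin phi.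
  move=> h; have [_ Gz] := gG phi h; have cs1 := cos2Dsin2 phi.
  have Gz' : f4 (c (g phi)) * cos phi - f3 (c (g phi)) * sin phi = 0.
    by apply: (mulfI sg0); rewrite mulr0 -Gz /G; ring.
  rewrite /rho; split.
    transitivity (f3 (c (g phi)) * (cos phi ^+ 2 + sin phi ^+ 2) +
      sin phi * (f4 (c (g phi)) * cos phi - f3 (c (g phi)) * sin phi)); last by ring.
    by rewrite cs1 Gz'; ring.
  transitivity (f4 (c (g phi)) * (cos phi ^+ 2 + sin phi ^+ 2) -
    cos phi * (f4 (c (g phi)) * cos phi - f3 (c (g phi)) * sin phi)); last by ring.
  by rewrite cs1 Gz'; ring.
have cch (h : 'rV[R]_2 -> R) (phi : R) : smooth_on U h -> `|phi - phi1| < d1 ->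
    {for phi, continuous (fun x => h (c (g x)))}.
  move=> sh hp; apply: (@continuous_comp _ _ _ g (fun s => h (c s))); first exact: cg.
  exact: cc sh (gd _ hp).
have p1 : `|phi1 - phi1| < d1 by rewrite subrr normr0.
have crho : {for phi1, continuous rho}.
  exact: cvgD (cvgM (cch f3 phi1 s3 p1) (@continuous_cos R phi1))
    (cvgM (cch f4 phi1 s4 p1) (@continuous_sin R phi1)).
have rho1E : rho phi1 = rho1.
  rewrite /rho g1 c0u w3 w4 -[RHS]mulr1 -(cos2Dsin2 phi1); ring.
have /near_real[d2 d20 rhop] : \forall phi \near phi1, 0 < rho phi.
  by apply: (cvgr_gt _ crho); rewrite rho1E.
(* [d2] keeps [rho > 0], which selects one ray of the line; the bound 1 ensures later that two such
   angles differ by less than [pi]. *)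
pose d := Num.min (Num.min d1 d2) 1; have dp : 0 < d <= 1 by rewrite !lt_min d10 d20 ltr01 ge_min lexx orbT.
have dd1 phi : `|phi - phi1| < d -> `|phi - phi1| < d1 by rewrite !lt_min -andbA => /andP[].
have rpos phi : `|phi - phi1| < d -> 0 < rho phi by rewrite !lt_min -andbA => /and3P[_ h _]; exact: rhop.
pose V phi := c (g phi).
pose N2 v := f3 v * f3 v + f4 v * f4 v.
have N2E phi : `|phi - phi1| < d -> N2 (V phi) = rho phi ^+ 2.
  move=> h; have [e3 e4] := wE phi (dd1 _ h).
  by rewrite /N2 /V e3 e4 -[RHS]mulr1 -(cos2Dsin2 phi); ring.
have UV phi : `|phi - phi1| < d -> U (V phi) by move=> h; apply/Uc/gd/dd1.
have fV phi : `|phi - phi1| < d -> f1 (V phi) = b by move=> h; apply/fc/gd/dd1.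
have WV phi : `|phi - phi1| < d -> W (V phi) != 0 by move=> h; apply: mom; [exact: UV|exact: fV].
have dV (h : 'rV[R]_2 -> R) (phi L : R) : `|phi - phi1| < d -> has_D f1 (V phi) h L ->
    is_derive phi 1 (fun x => h (V x)) (L * (N2 (V phi) / W (V phi))).
  move=> hp hD; have h1 := dd1 _ hp; have sd := gd _ h1.
  have := isd_comp (dc h (g phi) L sd hD) (dg phi h1); move=> /isd_eq; apply.
  have [e3 e4] := wE phi h1; have r1 := rpos phi hp; have Wn := WV phi hp.
  rewrite N2E// /Gp /Gs.
  have l0 : l (g phi) != 0 by rewrite gt_eqF// lp.
  have cs1 := cos2Dsin2 phi.
  move: Wn; rewrite /W /momentum -/(V phi) in e3 e4 *; rewrite e3 e4.
  move: (vel3 f1 f3 (V phi)) (vel4 f1 f4 (V phi)) (rho phi) (l (g phi)) r1 l0 => p3 p4 q k q0 k0.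
  rewrite (_ : q * cos phi * p4 - q * sin phi * p3 = q * (p4 * cos phi - p3 * sin phi)); last by ring.
  rewrite mulf_eq0 negb_or => /andP[qn wn].
  rewrite (_ : - (q * sin phi * (- sg * sin phi) + _) = sg * q * (cos phi ^+ 2 + sin phi ^+ 2)); last by ring.
  rewrite (_ : k * p4 * (sg * cos phi) + _ = sg * k * (p4 * cos phi - p3 * sin phi)); last by ring.
  rewrite cs1; move: (p4 * _ - _) wn => z zn.
  by field; rewrite sg0 k0 zn qn.
have D3 v : U v -> has_D f1 v f3 (vel3 f1 f3 v) by exact: has_D_smooth.
have D4 v : U v -> has_D f1 v f4 (vel4 f1 f4 v) by exact: has_D_smooth.
have DV3 v : U v -> has_D f1 v (vel3 f1 f3) (wedge f1 (vel3 f1 f3) v) by exact: has_D_smooth.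
have DV4 v : U v -> has_D f1 v (vel4 f1 f4) (wedge f1 (vel4 f1 f4) v) by exact: has_D_smooth.
pose S v := f3 v * vel3 f1 f3 v + f4 v * vel4 f1 f4 v.
(* The logarithm of the radius and its derivative in the angle, [<w, w'> / det(w, w')]. *)
pose m phi := ln (N2 (V phi)) / 2; pose n phi := S (V phi) / W (V phi).
have N20 phi : `|phi - phi1| < d -> 0 < N2 (V phi) by move=> h; rewrite N2E// exprn_gt0// rpos.
have em phi : `|phi - phi1| < d -> expR (m phi) = rho phi.
  move=> h; rewrite /m N2E// lnXn ?rpos// -[X in X / 2]mulr_natr mulfK ?lnK// posrE; exact: rpos.
exists V, m, n, d; split => //.
- move=> phi h; have [e3 e4] := wE phi (dd1 _ h); have Uv := UV phi h.
  have C := curvature P M Uv (fV phi h); have Wn := WV phi h; have Np := N20 phi h.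
  have e2m : expR (2 * m phi) = N2 (V phi).
    by rewrite /m mulrC divfK// lnK// posrE.
  split; [by split => //; exact: fV|by rewrite em|by rewrite em| |].
  + have DN := has_DD (has_DM (D3 _ Uv) (D3 _ Uv)) (has_DM (D4 _ Uv) (D4 _ Uv)).
    have := dV N2 phi _ h DN => dN.
    have dl := @isd_comp R (@ln R) (fun x => N2 (V x)) phi _ _ (is_derive1_ln Np) dN.
    have := isdM dl (is_derive_cst (2^-1 : R) phi 1).
    move=> /isd_eq; apply; rewrite /n /S mulr0 add0r.
    rewrite /=; move: (N2 (V phi)) (W (V phi)) (lt0r_neq0 Np) Wn => ? ? ? ?; field; exact/andP.
  have DW := has_DD (has_DM (D3 _ Uv) (DV4 _ Uv)) (has_DN (has_DM (D4 _ Uv) (DV3 _ Uv))).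
  have DS := has_DD (has_DM (D3 _ Uv) (DV3 _ Uv)) (has_DM (D4 _ Uv) (DV4 _ Uv)).
  have := dV (fun v => S v / W v) phi _ h (has_DM DS (has_DV Wn DW)).
  move=> /isd_eq; apply; rewrite e2m /n; move: Wn C Np; rewrite /W /momentum /S /N2 /speed2.
  move: (f3 (V phi)) (f4 (V phi)) (vel3 f1 f3 (V phi)) (vel4 f1 f4 (V phi))
    (wedge f1 (vel3 f1 f3) (V phi)) (wedge f1 (vel4 f1 f4) (V phi)) => F3 F4 p3 p4 Q3 Q4 Wn C _.
  apply/eqP; rewrite -subr_eq0; apply/eqP.
  transitivity (- (F3 * F3 + F4 * F4) ^+ 2 / (F3 * p4 - F4 * p3) ^+ 3 *
    ((p3 * Q4 - p4 * Q3) - (p3 ^+ 2 + p4 ^+ 2) * (F3 * p4 - F4 * p3))); last first.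
    by rewrite C subrr mulr0.
  by field.
- by rewrite /V g1.
- move=> Q /near_square[q q0 HQ].
  have cX : {for phi1, continuous (fun phi => X (g phi))}.
    apply: (@continuous_comp _ _ _ g X); first exact: cg.
    by rewrite g1; have [_ _ _ h _] := cs 0 d0'; exact: is_derive_continuous h.
  have cY : {for phi1, continuous (fun phi => Y (g phi))}.
    apply: (@continuous_comp _ _ _ g Y); first exact: cg.
    by rewrite g1; have [_ _ _ _ h] := cs 0 d0'; exact: is_derive_continuous h.
  have [uX uY] : u 0 0 = X 0 /\ u 0 1 = Y 0 by rewrite -c0 pt0 pt1.
  near=> phi; apply: HQ; rewrite /V /c ?pt0 ?pt1 ?uX ?uY -g1 distrC.
    by near: phi; move/cvgrPdist_lt : cX; exact.
  by near: phi; move/cvgrPdist_lt : cY; exact.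
move=> d' /andP[d'0 d'd]; have [e3 e30 pol] := near_polar phi1 d'0.
have cf3 := smooth_on_continuous s3 Uu; have cf4 := smooth_on_continuous s4 Uu.
have ca : {for u, continuous (fun v => f3 v * cos phi1 + f4 v * sin phi1)}.
  exact: cvgD (cvgM cf3 (cvg_cst _)) (cvgM cf4 (cvg_cst _)).
have cb : {for u, continuous (fun v => f4 v * cos phi1 - f3 v * sin phi1)}.
  exact: cvgB (cvgM cf4 (cvg_cst _)) (cvgM cf3 (cvg_cst _)).
have au : f3 u * cos phi1 + f4 u * sin phi1 = rho1.
  by rewrite w3 w4 -[RHS]mulr1 -(cos2Dsin2 phi1); ring.
have bu : f4 u * cos phi1 - f3 u * sin phi1 = 0 by rewrite w3 w4; ring.
have an0 : f3 u * cos phi1 + f4 u * sin phi1 != 0 by rewrite au gt_eqF.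
have cq : {for u, continuous (fun v => (f4 v * cos phi1 - f3 v * sin phi1) /
    (f3 v * cos phi1 + f4 v * sin phi1))}.
  exact: cvgM cb (cvgV an0 ca).
have n1 : \forall v \near u, 0 < f3 v * cos phi1 + f4 v * sin phi1.
  by apply: (cvgr_gt _ ca); rewrite au.
have n2 : \forall v \near u, `|(f4 v * cos phi1 - f3 v * sin phi1) /
    (f3 v * cos phi1 + f4 v * sin phi1)| < e3.
  move/cvgrPdist_lt: cq => /(_ e3 e30); apply: filterS => v.
  by rewrite bu mul0r sub0r normrN.
pose K := `|dx f1 u| + `|dy f1 u| + 1; have K0 : 0 < K by rewrite ltr_wpDl// addr_ge0.
have n3 : \forall v \near u, `|(v : 'rV[R]_2) 0 0 - u 0 0| < e1 * n0 / K /\ `|v 0 1 - u 0 1| < e1 * n0 / K.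
  by apply/near_square; exists (e1 * n0 / K) => //; rewrite divr_gt0// mulr_gt0.
have n4 : \forall v \near u, `|(v : 'rV[R]_2) 0 0 - u 0 0| < r /\ `|v 0 1 - u 0 1| < r.
  by apply/near_square; exists r.
have H : \forall v \near u, [/\ 0 < f3 v * cos phi1 + f4 v * sin phi1,
    `|(f4 v * cos phi1 - f3 v * sin phi1) / (f3 v * cos phi1 + f4 v * sin phi1)| < e3,
    `|(v : 'rV[R]_2) 0 0 - u 0 0| < e1 * n0 / K /\ `|v 0 1 - u 0 1| < e1 * n0 / K &
    `|(v : 'rV[R]_2) 0 0 - u 0 0| < r /\ `|v 0 1 - u 0 1| < r].
  by near=> v; split; near: v.
apply: filterS H => v [h1 h2 [k0 k1] [v0 v1]] fv.
have [psi [q [psid q0 E3 E4]]] := pol _ _ h1 h2.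
exists psi => //; rewrite -fu in fv.
have [s [sd sE] vE] := cov v v0 v1 fv.
rewrite /V vE; congr (c _); apply: guniq; first exact/dd1/(lt_le_trans psid).
  rewrite subr0 -(ltr_pM2r n00) -{1}(gtr0_norm n00) -normrM sE.
  apply: le_lt_trans (ler_normD _ _) _; rewrite !normrM normrN.
  apply: (@le_lt_trans _ _ ((`|dx f1 u| + `|dy f1 u|) * (e1 * n0 / K))).
    by rewrite mulrDl addrC lerD// ler_wpM2l// ltW.
  rewrite -ltr_pdivlMr ?divr_gt0// ?mulr_gt0// invf_div mulrCA divff ?mulr1; last by rewrite gt_eqF// mulr_gt0.
  by rewrite /K ltrDl.
by rewrite /G -[c s]/(pt (X s) (Y s)) -vE E3 E4; ring.
Unshelve. all: by end_near. Qed.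

End AngularGraph.

(** * The elliptic equation for [|w|^2 - 1] *)

Section RadiusEquation.
Variable R : realType.
Implicit Types (u v w : 'rV[R]_2) (U : set 'rV[R]_2) (f g h : 'rV[R]_2 -> R).

Definition unit_defect f g v : R := f v * f v + g v * g v - 1.

Section Patch.
Variables (U : set 'rV[R]_2) (f1 f2 f3 f4 : 'rV[R]_2 -> R).
Hypothesis P : lag_patch U f1 f2 f3 f4.

Let oU := patch_open P.
Let s1 : smooth_on U f1. Proof. by have [] := patch_smooth P. Qed.
Let s2 : smooth_on U f2. Proof. by have [] := patch_smooth P. Qed.
Let s3 : smooth_on U f3. Proof. by have [] := patch_smooth P. Qed.
Let s4 : smooth_on U f4. Proof. by have [] := patch_smooth P. Qed.

Lemma smooth_metric : [/\ smooth_on U (metric_xx f1 f2 f3 f4),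
  smooth_on U (metric_xy f1 f2 f3 f4) & smooth_on U (metric_yy f1 f2 f3 f4)].
Proof.
by split; rewrite /metric_xx /metric_xy /metric_yy /sum4 /ptmul; smooth.
Qed.

Lemma smooth_trace_op h : smooth_on U h -> smooth_on U (trace_op f1 f2 f3 f4 h).
Proof.
by have [sxx sxy syy] := smooth_metric; move=> sh; rewrite /trace_op /elliptic_part; smooth.
Qed.

Lemma smooth_det_metric : smooth_on U (det_metric f1 f2 f3 f4).
Proof.
have [sxx sxy syy] := smooth_metric.
rewrite (_ : det_metric f1 f2 f3 f4 = fun v => metric_xx f1 f2 f3 f4 v * metric_yy f1 f2 f3 f4 v -
  metric_xy f1 f2 f3 f4 v * metric_xy f1 f2 f3 f4 v); first by smooth.
by apply/funext => v; rewrite /det_metric expr2.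
Qed.

Lemma smooth_radius : smooth_on U (unit_defect f3 f4).
Proof. by rewrite /unit_defect; smooth. Qed.

(** [lag_patch] provides [c1] and [c2] point by point. Pairing the equation with the two tangent
    vectors gives a linear system with the metric as matrix, and Cramer's rule writes them as smooth
    functions. *)
Lemma shrinker_drift : exists k1 k2 : 'rV[R]_2 -> R, [/\ smooth_on U k1, smooth_on U k2 &
  forall v, U v -> forall f, (f = f3 \/ f = f4) ->
    trace_op f1 f2 f3 f4 f v + det_metric f1 f2 f3 f4 v * f v = k1 v * dx f v + k2 v * dy f v].
Proof.
have [sxx sxy syy] := smooth_metric; have sd := smooth_det_metric.
have sdV : smooth_on U (fun v => (det_metric f1 f2 f3 f4 v)^-1).
  by apply: smooth_onV => // v Uv; rewrite gt_eqF// (det_metric_gt0 P).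
pose V f v := trace_op f1 f2 f3 f4 f v + det_metric f1 f2 f3 f4 v * f v.
have sV f : smooth_on U f -> smooth_on U (V f).
  by move=> sf; have := smooth_trace_op sf; rewrite /V => st; smooth.
have sV1 := sV _ s1; have sV2 := sV _ s2; have sV3 := sV _ s3; have sV4 := sV _ s4.
pose A v := V f1 v * dx f1 v + V f2 v * dx f2 v + V f3 v * dx f3 v + V f4 v * dx f4 v.
pose B v := V f1 v * dy f1 v + V f2 v * dy f2 v + V f3 v * dy f3 v + V f4 v * dy f4 v.
have sA : smooth_on U A by rewrite /A; smooth.
have sB : smooth_on U B by rewrite /B; smooth.
exists (fun v => (metric_yy f1 f2 f3 f4 v * A v - metric_xy f1 f2 f3 f4 v * B v) *
    (det_metric f1 f2 f3 f4 v)^-1).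
exists (fun v => (metric_xx f1 f2 f3 f4 v * B v - metric_xy f1 f2 f3 f4 v * A v) *
    (det_metric f1 f2 f3 f4 v)^-1).
split; [by smooth|by smooth|].
move=> v Uv f ff; have [c1 [c2 [E1 E2 E3 E4]]] := patch_shrinker P Uv.
have d0 : det_metric f1 f2 f3 f4 v != 0 by rewrite gt_eqF// (det_metric_gt0 P).
have EA : A v = c1 * metric_xx f1 f2 f3 f4 v + c2 * metric_xy f1 f2 f3 f4 v.
  rewrite /A /V E1 E2 E3 E4 /metric_xx /metric_xy /sum4 /ptmul; ring.
have EB : B v = c1 * metric_xy f1 f2 f3 f4 v + c2 * metric_yy f1 f2 f3 f4 v.
  rewrite /B /V E1 E2 E3 E4 /metric_yy /metric_xy /sum4 /ptmul; ring.
have -> : (metric_yy f1 f2 f3 f4 v * A v - metric_xy f1 f2 f3 f4 v * B v) *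
    (det_metric f1 f2 f3 f4 v)^-1 = c1.
  rewrite (_ : _ - _ = c1 * det_metric f1 f2 f3 f4 v) ?mulfK//.
  by rewrite EA EB /det_metric; ring.
have -> : (metric_xx f1 f2 f3 f4 v * B v - metric_xy f1 f2 f3 f4 v * A v) *
    (det_metric f1 f2 f3 f4 v)^-1 = c2.
  rewrite (_ : _ - _ = c2 * det_metric f1 f2 f3 f4 v) ?mulfK//.
  by rewrite EA EB /det_metric; ring.
by case: ff => ->.
Qed.

Lemma radius_grad v : U v -> dx (unit_defect f3 f4) v = 2 * (f3 v * dx f3 v + f4 v * dx f4 v) /\
  dy (unit_defect f3 f4) v = 2 * (f3 v * dy f3 v + f4 v * dy f4 v).
Proof.
move=> Uv; have g3 := smooth_has_grad s3 Uv; have g4 := smooth_has_grad s4 Uv.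
have [_ e1 e2] := has_gradB (has_gradD (has_gradM g3 g3) (has_gradM g4 g4)) (has_grad_cst 1 v).
by split; [apply: etrans e1 _|apply: etrans e2 _]; ring.
Qed.

(* The trace of the projection of a Lagrangian plane to a complex line is 1,
   whence the zeroth order term. *)
Lemma radius_trace v (k1 k2 : R) : U v -> (forall f, (f = f3 \/ f = f4) ->
    trace_op f1 f2 f3 f4 f v + det_metric f1 f2 f3 f4 v * f v = k1 * dx f v + k2 * dy f v) ->
  trace_op f1 f2 f3 f4 (unit_defect f3 f4) v = k1 * dx (unit_defect f3 f4) v + k2 * dy (unit_defect f3 f4) v -
    2 * det_metric f1 f2 f3 f4 v * unit_defect f3 f4 v.
Proof.
move=> Uv E; have E3 := E f3 (or_introl erefl); have E4 := E f4 (or_intror erefl).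
have nU : \forall w \near v, U w by exact: open_nbhs_nbhs.
have G f : smooth_on U f -> has_grad f v (dx f v) (dy f v).
  by move=> sf; exact: smooth_has_grad sf Uv.
have second g3 g4 h : smooth_on U g3 -> smooth_on U g4 ->
    (forall w, U w -> h w = 2 * (f3 w * g3 w + f4 w * g4 w)) ->
    has_grad h v (2 * (f3 v * dx g3 v + g3 v * dx f3 v + (f4 v * dx g4 v + g4 v * dx f4 v)))
      (2 * (f3 v * dy g3 v + g3 v * dy f3 v + (f4 v * dy g4 v + g4 v * dy f4 v))).
  move=> sg3 sg4 H.
  have := has_gradM (has_grad_cst 2 v) (has_gradD (has_gradM (G _ s3) (G _ sg3)) (has_gradM (G _ s4) (G _ sg4))).
  move=> /(has_grad_near (g := h)) K.
  by apply: has_grad_eq (K _) _ _; [apply: filterS nU => w Uw; rewrite H|rewrite /=; ring|rewrite /=; ring].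
have [_ xx _] := second _ _ _ (smooth_dx s3) (smooth_dx s4) (fun w Uw => (radius_grad Uw).1).
have [_ xy yy] := second _ _ _ (smooth_dy s3) (smooth_dy s4) (fun w Uw => (radius_grad Uw).2).
have [e1 e2] := radius_grad Uv.
have lag := patch_lag P Uv.
have tr1 : metric_yy f1 f2 f3 f4 v * (dx f3 v ^+ 2 + dx f4 v ^+ 2) -
    2 * metric_xy f1 f2 f3 f4 v * (dx f3 v * dy f3 v + dx f4 v * dy f4 v) +
    metric_xx f1 f2 f3 f4 v * (dy f3 v ^+ 2 + dy f4 v ^+ 2) = det_metric f1 f2 f3 f4 v.
  apply/eqP; rewrite -subr_eq0; apply/eqP.
  transitivity ((wedge f1 f2 v + wedge f3 f4 v) * (wedge f3 f4 v - wedge f1 f2 v)).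
    by rewrite /det_metric /metric_xx /metric_xy /metric_yy /sum4 /ptmul /wedge; ring.
  by rewrite lag mul0r.
rewrite /trace_op /elliptic_part xx xy yy e1 e2 /unit_defect.
move: E3 E4 tr1; rewrite /trace_op /elliptic_part.
move: (metric_xx f1 f2 f3 f4 v) (metric_xy f1 f2 f3 f4 v) (metric_yy f1 f2 f3 f4 v)
  (det_metric f1 f2 f3 f4 v) => mx mxy my de E3 E4 tr1.
apply/eqP; rewrite -subr_eq0; apply/eqP.
transitivity (2 * f3 v * (my * dx (dx f3) v + 2 * - mxy * dx (dy f3) v + mx * dy (dy f3) v + de * f3 v
    - (k1 * dx f3 v + k2 * dy f3 v)) + 2 * f4 v * (my * dx (dx f4) v + 2 * - mxy * dx (dy f4) v +
    mx * dy (dy f4) v + de * f4 v - (k1 * dx f4 v + k2 * dy f4 v)) +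
  2 * (my * (dx f3 v ^+ 2 + dx f4 v ^+ 2) - 2 * mxy * (dx f3 v * dy f3 v + dx f4 v * dy f4 v) +
    mx * (dy f3 v ^+ 2 + dy f4 v ^+ 2) - de)); first by ring.
by rewrite E3 E4 tr1; ring.
Qed.

(** Near [v] the drift and the determinant are bounded, which turns the equation of [radius_trace]
    into the differential inequality of the Carleman estimate. *)
Lemma radius_elliptic v : U v -> exists C r : R, [/\ 0 <= C, 0 < r &
  forall w, square v r w -> U w ->
    `|elliptic_part (metric_yy f1 f2 f3 f4) (fun u => - metric_xy f1 f2 f3 f4 u)
      (metric_xx f1 f2 f3 f4) (unit_defect f3 f4) w| <=
    C * (`|unit_defect f3 f4 w| + `|dx (unit_defect f3 f4) w| + `|dy (unit_defect f3 f4) w|)].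
Proof.
move=> Uv; have [k1 [k2 [sk1 sk2 E]]] := shrinker_drift.
have loc h : smooth_on U h -> exists2 r : R, 0 < r & forall w, square v r w -> `|h w| <= `|h v| + 1.
  move=> sh; have [r r0 H] := continuous_near_lt (smooth_on_continuous sh Uv) ltr01.
  exists r => // w [w0 w1]; rewrite -[h w](subrK (h v)) addrC.
  by apply: le_trans (ler_normD _ _) _; rewrite lerD2l ltW// H.
have [r1 r10 H1] := loc _ sk1; have [r2 r20 H2] := loc _ sk2.
have [r3 r30 H3] := loc _ smooth_det_metric.
pose A := `|k1 v| + 1 + (`|k2 v| + 1) + 2 * (`|det_metric f1 f2 f3 f4 v| + 1).
exists A, (Num.min r1 (Num.min r2 r3)); split.
- by rewrite /A !addr_ge0// mulr_ge0// addr_ge0.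
- by rewrite !lt_min r10 r20.
move=> w; rewrite /square /= !lt_min => -[/and3P[a1 a2 a3] /and3P[b1 b2 b3]] Uw.
have B1 := H1 w (conj a1 b1); have B2 := H2 w (conj a2 b2); have B3 := H3 w (conj a3 b3).
have := radius_trace Uw (E w Uw); rewrite /trace_op => ->.
have n1 := normr_ge0 (unit_defect f3 f4 w); have n2 := normr_ge0 (dx (unit_defect f3 f4) w).
have n3 := normr_ge0 (dy (unit_defect f3 f4) w).
apply: le_trans (ler_normB _ _) _; apply: (@le_trans _ _ ((`|k1 v| + 1) * `|dx (unit_defect f3 f4) w| +
  (`|k2 v| + 1) * `|dy (unit_defect f3 f4) w| + 2 * (`|det_metric f1 f2 f3 f4 v| + 1) * `|unit_defect f3 f4 w|)).
  apply: lerD.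
    by apply: le_trans (ler_normD _ _) _; apply: lerD; rewrite normrM ler_wpM2r.
  by rewrite !normrM (ger0_norm (ler0n _ 2)) ler_wpM2r// ler_wpM2l.
rewrite /A; have q1 : 0 <= `|k1 v| + 1 by rewrite addr_ge0.
have q2 : 0 <= `|k2 v| + 1 by rewrite addr_ge0.
have q3 : 0 <= 2 * (`|det_metric f1 f2 f3 f4 v| + 1) by rewrite mulr_ge0// addr_ge0.
set a := `|k1 v| + 1 in q1 *; set c := `|k2 v| + 1 in q2 *; set e := 2 * _ in q3 *.
set x := `|unit_defect _ _ _| in n1 *; set y := `|dx _ _| in n2 *; set z := `|dy _ _| in n3 *.
rewrite (_ : (a + c + e) * (x + y + z) = a * y + c * z + e * x +
  (a * x + a * z + c * x + c * y + e * y + e * z)); last by ring.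
by rewrite lerDl !addr_ge0// mulr_ge0.
Qed.

Lemma metric_elliptic v : U v -> 0 < metric_yy f1 f2 f3 f4 v /\
  0 < metric_yy f1 f2 f3 f4 v * metric_xx f1 f2 f3 f4 v - (- metric_xy f1 f2 f3 f4 v) ^+ 2.
Proof.
move=> Uv; split; first exact: metric_yy_gt0 P _ Uv.
by have := det_metric_gt0 P Uv; rewrite /det_metric sqrrN mulrC.
Qed.

Lemma radius_closure p : U p ->
  (forall r : R, 0 < r -> exists2 q, square p r q & \forall v \near q, unit_defect f3 f4 v = 0) ->
  \forall v \near p, unit_defect f3 f4 v = 0.
Proof.
move=> Up; have [sxx sxy syy] := smooth_metric.
apply: (@unique_continuation_closure R U _ _ _ _ p oU Up syy (smooth_onN oU sxy) sxx smooth_radius).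
- exact: metric_elliptic.
- exact: radius_elliptic.
Qed.

End Patch.

(** On the mirror the gradients of [f3] and [f4] are proportional, so the gradient of [|w|^2] is
    determined by its tangential derivative, which is 0. Thus both Cauchy data of [unit_defect]
    vanish on the curve [f1 = b]. *)
Lemma radius_across U (f1 f2 f3 f4 : 'rV[R]_2 -> R) (b : R) u :
  mirror_patch U f1 f2 f3 f4 b -> U u -> f1 u = b ->
  (\forall v \near u, f1 v = b -> unit_defect f3 f4 v = 0) ->
  \forall v \near u, unit_defect f3 f4 v = 0.
Proof.
move=> MP Uu fu H0; have [P M] := MP; have oU := patch_open P.
have [s1 s2 s3 s4] := patch_smooth P; have sr := smooth_radius P.
have [sxx sxy syy] := smooth_metric P.
have [C [r [C0 r0 HC]]] := radius_elliptic P Uu.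
have [g0 _ _] := M u Uu fu.
have Z : \forall v \near u, U v /\ \forall w \near v, f1 w = b -> unit_defect f3 f4 w = 0.
  have H1 : \forall v \near u, \forall w \near v, f1 w = b -> unit_defect f3 f4 w = 0.
    by apply: near_join; exact: H0.
  by apply: filterI => //; exact: open_nbhs_nbhs.
have /near_square[r1 r10 H1] := Z.
pose k := Num.min r r1; have k0 : 0 < k by rewrite lt_min r0.
pose V := square u k; have oV : open V by exact: open_square.
have VV v : V v -> square u r v /\ square u r1 v.
  by rewrite /V /square /= !lt_min => -[/andP[a1 a2] /andP[b1 b2]].
have VU : V `<=` U by move=> v /VV[_ [a b']]; have [] := H1 v a b'.
have ss h : smooth_on U h -> smooth_on V h by apply: smooth_on_sub.
apply: (@unique_continuation_across R V (metric_yy f1 f2 f3 f4)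
  (fun u => - metric_xy f1 f2 f3 f4 u) (metric_xx f1 f2 f3 f4)
  (fun v => f1 v - b) (unit_defect f3 f4) u C) => //.
- by split; rewrite subrr normr0.
- exact: ss.
- by apply: ss; exact: smooth_onN.
- exact: ss.
- by apply: ss; apply: (smooth_onB oU s1); exact: smooth_on_cst.
- exact: ss.
- by have [] := metric_elliptic P Uu.
- by have [] := metric_elliptic P Uu.
- by move=> v Vv; apply: HC; [exact: (VV v Vv).1|exact: VU].
- by rewrite fu subrr.
- have [_ -> ->] := has_gradB (smooth_has_grad s1 Uu) (has_grad_cst b u).
  by rewrite !subr0.
move=> v Vv /eqP; rewrite subr_eq0 => /eqP fv.
have [_ [a b']] := VV v Vv; have [Uv nv] := H1 v a b'.
have [dr1 dr2] := radius_grad P Uv; have rk := curve_rank P M Uv fv.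
have wr : wedge f1 (unit_defect f3 f4) v = 0.
  by apply: (level_tangent_near oU Uv s1 sr); rewrite fv.
have A0 : f3 v * vel3 f1 f3 v + f4 v * vel4 f1 f4 v = 0.
  apply: (@mulfI _ 2) => //; rewrite mulr0 -wr /vel3 /vel4 /wedge dr1 dr2; ring.
have sp := speed2_gt0 P M Uv fv.
have kill (q3 q4 : R) : vel3 f1 f3 v * q4 = vel4 f1 f4 v * q3 -> 2 * (f3 v * q3 + f4 v * q4) = 0.
  move=> e; apply: (mulfI (lt0r_neq0 sp)); rewrite mulr0 /speed2.
  transitivity (2 * ((q3 * vel3 f1 f3 v + q4 * vel4 f1 f4 v) * (f3 v * vel3 f1 f3 v + f4 v * vel4 f1 f4 v)
    + (f4 v * vel3 f1 f3 v - f3 v * vel4 f1 f4 v) * (vel3 f1 f3 v * q4 - vel4 f1 f4 v * q3))).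
    by ring.
  by rewrite A0 e subrr; ring.
have rk1 := congr1 ( *%R (dx f1 v)) rk; have rk2 := congr1 ( *%R (dy f1 v)) rk.
rewrite /= in rk1 rk2; have rv : unit_defect f3 f4 v = 0 by exact: (nbhs_singleton nv).
clear - dr1 dr2 kill rk1 rk2 rv.
split => //.
  by rewrite dr1; apply: kill; rewrite /vel3 /vel4 /wedge; lra.
by rewrite dr2; apply: kill; rewrite /vel3 /vel4 /wedge; lra.
Qed.

End RadiusEquation.

(** * Polar coordinates on the mirror *)

Section Outermost.
Variables (R : realType) (T : topologicalType).

Lemma exists_angle (a c : R) : a ^+ 2 + c ^+ 2 != 0 ->
  exists phi rho : R, [/\ 0 < rho, a = rho * cos phi & c = rho * sin phi].
Proof.
move=> n0; pose rho := Num.sqrt (a ^+ 2 + c ^+ 2).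
have n1 : 0 < a ^+ 2 + c ^+ 2 by rewrite lt_neqAle eq_sym n0 addr_ge0// sqr_ge0.
have r0 : 0 < rho by rewrite sqrtr_gt0.
have r2 : rho ^+ 2 = a ^+ 2 + c ^+ 2 by rewrite sqr_sqrtr// ltW.
have rn : rho != 0 by rewrite gt_eqF.
have a1 : -1 <= a / rho <= 1.
  rewrite -ler_norml normrM normfV (gtr0_norm r0) ler_pdivrMr// mul1r.
  by rewrite -(@ler_pXn2r _ 2) ?nnegrE ?(ltW r0)// real_normK ?num_real// r2 lerDl sqr_ge0.
have s1 : sin (acos (a / rho)) = `|c| / rho.
  rewrite sin_acos// (_ : 1 - _ = (c / rho) ^+ 2); last first.
    rewrite !exprMn exprVn r2; field.
    by move: n0; rewrite !expr2.
  by rewrite sqrtr_sqr normrM normfV (gtr0_norm r0).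
have c1 : cos (acos (a / rho)) = a / rho by rewrite acosK// in_itv.
have [c0|c0] := leP 0 c.
  exists (acos (a / rho)), rho; rewrite c1 s1 ger0_norm//.
  by split=> //; rewrite mulrC divfK.
exists (- acos (a / rho)), rho; rewrite cosN sinN c1 s1 ltr0_norm//.
by split=> //; [rewrite mulrC divfK|rewrite mulNr opprK mulrC divfK].
Qed.

Lemma polar_inj (phi psi r s : R) : 0 < r -> 0 < s -> `|psi - phi| < pi ->
  r * cos phi = s * cos psi -> r * sin phi = s * sin psi -> psi = phi /\ r = s.
Proof.
move=> r0 s0 d ec es.
have z : sin (psi - phi) = 0.
  apply: (mulfI (lt0r_neq0 s0)); rewrite mulr0 sinB.
  transitivity (s * sin psi * cos phi - s * cos psi * sin phi); first by ring.
  by rewrite -ec -es; ring.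
have e : psi = phi.
  apply/eqP; rewrite -subr_eq0; apply: contraT => n0.
  have : 0 < sin `|psi - phi| by rewrite sin_gt0_pi// normr_gt0 n0.
  have [h|h] := leP 0 (psi - phi).
    by rewrite ger0_norm// z ltxx.
  by rewrite ltr0_norm// sinN z oppr0 ltxx.
split=> //; rewrite e in ec es.
rewrite -[LHS]mulr1 -[RHS]mulr1 -(cos2Dsin2 phi) !expr2.
transitivity (r * cos phi * cos phi + r * sin phi * sin phi); first by ring.
by rewrite ec es; ring.
Qed.

Variables (X1 X2 X3 X4 : T -> R) (b : R).
Hypothesis D : lag_data X1 X2 X3 X4.
Hypothesis refl : reflective X1 X2 X3 X4 b.
Implicit Types (U : set 'rV[R]_2) (inv : 'rV[R]_2 -> T) (C : set T).

Definition polar_at (y : T) (phi rho : R) : Prop :=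
  [/\ 0 < rho, X3 y = rho * cos phi & X4 y = rho * sin phi].

Definition along phi (y : T) : R := X3 y * cos phi + X4 y * sin phi.
Definition across phi (y : T) : R := X4 y * cos phi - X3 y * sin phi.

Lemma along_across phi y : X3 y = along phi y * cos phi - across phi y * sin phi /\
  X4 y = along phi y * sin phi + across phi y * cos phi.
Proof.
split; rewrite /along /across -[LHS]mulr1 -(cos2Dsin2 phi); ring.
Qed.

Lemma norm_along_across phi y :
  X3 y ^+ 2 + X4 y ^+ 2 = along phi y ^+ 2 + across phi y ^+ 2.
Proof.
rewrite -[LHS]mulr1 -(cos2Dsin2 phi) /along /across; ring.
Qed.

Lemma polar_atE y phi rho : polar_at y phi rho ->
  [/\ along phi y = rho, across phi y = 0 & X3 y ^+ 2 + X4 y ^+ 2 = rho ^+ 2].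
Proof.
move=> [r0 e3 e4]; rewrite /along /across e3 e4; split.
- by rewrite -[RHS]mulr1 -(cos2Dsin2 phi); ring.
- by ring.
- by rewrite -[RHS]mulr1 -(cos2Dsin2 phi); ring.
Qed.

Lemma polar_at_along y phi : 0 <= along phi y -> across phi y = 0 ->
  X3 y ^+ 2 + X4 y ^+ 2 != 0 -> polar_at y phi (along phi y).
Proof.
move=> a0 c0 n0; have [e3 e4] := along_across phi y; rewrite c0 in e3 e4.
split; [|by rewrite [LHS]e3; ring|by rewrite [LHS]e4; ring].
rewrite lt_neqAle a0 andbT; apply/eqP => z.
by move: n0; rewrite (norm_along_across phi) c0 -z expr0n addr0 eqxx.
Qed.

Lemma along_continuous phi : continuous (along phi) /\ continuous (across phi).
Proof.
have [_ _ c3 c4] := data_continuous D.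
split=> y; first exact: cvgD (cvgM (c3 y) (cvg_cst _)) (cvgM (c4 y) (cvg_cst _)).
exact: cvgB (cvgM (c4 y) (cvg_cst _)) (cvgM (c3 y) (cvg_cst _)).
Qed.

Lemma closed_fun_eq (h : T -> R) (c : R) : continuous h -> closed [set y | h y = c].
Proof. by move=> ch; apply: (@preimage_closed _ _ h [set c]) => [y _|]; [exact: ch|exact: closed_eq]. Qed.

Lemma closed_fun_ge (h : T -> R) (c : R) : continuous h -> closed [set y | c <= h y].
Proof.
by move=> ch; apply: (@preimage_closed _ _ h [set z | c <= z]) => [y _|]; [exact: ch|exact: closed_ge].
Qed.

(* On [C] the function [across^2 + (|along| - along)] vanishes exactly on the
   ray, hence is bounded below when [C] avoids it. *)
Lemma ray_avoid C phi : closed C -> (forall y, C y -> X3 y ^+ 2 + X4 y ^+ 2 != 0) ->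
  (forall y rho, C y -> ~ polar_at y phi rho) ->
  exists2 d : R, 0 < d & forall psi y rho, `|psi - phi| < d -> C y -> ~ polar_at y psi rho.
Proof.
move=> cC nC ray; have [[y1 Cy1]|none] := pselect (C !=set0); last first.
  by exists 1 => // psi y rho _ Cy; case: none; exists y.
have [_ _ c3 c4] := data_continuous D; have [ca cx] := along_continuous phi.
pose h y := across phi y * across phi y + (`|along phi y| - along phi y).
have ch : continuous (fun y => - h y).
  move=> y; apply: cvgN; exact: cvgD (cvgM (cx y) (cx y)) (cvgB (cvg_norm (ca y)) (ca y)).
have [y0 Cy0 ymax] := data_max D cC (ex_intro _ y1 Cy1) ch.
have hmin y : C y -> h y0 <= h y by move=> /ymax; rewrite lerN2.
have n0 y : 0 <= `|along phi y| - along phi y by rewrite subr_ge0 ler_norm.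
have h0 : 0 < h y0.
  rewrite lt_neqAle addr_ge0 -?expr2 ?sqr_ge0// andbT; apply/negP => /eqP/esym/eqP.
  rewrite paddr_eq0 ?sqr_ge0// sqrf_eq0 => /andP[/eqP e1]; rewrite subr_eq0 => /eqP e2.
  by apply: (ray y0 (along phi y0) Cy0); apply: polar_at_along => //; [rewrite -e2|exact: nC].
have cN : continuous (fun y => X3 y * X3 y + X4 y * X4 y).
  by move=> x; exact: cvgD (cvgM (c3 x) (c3 x)) (cvgM (c4 x) (c4 x)).
have [z _ zmax] := data_max D closedT (data_nonempty D) cN.
set B := _ + _ in zmax.
have B0 : 0 <= B by rewrite addr_ge0// -expr2 sqr_ge0.
have cs : {for (0 : R), continuous (fun t : R => sin t * sin t)}.
  exact: cvgM (@continuous_sin R 0) (@continuous_sin R 0).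
have n1 : \forall t \near (0 : R), sin t * sin t < h y0 / (B + 1).
  by apply: (cvgr_lt _ cs); rewrite sin0 mul0r divr_gt0// ltr_wpDl.
have n2 : \forall t \near (0 : R), 0 < cos t.
  by apply: (cvgr_gt _ (@continuous_cos R 0)); rewrite cos0.
have /near_real[d d0 Hd] : \forall t \near (0 : R), sin t * sin t < h y0 / (B + 1) /\ 0 < cos t.
  exact: filterI.
exists d => // psi y rho pd Cy P; have [r0 e3 e4] := P.
have [s1 k1] := Hd (psi - phi) ltac:(by rewrite subr0).
have [_ _ N] := polar_atE P.
have E1 : across phi y = rho * sin (psi - phi) by rewrite /across e3 e4 sinB; ring.
have E2 : along phi y = rho * cos (psi - phi) by rewrite /along e3 e4 cosB; ring.
have := hmin y Cy; rewrite leNgt; case/negP.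
rewrite /h E2 ger0_norm; last by rewrite ltW// mulr_gt0.
rewrite subrr addr0 E1 mulrACA.
have rB : rho * rho <= B by have := zmax y I; rewrite -!expr2 N expr2.
apply: (@le_lt_trans _ _ (B * (sin (psi - phi) * sin (psi - phi)))).
  by rewrite ler_wpM2r// -expr2 sqr_ge0.
apply: (@le_lt_trans _ _ ((B + 1) * (sin (psi - phi) * sin (psi - phi)))).
  by rewrite ler_wpM2r ?lerDl// -expr2 sqr_ge0.
by rewrite mulrC -ltr_pdivlMr// ltr_wpDl.
Qed.

Lemma mirror_neq0 x : X1 x = b -> X3 x ^+ 2 + X4 x ^+ 2 != 0.
Proof.
move=> xb; have [U [inv [p [L Up px]]]] := data_chart D x; rewrite -px in xb *.
have := momentum_neq0 D refl L Up xb; apply: contraNneq => /eqP.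
rewrite paddr_eq0 ?sqr_ge0// !sqrf_eq0 => /andP[/eqP e3 /eqP e4].
by rewrite /momentum /= e3 e4 !mul0r subrr.
Qed.

Lemma mirror_graph x phi1 rho1 : X1 x = b -> polar_at x phi1 rho1 ->
  exists (Y : R -> T) (m n : R -> R) (d : R), [/\ 0 < d <= 1,
    forall phi, `|phi - phi1| < d -> [/\ X1 (Y phi) = b, polar_at (Y phi) phi (expR (m phi)),
      is_derive phi 1 m (n phi) &
      is_derive phi 1 n ((1 + n phi ^+ 2) * (1 - expR (2 * m phi)))],
    Y phi1 = x,
    forall Q : set T, nbhs x Q -> \forall phi \near phi1, Q (Y phi) &
    forall d', 0 < d' <= d ->
      \forall y \near x, X1 y = b -> exists2 phi, `|phi - phi1| < d' & y = Y phi].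
Proof.
move=> xb [r0 e3 e4]; have [U [inv [p [L Up px]]]] := data_chart D x.
rewrite -px in xb e3 e4 *.
have [V [m [n [d [d01 HV Vp near_V cov]]]]] :=
  angular_graph (chart_mirror D refl L) Up xb r0 e3 e4 (fun v Uv fv => momentum_neq0 D refl L Uv fv).
exists (inv \o V), m, n, d; split=> //.
- move=> phi h; have [[_ h1] h3 h4 h5 h6] := HV phi h; split => //.
  by split => //; exact: expR_gt0.
- by rewrite /= Vp.
- move=> Q pQ; apply: (near_V [set v | Q (inv v)]).
  exact/(chart_near L Q Up).
move=> d' d'd; have H := cov d' d'd.
apply/(chart_near L (fun y => X1 y = b -> exists2 phi, `|phi - phi1| < d' & y = (inv \o V) phi) Up).
by apply: filterS H => v Hv vb; have [phi h ->] := Hv vb; exists phi.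
Qed.

End Outermost.

(** * The outermost radius *)

Section UnitCircle.
Variables (R : realType) (T : topologicalType).
Variables (X1 X2 X3 X4 : T -> R) (b : R).
Hypothesis D : lag_data X1 X2 X3 X4.
Hypothesis refl : reflective X1 X2 X3 X4 b.
Implicit Types (U : set 'rV[R]_2) (inv : 'rV[R]_2 -> T).

Let polar := polar_at X3 X4.
Let al := along X3 X4.
Let ac := across X3 X4.

Variable c : R.

(** A level of [X2] on the mirror. With both [X1] and [X2] fixed, closeness in [X3] and [X4] alone
    implies closeness on the surface, by [data_embedding]. *)
Let K : set T := [set x | X1 x = b /\ X2 x = c].
Hypothesis K0 : K !=set0.

Let closed_K : closed K.
Proof.
have [c1 c2 _ _] := data_continuous D.
rewrite (_ : K = [set x | X1 x = b] `&` [set x | X2 x = c])//.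
by apply: closedI; exact: closed_fun_eq.
Qed.

Let near_K x : K x -> \forall y \near x, X1 y = b -> K y.
Proof.
move=> [xb xc]; have [U [inv [p [L Up px]]]] := data_chart D x; rewrite -px in xb xc *.
have := mirror_partner_const D refl L Up xb; apply: filterS => y H yb.
by split => //; rewrite -xc; exact: H.
Qed.

Let K_neq0 y : K y -> X3 y ^+ 2 + X4 y ^+ 2 != 0.
Proof. by move=> [yb _]; exact: mirror_neq0 D refl y yb. Qed.

(** The set of angles met is open because [K] is locally a polar graph, closed by compactness
    through [ray_avoid], and nonempty; the real line is connected. *)
Lemma rays_meet phi : exists x rho, K x /\ polar x phi rho.
Proof.
pose B := [set phi : R | exists x rho, K x /\ polar x phi rho].
suff: B phi by [].
apply: clopen_all.
- by apply/connected_intervalP => x y _ _ z _.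
- rewrite openE => psi [x [rho [Kx Px]]].
  have [Y [m [n [d [/andP[d0 _] HY Yx near_Y _]]]]] := mirror_graph D refl Kx.1 Px.
  have H := near_Y _ (near_K Kx).
  have H2 : \forall t \near psi, `|t - psi| < d by apply/near_real; exists d.
  apply: filterS2 H H2 => t KY td; have [h1 h2 _ _] := HY t td.
  by exists (Y t), (expR (m t)); split => //; exact: KY.
- move=> psi cB; apply: contrapT => nB.
  have [d d0 Hd] := ray_avoid D closed_K K_neq0
    (fun y rho Ky P => nB (ex_intro _ y (ex_intro _ rho (conj Ky P)))).
  have [t [[x [rho [Kx Px]]] /= td]] := cB _ (nbhsx_ballx psi d d0).
  by apply: (Hd t x rho) => //; rewrite distrC.
have [x Kx] := K0; have [psi [rho P]] := exists_angle (K_neq0 Kx).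
by exists psi, x, rho.
Qed.

Lemma outermost phi : exists x, [/\ K x, polar x phi (al phi x) &
  forall y rho, K y -> polar y phi rho -> rho <= al phi x].
Proof.
have [ca cx] := along_continuous D phi.
pose A := K `&` ([set y | ac phi y = 0] `&` [set y | 0 <= al phi y]).
have cA : closed A.
  apply: closedI; first exact: closed_K.
  by apply: closedI; [exact: closed_fun_eq|exact: closed_fun_ge].
have inA y rho : K y -> polar y phi rho -> A y /\ al phi y = rho.
  move=> Ky P; have [e1 e2 _] := polar_atE P; have [r0 _ _] := P.
  by split => //; split => //; split => //=; rewrite /al e1 ltW.
have [x0 [rho0 [Kx0 P0]]] := rays_meet phi.
have [x [Kx [/= x1 x2]] xmax] := data_max D cA (ex_intro _ x0 (inA _ _ Kx0 P0).1) ca.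
exists x; split => //; first by apply: polar_at_along => //; exact: K_neq0.
by move=> y rho Ky P; have [Ay <-] := inA y rho Ky P; exact: xmax.
Qed.

(** [xm] is a choice and need not be periodic, but the maximal radius depends only on the ray. *)
Lemma outermost_radius : exists (xm : R -> T) (r : R -> R), [/\
  forall phi, K (xm phi) /\ polar (xm phi) phi (r phi),
  forall phi y rho, K y -> polar y phi rho -> rho <= r phi &
  forall phi, r (phi + pi *+ 2) = r phi].
Proof.
have [xm H] := choice outermost.
exists xm, (fun phi => al phi (xm phi)); split.
- by move=> phi; have [] := H phi.
- by move=> phi y rho Ky P; have [_ _] := H phi; apply: (_ : _ -> _) => h; exact: h Ky P.
move=> phi; have [K1 P1 M1] := H phi; have [K2 P2 M2] := H (phi + pi *+ 2).
have per y rho : polar y (phi + pi *+ 2) rho <-> polar y phi rho.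
  by rewrite /polar /polar_at sinD2pi cosD2pi.
apply/eqP; rewrite eq_le; apply/andP; split.
  by apply: (M1 _ _ K2); apply/per.
by apply: (M2 _ _ K1); apply/per.
Qed.

Section Radius.
Variables (xm : R -> T) (r : R -> R).
Hypothesis Hxm : forall phi, K (xm phi) /\ polar (xm phi) phi (r phi).
Hypothesis rmax : forall phi y rho, K y -> polar y phi rho -> rho <= r phi.

(* The outermost point on a ray is unique since the four functions separate
   points, so the outermost radius is locally the radius of one graph. *)
Lemma outermost_graph phi1 : exists (m n : R -> R) (d : R), [/\ 0 < d,
  forall phi, `|phi - phi1| < d -> [/\ r phi = expR (m phi), is_derive phi 1 m (n phi) &
      is_derive phi 1 n ((1 + n phi ^+ 2) * (1 - expR (2 * m phi)))] &
  \forall y \near xm phi1, X1 y = b ->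
    exists2 phi, `|phi - phi1| < d & X3 y ^+ 2 + X4 y ^+ 2 = r phi ^+ 2].
Proof.
set x1 := xm phi1; have [Kx1 P1] := Hxm phi1; rewrite -/x1 in Kx1 P1.
have [Y [m [n [d [/andP[d0 d1] HY Yx near_Y cov]]]]] := mirror_graph D refl Kx1.1 P1.
have [r1 _ _] := P1; set rho1 := r phi1 in r1 P1.
have Em : expR (m phi1) = rho1.
  have [_ Q _ _] := HY phi1 ltac:(by rewrite subrr normr0).
  rewrite Yx in Q; have [<- _ _] := polar_atE Q; by have [] := polar_atE P1.
have dm phi : `|phi - phi1| < d -> is_derive phi 1 m (n phi) by move=> h; have [] := HY phi h.
have nO : \forall y \near x1, X1 y = b -> exists2 phi, `|phi - phi1| < d & y = Y phi.
  by apply: cov; rewrite d0 lexx.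
have [e0 e00 HO] := data_embedding D nO.
pose e := Num.min e0 rho1; have e_gt0 : 0 < e by rewrite lt_min e00.
have ee0 : e <= e0 by rewrite ge_min lexx.
have er : e <= rho1 by rewrite ge_min lexx orbT.
move: e e_gt0 ee0 er => e e_gt0 ee0 er.
have [_ _ c3 c4] := data_continuous D.
pose far y := `|X3 y - X3 x1| + `|X4 y - X4 x1|.
have cfar : continuous far.
  move=> y; exact: cvgD (cvg_norm (cvgB (c3 y) (cvg_cst _))) (cvg_norm (cvgB (c4 y) (cvg_cst _))).
pose N y := X3 y * X3 y + X4 y * X4 y.
have cN : continuous N.
  by move=> y; exact: cvgD (cvgM (c3 y) (c3 y)) (cvgM (c4 y) (c4 y)).
have NE y : N y = X3 y ^+ 2 + X4 y ^+ 2 by rewrite /N !expr2.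
(* Points of [K] away from [x1] whose radius is not much below [rho1]. The ray of [phi1] avoids [C]:
   on it the radius is at most [rho1], so being far means having smaller radius. Nearby rays avoid
   [C] as well, and their outermost points, at least as far out as the graph, are close to [x1] and
   hence on the graph. *)
pose C := K `&` ([set y | e <= far y] `&` [set y | (rho1 - e / 4) ^+ 2 <= N y]).
have cC : closed C.
  apply: closedI; first exact: closed_K.
  by apply: closedI; exact: closed_fun_ge.
have [d2 d20 avoid] : exists2 d2 : R, 0 < d2 &
    forall psi y rho, `|psi - phi1| < d2 -> C y -> ~ polar y psi rho.
  apply: (ray_avoid D cC) => [y [Ky _]|y rho [Ky [fy Ny]] P]; first exact: K_neq0.
  have rr := rmax Ky P; have [r0 e3 e4] := P; have [_ _ NP] := polar_atE P.
  have [_ f3 f4] := P1.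
  move: fy Ny; rewrite /= NE NP /far e3 e4 f3 f4 -!mulrBl !normrM => fy Ny.
  have cb : `|cos phi1| <= 1 by rewrite ler_norml cos_geN1 cos_le1.
  have sb : `|sin phi1| <= 1 by rewrite ler_norml sin_geN1 sin_le1.
  have k : `|rho - rho1| = rho1 - rho by rewrite ler0_norm ?opprB// subr_le0.
  rewrite k in fy; have q0 : 0 <= rho1 - rho by rewrite subr_ge0.
  have h1 := ler_wpM2l q0 cb; have h2 := ler_wpM2l q0 sb.
  have : rho < rho1 - e / 4.
    move: fy h1 h2 e_gt0; rewrite mulr1.
    move: (_ * `|cos _|) (_ * `|sin _|) => z1 z2; lra.
  rewrite -(@ltr_pXn2r _ 2) ?nnegrE ?(ltW r0)//; first by rewrite ltNge Ny.
  by rewrite subr_ge0; move: er e_gt0; lra.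
have cm : {for phi1, continuous m}.
  by apply: is_derive_continuous (dm phi1 _); rewrite subrr normr0.
have cem : {for phi1, continuous (fun phi => expR (m phi))}.
  by apply: (@continuous_comp _ _ _ m expR) => //; exact: continuous_expR.
have n1 : \forall phi \near phi1, rho1 - e / 4 < expR (m phi).
  by apply: (cvgr_gt _ cem); rewrite Em ltrBlDr ltrDl divr_gt0.
have n2 := near_Y _ (near_K Kx1).
have n3 : \forall phi \near phi1, `|phi - phi1| < Num.min d d2.
  by apply/near_real; exists (Num.min d d2) => //; rewrite lt_min d0.
have /near_real[d3 d30 H3] : \forall phi \near phi1, [/\ rho1 - e / 4 < expR (m phi),
    X1 (Y phi) = b -> K (Y phi) & `|phi - phi1| < Num.min d d2].
  by near=> phi; split; near: phi.
have rE phi : `|phi - phi1| < d3 -> r phi = expR (m phi).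
  move=> h; have [h1 h2] := H3 phi h; rewrite lt_min => /andP[hd hd2].
  have [Yb YP _ _] := HY phi hd.
  have le1 := rmax (h2 Yb) YP; have [Ky Py] := Hxm phi.
  set y := xm phi in Ky Py; have [_ _ NP] := polar_atE Py.
  have nC : ~ C y by move=> Cy; exact: avoid hd2 Cy Py.
  have near1 : far y < e.
    rewrite ltNge; apply/negP => fy; apply: nC; split => //; split => //=.
    have q0 : 0 <= rho1 - e / 4 by rewrite subr_ge0; move: er e_gt0; lra.
    have q1 : rho1 - e / 4 <= r phi by rewrite (le_trans (ltW h1)).
    by rewrite NE NP ler_pXn2r// nnegrE (le_trans q0).
  have [|psi pd yE] := HO y _ Ky.1.
    have [k1 k2] := Ky; have [l1 l2] := Kx1.
    have near2 : far y < e0 by apply: lt_le_trans near1 ee0.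
    split; rewrite ?k1 ?k2 ?l1 ?l2 ?subrr ?normr0//; apply: le_lt_trans near2.
      by rewrite /far lerDl.
    by rewrite /far lerDr.
  have [_ QP _ _] := HY psi pd; rewrite -yE in QP.
  have [p0 p3 p4] := Py; have [q0 q3 q4] := QP.
  have [pp] : psi = phi /\ r phi = expR (m psi).
    apply: polar_inj => //; rewrite -?p3 -?p4 ?q3 ?q4//.
    rewrite -(subrKA phi1); apply: (lt_le_trans _ (pi_ge2 R)).
    apply: le_lt_trans (ler_normD _ _) _; rewrite [X in _ + X]distrC.
    by move: pd hd d1; lra.
  by rewrite pp.
pose d4 := Num.min d3 d; have d40 : 0 < d4 by rewrite lt_min d30.
exists m, n, d4; split => //.
  move=> phi; rewrite lt_min => /andP[h h']; have [_ _ h1 h2] := HY phi h'.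
  by split => //; exact: rE.
have d4d : 0 < d4 <= d by rewrite d40 ge_min lexx orbT.
have := cov d4 d4d; apply: filterS => y Hy yb; have [phi pd yE] := Hy yb.
exists phi => //; move: pd; rewrite lt_min => /andP[h h'].
have [_ YP _ _] := HY phi h'; rewrite -yE in YP; have [_ _ ->] := polar_atE YP.
by rewrite rE.
Unshelve. all: by end_near. Qed.

(** Each local graph has [m] equal to [ln r], which is defined for all angles, so the local
    equations form one global periodic solution, to which [polar_shrinker] applies. *)
Lemma outermost_unit : (forall phi, r (phi + pi *+ 2) = r phi) -> forall phi, r phi = 1.
Proof.
move=> rT; pose m phi := ln (r phi); pose m1 (phi : R) := 'D_1 m phi.
have loc phi1 : exists n : R -> R, exists2 d : R, 0 < d &
    forall phi : R, `|phi - phi1| < d -> is_derive phi 1 m (n phi) /\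
      is_derive phi 1 n ((1 + n phi ^+ 2) * (1 - expR (2 * m phi))).
  have [m' [n [d [d0 H _]]]] := outermost_graph phi1; exists n, d => // phi h.
  have mE (psi : R) : `|psi - phi1| < d -> m' psi = m psi.
    by move=> hp; have [E _ _] := H psi hp; rewrite /m E expRK.
  have [_ h1 h2] := H phi h; rewrite -(mE phi h); split => //.
  apply: near_eq_is_derive h1; apply/near_real; exists (d - `|phi - phi1|); first by rewrite subr_gt0.
  move=> psi hp; apply: mE; rewrite -(subrKA phi); apply: le_lt_trans (ler_normD _ _) _.
  by rewrite -ltrBrDr.
have [dm dm1] : (forall x : R, is_derive x 1 m (m1 x)) /\
    (forall x : R, is_derive x 1 m1 ((1 + m1 x ^+ 2) * (1 - expR (2 * m x)))).
  split=> x; have [n [d d0 H]] := loc x; have [h1 h2] := H x ltac:(by rewrite subrr normr0).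
    have e1 : m1 x = n x by rewrite /m1; exact: (@derive_val _ _ _ _ _ _ _ h1).
    by rewrite e1.
  have m1E (psi : R) : `|psi - x| < d -> n psi = m1 psi.
    by move=> hp; have [k1 _] := H psi hp; rewrite /m1; apply/esym/(@derive_val _ _ _ _ _ _ _ k1).
  rewrite -(m1E x) ?subrr ?normr0//.
  by apply: near_eq_is_derive h2; apply/near_real; exists d.
move=> phi; have [r0 _ _] := (Hxm phi).2.
have [m0 _] := polar_shrinker dm dm1 (fun x => congr1 (@ln R) (rT x)) phi.
by rewrite -[LHS]lnK ?posrE// -/(m phi) m0 expR0.
Qed.

End Radius.

Lemma unit_circle_near : exists x, K x /\
  \forall y \near x, X1 y = b -> X3 y ^+ 2 + X4 y ^+ 2 = 1.
Proof.
have [xm [r [Hxm rmax rT]]] := outermost_radius; exists (xm 0); split; first by have [] := Hxm 0.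
have [m [n [d [_ _ H]]]] := outermost_graph Hxm rmax 0.
apply: filterS H => y Hy yb; have [phi _ ->] := Hy yb.
by rewrite (outermost_unit Hxm rmax rT) expr1n.
Qed.

End UnitCircle.

(** * From the mirror to the whole surface *)

Section MainLemma.
Variables (R : realType) (T : topologicalType).

(** The set of points near which [|w| = 1] is open by definition, meets the mirror by
    [radius_across], and is closed by [radius_closure]. *)
Lemma reflective_unit_circle (X1 X2 X3 X4 : T -> R) (b : R) :
  lag_data X1 X2 X3 X4 -> reflective X1 X2 X3 X4 b -> forall x, X3 x ^+ 2 + X4 x ^+ 2 = 1.
Proof.
move=> D refl; have [x0 x0b] := mirror_nonempty D refl.
have [x1 [[x1b _] nx1]] := unit_circle_near D refl (ex_intro _ x0 (conj x0b (erefl (X2 x0)))).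
pose Z := [set x : T | \forall y \near x, X3 y ^+ 2 + X4 y ^+ 2 = 1].
have oZ : open Z by exact: open_near_set.
have rad (inv : 'rV[R]_2 -> T) v : unit_defect (X3 \o inv) (X4 \o inv) v = 0 <->
    X3 (inv v) ^+ 2 + X4 (inv v) ^+ 2 = 1.
  by rewrite /unit_defect /= !expr2; split=> [/eqP|->]; [rewrite subr_eq0 => /eqP|rewrite subrr].
have Zx1 : Z x1.
  have [U [inv [p [L Up px]]]] := data_chart D x1; rewrite /Z /= -px in nx1 x1b *.
  apply/(chart_near L (fun y => X3 y ^+ 2 + X4 y ^+ 2 = 1) Up).
  have := radius_across (chart_mirror D refl L) Up x1b.
  move=> H; have {}H : \forall v \near p, unit_defect (X3 \o inv) (X4 \o inv) v = 0.
    apply: H; have := (chart_near L (fun y => X1 y = b -> X3 y ^+ 2 + X4 y ^+ 2 = 1) Up).2 nx1.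
    by apply: filterS => v Hv vb; apply/rad/Hv.
  by apply: filterS H => v /rad.
have cZ : closed Z.
  move=> z zZ; have [U [inv [p [L Up px]]]] := data_chart D z; rewrite /Z /= -px in zZ *.
  apply/(chart_near L (fun y => X3 y ^+ 2 + X4 y ^+ 2 = 1) Up).
  have H : \forall v \near p, unit_defect (X3 \o inv) (X4 \o inv) v = 0.
    apply: (radius_closure (chart_patch L) Up) => r r0.
    have [q sq [Uq Zq]] := chart_closure L Up zZ r0; exists q => //.
    have := (chart_near L (fun y => X3 y ^+ 2 + X4 y ^+ 2 = 1) Uq).2 Zq.
    by apply: filterS => v /rad.
  by apply: filterS H => v /rad.
move=> x; have Zx := clopen_all (data_connected D) oZ cZ (ex_intro _ x1 Zx1) x.
exact: (nbhs_singleton Zx).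
Qed.

End MainLemma.

(** * Rotational symmetry *)

Section Rotation.
Variables (R : realType) (T : topologicalType).
Implicit Types (U : set 'rV[R]_2) (inv : 'rV[R]_2 -> T).

(* On the fibre of (X1, X2), the point maximizing <(X3, X4), z> is critical along
   a curve on which (X3, X4) moves on the unit circle, so (X3, X4) = z there. *)
Lemma rotation_invariant (X1 X2 X3 X4 : T -> R) : lag_data X1 X2 X3 X4 ->
  (forall x, X3 x ^+ 2 + X4 x ^+ 2 = 1) ->
  forall x0 (z3 z4 : R), z3 ^+ 2 + z4 ^+ 2 = 1 ->
  exists y, [/\ X1 y = X1 x0, X2 y = X2 x0, X3 y = z3 & X4 y = z4].
Proof.
move=> D unit x0 z3 z4 z1; have [c1 c2 c3 c4] := data_continuous D.
pose A := [set y | X1 y = X1 x0] `&` [set y | X2 y = X2 x0].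
have cA : closed A by apply: closedI; exact: closed_fun_eq.
pose h y := z3 * X3 y + z4 * X4 y.
have ch : continuous h.
  by move=> y; exact: cvgD (cvgM (cvg_cst _) (c3 y)) (cvgM (cvg_cst _) (c4 y)).
have [y [/= y1 y2] ymax] := data_max D cA (ex_intro _ x0 (conj erefl erefl)) ch.
have [U [inv [p [L Up py]]]] := data_chart D y; have P := chart_patch L.
have oU := patch_open P; have [s1 s2 s3 s4] := patch_smooth P.
set f1 := X1 \o inv in P s1; set f2 := X2 \o inv in P s2.
set f3 := X3 \o inv in P s3; set f4 := X4 \o inv in P s4.
have nU : \forall v \near p, U v by exact: open_nbhs_nbhs.
have radial v : U v -> f3 v * dx f3 v + f4 v * dx f4 v = 0 /\ f3 v * dy f3 v + f4 v * dy f4 v = 0.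
  move=> Uv; have [e1 e2] := radius_grad P Uv.
  have [|_ d1 d2] := @near_zero_grad R (unit_defect f3 f4) v.
    by near=> w; rewrite /unit_defect -!expr2 /f3 /f4 /= unit subrr.
  by rewrite d1 in e1; rewrite d2 in e2; move: e1 e2; clear; lra.
have w34 v : U v -> wedge f3 f4 v = 0.
  move=> Uv; have [e1 e2] := radial v Uv.
  rewrite -[LHS]mul1r -(unit (inv v)) -/(f3 v) -/(f4 v) /wedge.
  transitivity ((f3 v * dx f3 v + f4 v * dx f4 v) * (f3 v * dy f4 v - f4 v * dy f3 v)
    - (f3 v * dy f3 v + f4 v * dy f4 v) * (f3 v * dx f4 v - f4 v * dx f3 v)); first by rewrite /f3 /f4 /=; ring.
  by rewrite e1 e2; ring.
have w12 v : U v -> wedge f1 f2 v = 0.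
  by move=> Uv; have := patch_lag P Uv; rewrite w34// addr0.
(* [G] is whichever of [X1], [X2] is not critical at [p]. As [wedge f1 f2 = 0], the other one is
   constant on its level curve, which therefore lies in the fibre. *)
have key (G G' : T -> R) : smooth_on U (G \o inv) -> smooth_on U (G' \o inv) ->
    (dx (G \o inv) p != 0) || (dy (G \o inv) p != 0) ->
    (forall v, U v -> wedge (G \o inv) (G' \o inv) v = 0) ->
    (wedge (G \o inv) f1 p = 0 /\ wedge (G \o inv) f2 p = 0) ->
    (forall v, G (inv v) = G (inv p) -> G' (inv v) = G' (inv p) -> A (inv v)) ->
    X3 y = z3 /\ X4 y = z4.
  move=> sg sg' g0 gg' [k1 k2] inA.
  have nA : \forall v \near p, G (inv v) = G (inv p) -> A (inv v).
    have H : \forall v \near p, (G \o inv) v = (G \o inv) p -> (G' \o inv) v = (G' \o inv) p.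
      by apply: (level_const_near oU Up sg sg' g0); apply: filterS nU => v Uv _; exact: gg'.
    by apply: filterS H => v Hv e; apply: inA => //; exact: Hv.
  have sh : smooth_on U (h \o inv).
    apply: (smooth_onD oU); apply: (smooth_onM oU) => //; exact: smooth_on_cst.
  have q0 : ~ (wedge (G \o inv) f3 p = 0 /\ wedge (G \o inv) f4 p = 0).
    move=> [k3 k4]; have [|||| e1 e2] := patch_imm P (s := - dy (G \o inv) p) (t := dx (G \o inv) p) Up.
    - by rewrite -[RHS]k1 /wedge /f1; ring.
    - by rewrite -[RHS]k2 /wedge /f2; ring.
    - by rewrite -[RHS]k3 /wedge /f3; ring.
    - by rewrite -[RHS]k4 /wedge /f4; ring.
    by move: g0; rewrite e2 -[dy _ p == 0]oppr_eq0 e1 eqxx.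
  have hz : z3 * wedge (G \o inv) f3 p + z4 * wedge (G \o inv) f4 p = 0.
    have hm : \forall v \near p, (G \o inv) v = (G \o inv) p -> (h \o inv) v <= (h \o inv) p.
      by apply: filterS nA => v Av e; rewrite /= py; apply: ymax; exact: Av.
    rewrite -(level_max oU Up sg sh hm).
    have Dh := has_DD (has_DM (has_D_cst (G \o inv) p z3) (has_D_smooth (G \o inv) s3 Up))
      (has_DM (has_D_cst (G \o inv) p z4) (has_D_smooth (G \o inv) s4 Up)).
    have := has_DE Dh; rewrite -/f3 -/f4 => E.
    rewrite [RHS](_ : _ = wedge (G \o inv) (h \o inv) p); last by rewrite /wedge; ring.
    by rewrite [RHS]E; ring.
  have hw : f3 p * wedge (G \o inv) f3 p + f4 p * wedge (G \o inv) f4 p = 0.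
    have [e1 e2] := radial p Up; rewrite /wedge.
    transitivity (dx (G \o inv) p * (f3 p * dy f3 p + f4 p * dy f4 p) -
      dy (G \o inv) p * (f3 p * dx f3 p + f4 p * dx f4 p)); first by ring.
    by rewrite e1 e2; ring.
  have u1 : f3 p ^+ 2 + f4 p ^+ 2 = 1 by exact: unit.
  have e3 : X3 y = f3 p by rewrite /f3 /= py.
  have e4 : X4 y = f4 p by rewrite /f4 /= py.
  have dt : z3 * f4 p - z4 * f3 p = 0.
    apply: contrapT => /eqP dn; apply: q0; split; apply: (mulfI dn); rewrite mulr0.
      transitivity (f4 p * (z3 * wedge (G \o inv) f3 p + z4 * wedge (G \o inv) f4 p) -
        z4 * (f3 p * wedge (G \o inv) f3 p + f4 p * wedge (G \o inv) f4 p)); first by ring.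
      by rewrite hz hw; ring.
    transitivity (z3 * (f3 p * wedge (G \o inv) f3 p + f4 p * wedge (G \o inv) f4 p) -
      f3 p * (z3 * wedge (G \o inv) f3 p + z4 * wedge (G \o inv) f4 p)); first by ring.
    by rewrite hz hw; ring.
  pose l := z3 * f3 p + z4 * f4 p.
  have l3 : z3 = l * f3 p.
    transitivity (z3 * (f3 p ^+ 2 + f4 p ^+ 2)); first by rewrite u1 mulr1.
    transitivity (l * f3 p + f4 p * (z3 * f4 p - z4 * f3 p)); first by rewrite /l; ring.
    by rewrite dt mulr0 addr0.
  have l4 : z4 = l * f4 p.
    transitivity (z4 * (f3 p ^+ 2 + f4 p ^+ 2)); first by rewrite u1 mulr1.
    transitivity (l * f4 p - f3 p * (z3 * f4 p - z4 * f3 p)); first by rewrite /l; ring.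
    by rewrite dt mulr0 subr0.
  have l1 : l ^+ 2 = 1.
    by rewrite -z1 l3 l4 !exprMn -mulrDr u1 mulr1.
  have /eqP := l1; rewrite sqrf_eq1 => /orP[/eqP l0|/eqP l0].
    by rewrite e3 e4 l3 l4 l0 !mul1r.
  (* If [w = - z] at the maximum, the maximum is the least possible value, so [w = - z] along the
     whole curve and its velocity vanishes. *)
  exfalso; apply: q0.
  have opp : \forall v \near p, (G \o inv) v = (G \o inv) p -> f3 v + z3 = 0 /\ f4 v + z4 = 0.
    apply: filterS nA => v Av e; have := ymax _ (Av e).
    rewrite -py /h -/(f3 v) -/(f4 v) -/(f3 p) -/(f4 p) -/l l0 => hv.
    have uv : f3 v ^+ 2 + f4 v ^+ 2 = 1 by exact: unit.
    have : (f3 v + z3) ^+ 2 + (f4 v + z4) ^+ 2 <= 0.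
      rewrite (_ : _ + _ = (f3 v ^+ 2 + f4 v ^+ 2) + (z3 ^+ 2 + z4 ^+ 2) +
        2 * (z3 * f3 v + z4 * f4 v)); last by ring.
      by rewrite uv z1; move: hv; rewrite /f3 /f4 /=; lra.
    move=> le0; have /eqP : (f3 v + z3) ^+ 2 + (f4 v + z4) ^+ 2 = 0.
      by apply/eqP; rewrite eq_le le0 addr_ge0 ?sqr_ge0.
    by rewrite paddr_eq0 ?sqr_ge0// !sqrf_eq0 => /andP[/eqP ? /eqP ?].
  have tz (f : 'rV[R]_2 -> R) (z : R) : smooth_on U f ->
      (\forall v \near p, (G \o inv) v = (G \o inv) p -> f v + z = 0) -> wedge (G \o inv) f p = 0.
    move=> sf H; have sfz : smooth_on U (fun v => f v + z).
      by apply: smooth_onD => //; exact: smooth_on_cst.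
    have <- := level_tangent_near oU Up sg sfz H.
    have E := has_DE (has_DD (has_D_smooth (G \o inv) sf Up) (has_D_cst (G \o inv) p z)).
    by rewrite E addr0.
  split; [apply: (tz _ z3) => //|apply: (tz _ z4) => //].
    by apply: filterS opp => v Hv e; have [] := Hv e.
  by apply: filterS opp => v Hv e; have [] := Hv e.
have zz f : wedge f f p = 0 by rewrite /wedge mulrC subrr.
exists y; suff [] : X3 y = z3 /\ X4 y = z4 by split.
have [g1|/norP[/negPn/eqP a1 /negPn/eqP a2]] := boolP ((dx f1 p != 0) || (dy f1 p != 0)).
  apply: (key X1 X2) => //; first by split; [exact: zz|exact: w12].
  by move=> v; rewrite py y1 y2.
have [g2|/norP[/negPn/eqP b1 /negPn/eqP b2]] := boolP ((dx f2 p != 0) || (dy f2 p != 0)).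
  apply: (key X2 X1) => //.
  - by move=> v Uv; have := w12 v Uv; rewrite /wedge -/f1 -/f2; lra.
  - by split; [have := w12 p Up; rewrite /wedge -/f1 -/f2; lra|exact: zz].
  by move=> v; rewrite py y1 y2.
have := det_metric_gt0 P Up; rewrite det_metricE w34// /wedge a1 a2 b1 b2.
by rewrite !mul0r !subrr !expr0n/= !addr0 ltxx.
Unshelve. all: by end_near. Qed.

(** Rotations of [w] contain the reflection [X3 -> - X3], a mirror through the origin, which
    exchanges the roles of the planes. A prescribed point is reached by rotating in the second plane
    and then in the first. *)
Lemma reflective_torus (X1 X2 X3 X4 : T -> R) (b : R) :
  lag_data X1 X2 X3 X4 -> reflective X1 X2 X3 X4 b ->
  (forall x, X1 x ^+ 2 + X2 x ^+ 2 = 1 /\ X3 x ^+ 2 + X4 x ^+ 2 = 1) /\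
  forall z1 z2 z3 z4 : R, z1 ^+ 2 + z2 ^+ 2 = 1 -> z3 ^+ 2 + z4 ^+ 2 = 1 ->
  exists y, [/\ X1 y = z1, X2 y = z2, X3 y = z3 & X4 y = z4].
Proof.
move=> D refl; have u34 := reflective_unit_circle D refl.
have rot := rotation_invariant D u34.
have refl' : reflective X3 X4 X1 X2 0.
  move=> x; have [|y [e1 e2 e3 e4]] := rot x (- X3 x) (X4 x); first by rewrite sqrrN.
  by exists y; split => //; rewrite e3 mulr0 sub0r.
have u12 := reflective_unit_circle (lag_dataC D) refl'.
have rot' := rotation_invariant (lag_dataC D) u12.
split=> // z1 z2 z3 z4 h12 h34; have [x _] := data_nonempty D.
have [y [_ _ e3 e4]] := rot x z3 z4 h34; have [y' [e1 e2 e3' e4']] := rot' y z1 z2 h12.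
by exists y'; rewrite e1 e2 e3' e4'.
Qed.

End Rotation.

(** * Unitary frames *)

Section LinearForms.
Variable R : realType.

Definition lform (a0 a1 a2 a3 : R) (Y : 'rV[R]_4) : R :=
  a0 * Y 0 0 + a1 * Y 0 1 + a2 * Y 0 2 + a3 * Y 0 3.

Fact lform_linear a0 a1 a2 a3 : linear (lform a0 a1 a2 a3).
Proof. by move=> k u v; rewrite /lform !mxE /GRing.scale /=; ring. Qed.

HB.instance Definition _ a0 a1 a2 a3 :=
  GRing.isLinear.Build R 'rV[R]_4 R _ (lform a0 a1 a2 a3) (lform_linear a0 a1 a2 a3).

Lemma lform_continuous a0 a1 a2 a3 : continuous (lform a0 a1 a2 a3).
Proof.
have c (a : R) (i : 'I_4) Y : {for Y, continuous (fun Y : 'rV[R]_4 => a * Y 0 i)}.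
  exact: cvgM (cvg_cst _) (@coord_continuous R 1 4 0 i Y).
by move=> Y; exact: cvgD (cvgD (cvgD (c a0 0 Y) (c a1 1 Y)) (c a2 2 Y)) (c a3 3 Y).
Qed.

Lemma dot4E (x y : 'rV[R]_4) :
  dot x y = x 0 0 * y 0 0 + x 0 1 * y 0 1 + x 0 2 * y 0 2 + x 0 3 * y 0 3.
Proof.
rewrite /dot !big_ord_recl big_ord0 addr0 !addrA.
by do !congr (_ + _); congr (_ * _); congr (_ 0 _); exact/val_inj.
Qed.

Lemma row4P (Y Z : 'rV[R]_4) : Y 0 0 = Z 0 0 -> Y 0 1 = Z 0 1 -> Y 0 2 = Z 0 2 ->
  Y 0 3 = Z 0 3 -> Y = Z.
Proof.
move=> h0 h1 h2 h3; apply/rowP => i; case: i => [[|[|[|[|//]]]] Hi].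
- by rewrite (_ : Ordinal Hi = 0)//; exact/val_inj.
- by rewrite (_ : Ordinal Hi = 1)//; exact/val_inj.
- by rewrite (_ : Ordinal Hi = 2)//; exact/val_inj.
- by rewrite (_ : Ordinal Hi = 3)//; exact/val_inj.
Qed.

Lemma dotC (x y : 'rV[R]_4) : dot x y = dot y x.
Proof. by rewrite /dot; apply: eq_bigr => i _; rewrite mulrC. Qed.

Lemma dot_eq0 (Y : 'rV[R]_4) : dot Y Y = 0 -> Y = 0.
Proof.
rewrite dot4E -!expr2 => /eqP; rewrite !paddr_eq0 ?addr_ge0 ?sqr_ge0// !sqrf_eq0.
move=> /andP[/andP[/andP[/eqP h0 /eqP h1] /eqP h2] /eqP h3].
by apply: row4P; rewrite mxE.
Qed.

(** A vanishing Gram determinant makes [|B|^2 A - <A, B> B] zero, which is a linear relation between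
    [A] and [B]. *)
Lemma gram_dot (A B : 'rV[R]_4) :
  dot (dot B B *: A + (- dot A B) *: B) (dot B B *: A + (- dot A B) *: B) =
    dot B B * (dot A A * dot B B - dot A B * dot A B).
Proof.
rewrite [LHS]dot4E !mxE !dot4E.
move: (A 0 0) (A 0 1) (A 0 2) (A 0 3) (B 0 0) (B 0 1) (B 0 2) (B 0 3).
by move=> p0 p1 p2 p3 q0 q1 q2 q3; ring.
Qed.

Lemma sum2E (V : nmodType) (f : 'I_2 -> V) : \sum_i f i = f 0 + f 1.
Proof.
by rewrite !big_ord_recl big_ord0 addr0; congr (f _ + f _); exact/val_inj.
Qed.

Section Composition.
Variables (l : {linear 'rV[R]_4 -> R}) (cl : continuous l).

Lemma derive_linear (f : 'rV[R]_2 -> 'rV[R]_4) u w : differentiable f u ->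
  differentiable (fun v => l (f v)) u /\ 'D_w (fun v => l (f v)) u = l ('D_w f u).
Proof.
move=> df; have dl : differentiable l (f u) by exact: linear_differentiable.
have dlf : differentiable (l \o f) u by exact: differentiable_comp.
split=> //; rewrite -[fun v => _]/(l \o f) deriveE// diff_comp//= diff_lin//.
by rewrite deriveE.
Qed.

Lemma smooth_linear (U : set 'rV[R]_2) (f : 'rV[R]_2 -> 'rV[R]_4) : open U ->
  smooth_on U f -> smooth_on U (fun v => l (f v)).
Proof.
move=> oU sf k; elim: k f {sf}(sf k) => [|k IH] f /=.
  move=> cf v Uv; apply: (@continuous_comp _ _ _ f l); first exact: cf.
  exact: cl.
move=> [df cf]; split=> [v Uv|w]; first by have [] := derive_linear 0 (df v Uv).
apply: (class_C_ext (f := fun v => l ('D_w f v)) oU).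
  by move=> v Uv; have [_ ->] := derive_linear w (df v Uv).
exact: IH.
Qed.

Lemma linear_dx (U : set 'rV[R]_2) (f : 'rV[R]_2 -> 'rV[R]_4) v : open U ->
  smooth_on U f -> U v -> dx (fun w => l (f w)) v = l (partial 0 f v) /\
  dy (fun w => l (f w)) v = l (partial 1 f v).
Proof.
move=> oU sf Uv; have df : differentiable f v := (sf 1%N).1 v Uv.
by rewrite dxE dyE /partial (derive_linear (delta_mx 0 0) df).2 (derive_linear (delta_mx 0 1) df).2.
Qed.

Lemma linear_dxx (U : set 'rV[R]_2) (f : 'rV[R]_2 -> 'rV[R]_4) v : open U ->
  smooth_on U f -> U v ->
  [/\ dx (dx (fun w => l (f w))) v = l (partial 0 (partial 0 f) v),
      dx (dy (fun w => l (f w))) v = l (partial 0 (partial 1 f) v),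
      dy (dx (fun w => l (f w))) v = l (partial 1 (partial 0 f) v) &
      dy (dy (fun w => l (f w))) v = l (partial 1 (partial 1 f) v)].
Proof.
move=> oU sf Uv; have nU : \forall w \near v, U w by exact: open_nbhs_nbhs.
have sp i : smooth_on U (partial i f) by move=> k; exact: (sf k.+1).2.
have second i (h : 'rV[R]_2 -> R) : (forall w, U w -> h w = l (partial i f w)) ->
    dx h v = l (partial 0 (partial i f) v) /\ dy h v = l (partial 1 (partial i f) v).
  move=> H; have G := smooth_has_grad (smooth_linear oU (sp i)) Uv.
  have [_ -> ->] : has_grad h v (dx (fun w => l (partial i f w)) v) (dy (fun w => l (partial i f w)) v).
    by apply: has_grad_near G; apply: filterS nU => w Uw; rewrite H.
  exact: linear_dx oU (sp i) Uv.
have [-> ->] := second 0 _ (fun w Uw => (linear_dx oU sf Uw).1).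
by have [-> ->] := second 1 _ (fun w Uw => (linear_dx oU sf Uw).2).
Qed.

End Composition.

Lemma invmx2 (A : 'M[R]_2) : let d := A 0 0 * A 1 1 - A 0 1 * A 1 0 in d != 0 ->
  [/\ invmx A 0 0 = A 1 1 / d, invmx A 0 1 = - A 0 1 / d,
      invmx A 1 0 = - A 1 0 / d & invmx A 1 1 = A 0 0 / d].
Proof.
move=> d d0.
pose B : 'M[R]_2 := \matrix_(i, j) ((if i == 0 then (if j == 0 then A 1 1 else - A 0 1)
  else (if j == 0 then - A 1 0 else A 0 0)) / d).
have AB : A *m B = 1%:M.
  have two (i : 'I_2) : i = 0 \/ i = 1.
    by case: i => [[|[|//]] Hi]; [left|right]; exact/val_inj.
  apply/matrixP => i j; rewrite mxE sum2E !mxE.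
  by case: (two i) => ->; case: (two j) => ->; rewrite /=; move: d0; rewrite /d;
    move: (A 0 0) (A 0 1) (A 1 0) (A 1 1) => a1 a2 a3 a4 d0; field.
have -> : invmx A = B.
  have [uA _] := mulmx1_unit AB.
  by rewrite -[LHS]mulmx1 -AB mulmxA mulVmx// mul1mx.
by rewrite !mxE.
Qed.

Lemma tangential_part (g : 'M[R]_2) (p : 'I_2 -> 'rV[R]_4) v : exists s t : R,
  v - \sum_i \sum_j (g i j * dot v (p i)) *: p j = v - (s *: p 0 + t *: p 1).
Proof.
exists (g 0 0 * dot v (p 0) + g 1 0 * dot v (p 1)).
exists (g 0 1 * dot v (p 0) + g 1 1 * dot v (p 1)).
rewrite sum2E (sum2E (fun j => (g 0 j * dot v (p 0)) *: p j)).
rewrite (sum2E (fun j => (g 1 j * dot v (p 1)) *: p j)).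
by rewrite !scalerDl addrACA.
Qed.

Lemma trace_algebra (d aa ab bb s t s00 s01 s10 s11 t00 t01 t10 t11 : R)
    (P Q P' Q' A B F : 'rV[R]_4) : d != 0 ->
  (bb / d) *: (P - (s00 *: A + t00 *: B)) + (- ab / d) *: (Q - (s01 *: A + t01 *: B)) +
  ((- ab / d) *: (P' - (s10 *: A + t10 *: B)) + (aa / d) *: (Q' - (s11 *: A + t11 *: B))) =
    - (F - (s *: A + t *: B)) ->
  bb *: P - ab *: Q - ab *: P' + aa *: Q' + d *: F =
    (bb * s00 - ab * s01 - ab * s10 + aa * s11 + d * s) *: A +
    (bb * t00 - ab * t01 - ab * t10 + aa * t11 + d * t) *: B.
Proof.
move=> d0 E; apply/rowP => i; have := congr1 (fun Y : 'rV[R]_4 => Y 0 i) E; rewrite !mxE.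
move: (P 0 i) (Q 0 i) (P' 0 i) (Q' 0 i) (A 0 i) (B 0 i) (F 0 i) => p q p' q' a b f.
have dv (x1 x2 x3 x4 x5 : R) : (bb / d) * x1 + (- ab / d) * x2 + ((- ab / d) * x3 + (aa / d) * x4)
    = - x5 -> bb * x1 - ab * x2 - ab * x3 + aa * x4 = - (d * x5).
  by move=> h; rewrite -[- (d * x5)]mulrN -h; field.
move=> /dv h; apply/eqP; rewrite -subr_eq0; apply/eqP.
transitivity (bb * (p - (s00 * a + t00 * b)) - ab * (q - (s01 * a + t01 * b)) -
  ab * (p' - (s10 * a + t10 * b)) + aa * (q' - (s11 * a + t11 * b)) +
  d * (f - (s * a + t * b))); first by ring.
by rewrite h addNr.
Qed.

(** Every ingredient enters through an equation, so that the identity applies to large terms without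
    rewriting inside them; [invmx2_of], [wedge_of], [metric_of] and [trace_of] have the same
    form. *)
Lemma trace_algebra_of (d aa ab bb s t s00 s01 s10 s11 t00 t01 t10 t11 g00 g01 g10 g11 : R)
    (P Q P' Q' A B F x00 x01 x10 x11 y : 'rV[R]_4) : d != 0 ->
  g00 = bb / d -> g01 = - ab / d -> g10 = - ab / d -> g11 = aa / d ->
  x00 = P - (s00 *: A + t00 *: B) -> x01 = Q - (s01 *: A + t01 *: B) ->
  x10 = P' - (s10 *: A + t10 *: B) -> x11 = Q' - (s11 *: A + t11 *: B) ->
  y = F - (s *: A + t *: B) ->
  g00 *: x00 + g01 *: x01 + (g10 *: x10 + g11 *: x11) = - y ->
  bb *: P - ab *: Q - ab *: P' + aa *: Q' + d *: F =
    (bb * s00 - ab * s01 - ab * s10 + aa * s11 + d * s) *: A +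
    (bb * t00 - ab * t01 - ab * t10 + aa * t11 + d * t) *: B.
Proof. by move=> d0 -> -> -> -> -> -> -> -> ->; exact: trace_algebra. Qed.

Lemma double_sum2 (g : 'M[R]_2) (p : 'I_2 -> 'I_2 -> 'rV[R]_4) :
  \sum_i \sum_j g i j *: p i j =
    g 0 0 *: p 0 0 + g 0 1 *: p 0 1 + (g 1 0 *: p 1 0 + g 1 1 *: p 1 1).
Proof.
rewrite sum2E (sum2E (fun j => g 0 j *: p 0 j)).
by rewrite (sum2E (fun j => g 1 j *: p 1 j)).
Qed.

Lemma invmx2_of (A : 'M[R]_2) (aa ab ba bb d : R) : A 0 0 = aa -> A 0 1 = ab -> A 1 0 = ba ->
  A 1 1 = bb -> d = aa * bb - ab * ba -> d != 0 ->
  [/\ invmx A 0 0 = bb / d, invmx A 0 1 = - ab / d, invmx A 1 0 = - ba / d & invmx A 1 1 = aa / d].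
Proof. by move=> <- <- <- <- ->; exact: invmx2. Qed.

Section NormalPart.
Variables (X : 'rV[R]_2 -> 'rV[R]_4) (u : 'rV[R]_2).
Let A := partial 0 X u.
Let B := partial 1 X u.

Lemma normal_partE v : exists s t, normal_part X u v = v - (s *: A + t *: B).
Proof. exact: (tangential_part (invmx (first_form X u)) (fun i => partial i X u) v). Qed.

(** Multiplying by the Gram determinant replaces the inverse metric by its adjugate, and each normal
    projection only subtracts a tangent vector, so all corrections merge into [s] and [t]. *)
Lemma shrinker_traceE : dot A A * dot B B - dot A B * dot A B != 0 ->
  mean_curvature X u = - normal_part X u (X u) -> exists s t : R,
  dot B B *: partial 0 (partial 0 X) u - dot A B *: partial 0 (partial 1 X) u
    - dot A B *: partial 1 (partial 0 X) u + dot A A *: partial 1 (partial 1 X) u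
    + (dot A A * dot B B - dot A B * dot A B) *: X u = s *: A + t *: B.
Proof.
set d := _ - _ => d0 E.
have ff i j : first_form X u i j = dot (partial i X u) (partial j X u) by rewrite mxE.
have BA : dot B A = dot A B := dotC B A.
have [i00 i01 i10 i11] := invmx2_of (ff 0 0) (ff 0 1) (etrans (ff 1 0) BA) (ff 1 1)
  (erefl d) d0.
have [s00 [t00 e00]] := normal_partE (partial 0 (partial 0 X) u).
have [s01 [t01 e01]] := normal_partE (partial 0 (partial 1 X) u).
have [s10 [t10 e10]] := normal_partE (partial 1 (partial 0 X) u).
have [s11 [t11 e11]] := normal_partE (partial 1 (partial 1 X) u).
have [s [t e]] := normal_partE (X u).
have E2 : \sum_i \sum_j invmx (first_form X u) i j *: second_form X u i j =
  - normal_part X u (X u) := E.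
have E3 := etrans (esym (double_sum2 (invmx (first_form X u)) (second_form X u))) E2.
by do 2!eexists; exact: (trace_algebra_of d0 i00 i01 i10 i11 e00 e01 e10 e11 e E3).
Qed.

End NormalPart.

Lemma wedge_of (F G : 'rV[R]_2 -> R) u (a a' c c' : R) : dx F u = a -> dy F u = a' ->
  dx G u = c -> dy G u = c' -> wedge F G u = a * c' - a' * c.
Proof. by rewrite /wedge => -> -> -> ->. Qed.

Lemma metric_of (F1 F2 F3 F4 : 'rV[R]_2 -> R) u (a1 a2 a3 a4 b1 b2 b3 b4 : R) :
  dx F1 u = a1 -> dx F2 u = a2 -> dx F3 u = a3 -> dx F4 u = a4 ->
  dy F1 u = b1 -> dy F2 u = b2 -> dy F3 u = b3 -> dy F4 u = b4 ->
  [/\ metric_xx F1 F2 F3 F4 u = a1 * a1 + a2 * a2 + a3 * a3 + a4 * a4,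
      metric_xy F1 F2 F3 F4 u = a1 * b1 + a2 * b2 + a3 * b3 + a4 * b4 &
      metric_yy F1 F2 F3 F4 u = b1 * b1 + b2 * b2 + b3 * b3 + b4 * b4].
Proof.
by rewrite /metric_xx /metric_xy /metric_yy /sum4 /ptmul => -> -> -> -> -> -> -> ->.
Qed.

Lemma linear_trace (l : {linear 'rV[R]_4 -> R}) (aa ab bb d s t : R) (P Q P' Q' F A B : 'rV[R]_4) :
  bb *: P - ab *: Q - ab *: P' + aa *: Q' + d *: F = s *: A + t *: B ->
  bb * l P - ab * l Q - ab * l P' + aa * l Q' + d * l F = s * l A + t * l B.
Proof.
by move=> /(congr1 l); rewrite !(linearD, linearN, linearZ).
Qed.

Lemma trace_of (aa ab bb d s t x y y' z w p q xx xy yy a b : R) :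
  bb * x - ab * y - ab * y' + aa * z + d * w = s * p + t * q -> y' = y ->
  xx = x -> xy = y -> yy = z -> a = p -> b = q ->
  bb * xx + 2 * - ab * xy + aa * yy + d * w = s * a + t * b.
Proof. by move=> + yE -> -> -> -> ->; rewrite yE => <-; ring. Qed.

(** The forms are orthonormal and compatible with the Kahler form, so the metric, the Lagrangian
    condition and the shrinker equation keep their shape in the new coordinates. *)
Lemma linear_patch (l1 l2 l3 l4 : {linear 'rV[R]_4 -> R}) (U : set 'rV[R]_2)
    (f : 'rV[R]_2 -> 'rV[R]_4) :
  continuous l1 -> continuous l2 -> continuous l3 -> continuous l4 ->
  (forall Y Z, dot Y Z = l1 Y * l1 Z + l2 Y * l2 Z + l3 Y * l3 Z + l4 Y * l4 Z) ->
  (forall Y Z, kahler_form Y Z = l1 Y * l2 Z - l1 Z * l2 Y + (l3 Y * l4 Z - l3 Z * l4 Y)) ->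
  open U -> smooth_on U f ->
  (forall u, U u -> injective ('d f u)) ->
  (forall u, U u -> forall v w, kahler_form ('d f u v) ('d f u w) = 0) ->
  (forall u, U u -> mean_curvature f u = - normal_part f u (f u)) ->
  lag_patch U (fun v => l1 (f v)) (fun v => l2 (f v)) (fun v => l3 (f v)) (fun v => l4 (f v)).
Proof.
move=> c1 c2 c3 c4 dotE kahE oU sf imm lag shr.
have pE i u : U u -> partial i f u = 'd f u (delta_mx 0 i).
  by move=> Uu; rewrite /partial deriveE//; exact: (sf 1%N).1.
have immE u (s t : R) : U u -> s *: partial 0 f u + t *: partial 1 f u = 0 -> s = 0 /\ t = 0.
  move=> Uu E; have p0 := pE 0 u Uu; have p1 := pE 1 u Uu.
  have E2 : 'd f u (pt s t) = 0.
    rewrite ptE linearD !linearZ.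
    exact: etrans (congr2 (fun a b => s *: a + t *: b) (esym p0) (esym p1)) E.
  have /(imm u Uu) e : 'd f u (pt s t) = 'd f u 0 by rewrite E2 linear0.
  by split; [have := congr1 (fun v : 'rV[R]_2 => v 0 0) e|have := congr1 (fun v : 'rV[R]_2 => v 0 1) e];
    rewrite ?pt0 ?pt1 mxE.
have D1 u (Uu : U u) := linear_dx c1 oU sf Uu.
have D2 u (Uu : U u) := linear_dx c2 oU sf Uu.
have D3 u (Uu : U u) := linear_dx c3 oU sf Uu.
have D4 u (Uu : U u) := linear_dx c4 oU sf Uu.
split => //.
- by split; exact: smooth_linear.
- move=> u Uu.
  have H := etrans (congr2 (@kahler_form R) (pE 0 u Uu) (pE 1 u Uu))
    (lag u Uu (delta_mx 0 0) (delta_mx 0 1)).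
  have [a1 b1] := D1 u Uu; have [a2 b2] := D2 u Uu.
  have [a3 b3] := D3 u Uu; have [a4 b4] := D4 u Uu.
  apply: etrans (congr2 +%R (wedge_of a1 b1 a2 b2) (wedge_of a3 b3 a4 b4)) _.
  apply: (etrans _ H); apply: (etrans _ (esym (kahE _ _))).
  by congr (_ + _); congr (_ - _); rewrite mulrC.
- move=> u s t Uu.
  have [a1 b1] := D1 u Uu; have [a2 b2] := D2 u Uu.
  have [a3 b3] := D3 u Uu; have [a4 b4] := D4 u Uu.
  have k (l : {linear 'rV[R]_4 -> R}) (F : 'rV[R]_2 -> R) (A B : 'rV[R]_4) :
      dx F u = l A -> dy F u = l B -> s * dx F u + t * dy F u = 0 -> l (s *: A + t *: B) = 0.
    by move=> -> ->; rewrite linearD !linearZ.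
  move=> /(k _ _ _ _ a1 b1) h1 /(k _ _ _ _ a2 b2) h2 /(k _ _ _ _ a3 b3) h3 /(k _ _ _ _ a4 b4) h4.
  apply: (immE u s t Uu); apply: dot_eq0; apply: (etrans (dotE _ _)).
  by rewrite h1 h2 h3 h4 !mulr0 !addr0.
move=> u Uu.
have [a1 b1] := D1 u Uu; have [a2 b2] := D2 u Uu.
have [a3 b3] := D3 u Uu; have [a4 b4] := D4 u Uu.
have [xx xy yy] := metric_of a1 a2 a3 a4 b1 b2 b3 b4.
have dn : dot (partial 0 f u) (partial 0 f u) * dot (partial 1 f u) (partial 1 f u) -
    dot (partial 0 f u) (partial 1 f u) * dot (partial 0 f u) (partial 1 f u) != 0.
  apply/eqP => z.
  have g := etrans (gram_dot (partial 0 f u) (partial 1 f u)) (etrans (congr1 _ z) (mulr0 _)).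
  have [/dot_eq0 B0 _] := immE u _ _ Uu (dot_eq0 g).
  have E : 0 *: partial 0 f u + 1 *: partial 1 f u = 0.
    by rewrite scale0r add0r scale1r.
  by have [_ /eqP] := immE u 0 1 Uu E; rewrite oner_eq0.
have [s [t E]] := shrinker_traceE dn (shr u Uu); exists s, t.
have xx' := etrans xx (esym (dotE _ _)); have xy' := etrans xy (esym (dotE _ _)).
have yy' := etrans yy (esym (dotE _ _)).
rewrite /trace_op /elliptic_part /det_metric xx' xy' yy' expr2.
have fin (l : {linear 'rV[R]_4 -> R}) (cl : continuous l) :=
  let: conj e1 e2 := linear_dx cl oU sf Uu in
  let: And4 xxE xyE yxE yyE := linear_dxx cl oU sf Uu in
  trace_of (linear_trace l E)
    (etrans (esym yxE) (etrans (esym (schwarz oU (smooth_linear cl oU sf) Uu)) xyE))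
    xxE xyE yyE e1 e2.
by split; apply: fin.
Qed.

Section Frame.
Variables n1 n2 n3 n4 : R.
Hypothesis N : n1 * n1 + n2 * n2 + n3 * n3 + n4 * n4 = 1.

(** Inner products with [n], [J n], [m], [J m], where [J] is multiplication by [i] and
    [m = (- n3, n4, n1, - n2)] spans the complex orthogonal complement of [n]. *)
Definition frame1 := lform n1 n2 n3 n4.
Definition frame2 := lform (- n2) n1 (- n4) n3.
Definition frame3 := lform (- n3) n4 n1 (- n2).
Definition frame4 := lform (- n4) (- n3) n2 n1.

Lemma frame_dot Y Z : dot Y Z =
  frame1 Y * frame1 Z + frame2 Y * frame2 Z + frame3 Y * frame3 Z + frame4 Y * frame4 Z.
Proof.
by rewrite dot4E -[LHS]mul1r -N /frame1 /frame2 /frame3 /frame4 /lform; ring.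
Qed.

Lemma frame_kahler Y Z : kahler_form Y Z =
  frame1 Y * frame2 Z - frame1 Z * frame2 Y + (frame3 Y * frame4 Z - frame3 Z * frame4 Y).
Proof.
by rewrite /kahler_form -[LHS]mul1r -N /frame1 /frame2 /frame3 /frame4 /lform; ring.
Qed.

Lemma frame_coord (Y : 'rV[R]_4) : [/\
  Y 0 0 = n1 * frame1 Y - n2 * frame2 Y - n3 * frame3 Y - n4 * frame4 Y,
  Y 0 1 = n2 * frame1 Y + n1 * frame2 Y + n4 * frame3 Y - n3 * frame4 Y,
  Y 0 2 = n3 * frame1 Y - n4 * frame2 Y + n1 * frame3 Y + n2 * frame4 Y &
  Y 0 3 = n4 * frame1 Y + n3 * frame2 Y - n2 * frame3 Y + n1 * frame4 Y].
Proof.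
by split; rewrite -[LHS]mul1r -N /frame1 /frame2 /frame3 /frame4 /lform; ring.
Qed.

Lemma frame_patch (U : set 'rV[R]_2) (f : 'rV[R]_2 -> 'rV[R]_4) : open U -> smooth_on U f ->
  (forall u, U u -> injective ('d f u)) ->
  (forall u, U u -> forall v w, kahler_form ('d f u v) ('d f u w) = 0) ->
  (forall u, U u -> mean_curvature f u = - normal_part f u (f u)) ->
  lag_patch U (fun v => frame1 (f v)) (fun v => frame2 (f v)) (fun v => frame3 (f v))
    (fun v => frame4 (f v)).
Proof.
move=> oU sf imm lag shr.
exact: (linear_patch (@lform_continuous _ _ _ _) (@lform_continuous _ _ _ _)
  (@lform_continuous _ _ _ _) (@lform_continuous _ _ _ _) frame_dot frame_kahler).
Qed.

End Frame.
End LinearForms.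

(** * The frame as a unitary matrix *)

Section ComplexFrame.
Variable R : realType.

Lemma normc_eq1 (a c : R) : `|(a +i* c)%C| = 1 <-> a ^+ 2 + c ^+ 2 = 1.
Proof.
rewrite normc_def /=; split=> [/complexI h|->]; last by rewrite sqrtr1.
by rewrite -[LHS]sqr_sqrtr ?addr_ge0 ?sqr_ge0// h expr1n.
Qed.

(** Its rows are the complex conjugates of the frame vectors [(n1, n2, n3, n4)] and
    [(- n3, n4, n1, - n2)] seen in [C^2]; for a unit normal it belongs to [SU(2)]. *)
Definition frame_unitary (n1 n2 n3 n4 : R) : 'M[R[i]]_2 :=
  \matrix_(i, j) if i == 0 then (if j == 0 then (n1 +i* - n2)%C else (n3 +i* - n4)%C)
    else (if j == 0 then (- n3 +i* - n4)%C else (n1 +i* n2)%C).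

Lemma two_cases (i : 'I_2) : i = 0 \/ i = 1.
Proof. by case: i => [[|[|//]] Hi]; [left|right]; exact/val_inj. Qed.

Lemma frame_unitaryP (n1 n2 n3 n4 : R) :
  n1 * n1 + n2 * n2 + n3 * n3 + n4 * n4 = 1 -> frame_unitary n1 n2 n3 n4 \is unitarymx.
Proof.
move=> N; apply/unitarymxP/matrixP => i j; rewrite mxE sum2E !mxE.
have cE (a c : R) : Num.conj (a +i* c)%C = (a +i* - c)%C by [].
by case: (two_cases i) => ->; case: (two_cases j) => -> /=; rewrite ?cE; apply/eqP;
  rewrite eq_complex /=; apply/andP; split; apply/eqP; rewrite -?N; ring.
Qed.

Lemma frame_unitaryE (n1 n2 n3 n4 : R) (x : 'rV[R]_4) :
  (frame_unitary n1 n2 n3 n4 *m to_C2 x) 0 0 = (frame1 n1 n2 n3 n4 x +i* frame2 n1 n2 n3 n4 x)%C /\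
  (frame_unitary n1 n2 n3 n4 *m to_C2 x) 1 0 = (frame3 n1 n2 n3 n4 x +i* frame4 n1 n2 n3 n4 x)%C.
Proof.
by split; rewrite mxE sum2E !mxE /=; apply/eqP; rewrite eq_complex /=; apply/andP; split; apply/eqP;
  rewrite /frame1 /frame2 /frame3 /frame4 /lform; ring.
Qed.

End ComplexFrame.

(** * From embedded manifolds to the abstract data *)

Section ManifoldData.
Variables (R : realType) (S : smoothManifold R 2) (F : S -> 'rV[R]_4).
Variables n1 n2 n3 n4 : R.
Hypothesis N : n1 * n1 + n2 * n2 + n3 * n3 + n4 * n4 = 1.

Lemma chart_nearP (c : chart R 2 S) v (P : S -> Prop) : chart_cod c v ->
  (\forall w \near v, P (chart_inv c w)) <-> (\forall y \near chart_inv c v, P y).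
Proof.
move=> cv; have dv : chart_dom c (chart_inv c v) by exact: chart_inv_fun.
split=> H; last exact: (chart_inv_cont (mem_set cv) H).
have K := chart_invK (mem_set cv).
have cont := chart_to_cont (mem_set dv).
rewrite /continuous_at K in cont.
have H1 : \forall y \near chart_inv c v, P (chart_inv c (chart_to c y)) by exact: (cont _ H).
have H2 : \forall y \near chart_inv c v, chart_dom c y.
  exact: open_nbhs_nbhs (conj (chart_dom_open c) dv).
by apply: filterS2 H1 H2 => y Py dy; rewrite -(chart_toK (mem_set dy)).
Qed.

(** The norm is the sup norm, and each coordinate is a combination of the four frame coordinates
    with coefficients of absolute value at most 1; hence the factor 4. *)
Lemma frame_separation (Y Z : 'rV[R]_4) (e : R) : 0 < e ->
  `|frame1 n1 n2 n3 n4 Y - frame1 n1 n2 n3 n4 Z| < e ->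
  `|frame2 n1 n2 n3 n4 Y - frame2 n1 n2 n3 n4 Z| < e ->
  `|frame3 n1 n2 n3 n4 Y - frame3 n1 n2 n3 n4 Z| < e ->
  `|frame4 n1 n2 n3 n4 Y - frame4 n1 n2 n3 n4 Z| < e -> `|Y - Z| < 4 * e.
Proof.
move=> e0 h1 h2 h3 h4.
have [y0 y1 y2 y3] := frame_coord N Y; have [z0 z1 z2 z3] := frame_coord N Z.
have le1 (a : R) : a * a <= 1 -> `|a| <= 1.
  by move=> h; rewrite -(@ler_pXn2r _ 2) ?nnegrE// real_normK ?num_real// expr1n expr2.
have sq (a : R) : 0 <= a * a by rewrite -expr2 sqr_ge0.
have := (sq n1, sq n2, sq n3, sq n4) => -[[[q1 q2] q3] q4].
have [m1 m2 m3 m4] : [/\ `|n1| <= 1, `|n2| <= 1, `|n3| <= 1 & `|n4| <= 1].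
  by split; apply: le1; rewrite -N; lra.
have bd (a b c d x y z t : R) : `|a| <= 1 -> `|b| <= 1 -> `|c| <= 1 -> `|d| <= 1 ->
    `|x| < e -> `|y| < e -> `|z| < e -> `|t| < e ->
    `|a * x + b * y + c * z + d * t| < 4 * e.
  have one (u w : R) : `|u| <= 1 -> `|w| < e -> `|u * w| < e.
    by move=> hu hw; rewrite normrM (le_lt_trans _ hw)// ler_piMl.
  move=> *; rewrite (_ : 4 * e = e + e + e + e); last by ring.
  by do 3!(apply: le_lt_trans (ler_normD _ _) _; apply: ltrD; last exact: one); exact: one.
have nb (a : R) : `|a| <= 1 -> `|- a| <= 1 by rewrite normrN.
rewrite [ltLHS]/Num.norm /= mx_normrE; apply/bigmax_ltP; split; first by rewrite mulr_gt0.
move=> [i j] _ /=; rewrite (ord1 i) !mxE.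
have four : [\/ j = 0, j = 1, j = 2 | j = 3].
  case: j => [[|[|[|[|//]]]] Hj].
  - by apply: Or41; exact/val_inj.
  - by apply: Or42; exact/val_inj.
  - by apply: Or43; exact/val_inj.
  - by apply: Or44; exact/val_inj.
move: h1 h2 h3 h4; move: (frame1 _ _ _ _ Y) (frame1 _ _ _ _ Z) (frame2 _ _ _ _ Y)
  (frame2 _ _ _ _ Z) (frame3 _ _ _ _ Y) (frame3 _ _ _ _ Z) (frame4 _ _ _ _ Y)
  (frame4 _ _ _ _ Z) y0 y1 y2 y3 z0 z1 z2 z3.
move=> a1 c1 a2 c2 a3 c3 a4 c4 y0 y1 y2 y3 z0 z1 z2 z3 h1 h2 h3 h4.
case: four => ->.
- rewrite y0 z0 (_ : _ - _ = n1 * (a1 - c1) + - n2 * (a2 - c2) + - n3 * (a3 - c3) + - n4 * (a4 - c4)).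
    by apply: bd => //; exact: nb.
  by ring.
- rewrite y1 z1 (_ : _ - _ = n2 * (a1 - c1) + n1 * (a2 - c2) + n4 * (a3 - c3) + - n3 * (a4 - c4)).
    by apply: bd => //; exact: nb.
  by ring.
- rewrite y2 z2 (_ : _ - _ = n3 * (a1 - c1) + - n4 * (a2 - c2) + n1 * (a3 - c3) + n2 * (a4 - c4)).
    by apply: bd => //; exact: nb.
  by ring.
rewrite y3 z3 (_ : _ - _ = n4 * (a1 - c1) + n3 * (a2 - c2) + - n2 * (a3 - c3) + n1 * (a4 - c4)).
  by apply: bd => //; exact: nb.
by ring.
Qed.

Lemma manifold_data : closed_connected_manifold S -> embedding F ->
  lagrangian_self_shrinker F ->
  lag_data (fun x => frame1 n1 n2 n3 n4 (F x)) (fun x => frame2 n1 n2 n3 n4 (F x))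
    (fun x => frame3 n1 n2 n3 n4 (F x)) (fun x => frame4 n1 n2 n3 n4 (F x)).
Proof.
move=> [cS kS nS] [[smF immF] injF embF] [[_ shrF] lagF]; split => //.
  move=> x; have [c ac xc] : (\bigcup_(c in @atlas R 2 S) chart_dom c) x by rewrite atlas_cover.
  exists (chart_cod c), (chart_inv c), (chart_to c x); split.
  - split; first by move=> v P cv; exact: chart_nearP.
    have Q := (frame_patch N (@chart_cod_open _ _ _ c) (smF c ac) (fun u cu => immF c u ac cu)
      (fun u cu => lagF c u ac cu) (fun u cu => shrF c u ac cu)).
    exact Q.
  - exact: chart_to_fun.
  - exact: chart_toK (mem_set xc).
move=> x A; rewrite nbhsE => -[U [oU Ux] UA].
have [V oV FV] := embF U oU.
have VFx : V (F x).
  have : (F @` U) (F x) by exists x.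
  by rewrite FV => -[].
have /nbhs_ballP[r /= r0 Hr] : nbhs (F x) V by exact: open_nbhs_nbhs.
exists (r / 4); first by rewrite divr_gt0.
move=> y [h1 h2 h3 h4]; have Vy : V (F y).
  apply: Hr; rewrite -ball_normE /= distrC.
  rewrite (_ : r = 4 * (r / 4)); last by field.
  by apply: frame_separation => //; rewrite divr_gt0.
have [z Uz /injF <-] : (F @` U) (F y) by rewrite FV; split => //; exists y.
exact: UA.
Qed.

End ManifoldData.

Theorem theorem1p3 (R : realType) (S : smoothManifold R 2)
    (F : S -> 'rV[R]_4) (nu : 'rV[R]_4) (b : R) :
  closed_connected_manifold S ->
  embedding F ->
  lagrangian_self_shrinker F ->
  nu != 0 ->
  symmetric_wrt_hyperplane nu b F ->
  exists2 G : 'M[R[i]]_2, G \is unitarymx &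
    (fun x => G *m to_C2 x) @` range F = @clifford_torus R.

Proof.
move=> closedS embF lagF nu0 sym.
have d0 : 0 < dot nu nu.
  rewrite lt_neqAle; apply/andP; split; last by rewrite dot4E -!expr2 !addr_ge0 ?sqr_ge0.
  by rewrite eq_sym; apply: contra_neq nu0; exact: dot_eq0.
pose s := Num.sqrt (dot nu nu); have s0 : 0 < s by rewrite sqrtr_gt0.
have ss : s * s = dot nu nu by rewrite -expr2 sqr_sqrtr// ltW.
have sn : s != 0 by rewrite gt_eqF.
move: s ss s0 sn => s ss s0 sn.
have [n1 [n2 [n3 [n4 [e1 e2 e3 e4]]]]] : exists n1 n2 n3 n4 : R,
    [/\ nu 0 0 = s * n1, nu 0 1 = s * n2, nu 0 2 = s * n3 & nu 0 3 = s * n4].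
  exists (nu 0 0 / s), (nu 0 1 / s), (nu 0 2 / s), (nu 0 3 / s).
  by split; rewrite mulrC divfK.
have N : n1 * n1 + n2 * n2 + n3 * n3 + n4 * n4 = 1.
  have ssn : s * s != 0 by rewrite mulf_neq0.
  by apply: (mulfI ssn); rewrite mulr1 [RHS]ss dot4E e1 e2 e3 e4; ring.
have D := manifold_data N closedS embF lagF.
(* The hyperplane [<x, nu> = b] reads [frame1 = b / s] for the unit normal [n = nu / s]. *)
have refl : reflective (fun x => frame1 n1 n2 n3 n4 (F x)) (fun x => frame2 n1 n2 n3 n4 (F x))
    (fun x => frame3 n1 n2 n3 n4 (F x)) (fun x => frame4 n1 n2 n3 n4 (F x)) (b / s).
  move=> x; have : range F (hyperplane_reflection nu b (F x)).
    by rewrite -sym; exists (F x) => //; exists x.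
  move=> [y _ yE]; exists y; rewrite yE /hyperplane_reflection -ss dot4E e1 e2 e3 e4.
  move: (F x) => Z; rewrite /frame1 /frame2 /frame3 /frame4 /lform !mxE e1 e2 e3 e4.
  move: (Z 0 0) (Z 0 1) (Z 0 2) (Z 0 3) => a1 a2 a3 a4; split; last 3 first; try by ring.
  set m := n1 * a1 + n2 * a2 + n3 * a3 + n4 * a4.
  transitivity (m - 2 * (s * m - b) / (s * s) * s * (n1 * n1 + n2 * n2 + n3 * n3 + n4 * n4)).
    by rewrite /m; ring.
  by rewrite N; field.
have [unit onto] := reflective_torus D refl.
exists (frame_unitary n1 n2 n3 n4); first exact: frame_unitaryP.
apply/seteqP; split=> [_ [_ [x _ <-] <-]|z [h0 h1]].
  have [u12 u34] := unit x; have [E0 E1] := frame_unitaryE n1 n2 n3 n4 (F x).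
  by split; rewrite ?E0 ?E1; apply/normc_eq1.
case E0 : (z 0 0) h0 => [z1 z2] h0; case E1 : (z 1 0) h1 => [z3 z4] h1.
have [y [y1 y2 y3 y4]] := onto z1 z2 z3 z4 ((normc_eq1 _ _).1 h0) ((normc_eq1 _ _).1 h1).
exists (F y); first by exists y.
have [G0 G1] := frame_unitaryE n1 n2 n3 n4 (F y).
apply/colP => i; case: (two_cases i) => ->.
  by rewrite G0 E0 y1 y2.
by rewrite G1 E1 y3 y4.
Qed.
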